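(* There is an algorithm which takes as input an instance $\mathcal{I}$ of $\textsc{PL}^{\neq 0}$ whose superstructure graph has feedback edge number $k$, runs in time $O(|\mathcal{I}|^2)$, and outputs an equivalent instance $\mathcal{I}'=(V',\mathcal{F}',\ell')$ of $\textsc{PL}^{\neq 0}$ such that $|V'|\leq 24k$.
   Context: Let $V$ be a finite set and $\mathcal{F}=\{f_v:2^{V\setminus\{v\}}\to\mathbb{N}_0 : v\in V\}$. For a digraph $D=(V,A)$ let $P_D(v)=\{u:uv\in A\}$ and $\texttt{score}(D)=\sum_v f_v(P_D(v))$. A polytree is a digraph whose underlying undirected graph is a forest. \textsc{Polytree Learning} (PL): given $V$, $\mathcal{F}$ and an integer $\ell$, decide whether there is a polytree $D$ on $V$ with $\texttt{score}(D)\geq\ell$ (a solution). In $\textsc{PL}^{\neq 0}$, $\mathcal{F}$ is given in the non-zero representation: for each $v$ the collection $\Gamma_f(v)=\{Z:f_v(Z)\neq0\}$ with its values; the input size is $|\mathcal{I}|=|V|+\ell+\sum_{v,P\in\Gamma_f(v)}|P|$. With $P_\to(v)=\bigcup_{Z\in\Gamma_f(v)}Z$, the superstructure graph $G=(V,E)$ has $ab\in E$ iff $a\in P_\to(b)$ or $b\in P_\to(a)$. The feedback edge number is the minimum number of edges whose deletion makes a graph acyclic. Two instances are equivalent if both are yes- or both are no-instances and a solution of one can be transformed into a solution of the other in polynomial time. *)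

(* Defs.v *)
From HB Require Import structures.
From mathcomp Require Import all_boot all_order all_algebra.

Set Implicit Arguments.
Unset Strict Implicit.
Unset Printing Implicit Defensive.

(** * Graphs *)

(* A simple graph on T is a symmetric irreflexive relation on T, so uniq cycles
   of size at most 2 are a single vertex or a back-and-forth edge. *)
Definition acyclic (T : finType) (e : rel T) : Prop :=
  forall c : seq T, ucycle e c -> size c <= 2.

Definition edges (T : finType) (e : rel T) : {set {set T}} :=
  [set [set x.1; x.2] | x in [pred x : T * T | e x.1 x.2]].

Definition delete_edges (T : finType) (e : rel T) (F : {set {set T}}) : rel T :=
  fun a b => e a b && ([set a; b] \notin F).

Definition feedback_edge_set (T : finType) (e : rel T) (F : {set {set T}}) :
    Prop :=
  F \subset edges e /\ acyclic (delete_edges e F).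

Definition feedback_edge_number (T : finType) (e : rel T) (k : nat) : Prop :=
  (exists2 F, feedback_edge_set e F & #|F| = k) /\
  (forall F, feedback_edge_set e F -> k <= #|F|).

(* D u v means that uv is an arc. Forgetting the directions, a loop or a pair
   of opposite arcs gives a cycle of length 1 or 2; longer cycles are those of
   the underlying simple graph. *)
Definition underlying (T : finType) (D : rel T) : rel T :=
  fun u v => D u v || D v u.

Definition polytree (T : finType) (D : rel T) : Prop :=
  [/\ irreflexive D, (forall u v, D u v -> ~~ D v u) & acyclic (underlying D)].

Definition parents (T : finType) (D : rel T) (v : T) : {set T} :=
  [set u | D u v].

(** * Polytree Learning *)

(* The local score f_v has domain 2^(V \ {v}); it is extended by 0 to the sets
   containing v. *)
Record instance := Instance {
  nvert : nat;
  fscore : 'I_nvert -> {set 'I_nvert} -> nat;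
  fscore_self : forall v (Z : {set 'I_nvert}), v \in Z -> fscore v Z = 0;
  target : int
}.

Definition score (I : instance) (D : rel 'I_(nvert I)) : nat :=
  \sum_(v < nvert I) fscore v (parents D v).

Definition solution (I : instance) (D : rel 'I_(nvert I)) : Prop :=
  polytree D /\ (target I <= Posz (score D))%R.

Definition yes_instance (I : instance) : Prop :=
  exists D : rel 'I_(nvert I), solution D.

Definition Gamma (I : instance) (v : 'I_(nvert I)) : {set {set 'I_(nvert I)}} :=
  [set Z | fscore v Z != 0].

Definition potential_parents (I : instance) (v : 'I_(nvert I)) :
    {set 'I_(nvert I)} :=
  \bigcup_(Z in Gamma v) Z.

Definition superstructure (I : instance) : rel 'I_(nvert I) :=
  fun a b => (a \in potential_parents b) || (b \in potential_parents a).
Arguments superstructure : clear implicits.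

Definition inst_size (I : instance) : nat :=
  nvert I + absz (target I) + \sum_(v < nvert I) \sum_(P in Gamma v) #|P|.

(** * Encodings as words of natural numbers *)

(* L lists the members of Gamma v, each once, with their scores; each member
   is given by a duplicate-free list of its elements. *)
Definition nonzero_list (I : instance) (v : 'I_(nvert I))
    (L : seq (seq 'I_(nvert I) * nat)) : Prop :=
  [/\ all (fun p => uniq p.1) L,
      uniq [seq [set x in p.1] | p <- L],
      [seq [set x in p.1] | p <- L] =i Gamma v
    & all (fun p => p.2 == fscore v [set x in p.1]) L].

Definition vlist_word (n : nat) (s : seq 'I_n) : seq nat :=
  size s :: map (@nat_of_ord n) s.

Definition nonzero_list_word (n : nat) (L : seq (seq 'I_n * nat)) : seq nat :=
  size L :: flatten [seq p.2 :: vlist_word p.1 | p <- L].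

(* w is a non-zero representation of I; the order of the lists is free. *)
Definition encodes_instance (I : instance) (w : seq nat) : Prop :=
  exists2 L : 'I_(nvert I) -> seq (seq 'I_(nvert I) * nat),
    forall v, nonzero_list v (L v)
  & w = [:: nvert I; nat_of_bool (target I < 0)%R; absz (target I)]
        ++ flatten [seq nonzero_list_word (L v) | v <- enum 'I_(nvert I)].

Definition encodes_digraph (n : nat) (D : rel 'I_n) (d : seq nat) : Prop :=
  exists2 p : 'I_n -> seq 'I_n,
    forall v, uniq (p v) /\ p v =i parents D v
  & d = flatten [seq vlist_word (p v) | v <- enum 'I_n].

(** * Unit-cost random access machine *)

(* The machine is presented as a while-language over finitely many unbounded
   arrays of natural numbers (a program can only name finitely many). Up to a
   constant factor in the running time, interleaving the arrays and compiling
   the control structures gives the usual RAM with a single memory,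
   indirect addressing, and instructions +, truncated - and jump-if-zero;
   there is no unit-cost multiplication. *)
Inductive expr :=
  | Const of nat
  | Get of nat & expr             (* a[e] *)
  | Add of expr & expr
  | Sub of expr & expr.           (* truncated *)

Inductive cmd :=
  | Skip
  | Put of nat & expr & expr      (* a[e1] := e2 *)
  | Seq of cmd & cmd
  | If of expr & cmd & cmd        (* nonzero is true *)
  | While of expr & cmd.

Definition memory := nat -> nat -> nat.

Fixpoint eval (s : memory) (e : expr) : nat :=
  match e with
  | Const n => n
  | Get a e1 => s a (eval s e1)
  | Add e1 e2 => eval s e1 + eval s e2
  | Sub e1 e2 => eval s e1 - eval s e2
  end.

Fixpoint expr_cost (e : expr) : nat :=
  match e with
  | Const _ => 1
  | Get _ e1 => (expr_cost e1).+1
  | Add e1 e2 | Sub e1 e2 => (expr_cost e1 + expr_cost e2).+1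
  end.

Definition update (s : memory) (a i x : nat) : memory :=
  fun b j => if (b == a) && (j == i) then x else s b j.

(* exec c s t s': from memory s, c halts after t steps with memory s'. *)
Inductive exec : cmd -> memory -> nat -> memory -> Prop :=
  | exec_skip s : exec Skip s 1 s
  | exec_put a e1 e2 s :
      exec (Put a e1 e2) s (expr_cost e1 + expr_cost e2).+1
           (update s a (eval s e1) (eval s e2))
  | exec_seq c1 c2 s1 s2 s3 t1 t2 :
      exec c1 s1 t1 s2 -> exec c2 s2 t2 s3 ->
      exec (Seq c1 c2) s1 (t1 + t2).+1 s3
  | exec_if e c1 c2 s s' t :
      exec (if eval s e != 0 then c1 else c2) s t s' ->
      exec (If e c1 c2) s (expr_cost e + t).+1 s'
  | exec_while_false e c s :
      eval s e = 0 -> exec (While e c) s (expr_cost e).+1 s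
  | exec_while_true e c s1 s2 s3 t1 t2 :
      eval s1 e != 0 -> exec c s1 t1 s2 -> exec (While e c) s2 t2 s3 ->
      exec (While e c) s1 (expr_cost e + t1 + t2).+1 s3.

(* The input is in array 0, all other cells being 0; the output is read from
   array 1. The words read and written are self-delimiting. *)
Definition initial (w : seq nat) : memory :=
  fun a i => if a == 0 then nth 0 w i else 0.

Definition computes (p : cmd) (w u : seq nat) (t : nat) : Prop :=
  exists2 s : memory, exec p (initial w) t s
  & forall i, i < size u -> s 1 i = nth 0 u i.

(** * Equivalence of instances *)

(* p turns every solution of I into a solution of J, given both instances, in
   time polynomial (with constant and exponent c) in m. *)
Definition transforms_solutions (p : cmd) (c m : nat)
    (I : instance) (w : seq nat) (J : instance) (u : seq nat) : Prop :=
  forall (D : rel 'I_(nvert I)) (d : seq nat),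
    solution D -> encodes_digraph D d ->
    exists (D' : rel 'I_(nvert J)) (d' : seq nat) (t : nat),
      [/\ solution D', encodes_digraph D' d',
          computes p (w ++ u ++ d) d' t & t <= c * m ^ c + c].

Definition equivalent_via (fwd bwd : cmd) (c m : nat)
    (I : instance) (w : seq nat) (J : instance) (u : seq nat) : Prop :=
  [/\ yes_instance I <-> yes_instance J,
      transforms_solutions fwd c m I w J u
    & transforms_solutions bwd c m J u I w].

(* Main.v *)
Require Import Defs.
From mathcomp Require Import all_boot all_order all_algebra zify.

Set Implicit Arguments.
Unset Strict Implicit.
Unset Printing Implicit Defensive.

(** Vertices of degree at most one in the superstructure are eliminated one by
    one: a leaf v attached to u is charged to the parent sets of u that contain v
    with the loss v incurs when u may not be its parent, and the target decreases
    by the best score of v. The remaining core has minimum degree two. Let K be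
    its vertices of degree at least three, together with one vertex of each
    component that is a cycle; the core is then made of K and of paths between
    vertices of K, and there are O(k) of both. A path w - y ... x - u with more
    than three inner vertices interacts with the rest only through three bits:
    whether u is a parent of x, whether w is a parent of y, and whether all its
    inner edges are used. Its optimum for the eight values of these bits is found
    by dynamic programming, and the path is replaced by four of its vertices y,
    z1, z2, x whose score lists have ten entries: a solution must choose between
    u and {z1, z2} as the parents of x, and y then reads off the three bits and
    collects the optimum.

    All programs are written with loops that run from 0 to the length of the
    input, so that the nesting depth of the loops bounds the exponent of the
    running time; the depth is two for the kernel. *)

(** * Bounded-loop programs *)

(** The weights of the gadget make its choices honest. With B at least every optimum of the path, x
    earns B from u and 2B from {z1, z2}, while y earns an extra B for claiming, by the parents z1
    and z2, that u is a parent of x. If x took {z1, z2}, the claim closes the cycle x z1 y z2; if x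
    took u, omitting the claim forfeits B. So an honest choice earns 2B plus the optimum for its
    bits, any other at most 2B. The third bit is forced by acyclicity: a fully used path connects
    its ends, and the arc from x to y stands for this connection. The obstacle to quadratic time is
    the non-zero representation: after eliminations several parent sets of a vertex may leave the
    same alive part, which must be listed once, with its best score. Coding sets as sums of powers
    of two lets all pairs of entries be compared at unit cost. The transformations of solutions see
    only two instances and a solution. They repeat the deterministic analysis of the original
    instance and so recover the same paths, tables and elimination order. *)

(* Every loop runs through 0 <= i < N, where N is the content of cell 0 of
   array [aN]; the counter i is cell 0 of the array named by the loop. *)
Inductive prog :=
  | PSkip
  | PPut of nat & expr & expr
  | PSeq of prog & prog
  | PIf of expr & prog & prog
  | PFor of nat & prog.

Notation aN := 3 (only parsing).

Definition var a := Get a (Const 0).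

Fixpoint compile (p : prog) : cmd :=
  match p with
  | PSkip => Skip
  | PPut a e1 e2 => Put a e1 e2
  | PSeq p q => Seq (compile p) (compile q)
  | PIf e p q => If e (compile p) (compile q)
  | PFor c p =>
      Seq (Put c (Const 0) (Const 0))
          (While (Defs.Sub (var aN) (var c))
                 (Seq (compile p) (Put c (Const 0) (Add (var c) (Const 1)))))
  end.

Definition tr (s : memory) (e : expr) := eval s e != 0.

Definition floop (c : nat) (f : memory -> memory) (s : memory) : memory :=
  iter (s aN 0) (fun s => update (f s) c 0 (f s c 0 + 1)) (update s c 0 0).

Fixpoint denote (p : prog) (s : memory) : memory :=
  match p with
  | PSkip => s
  | PPut a e1 e2 => update s a (eval s e1) (eval s e2)
  | PSeq p q => denote q (denote p s)
  | PIf e p q => if tr s e then denote p s else denote q s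
  | PFor c p => floop c (denote p) s
  end.
Arguments denote : simpl never.
Arguments tr : simpl never.
Arguments floop : simpl never.

Fixpoint writes (p : prog) : seq nat :=
  match p with
  | PSkip => [::]
  | PPut a _ _ => [:: a]
  | PSeq p q | PIf _ p q => writes p ++ writes q
  | PFor c p => c :: writes p
  end.

Fixpoint wf (p : prog) : bool :=
  match p with
  | PSkip | PPut _ _ _ => true
  | PSeq p q | PIf _ p q => wf p && wf q
  | PFor c p => [&& c \notin writes p, aN \notin c :: writes p & wf p]
  end.

Lemma denote_skip s : denote PSkip s = s. Proof. by []. Qed.
Lemma denote_put a e1 e2 s :
  denote (PPut a e1 e2) s = update s a (eval s e1) (eval s e2).
Proof. by []. Qed.
Lemma denote_seq p q s : denote (PSeq p q) s = denote q (denote p s).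
Proof. by []. Qed.
Lemma denote_if e p q s :
  denote (PIf e p q) s = if tr s e then denote p s else denote q s.
Proof. by []. Qed.
Definition denE := (denote_skip, denote_put, denote_seq, denote_if).

Lemma update_other s a i x b j : b != a -> update s a i x b j = s b j.
Proof. by rewrite /update => /negbTE->. Qed.

Lemma frame p s a i : a \notin writes p -> denote p s a i = s a i.
Proof.
elim: p s a i => [|b e1 e2|p IHp q IHq|e p IHp q IHq|c p IHp] s a i /=.
- by [].
- by rewrite inE => ab; rewrite denote_put update_other.
- by rewrite mem_cat negb_or => /andP[ap aq]; rewrite denote_seq IHq // IHp.
- rewrite mem_cat negb_or => /andP[ap aq]; rewrite denote_if.
  by case: ifP; rewrite ?IHp ?IHq.
- rewrite inE negb_or => /andP[ac ap]; rewrite /denote -/denote /floop.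
  elim: (s aN 0) => [|n IHn] /=; first by rewrite update_other.
  by rewrite update_other // IHp.
Qed.

Lemma floopS c p s n (f := fun s => update (denote p s) c 0 (denote p s c 0 + 1)) :
  wf (PFor c p) -> iter n f (update s c 0 0) c 0 = n /\
    (forall a j : nat, a \notin c :: writes p ->
       iter n f (update s c 0 0) a j = s a j).
Proof.
move=> /= /and3P[cp Np wp]; elim: n => [|n [IHc IHa]] /=.
  split=> [|a]; first by rewrite /update !eqxx.
  by move=> j; rewrite inE negb_or => /andP[ac _]; rewrite update_other.
split; first by rewrite {1}/f {1}/update !eqxx frame // IHc addn1.
move=> a j Ha; move: (Ha); rewrite inE negb_or => /andP[ac ap].
by rewrite {1}/f update_other // frame // IHa.
Qed.

(** Since [wf] forbids the body to write [aN] or the counter, the number of rounds is fixed on entry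
    and the counter in round i is exactly i; the invariant may therefore be indexed by it. *)
Lemma for_ind (Inv : nat -> memory -> Prop) c p s :
  wf (PFor c p) ->
  Inv 0 (update s c 0 0) ->
  (forall i (s1 : memory), i < s aN 0 ->
     (forall a j : nat, a \notin c :: writes p -> s1 a j = s a j) ->
     s1 c 0 = i -> s1 aN 0 = s aN 0 -> Inv i s1 ->
     Inv i.+1 (update (denote p s1) c 0 i.+1)) ->
  Inv (s aN 0) (denote (PFor c p) s).
Proof.
move=> wfp I0 IS; rewrite /denote -/denote /floop.
set f := (fun s => _).
have H n : n <= s aN 0 -> Inv n (iter n f (update s c 0 0)).
  elim: n => [|n IHn] //= ln; have [Hc Ha] := floopS s n wfp.
  move: (wfp) => /= /and3P[cp Np _].
  have := IS _ _ ln Ha Hc (Ha aN 0 Np) (IHn (ltnW ln)).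
  by rewrite /f -/f frame // Hc addn1.
exact: H.
Qed.

(** The cost with each loop body counted once; nesting is paid for by the factor [N.+1 ^ depth p] of
    [run_prog]. The 40 covers resetting, testing and incrementing the counter. *)
Fixpoint csize (p : prog) : nat :=
  match p with
  | PSkip => 1
  | PPut _ e1 e2 => (expr_cost e1 + expr_cost e2).+1
  | PSeq p q => (csize p + csize q).+1
  | PIf e p q => (expr_cost e + (csize p + csize q)).+1
  | PFor _ p => csize p + 40
  end.

Fixpoint depth (p : prog) : nat :=
  match p with
  | PSkip | PPut _ _ _ => 0
  | PSeq p q | PIf _ p q => maxn (depth p) (depth q)
  | PFor _ p => (depth p).+1
  end.

Lemma run_prog p s : wf p -> aN \notin writes p ->
  exists2 t, exec (compile p) s t (denote p s)
           & t <= csize p * (s aN 0).+1 ^ depth p.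
Proof.
have pw N a b : a <= b -> N.+1 ^ a <= N.+1 ^ b by move=> ?; rewrite leq_pexp2l.
have p1 N a : 1 <= N.+1 ^ a by rewrite expn_gt0.
elim: p s => [|b e1 e2|p IHp q IHq|e p IHp q IHq|c p IHp] s.
- by exists 1; [apply: exec_skip|].
- by move=> _ _; eexists; [apply: exec_put|rewrite /= expn0 muln1].
- move=> /= /andP[wp wq]; rewrite mem_cat negb_or => /andP[Np Nq].
  have [t1 e1 l1] := IHp s wp Np.
  have [t2 e2 l2] := IHq (denote p s) wq Nq.
  exists (t1 + t2).+1; first exact: exec_seq e1 e2.
  rewrite frame // in l2.
  have := pw (s aN 0) _ _ (leq_maxl (depth p) (depth q)).
  have := pw (s aN 0) _ _ (leq_maxr (depth p) (depth q)).
  have := p1 (s aN 0) (maxn (depth p) (depth q)).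
  nia.
- move=> /= /andP[wp wq]; rewrite mem_cat negb_or => /andP[Np Nq].
  have [t1 e1 l1] := IHp s wp Np; have [t2 e2 l2] := IHq s wq Nq.
  exists (expr_cost e + (if tr s e then t1 else t2)).+1.
    by apply: exec_if; rewrite denote_if /tr; case: ifP.
  have := pw (s aN 0) _ _ (leq_maxl (depth p) (depth q)).
  have := pw (s aN 0) _ _ (leq_maxr (depth p) (depth q)).
  have := p1 (s aN 0) (maxn (depth p) (depth q)).
  by case: ifP => _; nia.
- move=> wfp; have /and3P[cp Np wp] := wfp => NN.
  have {}Np : aN \notin writes p by move: Np; rewrite inE negb_or => /andP[].
  pose f s := update (denote p s) c 0 (denote p s c 0 + 1).
  pose st n := iter n f (update s c 0 0).
  set N := s aN 0; set T := csize p * N.+1 ^ depth p.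
  (* Induction on the number of rounds still to run, so that the rest of the [While] is available
     when one round is put in front of it. *)
  have H n : n <= N -> exists2 t', exec (While (Defs.Sub (var aN) (var c))
        (Seq (compile p) (Put c (Const 0) (Add (var c) (Const 1))))) (st (N - n)) t' (st N)
      & t' <= n * (T + 20) + 20.
    elim: n => [|n IHn] ln.
      exists 6; last by [].
      have [Hc Ha] := floopS s N wfp; rewrite -/f -/(st N) in Hc Ha.
      by rewrite subn0; apply: exec_while_false => /=; rewrite Hc Ha // subnn.
    have [t' E' l'] := IHn (ltnW ln).
    have [Hc Ha] := floopS s (N - n.+1) wfp.
    rewrite -/f -/(st (N - n.+1)) in Hc Ha.
    have [t1 E1 l1] := IHp (st (N - n.+1)) wp Np.
    eexists.
      apply: exec_while_true.
      - by rewrite /= Hc Ha // -/N; lia.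
      - by apply: exec_seq E1 _; apply: exec_put.
      - rewrite /= -/(f (st (N - n.+1))).
        have -> : f (st (N - n.+1)) = st (N - n) by rewrite -[in RHS]subnSK.
        exact: E'.
    by move: l1; rewrite Ha // -/N -/T /=; lia.
  have [t' E' l'] := H N (leqnn _); rewrite subnn in E'.
  exists (3 + t').+1; first by apply: exec_seq E'; apply: exec_put.
  have := p1 N (depth p); rewrite /= expnS -/N; move: l'; rewrite /T.
  by nia.
Qed.

Fixpoint ereads (e : expr) : seq nat :=
  match e with
  | Const _ => [::]
  | Get a e1 => a :: ereads e1
  | Add e1 e2 | Defs.Sub e1 e2 => ereads e1 ++ ereads e2
  end.

Fixpoint reads (p : prog) : seq nat :=
  match p with
  | PSkip => [::]
  | PPut _ e1 e2 => ereads e1 ++ ereads e2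
  | PSeq p q => reads p ++ reads q
  | PIf e p q => ereads e ++ reads p ++ reads q
  | PFor c p => [:: aN, c & reads p]
  end.

Lemma eval_agree (R : pred nat) e s s' :
  (forall a, R a -> s a =1 s' a) -> all R (ereads e) -> eval s e = eval s' e.
Proof.
move=> H; elim: e => [n|a e IH|e1 IH1 e2 IH2|e1 IH1 e2 IH2] //=.
- by move=> /andP[Ra /IH->]; rewrite H.
- by rewrite all_cat => /andP[/IH1-> /IH2->].
- by rewrite all_cat => /andP[/IH1-> /IH2->].
Qed.

(** [R] has to contain what [p] reads, not what it writes: an array of [R] that is overwritten
    receives equal values at equal places in both runs. Through this lemma the analysis gives the
    same result inside all three algorithms. *)
Lemma denote_agree (R : pred nat) p s s' :
  (forall a, R a -> s a =1 s' a) -> all R (reads p) ->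
  forall a, R a -> denote p s a =1 denote p s' a.
Proof.
elim: p s s' => [|b e1 e2|p IHp q IHq|e p IHp q IHq|c p IHp] s s' H //=.
- rewrite all_cat => /andP[H1 H2] a Ra i.
  by rewrite !denote_put /update !(eval_agree H) // H.
- rewrite all_cat => /andP[Hp Hq] a Ra i.
  by rewrite !denote_seq; apply: IHq => // b Rb; apply: IHp.
- rewrite !all_cat => /and3P[He Hp Hq] a Ra i.
  by rewrite !denote_if /tr (eval_agree H He); case: ifP => _; [apply: IHp|apply: IHq].
- move=> /and3P[RN Rc Rp] a Ra i; rewrite /denote -/denote /floop H //.
  have H0 a' : R a' -> update s c 0 0 a' =1 update s' c 0 0 a'.
    by move=> Ra' j; rewrite /update H.
  elim: (s' aN 0) a Ra i => [|n IHn] a Ra i //=; first exact: H0.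
  by rewrite /update !(IHp _ _ IHn).
Qed.

(** * Boolean expressions *)

Definition elt e1 e2 := Defs.Sub e2 e1.
Definition enot e := Defs.Sub (Const 1) e.
Definition eand e1 e2 := Defs.Sub (Const 1) (Add (enot e1) (enot e2)).
Definition eeq e1 e2 := enot (Add (Defs.Sub e1 e2) (Defs.Sub e2 e1)).

Lemma tr_lt s e1 e2 : tr s (elt e1 e2) = (eval s e1 < eval s e2).
Proof. by rewrite /tr /elt /=; lia. Qed.
Lemma tr_not s e : tr s (enot e) = ~~ tr s e.
Proof. by rewrite /tr /enot /=; lia. Qed.
Lemma tr_and s e1 e2 : tr s (eand e1 e2) = tr s e1 && tr s e2.
Proof. by rewrite /tr /eand /=; lia. Qed.
Lemma tr_eq s e1 e2 : tr s (eeq e1 e2) = (eval s e1 == eval s e2).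
Proof. by rewrite /tr /eeq /=; lia. Qed.
Lemma tr_or s e1 e2 : tr s (Add e1 e2) = tr s e1 || tr s e2.
Proof. by rewrite /tr /=; lia. Qed.
Lemma tr_get s a e : tr s (Get a e) = (s a (eval s e) != 0).
Proof. by []. Qed.
Lemma tr_var s a : tr s (var a) = (s a 0 != 0).
Proof. by []. Qed.
Definition trE := (tr_lt, tr_not, tr_and, tr_eq, tr_or, tr_get, tr_var).

(** * Forests *)

Definition nbrs (T : finType) (e : rel T) (S : {set T}) (v : T) : {set T} :=
  [set b in S | e v b].

(* Equivalent to [acyclic] by [acyclicP]; unlike cycles, sets of minimum degree
   two are easily carried from one graph to another. *)
Definition degenerate (T : finType) (e : rel T) : Prop :=
  forall S : {set T}, S != set0 -> exists2 v, v \in S & #|nbrs e S v| <= 1.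

Section Forest.
Variables (T : finType) (e : rel T).
Hypotheses (e_sym : symmetric e) (e_irr : irreflexive e).

(** If every vertex of [S] had two neighbours in [S], a path in [S] could always be prolonged at its
    head, avoiding the vertex just left. The new vertex is fresh, since otherwise a cycle of length
    at least three closes, so there would be paths of any length. *)
Lemma acyclic_degenerate : acyclic e -> degenerate e.
Proof.
move=> ac S S0; case: (pickP [pred v in S | #|nbrs e S v| <= 1]) => [v /andP[? ?]|no].
  by exists v.
have deg2 v : v \in S -> 1 < #|nbrs e S v|.
  by move=> vS; have := no v; rewrite inE vS /= ltnNge => ->.
have {no}grow k : exists h t, [/\ path e h t, uniq (h :: t),
    {subset h :: t <= S} & size t = k].
  elim: k => [|k [h [t [pt ut st zt]]]].
    by have /set0Pn[v vS] := S0; exists v, [::]; split=> // x; rewrite inE => /eqP->.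
  have hS : h \in S by apply: st; rewrite mem_head.
  have [b bN bt] : exists2 b, b \in nbrs e S h & b != head h t.
    have := deg2 h hS; rewrite (cardD1 (head h t)).
    move=> lt1; have : 0 < #|[predD1 nbrs e S h & head h t]|.
      by move: lt1; case: (_ \in _) => /=; lia.
    by case/card_gt0P=> b; rewrite !inE => /andP[? /andP[? ?]]; exists b; rewrite ?inE; first apply/andP.
  move: bN; rewrite inE => /andP[bS hb].
  have bh : b != h by apply: contraTneq hb => ->; rewrite e_irr.
  have [bt'|bt'] := boolP (b \in t); last first.
    exists b, (h :: t); split=> //=.
    - by rewrite e_sym hb.
    - by rewrite inE negb_or bh bt'.
    - by move=> x; rewrite inE => /predU1P[->|/st].
    - by rewrite zt.
  move: pt ut bt; case/path.splitP: bt' => p1 p2; rewrite cat_path -cat_cons cat_uniq.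
  move=> /andP[pp1 _] /andP[up1 _] bt.
  have : ucycle e (h :: rcons p1 b).
    rewrite /ucycle /= rcons_path pp1 last_rcons e_sym hb /=.
    by move: up1.
  move/ac; rewrite /= size_rcons; case: p1 bt {pp1 up1} => //=.
  by rewrite eqxx.
have [h [t [_ ut _ zt]]] := grow #|T|.
by have := uniq_leq_size ut (fun x _ => mem_enum T x); rewrite -cardE /= zt ltnn.
Qed.

Lemma degenerate_acyclic : degenerate e -> acyclic e.
Proof.
move=> dg c /andP[cy un]; rewrite leqNgt; apply/negP => c3.
have S0 : [set x in c] != set0.
  by case: c c3 {cy un} => // x c _; apply/set0Pn; exists x; rewrite inE mem_head.
have [v] := dg _ S0; rewrite inE => vc; apply/negP; rewrite -ltnNge.
case: (rot_to vc) => i c' E.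
have un' : uniq (v :: c') by rewrite -E rot_uniq.
have cy' : cycle e (v :: c') by rewrite -E rot_cycle.
have m x : x \in c' -> x \in c by move=> xc; rewrite -(mem_rot i c) E inE xc orbT.
have z : size c' > 1 by have := size_rot i c; rewrite E /=; lia.
case: c' un' cy' z m {E} => // a c'; case/lastP: c' => // c' b.
rewrite /= => /and3P[_ ab _] /andP[va].
rewrite rcons_path last_rcons => /andP[_ bv] _ m.
have <- : #|[set a; b]| = 2.
  by rewrite cards2; move: ab; rewrite mem_rcons inE negb_or => /andP[->].
apply/subset_leq_card/subsetP => x; rewrite !inE => /orP[]/eqP->.
  by rewrite va m ?mem_head.
by rewrite e_sym bv m // inE mem_rcons mem_head orbT.
Qed.

Lemma nbrsD1 (S : {set T}) v x : v \in S ->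
  #|nbrs e S x| = #|nbrs e (S :\ v) x| + e x v.
Proof.
move=> vS; rewrite [LHS](cardsD1 v) addnC !inE vS /=.
by congr (_ + _); apply: eq_card => y; rewrite !inE; case: (y == v); rewrite ?andbF ?andbT.
Qed.

(* Each class of an edge-invariant labelling saves at least one edge. *)
Lemma degenerate_labels (L : finType) (lab : T -> L) (S : {set T}) :
  degenerate e -> (forall a b, e a b -> lab a = lab b) ->
  \sum_(v in S) #|nbrs e S v| + 2 * #|lab @: S| <= 2 * #|S|.
Proof.
move=> dg el; have [m] := ubnP #|S|; elim: m S => // m IH S lm.
have [->|S0] := eqVneq S set0; first by rewrite imset0 !cards0 big_set0.
have [v vS lv] := dg S S0.
have {}lm : #|S :\ v| < m by move: lm; rewrite (cardsD1 v) vS; lia.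
have {}IH := IH _ lm; rewrite (cardsD1 v S) vS (big_setD1 v) //=.
have E : \sum_(x in S :\ v) #|nbrs e S x| =
         \sum_(x in S :\ v) #|nbrs e (S :\ v) x| + #|nbrs e S v|.
  under eq_bigr do rewrite (nbrsD1 _ vS); rewrite big_split /=; congr (_ + _).
  rewrite -sum1_card [RHS]big_mkcond [LHS]big_mkcond; apply: eq_bigr => x _.
  rewrite !inE e_sym; case: (eqVneq x v) => [->|] /=; first by rewrite e_irr andbF.
  by case: (x \in S) => //=; case: (e v x).
rewrite E.
have lS : #|lab @: S| <= #|lab @: (S :\ v)| + (#|nbrs e S v| == 0).
  have [z|nz] := eqVneq #|nbrs e S v| 0.
    rewrite -[in lab @: S](setD1K vS) imsetU1 cardsU1 addnC; case: (_ \notin _); lia.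
  have [b] : exists b, b \in nbrs e S v by apply/set0Pn; rewrite -card_gt0 lt0n.
  rewrite inE => /andP[bS vb]; rewrite addn0; apply/subset_leq_card/subsetP => l.
  case/imsetP=> x xS ->; have [->|xv] := eqVneq x v; last by apply: imset_f; rewrite !inE xv.
  rewrite (el _ _ vb); apply: imset_f; rewrite !inE bS andbT.
  by apply: contraTneq vb => ->; rewrite e_irr.
by move: lS lv IH; case: #|nbrs e S v| => [|[|]] //=; lia.
Qed.

End Forest.

(** * Digraphs given by parent sets *)

Section Parents.
Variables (T : finType).
Implicit Type Pa : T -> {set T}.

Definition dig Pa : rel T := fun u v => u \in Pa v.
Definition adj Pa : rel T := fun u v => (u \in Pa v) || (v \in Pa u).

Definition ptree Pa :=
  [/\ forall v, v \notin Pa v, forall u v, u \in Pa v -> v \notin Pa u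
    & degenerate (adj Pa)].

Lemma adj_sym Pa : symmetric (adj Pa).
Proof. by move=> u v; rewrite /adj orbC. Qed.

Lemma adj_irr Pa : (forall v, v \notin Pa v) -> irreflexive (adj Pa).
Proof. by move=> H v; rewrite /adj orbb; apply/negbTE. Qed.

Lemma ptree_polytree (D : rel T) : ptree (parents D) <-> polytree D.
Proof.
have E : underlying D =2 adj (parents D) by move=> u v; rewrite /adj !inE.
have E' : acyclic (underlying D) <-> acyclic (adj (parents D)).
  by split=> H c uc; apply: H; move: uc; rewrite /ucycle /= (eq_cycle E).
split=> [[i a d]|[i a d]]; split.
- by move=> v; have := i v; rewrite inE => /negbTE.
- by move=> u v Duv; have := a u v; rewrite !inE; apply.
- by apply/E'/degenerate_acyclic => //; apply: adj_sym.
- by move=> v; rewrite inE i.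
- by move=> u v; rewrite !inE; apply: a.
- apply/acyclic_degenerate/E' => //; [exact: adj_sym|apply: adj_irr => v].
  by rewrite inE i.
Qed.

Lemma ptree_sub Pa Pa' :
  (forall v, Pa' v \subset Pa v) -> ptree Pa -> ptree Pa'.
Proof.
move=> sub [i a d]; have s v x : x \in Pa' v -> x \in Pa v by apply/subsetP.
split.
- by move=> v; apply: contra (i v) => /s.
- by move=> u v /s/a; apply: contra => /s.
- move=> S /d[v vS l]; exists v => //; apply: leq_trans l.
  apply/subset_leq_card/subsetP => x; rewrite !inE => /andP[->] /=.
  by case/orP=> /s; rewrite /adj => ->; rewrite ?orbT.
Qed.

End Parents.

(** * Elimination of leaves *)

Section Leaf.
Variable V : finType.
Notation item := (V * {set V} * nat)%type.
Variables (its : seq item) (A : rel V).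
Hypotheses (A_sym : symmetric A) (A_irr : irreflexive A).
Hypothesis itsA : forall i x, i \in its -> x \in i.1.2 -> A i.1.1 x.
Implicit Types (S Z : {set V}) (lam : V -> nat) (Pa : V -> {set V}).

(* The score of v on the alive vertices S, once every dead vertex x has been
   eliminated: a parent x costs lam x, the loss of x when its own parent set
   may not contain the owner. *)
Definition ascore_item lam S v Z (i : item) : nat :=
  if (i.1.1 == v) && (i.1.2 :&: S == Z)
  then i.2 - \sum_(x in i.1.2 :\: S) lam x else 0.

(** A maximum, because parent sets that differ only in dead vertices have become the same set. *)
Definition ascore lam S v Z : nat := \max_(i <- its) ascore_item lam S v Z i.

Lemma ascore_supp lam S v Z z : ascore lam S v Z != 0 -> z \in Z -> z \in S /\ A v z.
Proof.
move=> nz zZ; have : ~~ all (fun i => ascore_item lam S v Z i == 0) its.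
  apply: contra nz => /allP al; rewrite /ascore big1_seq // => i /andP[_ /al].
  by move/eqP.
case/allPn=> i ii; rewrite /ascore_item; case: ifP => // /andP[/eqP <- /eqP E] _.
by move: zZ; rewrite -E inE => /andP[zi ->]; split=> //; apply: itsA.
Qed.

Lemma ascore_lam lam lam' S v Z :
  (forall x, x \notin S -> lam x = lam' x) -> ascore lam S v Z = ascore lam' S v Z.
Proof.
move=> H; apply: eq_bigr => i _; rewrite /ascore_item; case: ifP => // _.
by congr (_ - _); apply: eq_bigr => x; rewrite inE => /andP[/H].
Qed.

(** When [v] dies, the items showing [Z] are those that showed [Z] before and those that showed
    [v |: Z]; the latter now pay [lam v]. Truncated subtraction is monotone, hence distributes over
    the maximum. *)
Lemma ascoreD1 lam S v x Z : v \in S -> v \notin Z ->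
  ascore lam (S :\ v) x Z =
  maxn (ascore lam S x Z) (ascore lam S x (v |: Z) - lam v).
Proof.
move=> vS vZ; rewrite /ascore.
rewrite (big_morph (fun y => y - lam v) (id1 := 0) (op1 := maxn)); last 2 first.
- by move=> a b; lia.
- by rewrite ?sub0n.
rewrite -big_split /=; apply: eq_bigr => i _; rewrite /ascore_item.
case: eqP => _ //=.
have [vi|vi] := boolP (v \in i.1.2); last first.
  have -> : i.1.2 :&: (S :\ v) = i.1.2 :&: S.
    by apply/setP=> y; rewrite !inE; case: eqP => // ->; rewrite (negbTE vi).
  have -> : i.1.2 :\: (S :\ v) = i.1.2 :\: S.
    by apply/setP=> y; rewrite !inE; case: eqP => // ->; rewrite (negbTE vi) !andbF.
  case: (i.1.2 :&: S =P v |: Z) => [E|_]; last by rewrite ?sub0n ?maxn0.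
  by have := setU11 v Z; rewrite -E inE (negbTE vi).
have -> : (i.1.2 :&: S == Z) = false.
  by apply: contraNF vZ => /eqP <-; rewrite inE vi.
have -> : (i.1.2 :&: (S :\ v) == Z) = (i.1.2 :&: S == v |: Z).
  apply/eqP/eqP=> [<-|E]; apply/setP=> y.
    by rewrite !inE; case: eqP => // ->; rewrite vi vS.
  have := congr1 (fun X : {set V} => y \in X) E; rewrite !inE.
  by case: (eqVneq y v) => [->|_] //=; rewrite (negbTE vZ) andbF.
rewrite max0n; case: ifP => _; last by rewrite ?sub0n.
rewrite -subnDA; congr (_ - _); rewrite (big_setD1 v) /=; last by rewrite !inE eqxx vi.
rewrite addnC; congr (_ + _); apply: eq_bigl => y; rewrite !inE.
by case: (eqVneq y v) => [->|_] //=; rewrite ?vS ?vi.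
Qed.

Definition atotal lam S Pa : nat := \sum_(v in S) ascore lam S v (Pa v :&: S).

(* v is isolated or a leaf of the graph induced by S; the attachment vertex of
   an isolated vertex is itself. *)
Definition leaf lam S v u :=
  [/\ v \in S, u \in S, forall x, x \in S -> A v x -> x = u
    & lam v = ascore lam S v [set u] - ascore lam S v set0].

Definition gain lam S v u := maxn (ascore lam S v set0) (ascore lam S v [set u]).

Section Step.
Variables (lam : V -> nat) (S : {set V}) (v u : V).
Hypothesis lf : leaf lam S v u.
Let S' := S :\ v.

Lemma leaf_set Z : ascore lam S v Z != 0 -> Z = set0 \/ Z = [set u] /\ u != v.
Proof.
have [vS uS H _] := lf => nz; have [->|/set0Pn[z zZ]] := eqVneq Z set0; first by left.
have zu z' : z' \in Z -> z' = u by move=> /(ascore_supp nz)[/H]; apply.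
right; split.
  by apply/setP=> y; rewrite inE; apply/idP/eqP => [/zu//|->]; rewrite -(zu _ zZ).
by have := ascore_supp nz zZ; rewrite (zu _ zZ) => -[_]; apply: contraTneq => ->; rewrite A_irr.
Qed.

Lemma leaf_other x Z : x \in S -> x != u -> ascore lam S x (v |: Z) = 0.
Proof.
have [vS uS H _] := lf => xS; apply: contraNeq => nz.
have [_ xv] := ascore_supp nz (setU11 v Z); apply/eqP/H => //.
by rewrite A_sym.
Qed.

(** Only [u] can profit from having [v] as a parent. If it does, asymmetry keeps [u] out of the
    parents of [v], and what [v] earns without [u], together with [lam v], is exactly [gain].
    Otherwise [u] loses nothing and [v] earns at most [gain]. *)
Lemma leaf_forward Pa :
  (forall a b, a \in Pa b -> b \notin Pa a) ->
  atotal lam S Pa <= atotal lam S' Pa + gain lam S v u.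
Proof.
have [vS uS H El] := lf => asy; rewrite /atotal (big_setD1 v) //= -/S'.
have step x : ascore lam S x (Pa x :&: S) - (if v \in Pa x then lam v else 0)
    <= ascore lam S' x (Pa x :&: S').
  rewrite ascoreD1 ?inE ?eqxx ?andbF //.
  case: ifP => vx; last first.
    rewrite subn0 (_ : Pa x :&: S' = Pa x :&: S) ?leq_maxl //.
    by apply/setP=> y; rewrite !inE; case: eqP => // ->; rewrite vx.
  rewrite (_ : v |: (Pa x :&: S') = Pa x :&: S) ?leq_maxr //.
  by apply/setP=> y; rewrite !inE; case: (eqVneq y v) => [->|] //=; rewrite vx vS.
have other x : x \in S' -> x != u ->
    ascore lam S x (Pa x :&: S) <= ascore lam S' x (Pa x :&: S').
  move=> xS xu; have := step x; case: ifP => [vx _|_]; last by rewrite subn0.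
  rewrite (_ : Pa x :&: S = v |: (Pa x :&: S)) ?leaf_other //.
    by move: xS; rewrite inE => /andP[].
  by apply/setP=> y; rewrite !inE; case: (eqVneq y v) => [->|] //=; rewrite vx vS.
have av : ascore lam S v (Pa v :&: S) <= gain lam S v u.
  have [->//|/leaf_set] := eqVneq (ascore lam S v (Pa v :&: S)) 0.
  by move=> [->|[-> _]]; rewrite ?leq_maxl ?leq_maxr.
have [uv|uv] := eqVneq u v.
  rewrite addnC leq_add //; apply: leq_sum => x xS; apply: other => //.
  by move: xS; rewrite !inE uv => /andP[].
have uS' : u \in S' by rewrite !inE uv.
rewrite (big_setD1 u) //= [in X in _ <= X](big_setD1 u) //=.
have : \sum_(x in S' :\ u) ascore lam S x (Pa x :&: S) <=
       \sum_(x in S' :\ u) ascore lam S' x (Pa x :&: S').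
  by apply: leq_sum => x; rewrite inE in_set1 => /andP[xu xS]; apply: other.
have := step u; case: ifP => vu; last by lia.
have : ascore lam S v (Pa v :&: S) <= ascore lam S v set0.
  have [->//|/leaf_set] := eqVneq (ascore lam S v (Pa v :&: S)) 0.
  move=> [->|[E _]] //; have := asy _ _ vu.
  by have := set11 u; rewrite -E inE => /andP[->].
by rewrite El /gain; lia.
Qed.

Variable Pa' : V -> {set V}.
Hypothesis sub' : forall x y, x \in Pa' y -> x \in S' /\ y \in S'.
Hypothesis pt' : ptree Pa'.

(** Decides which of the two alternatives of [ascoreD1] attains the value of [u]; [v] becomes a
    parent of [u] only if the second one is strictly better. *)
Definition leaf_in :=
  (u != v) && (ascore lam S u (Pa' u) < ascore lam S u (v |: Pa' u) - lam v).

Definition leaf_back (x : V) : {set V} :=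
  if (x == u) && leaf_in then v |: Pa' u
  else if [&& x == v, u != v, ~~ leaf_in & 0 < lam v] then [set u] else Pa' x.

Lemma leaf_backE x y :
  (x \in leaf_back y) = (x \in Pa' y) || [&& y == u, leaf_in & x == v] ||
    [&& y == v, u != v, ~~ leaf_in, 0 < lam v & x == u].
Proof.
have nv z : (z \in Pa' v) = false.
  by apply/negP => /sub'; rewrite !inE eqxx => -[].
rewrite /leaf_back; case: (eqVneq y u) => [->|yu] /=.
  case: (boolP leaf_in) => li /=.
    rewrite !inE orbC !andbF orbF; congr (_ || _).
  by case: (eqVneq u v) => [->|_]; rewrite ?nv ?andbF ?orbF.
case: (eqVneq y v) => [->|_] /=; last by rewrite !orbF.
rewrite nv /=; case: leaf_in; case: (u != v); case: (0 < lam v) => //=;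
  by rewrite ?inE ?nv.
Qed.

Lemma leaf_back_sub x y : x \in leaf_back y -> x \in S /\ y \in S.
Proof.
have [vS uS _ _] := lf; rewrite leaf_backE => /orP[/orP[/sub'|]|].
- by rewrite !inE => -[/andP[_ ->] /andP[_ ->]].
- by move=> /and3P[/eqP-> _ /eqP->].
- by move=> /and5P[/eqP-> _ _ _ /eqP->].
Qed.

(** In the extended digraph [v] has no neighbour besides [u]. So a vertex set containing [v] has [v]
    as its low vertex, and on a set without [v] nothing has changed. *)
Lemma leaf_back_ptree : ptree leaf_back.
Proof.
have [vS uS _ _] := lf; have [irr asy dg] := pt'.
have nv z : (z \in Pa' v) = false by apply/negP => /sub'; rewrite !inE eqxx => -[].
have nv' z : (v \in Pa' z) = false by apply/negP => /sub'; rewrite !inE eqxx => -[].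
have vlow (S0 : {set V}) : #|nbrs (adj leaf_back) S0 v| <= 1.
  rewrite -(cards1 u); apply/subset_leq_card/subsetP => y; rewrite !inE /adj.
  rewrite !leaf_backE nv nv' eqxx /= andbT => /andP[_].
  case: (eqVneq y u) => //= yu; rewrite !andbF ?orbF /=.
  by case: (eqVneq v u) => [E|_]; rewrite ?andbF // /leaf_in E eqxx !andbF.
split.
- move=> x; rewrite leaf_backE (negbTE (irr x)) /=; apply/negP => /orP[].
    by move=> /and3P[/eqP-> /andP[uv _]]; rewrite (negbTE uv).
  by move=> /and5P[/eqP-> uv _ _]; rewrite eq_sym (negbTE uv).
- move=> x y; rewrite !leaf_backE; case: (boolP leaf_in) => [/andP[uv _]|_] /=.
    rewrite !andbF !orbF => /orP[xy|/andP[/eqP-> /eqP->]].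
      rewrite negb_or (asy _ _ xy) /=; apply/negP => /andP[/eqP xu /eqP yv].
      by rewrite yv nv in xy.
    by rewrite nv eq_sym (negbTE uv).
  rewrite !andbF !orbF => /orP[xy|/and4P[/eqP-> uv _ /eqP->]].
    rewrite negb_or (asy _ _ xy) /=; apply/negP => /and4P[/eqP xv _ _ _].
    by rewrite xv nv' in xy.
  by rewrite nv' (negbTE uv).
- move=> S0 /set0Pn[s sS]; have [vS0|vS0] := boolP (v \in S0); first by exists v.
  have [|x xS lx] := dg S0; first by apply/set0Pn; exists s.
  exists x => //; apply: leq_trans lx; apply/subset_leq_card/subsetP => y.
  rewrite !inE => /andP[yS]; rewrite yS /adj !leaf_backE /=.
  have -> : (x == v) = false by apply: contraNF vS0 => /eqP <-.
  have -> : (y == v) = false by apply: contraNF vS0 => /eqP <-.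
  by rewrite /= !andbF !orbF.
Qed.

Lemma leaf_backward :
  atotal lam S' Pa' + gain lam S v u <= atotal lam S leaf_back.
Proof.
have [vS uS H El] := lf.
have E x : leaf_back x :&: S = leaf_back x.
  by apply/setIidPl/subsetP => y /leaf_back_sub[].
have E' x : Pa' x :&: S' = Pa' x by apply/setIidPl/subsetP => y /sub'[].
have nv z : (z \in Pa' v) = false by apply/negP => /sub'; rewrite !inE eqxx => -[].
have nv' z : v \notin Pa' z by apply/negP => /sub'; rewrite !inE eqxx => -[].
have Pv0 : Pa' v = set0 by apply/setP=> z; rewrite nv inE.
rewrite /atotal [in X in _ <= X](big_setD1 v) //= -/S'.
under eq_bigr do rewrite E'; under [in X in _ <= X]eq_bigr do rewrite E.
rewrite E; have other x : x \in S' -> x != u ->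
    ascore lam S' x (Pa' x) <= ascore lam S x (leaf_back x).
  rewrite !inE => /andP[xv xS] xu; rewrite ascoreD1 ?leaf_other ?sub0n ?maxn0 //.
  by rewrite /leaf_back (negbTE xu) (negbTE xv).
have [uv|uv] := eqVneq u v.
  have Ev : leaf_back v = set0.
    by apply/setP=> z; rewrite leaf_backE nv /leaf_in uv eqxx inE /= ?andbF.
  rewrite addnC leq_add //.
    rewrite Ev /gain geq_max leqnn /= uv.
    have [->//|/leaf_set] := eqVneq (ascore lam S v [set v]) 0.
    by rewrite uv eqxx; case=> [->//|[]].
  apply: leq_sum => x xS; apply: other => //.
  by move: xS; rewrite !inE uv => /andP[].
have uS' : u \in S' by rewrite !inE uv.
rewrite (big_setD1 u) //= [in X in _ <= X](big_setD1 u) //=.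
have : \sum_(x in S' :\ u) ascore lam S' x (Pa' x) <=
       \sum_(x in S' :\ u) ascore lam S x (leaf_back x).
  by apply: leq_sum => x; rewrite inE in_set1 => /andP[xu xS]; apply: other.
rewrite ascoreD1 //; case: (boolP leaf_in) => li.
  have -> : leaf_back v = set0.
    by apply/setP=> z; rewrite leaf_backE nv li inE /= !andbF (eq_sym v) (negbTE uv).
  have -> : leaf_back u = v |: Pa' u by rewrite /leaf_back eqxx li.
  by move: li; rewrite /leaf_in uv /= /gain El; lia.
have -> : leaf_back u = Pa' u by rewrite /leaf_back (negbTE li) andbF (negbTE uv).
have -> : leaf_back v = if 0 < lam v then [set u] else set0.
  by rewrite /leaf_back eq_sym (negbTE uv) eqxx li Pv0.
by move: li; rewrite /leaf_in uv /= /gain -leqNgt El; case: ifP; lia.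
Qed.

End Step.

(* Vertices are listed in reverse order of elimination. *)
Definition alive (r : seq V) : {set V} := ~: [set x in r].

Fixpoint elim_seq lam (par : V -> V) (r : seq V) : Prop :=
  if r is v :: r' then leaf lam (alive r') v (par v) /\ elim_seq lam par r'
  else True.

Fixpoint elim_gain lam (par : V -> V) (r : seq V) : nat :=
  if r is v :: r' then gain lam (alive r') v (par v) + elim_gain lam par r' else 0.

Lemma alive_cons v r : alive (v :: r) = alive r :\ v.
Proof. by apply/setP=> x; rewrite !inE negb_or. Qed.

Lemma elim_forward lam par r Pa :
  elim_seq lam par r -> (forall a b, a \in Pa b -> b \notin Pa a) ->
  atotal lam setT Pa <= atotal lam (alive r) Pa + elim_gain lam par r.
Proof.
move=> er asy; elim: r er => [_|v r IH /= [lf /IH {}IH]] /=.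
  by rewrite addn0 (_ : alive [::] = setT) //; apply/setP=> x; rewrite !inE.
by have := leaf_forward lf asy; rewrite alive_cons; lia.
Qed.

(** Past eliminations consult [lam] and [par] at dead vertices only. Hence writing the entries of a
    vertex that is still alive does not invalidate them. *)
Lemma elim_seq_ext lam par lam' par' r :
  {in r, lam =1 lam'} -> {in r, par =1 par'} ->
  elim_seq lam par r -> elim_seq lam' par' r /\
  elim_gain lam par r = elim_gain lam' par' r.
Proof.
elim: r => [//|v r IH] El Ep /= [[vS uS H Ev] /IH[]] => [x xr|x xr|e g].
- by apply: El; rewrite inE xr orbT.
- by apply: Ep; rewrite inE xr orbT.
have Es x Z : ascore lam (alive r) x Z = ascore lam' (alive r) x Z.
  by apply: ascore_lam => y; rewrite !inE negbK => yr; apply: El; rewrite inE yr orbT.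
have Epv := Ep v (mem_head _ _); have Elv := El v (mem_head _ _).
by rewrite /gain /leaf -!Es -Epv -Elv g.
Qed.

End Leaf.

(** * Optimal orientations of a path *)

(* The path has vertices 0, 1, ...; [g j l r] is the score of vertex j when l
   (resp. r) tells whether its left (resp. right) neighbour is a parent. *)
Section Table.
Variable g : nat -> bool -> bool -> nat.

(** Addition in which a left argument 0 stands for minus infinity; this is why the entries of [tab]
    are shifted by one. *)
Definition addp (x y : nat) := if x == 0 then 0 else x + y.

(* One plus the best score of the vertices 0..i, or 0 if there is none. The bits
   b and a say whether the left neighbour of 0, resp. the right neighbour of i,
   is a parent; c says whether some edge between 0..i is unused. *)
Fixpoint tab (i : nat) (a b c : bool) : nat :=
  if i is i'.+1 then
    maxn (maxn (addp (tab i' false b c) (g i true a))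
               (addp (tab i' true b c) (g i false a)))
         (if c then addp (maxn (tab i' false b false) (tab i' false b true))
                         (g i false a) else 0)
  else if c then 0 else (g 0 b a).+1.

(* [rt j] is the arc from j to j+1, and [lf j] the arc from j+1 to j. *)
Section Orientation.
Variables (b : bool) (rt lf : nat -> bool).

Fixpoint oscore (i : nat) (a : bool) : nat :=
  if i is i'.+1 then g i (rt i') a + oscore i' (lf i') else g 0 b a.

Definition broken (i : nat) : bool := [exists j : 'I_i, ~~ (rt j || lf j)].

Lemma brokenS i : broken i.+1 = broken i || ~~ (rt i || lf i).
Proof.
apply/existsP/orP => [[j nj]|[/existsP[j nj]|ni]].
- have [ji|ji] := ltnP j i; first by left; apply/existsP; exists (Ordinal ji).
  by right; rewrite (_ : i = j) //; have := ltn_ord j; lia.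
- by exists (widen_ord (leqnSn i) j).
- by exists ord_max.
Qed.

Lemma oscore_sum i a :
  oscore i a = \sum_(j < i.+1)
    g j (if j == 0 :> nat then b else rt j.-1) (if j == i :> nat then a else lf j).
Proof.
elim: i a => [|i IH] a /=; first by rewrite big_ord1.
rewrite big_ord_recr /= eqxx addnC IH; congr (_ + _).
apply: eq_bigr => j _; congr (g _ _ _).
rewrite (_ : (j == i.+1 :> nat) = false); last by have := ltn_ord j; lia.
by case: eqP => // ->.
Qed.

Lemma tab_bound i a : (forall j, j < i -> ~~ (rt j && lf j)) ->
  (oscore i a).+1 <= tab i a b (broken i).
Proof.
elim: i a => [|i IH] a H /=.
  by rewrite (_ : broken 0 = false) //; apply/existsP => -[[]].
have {}IH a' : oscore i a' < tab i a' b (broken i) by apply: IH => j ji; apply: H; lia.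
have := H i (ltnSn i); rewrite brokenS /addp.
have := IH (lf i); have := IH false.
case: (rt i); case: (lf i); case: (broken i) => //=;
  case: (tab i false b false) => [|?]; case: (tab i false b true) => [|?];
  case: (tab i true b false) => [|?]; case: (tab i true b true) => [|?] //=;
  try (case: eqP => ?); lia.
Qed.

End Orientation.

(** An orientation with the prescribed bits exists unless an edge is to be missing where there is
    none. On a long path all eight entries are thus non-zero, and all eight parent sets of the first
    gadget vertex belong to its score list. *)
Lemma tab_gt0 i a b c : ~~ c || (0 < i) -> 0 < tab i a b c.
Proof.
elim: i a c => [|i IH] a c /=; first by case: c.
have p : 0 < tab i false b false by apply: IH.
have ap x y : 0 < x -> 0 < addp x y by case: x.
case: c => _; last by rewrite !leq_max ap.
by apply: leq_trans (leq_maxr _ _); apply: ap; rewrite leq_max p.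
Qed.

(* One backtracking step from vertex i+1 to vertex i: the arcs between them and
   whether the part up to i is broken. *)
Definition bpick (b : bool) (i : nat) (a c : bool) : bool * bool * bool :=
  if (tab i false b c != 0) && (tab i false b c + g i.+1 true a == tab i.+1 a b c)
  then (true, false, c)
  else if (tab i true b c != 0) && (tab i true b c + g i.+1 false a == tab i.+1 a b c)
  then (false, true, c)
  else (false, false, tab i false b false < tab i false b true).

Fixpoint back (b : bool) (i : nat) (a c : bool) (j : nat) : bool * bool :=
  if i is i'.+1 then
    let: (r, l, c') := bpick b i' a c in
    if j == i' then (r, l) else back b i' l c' j
  else (false, false).

Lemma bpickP b i a c : tab i.+1 a b c != 0 ->
  let: (r, l, c') := bpick b i a c in
  [/\ ~~ (r && l), tab i l b c' != 0, c = c' || ~~ (r || l)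
    & tab i.+1 a b c = g i.+1 r a + tab i l b c'].
Proof.
rewrite /bpick; case: ifP => [/andP[n0 /eqP <-] _|H1].
  by split; rewrite ?orbF //= addnC.
case: ifP => [/andP[n0 /eqP <-] _|H2]; first by split; rewrite ?orbF //= addnC.
have lt x y M : (x != 0) && (x + y == M) = false -> M != 0 -> addp x y <= M ->
    addp x y < M by rewrite /addp; case: x => [|x] /=; lia.
move=> nz; have := lt _ _ _ H1 nz; have := lt _ _ _ H2 nz.
rewrite /= !leq_max !leqnn !orbT => /(_ isT) l1 /(_ isT) l2.
have EM : tab i.+1 a b c =
    if c then addp (maxn (tab i false b false) (tab i false b true)) (g i.+1 false a)
    else 0 by move: l1 l2 => /=; lia.
move: nz; rewrite -/(tab i.+1 a b c) EM; case: c {EM H1 H2 l1 l2} => //=.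
rewrite /addp; case: ifP => // /negbT nz _.
by case: ltnP => l; split; rewrite ?orbT //; move: nz l; lia.
Qed.

Lemma back_opt b i a c : tab i a b c != 0 ->
  let rt j := (back b i a c j).1 in let lf j := (back b i a c j).2 in
  [/\ forall j, ~~ (rt j && lf j), broken rt lf i = c
    & (oscore b rt lf i a).+1 = tab i a b c].
Proof.
elim: i a c => [|i IH] a c nz /=.
  move: nz => /=; case: c => // _; split=> //.
  by apply/existsP => -[[]].
have := bpickP nz; rewrite -/(tab i.+1 a b c); case: (bpick b i a c) => -[r l] c' /= [nrl nz' Ec ->].
have [H1 H2 H3] := IH l c' nz'.
set rt := fun j => (if j == i then (r, l) else back b i l c' j).1.
set lf := fun j => (if j == i then (r, l) else back b i l c' j).2.
have ext k a' : k <= i -> oscore b rt lf k a' =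
    oscore b (fun j => (back b i l c' j).1) (fun j => (back b i l c' j).2) k a'.
  elim: k a' => //= k IHk a' ki; rewrite IHk 1?ltnW // /rt /lf.
  by rewrite (_ : (k == i) = false) //; lia.
have Er : rt i = r by rewrite /rt eqxx.
have El : lf i = l by rewrite /lf eqxx.
split.
- by move=> j; rewrite /rt /lf; case: eqP.
- rewrite brokenS Ec Er El -H2; congr (_ || _); apply: eq_existsb => j.
  by rewrite /rt /lf (_ : (j == i :> nat) = false) //; have := ltn_ord j; lia.
- by rewrite !eqxx /= ext // -addnS H3.
Qed.

End Table.

(** * Replacement of long paths *)

Lemma degenerateP (T : finType) (e : rel T) :
  (forall S : {set T}, (forall v, v \in S -> 1 < #|nbrs e S v|) -> S = set0) -> degenerate e.
Proof.
move=> H S S0; case: (pickP [pred v in S | #|nbrs e S v| <= 1]) => [v /andP[? ?]|no].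
  by exists v.
case/eqP: S0; apply: H => v vS; have := no v; rewrite /= vS /=; lia.
Qed.

Lemma in_nbrs (T : finType) (e : rel T) (S : {set T}) v b :
  (b \in nbrs e S v) = (b \in S) && e v b.
Proof. by rewrite inE. Qed.

Lemma degenerate_min2 (T : finType) (e : rel T) (S : {set T}) : degenerate e ->
  (forall v, v \in S -> 1 < #|nbrs e S v|) -> S = set0.
Proof.
move=> dg H; apply/eqP; apply: contraT => /dg[v /H]; lia.
Qed.

Lemma nbrs_pair (T : finType) (e : rel T) (S : {set T}) v a b : 1 < #|nbrs e S v| ->
  (forall x, x \in S -> e v x -> x = a \/ x = b) ->
  [/\ a \in S, b \in S, e v a & e v b].
Proof.
move=> /card_gt1P[x [y []]]; rewrite !inE => /andP[xS vx] /andP[yS vy] xy H.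
case: (H _ xS vx) => Ex; case: (H _ yS vy) => Ey; subst; split=> //;
  by rewrite eqxx in xy.
Qed.

Lemma uniq_flatten_map (T T' : eqType) (f : T -> seq T') (s : seq T) :
  uniq s -> (forall P, P \in s -> uniq (f P)) ->
  (forall P Q v, P \in s -> Q \in s -> v \in f P -> v \in f Q -> P = Q) ->
  uniq (flatten [seq f P | P <- s]).
Proof.
elim: s => //= P s IH /andP[Ps us] uf dj; rewrite cat_uniq; apply/and3P; split.
- by apply: uf; rewrite mem_head.
- apply/hasPn => v /flattenP[t /mapP[Q Qs ->] vQ]; apply/negP => vP.
  have E : P = Q by apply: (dj P Q v) => //; rewrite inE ?eqxx ?Qs ?orbT.
  by rewrite E Qs in Ps.
- apply: IH => // [Q Qs|Q R v Qs Rs]; first by apply: uf; rewrite inE Qs orbT.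
  by apply: dj; rewrite inE ?Qs ?Rs orbT.
Qed.

Section Path.
Variables (V : finType) (A : rel V) (C : {set V}) (F : V -> {set V} -> nat).
Hypotheses (A_sym : symmetric A) (A_irr : irreflexive A).
Hypothesis F_supp : forall v Z z, F v Z != 0 -> z \in Z -> z \in C /\ A v z.

(* (w, qs, u): the inner vertices qs of a path from w to u. *)
Notation vpath := (V * seq V * V)%type.
Implicit Types (P : vpath) (Pa : V -> {set V}).

Definition pw P := P.1.1.
Definition pqs P := P.1.2.
Definition pu P := P.2.
(** Position 0 is the end w, the positions from 1 to the length are the inner vertices, and the next
    one is the end u. The two ends may be the same vertex, as on a cycle opened at one vertex. *)
Definition pv P i := nth (pw P) (pw P :: rcons (pqs P) (pu P)) i.
Definition px P := pv P (size (pqs P)).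
Definition opt (b : bool) (x : V) : {set V} := if b then [set x] else set0.

Lemma in_opt b x y : (y \in opt b x) = b && (y == x).
Proof. by rewrite /opt; case: b; rewrite !inE. Qed.

Lemma pv0 P : pv P 0 = pw P. Proof. by []. Qed.
Lemma pvm P : pv P (size (pqs P)).+1 = pu P.
Proof. by rewrite /pv /= nth_rcons ltnn eqxx. Qed.

Lemma pvE P j : 0 < j <= size (pqs P) -> pv P j = nth (pw P) (pqs P) j.-1.
Proof. by case: j => // j /= jm; rewrite /pv /= nth_rcons jm. Qed.

Lemma pv_in P j : 0 < j <= size (pqs P) -> pv P j \in pqs P.
Proof. by case: j => // j jm; rewrite pvE // mem_nth. Qed.

Lemma pqsP P v : v \in pqs P -> exists2 j, 0 < j <= size (pqs P) & v = pv P j.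
Proof.
move=> vP; exists (index v (pqs P)).+1; first by rewrite /= index_mem.
by rewrite pvE /= ?index_mem // nth_index.
Qed.

Definition gpath P j l r := F (pv P j.+1) (opt l (pv P j) :|: opt r (pv P j.+2)).
Definition ptab P a b c := tab (gpath P) (size (pqs P)).-1 a b c.
(** The weight B of the gadget. It must dominate the eight optima, and their sum is an upper bound
    that costs no comparison. *)
Definition pbig P := \sum_(a : bool) \sum_(b : bool) \sum_(c : bool) ptab P a b c.

(** For the first vertex, [Z] is compared with the set rebuilt from three memberships, so that
    exactly eight sets score, one for each triple of bits. The parent [px P] means that the path is
    unbroken, hence the negation of [cn] in the table index. Inner vertices other than the first and
    the last score nothing. *)
Definition gad P v (Z : {set V}) : nat :=
  if v == px P then
    if Z == [set pv P 2; pv P 3] then 2 * pbig P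
    else if Z == [set pu P] then pbig P else 0
  else if v == pv P 1 then
    let a := pv P 2 \in Z in let b := pw P \in Z in let cn := px P \in Z in
    if Z == opt b (pw P) :|: opt cn (px P) :|: (opt a (pv P 2) :|: opt a (pv P 3))
    then ptab P a b (~~ cn) + (if a then pbig P else 0) else 0
  else 0.

Variable Ps : seq vpath.

Definition pof v : option vpath := ohead [seq P <- Ps | v \in pqs P].
Definition onpath v := pof v != None.

Definition good_path P :=
  [/\ 3 < size (pqs P), uniq (pqs P), pw P \in C /\ pu P \in C,
      ~~ onpath (pw P) /\ ~~ onpath (pu P)
    & forall j, j < size (pqs P) -> pv P j.+1 \in C /\
        forall x, x \in C -> A (pv P j.+1) x = (x == pv P j) || (x == pv P j.+2)].

Hypothesis good : forall P, P \in Ps -> good_path P.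
Hypothesis disj : forall P Q v, P \in Ps -> Q \in Ps -> v \in pqs P -> v \in pqs Q -> P = Q.

Definition fin v (Z : {set V}) : nat :=
  if pof v is Some P then gad P v Z else if v \in C then F v Z else 0.

Lemma pofP P v : P \in Ps -> v \in pqs P -> pof v = Some P.
Proof.
move=> PP vP; rewrite /pof.
case E: [seq Q <- Ps | v \in pqs Q] => [|Q l].
  have : P \in [seq Q <- Ps | v \in pqs Q] by rewrite mem_filter vP.
  by rewrite E.
have : Q \in [seq Q <- Ps | v \in pqs Q] by rewrite E mem_head.
by rewrite mem_filter => /andP[vQ QP] /=; rewrite (disj QP PP vQ vP).
Qed.

Lemma pofS P v : pof v = Some P -> P \in Ps /\ v \in pqs P.
Proof.
rewrite /pof; case E: [seq Q <- Ps | v \in pqs Q] => [|Q l] //= [<-].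
have : Q \in [seq Q <- Ps | v \in pqs Q] by rewrite E mem_head.
by rewrite mem_filter => /andP[].
Qed.

Section One.
Variable P : vpath.
Hypothesis PP : P \in Ps.
Let m := size (pqs P).

Lemma pm4 : 3 < m. Proof. by case: (good PP). Qed.

Lemma pof_pv j : 0 < j <= m -> pof (pv P j) = Some P.
Proof. by move=> jm; apply: pofP => //; apply: pv_in. Qed.

Lemma pv_eq i j : 0 < i <= m -> 0 < j <= m -> (pv P i == pv P j) = (i == j).
Proof.
move=> im jm; rewrite !pvE // nth_uniq; first by apply/eqP/eqP; lia.
- by rewrite -/m; lia.
- by rewrite -/m; lia.
- by case: (good PP).
Qed.

Lemma pv_neq0 i j : 0 < i <= m -> j = 0 \/ j = m.+1 -> (pv P i == pv P j) = false.
Proof.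
move=> im; have [_ _ _ [w0 u0] _] := good PP => -[]->; apply/eqP.
  by move=> E; move: w0; rewrite -pv0 -E /onpath pof_pv.
by move=> E; move: u0; rewrite -pvm -E /onpath pof_pv.
Qed.

Lemma pv_neq i j : i != j -> 0 < i <= m -> j <= m.+1 -> (pv P i == pv P j) = false.
Proof.
move=> ij im jm; have [jb|jb] := boolP (0 < j <= m); first by rewrite pv_eq //; lia.
by apply: pv_neq0 => //; lia.
Qed.

Lemma pvC j : j <= m.+1 -> pv P j \in C.
Proof.
have [_ _ [wC uC] _ H] := good PP; case: j => // j; rewrite leq_eqVlt.
by case/orP=> [/eqP[->]|]; [rewrite pvm|rewrite ltnS => /H[]].
Qed.

Lemma pvA j x : j < m -> x \in C -> A (pv P j.+1) x = (x == pv P j) || (x == pv P j.+2).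
Proof. by have [_ _ _ _ H] := good PP => /H[_]; apply. Qed.

Lemma off_end x j : 0 < j <= m -> ~~ onpath x -> x \in C -> A x (pv P j) ->
  x = pw P /\ j = 1 \/ x = pu P /\ j = m.
Proof.
case: j => // j jm xo xC; rewrite A_sym pvA //.
have on i : x == pv P i -> 0 < i <= m -> False.
  by move=> /eqP E im; move: xo; rewrite E /onpath pof_pv.
case: j jm => [|j] jm.
  case/orP=> [/eqP->|]; first by left.
  by move/on; case=> //; have := pm4; lia.
case/orP=> [/on|]; first by case=> //; lia.
have [->|jm'] := eqVneq j.+2 m; last by move/on; case; lia.
by rewrite pvm => /eqP; right.
Qed.

Lemma pofpx : pof (px P) = Some P.
Proof. by apply: pof_pv; have := pm4; rewrite -/m; lia. Qed.

End One.

Lemma onpathP v : onpath v -> exists P j, [/\ P \in Ps, 0 < j <= size (pqs P) & v = pv P j].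
Proof.
rewrite /onpath; case E: (pof v) => [P|] // _; have [PP vP] := pofS E.
by have [j jm ->] := pqsP vP; exists P, j.
Qed.

Lemma pv_path P Q i j : P \in Ps -> Q \in Ps -> 0 < i <= size (pqs P) ->
  0 < j <= size (pqs Q) -> pv P i = pv Q j -> P = Q /\ i = j.
Proof.
move=> PP QQ im jm E; have PQ : P = Q.
  by apply: (disj (v := pv P i)) => //; [|rewrite E]; apply: pv_in.
by subst Q; split=> //; apply/eqP; rewrite -(pv_eq PP) // E.
Qed.

Lemma off_pv x P j : P \in Ps -> 0 < j <= size (pqs P) -> ~~ onpath x -> (x == pv P j) = false.
Proof. by move=> PP jm; apply: contraNF => /eqP->; rewrite /onpath pof_pv. Qed.

Hypothesis uniqPs : uniq Ps.

(** Long paths are disjoint and lie in the core, so a score splits into one part per path and a part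
    off the paths that both transformations leave alone. *)
Lemma sum_paths (G : V -> nat) :
  \sum_(v in C) G v = \sum_(v in C | ~~ onpath v) G v +
    \sum_(P <- Ps) \sum_(j < size (pqs P)) G (pv P j.+1).
Proof.
rewrite (bigID onpath) /= addnC; congr (_ + _).
have -> : \sum_(P <- Ps) \sum_(j < size (pqs P)) G (pv P j.+1) =
          \sum_(P <- Ps) \sum_(v <- pqs P) G v.
  rewrite big_seq [RHS]big_seq; apply: eq_bigr => P PP.
  rewrite [RHS](big_nth (pw P)) big_mkord; apply: eq_bigr => j _.
  by rewrite pvE //=.
rewrite -(big_map pqs predT (fun s => \sum_(v <- s) G v)) -big_flatten big_uniq /=.
  apply: eq_bigl => v; apply/andP/flattenP => [[_]|[s]].
    case/onpathP=> P [j [PP jm ->]]; exists (pqs P); first exact: map_f.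
    exact: pv_in.
  case/mapP=> P PP -> vP; rewrite /onpath (pofP PP vP); split=> //.
  by have [j jm ->] := pqsP vP; apply: pvC => //; lia.
by apply: uniq_flatten_map => // P /good[].
Qed.

(** Arcs off the superstructure are allowed in a solution but earn nothing. Without them an inner
    vertex of a path is adjacent to its two path neighbours only. *)
Definition normal Pa := forall a b, a \in Pa b -> [/\ a \in C, b \in C & A a b].

Lemma normal_on Pa P j x : normal Pa -> P \in Ps -> j < size (pqs P) ->
  x \in Pa (pv P j.+1) -> x = pv P j \/ x = pv P j.+2.
Proof.
move=> nPa PP jm /nPa[xC _]; rewrite A_sym (pvA PP) //.
by case/orP=> /eqP; [left|right].
Qed.

Lemma normal_off Pa P j x : normal Pa -> P \in Ps -> 0 < j <= size (pqs P) ->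
  ~~ onpath x -> x \in Pa (pv P j) \/ pv P j \in Pa x ->
  x = pw P /\ j = 1 \/ x = pu P /\ j = size (pqs P).
Proof.
move=> nPa PP jm xo H; apply: off_end => //; first by case: H => /nPa[].
by case: H => /nPa[_ _] //; rewrite A_sym.
Qed.

Lemma pbigP P a b c : ptab P a b c <= pbig P.
Proof.
by rewrite /pbig !big_bool /=; case: a; case: b; case: c; lia.
Qed.

Lemma sum_gad P Pa : P \in Ps ->
  \sum_(j < size (pqs P)) gad P (pv P j.+1) (Pa (pv P j.+1)) =
  gad P (px P) (Pa (px P)) + gad P (pv P 1) (Pa (pv P 1)).
Proof.
move=> PP; have m4 := pm4 PP; move Em : (size (pqs P)) (m4) => m {}m4.
case: m m4 Em => // -[|m] // m4 Em.
rewrite big_ord_recl big_ord_recr /=.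
rewrite big1 ?add0n; first by rewrite addnC /px Em; congr (_ + _); rewrite /bump add1n.
move=> j _; rewrite /gad /px !pv_neq ?Em //=; have := ltn_ord j; rewrite /bump; lia.
Qed.

Lemma fin_total Pa :
  \sum_v fin v (Pa v) = \sum_(v in C | ~~ onpath v) F v (Pa v) +
  \sum_(P <- Ps) (gad P (px P) (Pa (px P)) + gad P (pv P 1) (Pa (pv P 1))).
Proof.
have -> : \sum_v fin v (Pa v) = \sum_(v in C) fin v (Pa v).
  rewrite [LHS](bigID (mem C)) /= [X in _ + X]big1 ?addn0 // => v vC; rewrite /fin.
  case E: (pof v) => [P|]; last by rewrite (negbTE vC).
  have [PP vP] := pofS E; have [j jm Ev] := pqsP vP.
  by rewrite Ev (pvC PP) // in vC; lia.
rewrite sum_paths; congr (_ + _).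
  apply: eq_bigr => v /andP[vC vo]; rewrite /fin vC.
  by move: vo; rewrite /onpath negbK => /eqP->.
rewrite big_seq [RHS]big_seq; apply: eq_bigr => P PP; rewrite -sum_gad //.
by apply: eq_bigr => j _; rewrite /fin (pof_pv PP) //=.
Qed.

(** ** From an instance to its gadgets *)

Section Forward.
Variable Pa : V -> {set V}.
Hypotheses (nPa : normal Pa) (ptPa : ptree Pa).

Definition conn P :=
  [forall j : 'I_(size (pqs P)).-1, adj Pa (pv P j.+1) (pv P j.+2)].

Definition fw v : {set V} :=
  if pof v is Some P then
    let a := pu P \in Pa (px P) in
    if v == px P then if a then [set pu P] else [set pv P 2; pv P 3]
    else if v == pv P 1 then
      opt (pw P \in Pa v) (pw P) :|: opt (conn P) (px P) :|:
        (opt a (pv P 2) :|: opt a (pv P 3))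
    else set0
  else Pa v.

Lemma fw_off v : ~~ onpath v -> fw v = Pa v.
Proof. by rewrite /onpath negbK /fw => /eqP->. Qed.

Variant fw_on_spec P j x : Prop :=
  | FwOn1 of [/\ j = size (pqs P), x = pu P & pu P \in Pa (px P)]
  | FwOn2 of [/\ j = size (pqs P), x = pv P 2 \/ x = pv P 3 & pu P \notin Pa (px P)]
  | FwOn3 of [/\ j = 1, x = pw P & pw P \in Pa (pv P 1)]
  | FwOn4 of [/\ j = 1, x = px P & conn P]
  | FwOn5 of [/\ j = 1, x = pv P 2 \/ x = pv P 3 & pu P \in Pa (px P)].

Lemma fw_on x P j : P \in Ps -> 0 < j <= size (pqs P) -> x \in fw (pv P j) ->
  fw_on_spec P j x.
Proof.
move=> PP jm; have m4 := pm4 PP; rewrite /fw (pof_pv PP) // /px !(pv_eq PP) //; try lia.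
case: eqP => [-> |_].
  case: ifP => a; rewrite !inE; first by move/eqP=> ->; constructor 1.
  by move=> H; constructor 2; split; rewrite ?a //; case/orP: H => /eqP->; [left|right].
case: eqP => [->|_]; last by rewrite inE.
rewrite !inE !in_opt => /orP[/orP[/andP[? /eqP]|/andP[? /eqP]]|].
- by constructor 3.
- by constructor 4.
- by case/orP=> /andP[? /eqP->]; constructor 5; split=> //; [left|right].
Qed.

Lemma fw_off_in v b : ~~ onpath v -> (v \in fw b) = (v \in Pa b).
Proof.
move=> vo; have [/onpathP[P [j [PP jm ->]]]|bo] := boolP (onpath b); last by rewrite fw_off.
have m4 := pm4 PP; apply/idP/idP => [|H].
  case/(fw_on PP jm) => [] [-> Ev Ha].
  - by rewrite Ev.
  - by exfalso; case: Ev => Ev; move: (vo); rewrite Ev /onpath (pof_pv PP) //; lia.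
  - by rewrite Ev.
  - by move: (vo); rewrite Ev /onpath pofpx.
  - by exfalso; case: Ev => Ev; move: (vo); rewrite Ev /onpath (pof_pv PP) //; lia.
rewrite /fw (pof_pv PP) //.
have [] := normal_off nPa PP jm vo (or_introl H) => -[Ev Ej]; subst v j.
  rewrite ifF ?eqxx; last by apply: pv_neq => //; lia.
  by rewrite !inE !in_opt eqxx H.
by rewrite eqxx -/(px P) H inE.
Qed.

Lemma fw_on_off P j b : P \in Ps -> 0 < j <= size (pqs P) -> ~~ onpath b ->
  pv P j \in fw b -> b = pw P /\ j = 1 \/ b = pu P /\ j = size (pqs P).
Proof.
by move=> PP jm bo; rewrite fw_off // => H; apply: (normal_off nPa) => //; right.
Qed.

Lemma fw_in_on P j b : P \in Ps -> 0 < j <= size (pqs P) -> onpath b ->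
  pv P j \in fw b ->
  let a := pu P \in Pa (px P) in
  [\/ [/\ j = 2 \/ j = 3, b = px P & ~~ a],
      [/\ j = 2 \/ j = 3, b = pv P 1 & a] |
      [/\ j = size (pqs P), b = pv P 1 & conn P]].
Proof.
move=> PP jm /onpathP[Q [i [QQ im ->]]] H; have m4 := pm4 QQ.
have [_ _ _ [wo uo] _] := good QQ.
have cs k : 0 < k <= size (pqs Q) -> pv P j = pv Q k -> P = Q /\ j = k by exact: pv_path.
case: (fw_on QQ im H) => [] [Ei Ev Ha].
- by move: uo; rewrite -Ev /onpath (pof_pv PP).
- by constructor 1; case: Ev => /cs[|EP Ej]; rewrite ?EP ?Ei; try lia; split=> //; [left|right].
- by move: wo; rewrite -Ev /onpath (pof_pv PP).
- by constructor 3; case: (cs _ _ Ev) => [|EP Ej]; rewrite ?EP ?Ei ?Ej; try lia.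
- by constructor 2; case: Ev => /cs[|EP Ej]; rewrite ?EP ?Ei; try lia; split=> //; [left|right].
Qed.

(** Let [S] have minimum degree two in the image. It contains no middle vertex of a path, for z1 and
    z2 have one neighbour and the others none. If it contains a gadget vertex, it contains both
    gadget vertices and both ends, and the path is fully used in [Pa]; adding the inner vertices to
    [S] yields a set of minimum degree two in [Pa]. *)
Lemma fw_ptree : ptree fw.
Proof.
have [irr asy dg] := ptPa; split.
- move=> v; have [/onpathP[P [j [PP jm Ev]]]|vo] := boolP (onpath v); last by rewrite fw_off.
  have m4 := pm4 PP; apply/negP => H; have on : onpath v by rewrite Ev /onpath (pof_pv PP).
  rewrite {1}Ev in H; have := fw_in_on PP jm on H; rewrite {H on}Ev /px.
  case=> -[Ej /eqP Ev _]; move: Ev; rewrite (pv_eq PP) //; lia.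
- move=> u v uv; apply/negP => vu.
  have [uo|uo] := boolP (onpath u); last first.
    by rewrite fw_off_in // in uv; rewrite fw_off // in vu; move: (asy _ _ uv); rewrite vu.
  have [vo|vo] := boolP (onpath v); last first.
    by rewrite fw_off_in // in vu; rewrite fw_off // in uv; move: (asy _ _ uv); rewrite vu.
  have [P [j [PP jm Eu]]] := onpathP uo; have m4 := pm4 PP; subst u.
  have [i [im Ev]] : exists i, 0 < i <= size (pqs P) /\ v = pv P i.
    case: (fw_in_on PP jm vo uv) => -[_ -> _].
    - by exists (size (pqs P)); split=> //; lia.
    - by exists 1; split=> //; lia.
    - by exists 1; split=> //; lia.
  subst v; case: (fw_in_on PP jm vo uv) => -[Ej /eqP + _]; rewrite /px (pv_eq PP) //; try lia;
  move/eqP=> Ei; case: (fw_in_on PP im uo vu) => -[Ei' /eqP + _]; rewrite /px (pv_eq PP) //; lia.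
apply: degenerateP => S S2.
have mid P j : P \in Ps -> 1 < j < size (pqs P) -> pv P j \notin S.
  move=> PP jm; apply/negP => /S2; apply/negP; rewrite -leqNgt.
  rewrite -(cards1 (if pu P \in Pa (px P) then pv P 1 else px P)).
  apply/subset_leq_card/subsetP => b; rewrite !inE => /andP[_ /orP[]] H.
    have [bo|bo] := boolP (onpath b).
      by case: (fw_in_on PP _ bo H) => [|[_ -> /negbTE->]|[_ -> ->]|[]]; rewrite ?eqxx; lia.
    by case: (fw_on_off PP _ bo H) => [|[]|[]]; lia.
  by case: (fw_on PP _ H) => [|[]|[]|[]|[]|[]]; lia.
have Hx P : P \in Ps -> px P \in S ->
    [/\ pu P \in S, pv P 1 \in S, adj fw (px P) (pu P) & conn P].
  move=> PP xS; have m4 := pm4 PP.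
  have mm : 0 < size (pqs P) <= size (pqs P) by lia.
  have [||-> -> -> ax] := @nbrs_pair _ (adj fw) S (px P) (pu P) (pv P 1); first exact: S2.
    move=> b bS /orP[] H.
      have [bo|bo] := boolP (onpath b).
        by case: (fw_in_on PP mm bo H) => [[]|[]|[_ -> _]]; [lia|lia|right].
      by case: (fw_on_off PP mm bo H) => [[]|[->]]; [lia|left].
    case: (fw_on PP mm H) => -[Ej Eb _]; try lia; first by left.
    by case: Eb => Eb; move: bS; rewrite Eb (negbTE (mid _ _ PP _)) //; lia.
  split=> //; case/orP: ax => H.
    have on1 : onpath (pv P 1) by rewrite /onpath (pof_pv PP) //; lia.
    by case: (fw_in_on PP mm on1 H) => -[Ej _ c] //; lia.
  case: (fw_on PP mm H) => -[Ej Eb _]; try lia.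
    by have /eqP := Eb; rewrite -(pvm P) pv_neq //; lia.
  by case: Eb => /eqP; rewrite pv_neq //; lia.
have Hy P : P \in Ps -> pv P 1 \in S ->
    [/\ pw P \in S, px P \in S, adj fw (pv P 1) (pw P) & true].
  move=> PP xS; have m4 := pm4 PP.
  have mm : 0 < 1 <= size (pqs P) by lia.
  have [||-> -> -> ax] := @nbrs_pair _ (adj fw) S (pv P 1) (pw P) (px P); first exact: S2.
    move=> b bS /orP[] H.
      have [bo|bo] := boolP (onpath b).
        by case: (fw_in_on PP mm bo H) => -[]; lia.
      by case: (fw_on_off PP mm bo H) => [[->]|[]]; [left|lia].
    case: (fw_on PP mm H) => -[Ej Eb _]; try lia; [by left|by right|].
    by case: Eb => Eb; move: bS; rewrite Eb (negbTE (mid _ _ PP _)) //; lia.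
  by split.
pose S1 := S :|: [set v | if pof v is Some P then px P \in S else false].
suff : S1 = set0.
  move=> E; apply/setP=> v; rewrite [RHS]in_set0; apply/negP => vS.
  by have := in_set0 v; rewrite -E inE vS.
apply: (degenerate_min2 dg) => v; have [vo|vo] := boolP (onpath v); last first.
  move=> vS1; have vS : v \in S.
    by move: vS1; rewrite !inE; move: vo; rewrite /onpath negbK => /eqP->; rewrite orbF.
  apply: leq_trans (S2 v vS) _; apply/subset_leq_card/subsetP => b.
  by rewrite !inE => /andP[->]; rewrite /adj fw_off_in // fw_off.
have [P [j [PP jm Ev]]] := onpathP vo; have m4 := pm4 PP; subst v => vS1.
have xS : px P \in S.
  move: vS1; rewrite !inE (pof_pv PP) // => /orP[jS|//].
  have [E|jnm] := eqVneq j (size (pqs P)); first by rewrite /px -E.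
  have [E|jn1] := eqVneq j 1; first by rewrite E in jS; have [] := Hy P PP jS.
  by move: jS; rewrite (negbTE (mid _ _ PP _)) //; lia.
have [uS yS xu cn] := Hx P PP xS; have [wS _ yw _] := Hy P PP yS.
have [_ _ _ [wo uo] _] := good PP.
have inS i : i <= (size (pqs P)).+1 -> pv P i \in S1.
  move=> im; rewrite !inE; have [ib|ib] := boolP (0 < i <= size (pqs P)).
    by rewrite (pof_pv PP) // xS orbT.
  have [->|->] : i = 0 \/ i = (size (pqs P)).+1 by clear -im ib; lia.
    by rewrite pv0 wS.
  by rewrite (pvm P) uS.
have ad i : i <= size (pqs P) -> adj Pa (pv P i) (pv P i.+1).
  move=> im; have [->|i0] := eqVneq i 0.
    by rewrite pv0 adj_sym; move: yw; rewrite /adj (fw_off_in _ wo) (fw_off wo).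
  have [->|im'] := eqVneq i (size (pqs P)).
    by rewrite (pvm P); move: xu; rewrite /adj (fw_off_in _ uo) (fw_off uo).
  have i1 : i.-1 < (size (pqs P)).-1 by clear -im i0 im'; lia.
  by have /forallP/(_ (Ordinal i1)) := cn; rewrite /= prednK ?lt0n.
apply/card_gt1P; exists (pv P j.-1), (pv P j.+1); split.
- rewrite /nbrs in_set inS; last by clear -jm; lia.
  have /andP[j0 jm'] := jm; have := ad j.-1; rewrite prednK // adj_sym; apply.
  by clear -jm; lia.
- by rewrite /nbrs in_set inS ?ad //; clear -jm; lia.
- have [->|j1] := eqVneq j 1; first by rewrite eq_sym pv_neq //; clear -m4; lia.
  by rewrite pv_neq //; clear -jm j1 m4; lia.
Qed.

Lemma normal_pa P j : P \in Ps -> j < size (pqs P) ->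
  Pa (pv P j.+1) = opt (pv P j \in Pa (pv P j.+1)) (pv P j)
                   :|: opt (pv P j.+2 \in Pa (pv P j.+1)) (pv P j.+2).
Proof.
move=> PP jm; apply/setP=> x; rewrite !inE !in_opt; apply/idP/idP.
  by move=> H; case: (normal_on nPa PP jm H) => E; rewrite -E H eqxx ?orbT.
by case/orP=> /andP[H /eqP->].
Qed.

(** On a path, [Pa] is one of the orientations bounded by the table entry for its own bits, and the
    gadget collects this entry together with [2 * pbig P]. The successor is the shift by one of
    [tab]. *)
Lemma fw_score :
  \sum_(v in C) F v (Pa v) + \sum_(P <- Ps) (2 * pbig P).+1 <= \sum_v fin v (fw v).
Proof.
have [irr asy dg] := ptPa.
rewrite fin_total sum_paths -addnA leq_add //.
  by apply: leq_sum => v /andP[_ vo]; rewrite fw_off.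
rewrite -big_split big_seq [in X in _ <= X]big_seq; apply: leq_sum => P PP.
have m4 := pm4 PP.
pose rt j := pv P j.+1 \in Pa (pv P j.+2); pose lf j := pv P j.+2 \in Pa (pv P j.+1).
pose a := pu P \in Pa (px P); pose b := pw P \in Pa (pv P 1).
have Em : (size (pqs P)).-1.+1 = size (pqs P) by lia.
have -> : \sum_(j < size (pqs P)) F (pv P j.+1) (Pa (pv P j.+1)) =
    oscore (gpath P) b rt lf (size (pqs P)).-1 a.
  rewrite oscore_sum Em; apply: eq_bigr => j _; rewrite normal_pa // /gpath.
  congr (F _ (opt _ _ :|: opt _ _)).
    by case: (nat_of_ord j) => [|i] //=.
  case: eqP => // E; rewrite /a -(pvm P) /px.
  by rewrite (_ : j.+1 = size (pqs P)) //; lia.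
have := @tab_bound (gpath P) b rt lf (size (pqs P)).-1 a.
have -> : broken rt lf (size (pqs P)).-1 = ~~ conn P.
  by rewrite /conn negb_forall; apply: eq_existsb => j; rewrite /rt /lf /adj orbC.
have nrl j : j < (size (pqs P)).-1 -> ~~ (rt j && lf j).
  by move=> jm; apply/negP => /andP[] /asy/negbTE; rewrite /lf => ->.
move=> /(_ nrl) tb; have wx i : i <= (size (pqs P)).+1 -> i != 1 -> (pv P 1 == pv P i) = false.
  by move=> im i1; apply: pv_neq => //; lia.
have xi i : i <= (size (pqs P)).+1 -> i != size (pqs P) -> (px P == pv P i) = false.
  by move=> im i1; apply: pv_neq => //; lia.
have zi k i : 0 < k <= size (pqs P) -> i <= (size (pqs P)).+1 -> k != i -> (pv P k == pv P i) = false.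
  by move=> km im i1; apply: pv_neq => //; lia.
have -> : fw (px P) = if a then [set pu P] else [set pv P 2; pv P 3].
  by rewrite /fw (pofpx PP) eqxx.
have -> : fw (pv P 1) = opt b (pw P) :|: opt (conn P) (px P) :|:
        (opt a (pv P 2) :|: opt a (pv P 3)).
  by rewrite /fw (pof_pv PP) ?eqxx ?wx //; lia.
have Gx : gad P (px P) (if a then [set pu P] else [set pv P 2; pv P 3]) =
    if a then pbig P else 2 * pbig P.
  rewrite /gad eqxx; case: (boolP a) => _ /=; last by rewrite eqxx.
  rewrite eqxx ifF //; apply/eqP => /setP/(_ (pv P 2)).
  by rewrite !inE eqxx -(pvm P) zi //; lia.
have Gy : gad P (pv P 1) (opt b (pw P) :|: opt (conn P) (px P) :|:
        (opt a (pv P 2) :|: opt a (pv P 3))) =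
    ptab P a b (~~ conn P) + (if a then pbig P else 0).
  rewrite /gad (eq_sym (pv P 1)) xi ?eqxx; [|clear -m4; lia|clear -m4; lia].
  have -> : (pv P 2 \in opt b (pw P) :|: opt (conn P) (px P) :|:
        (opt a (pv P 2) :|: opt a (pv P 3))) = a.
    rewrite !inE !in_opt eqxx -(pv0 P) /px !zi ?andbF ?andbT ?orbF //; lia.
  have -> : (pw P \in opt b (pw P) :|: opt (conn P) (px P) :|:
        (opt a (pv P 2) :|: opt a (pv P 3))) = b.
    rewrite !inE !in_opt eqxx -(pv0 P) !(eq_sym (pv P 0)) /px !zi ?andbF ?andbT ?orbF //; lia.
  have -> : (px P \in opt b (pw P) :|: opt (conn P) (px P) :|:
        (opt a (pv P 2) :|: opt a (pv P 3))) = conn P.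
    rewrite !inE !in_opt eqxx -(pv0 P) !xi ?andbF ?andbT ?orbF //; lia.
  by rewrite eqxx.
rewrite Gx Gy /ptab; move: tb; by case: (a); clear => /= tb; lia.
Qed.


End Forward.

(** ** From the gadgets back *)

Section Backward.
Variable Pa' : V -> {set V}.
Hypothesis ptPa' : ptree Pa'.

Definition bka P := pu P \in Pa' (px P).
Definition bkb P := pw P \in Pa' (pv P 1).
Definition bkc P := px P \notin Pa' (pv P 1).
Definition bk P := back (gpath P) (bkb P) (size (pqs P)).-1 (bka P) (bkc P).
Definition bkl P j := if j == 0 then bkb P else (bk P j.-1).1.
Definition bkr P j := if j.+1 == size (pqs P) then bka P else (bk P j).2.

(** Inner arcs come from backtracking in the table, starting from the bits that the gadget shows.
    Off the paths, arcs that no score list rewards are dropped; this makes the result [normal] and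
    costs no score by [F_supp]. *)
Definition bw v : {set V} :=
  if pof v is Some P then
    let j := index v (pqs P) in
    opt (bkl P j) (pv P j) :|: opt (bkr P j) (pv P j.+2)
  else if v \in C then Pa' v :&: nbrs A C v else set0.

Lemma bw_off v : ~~ onpath v -> bw v = if v \in C then Pa' v :&: nbrs A C v else set0.
Proof. by rewrite /onpath negbK /bw => /eqP->. Qed.

Lemma bw_pv P j : P \in Ps -> j < size (pqs P) ->
  bw (pv P j.+1) = opt (bkl P j) (pv P j) :|: opt (bkr P j) (pv P j.+2).
Proof.
move=> PP jm; rewrite /bw (pof_pv PP) // pvE //= index_uniq //.
by case: (good PP).
Qed.

Lemma bkP P : P \in Ps ->
  [/\ forall j, ~~ ((bk P j).1 && (bk P j).2),
      broken (fun j => (bk P j).1) (fun j => (bk P j).2) (size (pqs P)).-1 = bkc P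
    & (oscore (gpath P) (bkb P) (fun j => (bk P j).1) (fun j => (bk P j).2)
        (size (pqs P)).-1 (bka P)).+1 = ptab P (bka P) (bkb P) (bkc P)].
Proof.
move=> PP; apply: back_opt; rewrite -lt0n tab_gt0 //; have := pm4 PP; lia.
Qed.

Lemma bw_normal : normal bw.
Proof.
move=> a b; have [/onpathP[P [[|j] [PP jm ->]]]|bo] // := boolP (onpath b); last first.
  rewrite bw_off //; case: ifP => bC; last by rewrite inE.
  by rewrite !inE A_sym => /and3P[_ -> ->].
rewrite bw_pv // !inE !in_opt => /orP[]/andP[_ /eqP->].
  split; [by apply: pvC; lia|by apply: pvC; lia|].
  by rewrite A_sym (pvA PP) ?eqxx //; apply: pvC; lia.
split; [by apply: pvC; lia|by apply: pvC; lia|].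
by rewrite A_sym (pvA PP) ?eqxx ?orbT //; apply: pvC; lia.
Qed.

Lemma bw_in_off v b : ~~ onpath v -> v \in bw b -> v \in Pa' b.
Proof.
move=> vo; have [/onpathP[P [[|j] [PP jm ->]]]|bo] // := boolP (onpath b); last first.
  by rewrite bw_off //; case: ifP; rewrite ?inE // => _ /andP[].
move=> H; have m4 := pm4 PP; have := normal_off bw_normal PP jm vo (or_introl H).
move: H; rewrite bw_pv // !inE !in_opt => H [] [Ev Ej].
  have Ej' : j = 0 by clear -Ej; lia.
  move: H; rewrite (off_pv (j := j.+2) PP _ vo) ?andbF ?orbF; last by clear -m4 Ej'; lia.
  by rewrite Ev Ej' /bkl /= => /andP[].
move: H; rewrite (off_pv (j := j) PP _ vo) ?andbF /=; last by clear -m4 jm Ej; lia.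
by rewrite Ev Ej /bkr Ej eqxx => /andP[].
Qed.

Lemma bw_sub_off v b : ~~ onpath v -> b \in bw v -> b \in Pa' v.
Proof. by move=> vo; rewrite bw_off //; case: ifP; rewrite ?inE // => _ /andP[]. Qed.

Lemma bw_rt P j : P \in Ps -> j.+1 < size (pqs P) ->
  ((pv P j.+1 \in bw (pv P j.+2)) = (bk P j).1) *
  ((pv P j.+2 \in bw (pv P j.+1)) = (bk P j).2).
Proof.
move=> PP jm; rewrite !bw_pv //; last by lia.
rewrite !inE !in_opt !eqxx !andbT !pv_neq //; try lia.
rewrite /bkl /bkr /= !andbF orbF /= ifF //; lia.
Qed.

Lemma bw_on P j b : P \in Ps -> 0 < j <= size (pqs P) -> adj bw (pv P j) b ->
  b = pv P j.-1 \/ b = pv P j.+1.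
Proof.
case: j => // j PP jm ab; suff [bC] : b \in C /\ A (pv P j.+1) b.
  by rewrite (pvA PP) // => /orP[]/eqP; [left|right].
by case/orP: ab => /bw_normal[? ? ?]; split=> //; rewrite A_sym.
Qed.

(** A set of minimum degree two that meets a path contains all of it with both ends, and every edge
    of the path is used. Then the path is unbroken, which means that the gadget has the arc from its
    last to its first vertex. Dropping the other inner vertices leaves a set of minimum degree two
    in [Pa']. *)
Lemma bw_ptree : ptree bw.
Proof.
have [irr asy dg] := ptPa'; split.
- by move=> v; apply/negP => /bw_normal[_ _]; rewrite A_irr.
- move=> u v uv; apply/negP => vu.
  have [uo|uo] := boolP (onpath u); last first.
    by move: (asy _ _ (bw_in_off uo uv)); rewrite (bw_sub_off uo vu).
  have [vo|vo] := boolP (onpath v); last first.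
    by move: (asy _ _ (bw_in_off vo vu)); rewrite (bw_sub_off vo uv).
  have [P [j [PP jm Eu]]] := onpathP uo; subst u.
  have ex k i : 0 < k <= size (pqs P) -> i <= (size (pqs P)).+1 -> pv P i = pv P k ->
      0 < i <= size (pqs P).
    move=> km im /eqP; rewrite eq_sym; have [->//|ik] := eqVneq i k.
    by rewrite pv_neq // eq_sym.
  have vP : exists2 i, 0 < i <= size (pqs P) & v = pv P i.
    have [_ _ _ [wo uo'] _] := good PP.
    case: (@bw_on P j v PP jm); first by rewrite /adj uv.
      move=> E; exists j.-1 => //; rewrite E in vo.
      have [j0|] := eqVneq j.-1 0; last by lia.
      by move: vo; rewrite j0 (negbTE wo).
    move=> E; exists j.+1 => //; rewrite E in vo.
    have [Ej|] := eqVneq j (size (pqs P)); last by lia.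
    by move: vo; rewrite Ej pvm (negbTE uo').
  have [i' im' Ev'] := vP; subst v.
  have [nrl _ _] := bkP PP.
  have [] := @bw_on P j (pv P i') PP jm; first by rewrite /adj uv.
    move/eqP; have [Ei|ne] := eqVneq i' j.-1; last by rewrite pv_neq //; lia.
    case: i' Ei im' vo vu uv {vP} => // k Ek km vo vu uv _.
    rewrite (_ : j = k.+2) in vu uv jm; last by lia.
    have [E1 E2] := @bw_rt P k PP jm.
    by have := nrl k; rewrite -E1 -E2 uv vu.
  move/eqP; have [Ei|ne] := eqVneq i' j.+1; last by rewrite pv_neq //; lia.
  case: j jm {uo} Ei vu uv => // k km Ek vu uv _; rewrite Ek in vu uv im'.
  have [E1 E2] := @bw_rt P k PP im'.
  by have := nrl k; rewrite -E1 -E2 uv vu.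
apply: degenerateP => S S2.
have near P j : P \in Ps -> 0 < j <= size (pqs P) -> pv P j \in S ->
    [/\ pv P j.-1 \in S, pv P j.+1 \in S, adj bw (pv P j) (pv P j.-1)
      & adj bw (pv P j) (pv P j.+1)].
  move=> PP jm jS; apply: nbrs_pair; first exact: S2.
  by move=> x _; apply: bw_on.
have whole P j i : P \in Ps -> 0 < j <= size (pqs P) -> pv P j \in S ->
    i <= (size (pqs P)).+1 -> pv P i \in S.
  move=> PP jm jS im; have [ij|ij] := leqP i j.
    rewrite -(subKn ij); elim: (j - i) (leq_subr i j) => [|k IH] kj; first by rewrite subn0.
    have [k0|k0] := eqVneq (j - k) 0; first by rewrite (_ : j - k.+1 = j - k) ?IH; lia.
    have [] := near P (j - k) PP _ (IH _); [lia|lia|].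
    by rewrite (_ : (j - k).-1 = j - k.+1) //; lia.
  have up k : j + k <= (size (pqs P)).+1 -> pv P (j + k) \in S.
    elim: k => [|k IH] kj; first by rewrite addn0.
    have [] := near P (j + k) PP _ (IH _); [clear -kj jm; lia|clear -kj; lia|].
    by rewrite addnS.
  by rewrite -(subnKC (ltnW ij)) up // subnKC // ltnW.
have cn P j : P \in Ps -> 0 < j <= size (pqs P) -> pv P j \in S -> ~~ bkc P.
  move=> PP jm jS; have [_ <- _] := bkP PP; apply/existsP => -[k].
  have kS : k.+1 < size (pqs P) by have := ltn_ord k; lia.
  have [E1 E2] := @bw_rt P k PP kS; rewrite -E1 -E2.
  have kk : 0 < k.+1 <= size (pqs P) by lia.
  have [_ _ _] := near P k.+1 PP kk (whole P j k.+1 PP jm jS (ltnW (ltnW kS))).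
  by rewrite /adj orbC => /= ->.
pose S1 := [set v in S | if pof v is Some P then (v == px P) || (v == pv P 1) else true].
have S10 : S1 = set0.
  apply: (degenerate_min2 dg) => v; rewrite inE => /andP[vS].
  have [/onpathP[P [j [PP jm Ev]]]|vo _] := boolP (onpath v); last first.
    apply: leq_trans (S2 v vS) _; apply/subset_leq_card/subsetP => b.
    rewrite !inE => /andP[bS vb]; rewrite bS /=; apply/andP; split.
      case E: (pof b) => [P|] //; have [PP bP] := pofS E; have [j jm Eb] := pqsP bP.
      have := normal_off bw_normal PP jm vo; rewrite -Eb => H.
      have : v \in bw b \/ b \in bw v by case/orP: vb; [left|right].
      by case/H => -[_ Ej]; rewrite Eb Ej ?eqxx ?orbT.
    by case/orP: vb => [/(bw_in_off vo)|/(bw_sub_off vo)]; rewrite /adj => ->; rewrite ?orbT.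
  have m4 := pm4 PP; have [_ _ _ [wo uo] _] := good PP.
  have pS i : i <= (size (pqs P)).+1 -> pv P i \in S by apply: (whole P j); rewrite -?Ev.
  have cnP : px P \in Pa' (pv P 1).
    by have := cn P j PP jm; rewrite -Ev vS /bkc negbK; apply.
  have mm : 0 < size (pqs P) <= size (pqs P) by lia.
  have m1 : 0 < 1 <= size (pqs P) by lia.
  have off0 i : ~~ onpath (pv P i) -> i <= (size (pqs P)).+1 -> pv P i \in S1.
    by move=> io im; rewrite inE pS //; move: io; rewrite /onpath negbK => /eqP->.
  have xS : px P \in S1 by rewrite inE pS ?(pofpx PP) ?eqxx //; lia.
  have yS : pv P 1 \in S1 by rewrite inE pS ?(pof_pv PP) ?eqxx ?orbT //; lia.
  have uS : pu P \in S1 by rewrite -pvm off0 // pvm.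
  have wS : pw P \in S1 by rewrite -pv0 off0.
  have [_ _ _ xu] := near P _ PP mm (pS _ (leqnSn _)).
  have [_ _ yw _] := near P 1 PP m1 (pS 1 isT).
  rewrite {1}Ev (pof_pv PP) // => /orP[]/eqP->; apply/card_gt1P.
    exists (pu P), (pv P 1); rewrite !in_nbrs uS yS /= /adj cnP ?orbT; split=> //.
      move: xu; rewrite pvm => /orP[/(bw_sub_off uo)|/(bw_in_off uo)]; rewrite /px => ->;
      by rewrite ?orbT.
    by rewrite -(pvm P) eq_sym pv_neq //; clear -m4; lia.
  exists (pw P), (px P); rewrite !in_nbrs wS xS /= /adj cnP ?orbT; split=> //.
    by move: yw => /orP[/(bw_sub_off wo)|/(bw_in_off wo)] ->; rewrite ?orbT.
  by rewrite -(pv0 P) eq_sym pv_neq //; clear -m4; lia.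
apply/setP=> v; rewrite [RHS]in_set0; apply/negP => vS.
have [/onpathP[P [j [PP jm Ev]]]|vo] := boolP (onpath v); last first.
  have := in_set0 v; rewrite -S10 inE vS.
  by move: vo; rewrite /onpath negbK => /eqP->.
rewrite Ev in vS; have := in_set0 (px P).
by rewrite -S10 inE (whole P j) ?(pofpx PP) ?eqxx //; have := pm4 PP; lia.
Qed.


Lemma bw_score :
  \sum_v fin v (Pa' v) <= \sum_(v in C) F v (bw v) + \sum_(P <- Ps) (2 * pbig P).+1.
Proof.
have [irr asy dg] := ptPa'.
rewrite fin_total sum_paths -addnA leq_add //.
  apply: leq_sum => v /andP[vC vo]; rewrite bw_off // vC.
  have [->//|nz] := eqVneq (F v (Pa' v)) 0.
  rewrite (_ : Pa' v :&: nbrs A C v = Pa' v) //; apply/setIidPl/subsetP => z zP.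
  by have [zC vz] := F_supp nz zP; rewrite inE zC.
rewrite -big_split big_seq [in X in _ <= X]big_seq; apply: leq_sum => P PP.
have m4 := pm4 PP; have [_ _ Et] := bkP PP.
have Em : (size (pqs P)).-1.+1 = size (pqs P) by lia.
have -> : \sum_(j < size (pqs P)) F (pv P j.+1) (bw (pv P j.+1)) =
    (oscore (gpath P) (bkb P) (fun j => (bk P j).1) (fun j => (bk P j).2)
        (size (pqs P)).-1 (bka P)).
  rewrite oscore_sum Em; apply: eq_bigr => j _; rewrite bw_pv // /gpath /bkl /bkr.
  by rewrite (_ : (j.+1 == size (pqs P)) = (j == (size (pqs P)).-1 :> nat)) //; clear -Em; lia.
rewrite /= addnS -addSn Et; have pb := pbigP P.
have xi i : i <= (size (pqs P)).+1 -> i != size (pqs P) -> (px P == pv P i) = false.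
  by move=> im i1; apply: pv_neq => //; lia.
have zi k i : 0 < k <= size (pqs P) -> i <= (size (pqs P)).+1 -> k != i -> (pv P k == pv P i) = false.
  by move=> km im i1; apply: pv_neq => //; lia.
rewrite /gad eqxx (eq_sym (pv P 1)) xi ?eqxx; [|lia|lia].
rewrite -/(bkb P) -[px P \in _]negbK -/(bkc P).
case: ifP => [/eqP Ex|_].
  have u23 k : 0 < k <= 3 -> (pu P == pv P k) = false.
    by move=> k3; rewrite -(pvm P) eq_sym; apply: zi; clear -k3 m4; lia.
  have -> : bka P = false by rewrite /bka Ex !inE !u23.
  case: ifP => [/eqP Ey|_]; last by clear; lia.
  rewrite negbK; case: ifP => [z2|z2]; last by clear; lia.
  exfalso; have z3 : pv P 3 \in Pa' (pv P 1) by rewrite Ey !inE !in_opt z2 eqxx !orbT.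
  (* Both gadget vertices would have the parents z1 and z2: a cycle of length four in [Pa']. *)
  pose S := [set px P; pv P 1; pv P 2; pv P 3].
  suff : S = set0 by move/setP/(_ (px P)); rewrite !inE eqxx.
  apply: (degenerate_min2 dg) => v.
  have x1 : px P != pv P 1 by rewrite xi //; clear -m4; lia.
  have z23 : pv P 2 != pv P 3 by rewrite zi //; clear -m4; lia.
  rewrite !inE -!orbA => /or4P[]/eqP->.
  - by apply/card_gt1P; exists (pv P 2), (pv P 3); rewrite !inE /adj Ex !inE !eqxx !orbT.
  - by apply/card_gt1P; exists (pv P 2), (pv P 3); rewrite !inE /adj z2 z3 !eqxx !orbT.
  - by apply/card_gt1P; exists (px P), (pv P 1); rewrite !inE /adj z2 Ex !inE !eqxx !orbT.
  - by apply/card_gt1P; exists (px P), (pv P 1); rewrite !inE /adj z3 Ex !inE !eqxx !orbT.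
case: ifP => [/eqP Ex|_]; last first.
  case: ifP => // _; case: ifP => _;
  by move: (pb true (bkb P) (~~ ~~ bkc P)) (pb false (bkb P) (~~ ~~ bkc P)); clear; lia.
have -> : bka P by rewrite /bka Ex inE.
rewrite negbK; case: ifP => _; last by clear; lia.
by case: ifP => _; move: (pb false (bkb P) (bkc P)); clear; lia.
Qed.

End Backward.

End Path.

(** * Size of the kernel *)

Section Count.
Variables (V : finType) (A : rel V) (Fe : {set {set V}}) (C K R : {set V}).
Hypotheses (A_sym : symmetric A) (A_irr : irreflexive A).
Hypothesis fes : feedback_edge_set A Fe.
Notation deg v := #|nbrs A C v|.
Definition inC : rel V := fun a b => [&& A a b, a \in C & b \in C].

(** Handshake: each edge of [Fe] is seen at most once from each of its two ends. *)
Lemma sum_feedback :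
  \sum_(v in C) #|[set b | A v b & [set v; b] \in Fe]| <= 2 * #|Fe|.
Proof.
apply: (@leq_trans (\sum_v #|[set b | A v b & [set v; b] \in Fe]|)).
  by rewrite [in X in _ <= X](bigID (mem C)) /= leq_addr.
have E v : #|[set b | A v b & [set v; b] \in Fe]| =
    \sum_(f in Fe) #|[set b | A v b & [set v; b] == f]|.
  rewrite -sum1_card (partition_big (fun b => [set v; b]) (mem Fe)) /=; last first.
    by move=> b; rewrite inE => /andP[].
  apply: eq_bigr => f fF; rewrite -sum1_card; apply: eq_bigl => b; rewrite !inE.
  by case: eqP => [->|_]; rewrite ?fF ?andbT ?andbF.
rewrite (eq_bigr _ (fun v _ => E v)) exchange_big /= mulnC -sum_nat_const.
apply: leq_sum => f fF; have [/existsP[p /andP[ap /eqP Ef]]|no] :=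
  boolP [exists p : V * V, A p.1 p.2 && ([set p.1; p.2] == f)]; last first.
  rewrite big1 // => v _; apply/eqP; rewrite cards_eq0; apply/eqP/setP=> b.
  rewrite !inE; apply/negP => /andP[vb E']; case/existsP: no; exists (v, b).
  by rewrite vb.
have fE v : #|[set b | A v b & [set v; b] == f]| <= (v \in f).
  have [vf|vf] := boolP (v \in f); last first.
    rewrite leqn0 cards_eq0; apply/eqP/setP=> b; rewrite !inE; apply/negP => /andP[_ /eqP Ef'].
    by rewrite -Ef' !inE eqxx in vf.
  rewrite /= -(cards1 (if v == p.1 then p.2 else p.1)); apply/subset_leq_card/subsetP => b.
  rewrite !inE -Ef => /andP[vb /eqP Eb].
  have : b \in [set p.1; p.2] by rewrite -Eb !inE eqxx orbT.
  have : v \in [set p.1; p.2] by rewrite Ef.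
  have bv : b != v by apply: contraTneq vb => ->; rewrite A_irr.
  rewrite !inE => /orP[]/eqP Ev /orP[]/eqP Eb'; rewrite Ev Eb' ?eqxx // in bv *.
  by case: (eqVneq p.2 p.1) => [E2|_]; rewrite ?E2 ?eqxx.
apply: (@leq_trans (\sum_v (v \in f))); first by apply: leq_sum => v _; apply: fE.
have -> : \sum_v (v \in f) = #|f|.
  by rewrite -sum1_card [RHS]big_mkcond; apply: eq_bigr => v _; case: (v \in f).
by rewrite -Ef cards2; case: eqP.
Qed.

Hypotheses (KC : K \subset C) (RK : R \subset K).
Hypothesis deg2 : forall v, v \in C -> 1 < deg v.
Hypothesis deg3 : forall v, v \in K -> v \notin R -> 2 < deg v.
Hypothesis degR : forall v, v \in R -> deg v = 2.
Hypothesis discR : forall a b, a \in R -> b \in R -> connect inC a b -> a = b.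

(** Without [Fe] the core is a forest. Labelling each vertex by its component in the full core gives
    a labelling invariant along the remaining edges, with at least one class per element of [R]
    since [R] meets every component at most once. *)
Lemma sum_deg : \sum_(v in C) deg v + 2 * #|R| <= 2 * #|C| + 2 * #|Fe|.
Proof.
pose e : rel V := fun a b => inC a b && ([set a; b] \notin Fe).
have e_sym : symmetric e.
  move=> a b; rewrite /e /inC A_sym setUC; congr (_ && _).
  by rewrite [(a \in C) && _]andbC.
have e_irr : irreflexive e by move=> a; rewrite /e /inC A_irr.
have dgF : degenerate (delete_edges A Fe).
  apply: acyclic_degenerate => [a b|a|]; last by case: fes.
    by rewrite /delete_edges A_sym setUC.
  by rewrite /delete_edges A_irr.
have dg : degenerate e.
  move=> S /dgF[v vS l]; exists v => //; apply: leq_trans l.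
  apply/subset_leq_card/subsetP => b; rewrite !inE /e /inC /delete_edges.
  by move=> /and3P[-> /and3P[-> _ _] ->].
have i_sym : connect_sym inC.
  by apply: sym_connect_sym => a b; rewrite /inC A_sym [(a \in C) && _]andbC.
have el a b : e a b -> [set x | connect inC a x] = [set x | connect inC b x].
  case/andP=> ab _; apply/setP=> x; rewrite !inE.
  by apply: same_connect => //; apply: connect1.
have := @degenerate_labels _ _ e_sym e_irr _ _ C dg el.
have : #|R| <= #|[set [set x | connect inC a x] | a in C]|.
  rewrite -(card_in_imset (f := fun a => [set x | connect inC a x]) (D := mem R)).
    apply/subset_leq_card/subsetP => l /imsetP[a aR ->]; apply: imset_f.
    by apply: (subsetP KC); apply: (subsetP RK).
  move=> a b aR bR /setP/(_ b); rewrite !inE connect0; exact: discR.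
have : \sum_(v in C) deg v <= \sum_(v in C) #|nbrs e C v| +
    \sum_(v in C) #|[set b | A v b & [set v; b] \in Fe]|.
  rewrite -big_split /=; apply: leq_sum => v vC.
  rewrite -(cardsID [set b | [set v; b] \in Fe] (nbrs A C v)) addnC leq_add //;
    apply/subset_leq_card/subsetP => b; rewrite !inE /e /inC.
    by move=> /and3P[-> -> ->]; rewrite vC.
  by move=> /andP[/andP[_ ->] ->].
have := sum_feedback; lia.
Qed.

(** A vertex of degree d >= 3 contributes 2d + 1 <= 7(d - 2), with equality for d = 3; this is the
    origin of the 7. By [sum_deg] the sum of all d - 2 plus 2|R| is at most 2|Fe|, so each vertex of
    [R], which contributes 5, has 14 at its disposal. *)
Lemma count_branch : #|K| + 2 * \sum_(v in K) deg v <= 14 * #|Fe|.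
Proof.
have := sum_deg.
have -> : \sum_(v in C) deg v = \sum_(v in C) (deg v - 2) + 2 * #|C|.
  rewrite mulnC -sum_nat_const -big_split; apply: eq_bigr => v vC /=.
  by rewrite subnK // deg2.
have : \sum_(v in K :\: R) (2 * deg v + 1) <= 7 * \sum_(v in C) (deg v - 2).
  rewrite big_distrr /= [in X in _ <= X](big_setID (K :\: R)) /=.
  rewrite (_ : C :&: (K :\: R) = K :\: R); last first.
    by apply/setIidPr/subsetP => x; rewrite inE => /andP[_]; apply: (subsetP KC).
  apply: leq_trans (leq_addr _ _); apply: leq_sum => v; rewrite inE => /andP[vR vK].
  by have := deg3 vK vR; lia.
have -> : #|K| + 2 * \sum_(v in K) deg v = \sum_(v in K) (2 * deg v + 1).
  by rewrite big_split /= sum1_card big_distrr /= addnC.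
rewrite (big_setID (A := K) R) /= (_ : K :&: R = R); last by apply/setIidPr.
have -> : \sum_(v in R) (2 * deg v + 1) = 5 * #|R|.
  by rewrite mulnC -sum_nat_const; apply: eq_bigr => v /degR ->.
lia.
Qed.

(* The paths, short or long, between vertices of K. *)
Variable Qs : seq (V * seq V * V).
Hypothesis uniqQs : uniq Qs.
Hypothesis Qs_disj : forall P Q v, P \in Qs -> Q \in Qs ->
  v \in pqs P -> v \in pqs Q -> P = Q.
Hypothesis Qs_good : forall P, P \in Qs ->
  [/\ 0 < size (pqs P), uniq (pqs P), pw P \in K /\ pu P \in K
    & forall j, j < size (pqs P) -> pv P j.+1 \in C /\
        forall x, x \in C -> A (pv P j.+1) x = (x == pv P j) || (x == pv P j.+2)].

(** Each path keeps at most four vertices. A path also owns two pairs made of an end in [K] and the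
    adjacent inner vertex; all these pairs are distinct, so twice the number of paths is at most the
    degree sum of [K]. *)
Lemma count_kept (kept : {set V}) :
  (forall v, v \in kept -> v \in K \/ exists2 P, P \in Qs &
     [\/ v = pv P 1, v = pv P 2, v = pv P 3 | v = px P]) ->
  #|kept| <= 14 * #|Fe|.
Proof.
move=> H; apply: leq_trans count_branch.
pose s := flatten [seq [:: pv P 1; pv P 2; pv P 3; px P] | P <- Qs].
have sub : kept \subset K :|: [set x in s].
  apply/subsetP => v /H[vK|[P PQ E]]; first by rewrite inE vK.
  rewrite inE in_set orbC; apply/orP; left; apply/flattenP.
  exists [:: pv P 1; pv P 2; pv P 3; px P]; first by apply/mapP; exists P.
  by rewrite !inE; case: E => ->; rewrite eqxx ?orbT.
apply: leq_trans (subset_leq_card sub) _; apply: leq_trans (leq_card_setU _ _) _.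
rewrite leq_add2l; apply: (@leq_trans (size s)); first by rewrite cardsE card_size.
have -> : size s = 4 * size Qs.
  by rewrite /s; elim: (Qs) => //= P Q ->; rewrite mulnS.
rewrite -[4]/(2 * 2) -mulnA leq_mul2l /=.
pose d := [seq (pw P, pv P 1) | P <- Qs] ++ [seq (pu P, px P) | P <- Qs].
have -> : 2 * size Qs = size d by rewrite size_cat !size_map mul2n addnn.
have last_in P : P \in Qs -> px P \in pqs P /\ pv P 1 \in pqs P.
  move=> /Qs_good[m0 _ _ _]; split; last by apply: pv_in.
  by apply: pv_in; rewrite m0 /=.
have ud : uniq d.
  rewrite cat_uniq !map_inj_in_uniq //; last 2 first.
  - move=> P Q PQ QQ [_ E]; have [xP _] := last_in _ PQ; have [xQ _] := last_in _ QQ.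
    by apply: (Qs_disj (v := px P)) => //; rewrite E.
  - move=> P Q PQ QQ [_ E]; have [_ xP] := last_in _ PQ; have [_ xQ] := last_in _ QQ.
    by apply: (Qs_disj (v := pv P 1)) => //; rewrite E.
  rewrite uniqQs andbT /=; apply/hasPn => _ /mapP[P PQ ->]; apply/negP => /mapP[Q QQ [Ew Ex]].
  have [xP _] := last_in _ PQ; have [_ xQ] := last_in _ QQ.
  have PQE : P = Q by apply: (Qs_disj (v := px P)) => //; rewrite Ex.
  subst Q; have [m0 um _ good] := Qs_good PQ.
  (* The two pairs of one path coincide only if it has a single inner vertex and equal ends; that
     vertex would have degree one in the core. *)
  have m1 : size (pqs P) = 1.
    move/eqP: Ex; rewrite /px !pvE ?nth_uniq //=; lia.
  have [vC nb] := good 0 m0; have := deg2 vC.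
  rewrite (_ : nbrs A C _ = [set pw P]) ?cards1 //; apply/setP=> x; rewrite !inE.
  have [xC|xC] := boolP (x \in C) => /=.
    have E2 : pv P 2 = pu P by rewrite -(pvm P) m1.
    by rewrite nb // pv0 E2 Ew orbb.
  by apply/esym/negbTE; apply: contra xC => /eqP->; apply: (subsetP KC); case: (Qs_good PQ) => _ _ [].
pose dd := [set x : V * V | (x.1 \in K) && (x.2 \in nbrs A C x.1)].
have -> : \sum_(v in K) deg v = #|dd|.
  rewrite -[RHS]sum1_card (eq_bigr (fun v => \sum_(x in nbrs A C v) 1)); last first.
    by move=> v _; rewrite sum1_card.
  by rewrite pair_big_dep /=; apply: eq_bigl => x; rewrite [RHS]inE.
rewrite -(card_uniqP ud); apply/subset_leq_card/subsetP => x.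
rewrite mem_cat => /orP[]/mapP[P PQ ->]; have [m0 _ [wK uK] good] := Qs_good PQ; rewrite !inE /=.
  by have [vC nb] := good 0 m0; rewrite wK vC A_sym nb ?eqxx // (subsetP KC).
have m1 : (size (pqs P)).-1 < size (pqs P) by lia.
have [] := good _ m1; rewrite prednK // -/(px P) => vC nb.
by rewrite uK vC A_sym nb ?pvm ?eqxx ?orbT // (subsetP KC).
Qed.

End Count.

(** * The kernel as an instance *)

Section Transport.
Variables (V : finType) (kept : {set V}).
Notation V' := 'I_#|kept|.
Let f : V' -> V := enum_val.

(** Vertices of an instance are ordinals, so the kept ones are renumbered along [enum_val]; [pull]
    forgets the arcs at other vertices and [push] gives those vertices no arcs. *)
Definition pull (Pa : V -> {set V}) (v : V') : {set V'} := [set x | f x \in Pa (f v)].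

Definition push (Pa : V' -> {set V'}) (v : V) : {set V} :=
  [set x in kept | [exists p : V' * V', [&& f p.1 == x, f p.2 == v & p.1 \in Pa p.2]]].

Let f_inj : injective f. Proof. exact: enum_val_inj. Qed.

Lemma pushE Pa x y : (f x \in push Pa (f y)) = (x \in Pa y).
Proof.
rewrite inE enum_valP /=; apply/existsP/idP => [[p /and3P[/eqP/f_inj-> /eqP/f_inj->]]//|H].
by exists (x, y); rewrite !eqxx.
Qed.

Lemma push_in Pa a b : a \in push Pa b -> exists x y, [/\ a = f x, b = f y & x \in Pa y].
Proof.
by rewrite inE => /andP[_ /existsP[[x y] /and3P[/eqP <- /eqP <- H]]]; exists x, y.
Qed.

Lemma push_f Pa v : push Pa (f v) = [set f x | x in Pa v].
Proof.
apply/setP=> y; apply/idP/imsetP => [/push_in[x [z [-> /f_inj-> H]]]|[x H ->]].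
  by exists x.
by rewrite pushE.
Qed.

Lemma pull_f Pa v : [set f x | x in pull Pa v] = Pa (f v) :&: kept.
Proof.
apply/setP=> y; apply/imsetP/idP => [[x]|]; rewrite !inE.
  by move=> H ->; rewrite H enum_valP.
move=> /andP[H yk]; exists (enum_rank_in yk y); last by rewrite /f enum_rankK_in.
by rewrite inE /f enum_rankK_in.
Qed.

Lemma sum_kept (G : V -> nat) : (forall v, v \notin kept -> G v = 0) ->
  \sum_v G v = \sum_(v : V') G (f v).
Proof.
move=> H; rewrite (bigID (mem kept)) /= [X in _ + X]big1 // addn0.
by rewrite [LHS]big_enum_val.
Qed.

Lemma pull_ptree Pa : ptree Pa -> ptree (pull Pa).
Proof.
move=> [irr asy dg]; split.
- by move=> v; rewrite inE.
- by move=> u v; rewrite !inE; apply: asy.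
apply: degenerateP => S S2.
have S0 : f @: S = set0.
  apply: (degenerate_min2 dg) => _ /imsetP[v vS ->].
  apply: leq_trans (S2 v vS) _; rewrite -(card_imset _ f_inj).
  apply/subset_leq_card/subsetP => _ /imsetP[x xN ->].
  by move: xN; rewrite !inE /adj !inE => /andP[xS ->]; rewrite imset_f.
by apply/setP=> v; rewrite inE; apply/negP => vS; have := imset_f f vS; rewrite S0 inE.
Qed.

Lemma push_ptree Pa : ptree Pa -> ptree (push Pa).
Proof.
move=> [irr asy dg]; split.
- by move=> v; apply/negP => /push_in[x [y [-> /f_inj->]]]; apply/negP.
- by move=> u v /push_in[x [y [-> -> H]]]; rewrite pushE asy.
apply: degenerateP => S S2.
have Sk v : v \in S -> exists x, v = f x.
  move=> /S2/ltnW/card_gt0P[b]; rewrite !inE => /andP[_ /orP[]].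
    by rewrite /= => /push_in[x [y [-> _ _]]]; exists x.
  by move=> /push_in[x [y [_ -> _]]]; exists y.
have S0 : f @^-1: S = set0.
  apply: (degenerate_min2 dg) => v; rewrite inE => vS.
  apply: leq_trans (S2 _ vS) _; rewrite -(card_imset _ f_inj).
  apply/subset_leq_card/subsetP => b; rewrite !inE => /andP[bS]; have [x Eb] := Sk _ bS.
  by rewrite Eb /adj !pushE => H; apply: imset_f; rewrite !inE -Eb bS.
apply/setP=> v; rewrite inE; apply/negP => vS; have [x Ev] := Sk _ vS.
by have := in_set0 x; rewrite -S0 inE -Ev vS.
Qed.

End Transport.

Section Undo.
Variables (V : finType) (its : seq (V * {set V} * nat)) (A : rel V).
Hypotheses (A_sym : symmetric A) (A_irr : irreflexive A).
Hypothesis itsA : forall i x, i \in its -> x \in i.1.2 -> A i.1.1 x.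

Fixpoint undo lam (par : V -> V) (r : seq V) (Pa : V -> {set V}) : V -> {set V} :=
  if r is v :: r' then undo lam par r' (leaf_back its lam (alive r') v (par v) Pa)
  else Pa.

Lemma undoP lam par r (Pa : V -> {set V}) : elim_seq its A lam par r ->
  (forall x y, x \in Pa y -> x \in alive r /\ y \in alive r) -> ptree Pa ->
  ptree (undo lam par r Pa) /\
  atotal its lam (alive r) Pa + elim_gain its lam par r
    <= atotal its lam setT (undo lam par r Pa).
Proof.
elim: r Pa => [|v r IH] Pa /=.
  move=> _ _ pt; split=> //; rewrite addn0 (_ : alive [::] = setT) //.
  by apply/setP=> x; rewrite !inE.
move=> [lf er] sub pt; rewrite alive_cons in sub *.
have [|pt' le] := IH _ er _ (leaf_back_ptree lf sub pt).
  exact: (leaf_back_sub lf sub).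
by split=> //; have := leaf_backward A_sym A_irr itsA lf sub; lia.
Qed.

End Undo.

(** The arithmetic of [kforwardP] and, below, of [kbackwardP]. It is carried out in the integers
    because subtracting the gains of the leaves can make the target negative. *)
Lemma chain_forward (t : int) (s a1 a2 x y ad sb : nat) :
  (t <= Posz s)%R -> a1 = s -> a2 <= x -> a1 <= a2 + sb -> x + ad <= y ->
  (t + Posz ad - Posz sb <= Posz y)%R.
Proof. lia. Qed.

Lemma chain_backward (t : int) (s f a1 a2 b ad sb : nat) :
  (t + Posz ad - Posz sb <= Posz s)%R -> a2 + sb <= a1 -> f = s -> a2 = b ->
  forall a3, a1 = a3 -> f <= b + ad -> (t <= Posz a3)%R.
Proof. lia. Qed.

(** * The kernel of an instance with a given decomposition *)

Section Kernel.
Variable I : instance.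
Notation V := 'I_(nvert I).
Notation A := (superstructure I).
Variable its : seq (V * {set V} * nat).
Hypothesis its_score : forall lam v Z, ascore its lam setT v Z = fscore v Z.
Hypothesis itsA : forall i x, i \in its -> x \in i.1.2 -> A i.1.1 x.

Lemma super_sym : symmetric A.
Proof. by move=> a b; rewrite /superstructure orbC. Qed.

Lemma super_irr : irreflexive A.
Proof.
move=> v; rewrite /superstructure orbb; apply/negP => /bigcupP[Z].
by rewrite inE => nz vZ; rewrite fscore_self in nz.
Qed.

(** Equivalence and size are proved for every decomposition that satisfies [dec_ok], so that nothing
    depends on the order in which the program happens to find leaves and paths. *)
Record dec := Dec {
  d_r : seq V; d_lam : V -> nat; d_par : V -> V;
  d_K : {set V}; d_R : {set V};
  d_Q : seq (V * seq V * V) }.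

Variable d : dec.
Notation lam := (d_lam d).
Notation C := (alive (d_r d)).
Notation K := (d_K d).
Notation Qs := (d_Q d).
Notation F := (ascore its lam C).

Record dec_ok : Prop := DecOk {
  ok_elim : elim_seq its A lam (d_par d) (d_r d);
  ok_deg2 : forall v, v \in C -> 1 < #|nbrs A C v|;
  ok_KC : K \subset C;
  ok_RK : d_R d \subset K;
  ok_deg3 : forall v, v \in K -> v \notin d_R d -> 2 < #|nbrs A C v|;
  ok_degR : forall v, v \in d_R d -> #|nbrs A C v| = 2;
  ok_discR : forall a b, a \in d_R d -> b \in d_R d -> connect (inC A C) a b -> a = b;
  ok_uniq : uniq Qs;
  ok_disj : forall P Q v, P \in Qs -> Q \in Qs -> v \in pqs P -> v \in pqs Q -> P = Q;
  ok_paths : forall P, P \in Qs ->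
    [/\ 0 < size (pqs P), uniq (pqs P), pw P \in K /\ pu P \in K
      & forall j, j < size (pqs P) -> pv P j.+1 \in C /\
        forall x, x \in C -> A (pv P j.+1) x = (x == pv P j) || (x == pv P j.+2)];
  ok_offK : forall P v, P \in Qs -> v \in pqs P -> v \notin K;
  ok_cover : forall v, v \in C -> v \notin K -> exists2 P, P \in Qs & v \in pqs P }.

Hypothesis ok : dec_ok.

Definition longs := [seq P <- Qs | 3 < size (pqs P)].
Notation Ps := longs.
Notation FF := (fin C F Ps).

Definition keep v := (v \in C) && ((v \in K) || has (fun P => (v \in pqs P) &&
  [|| size (pqs P) <= 3, index v (pqs P) <= 2 | (index v (pqs P)).+1 == size (pqs P)]) Qs).
Definition kept : {set V} := [set v | keep v].

Lemma F_supp v Z z : F v Z != 0 -> z \in Z -> z \in C /\ A v z.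
Proof. exact: ascore_supp. Qed.

Lemma longsP P : P \in Ps -> P \in Qs /\ 3 < size (pqs P).
Proof. by rewrite mem_filter => /andP[]. Qed.

Lemma Ps_disj P Q v : P \in Ps -> Q \in Ps -> v \in pqs P -> v \in pqs Q -> P = Q.
Proof. by move=> /longsP[PQ _] /longsP[QQ _]; apply: (ok_disj ok). Qed.

Lemma offK v : v \in K -> ~~ onpath Ps v.
Proof.
move=> vK; rewrite /onpath negbK; case E: (pof Ps v) => [P|] //.
by have [/longsP[PQ _] vP] := pofS E; move: (ok_offK ok PQ vP); rewrite vK.
Qed.

Lemma Ps_good P : P \in Ps -> good_path A C Ps P.
Proof.
move=> /longsP[PQ l]; have [_ u [wK uK] H] := ok_paths ok PQ; split=> //.
  by split; apply: (subsetP (ok_KC ok)).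
by split; apply: offK.
Qed.

Lemma Ps_uniq : uniq Ps. Proof. exact/filter_uniq/(ok_uniq ok). Qed.

Lemma kept_K v : v \in K -> v \in kept.
Proof. by move=> vK; rewrite inE /keep vK (subsetP (ok_KC ok)). Qed.

Lemma kept_pv P j : P \in Qs -> 0 < j <= size (pqs P) ->
  [|| size (pqs P) <= 3, j <= 3 | j == size (pqs P)] = (pv P j \in kept).
Proof.
move=> PQ jm; have [m0 un _ H] := ok_paths ok PQ.
have jP := pv_in jm.
have Ei : index (pv P j) (pqs P) = j.-1.
  by case: j jm {jP} => // j jm; rewrite pvE //= index_uniq.
have jC : pv P j \in C by case: j jm {jP Ei} => // j /H[].
rewrite inE /keep jC (negbTE (ok_offK ok PQ jP)) /=; apply/idP/hasP => [H1|[Q QQ /andP[jQ]]].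
  by exists P => //; rewrite jP Ei /=; lia.
rewrite -(ok_disj ok PQ QQ jP jQ) Ei; lia.
Qed.

(** Justifies cutting the instance down to [kept]. The delicate case is a vertex off the long paths:
    by [off_end] its neighbours on such a path are the first or the last inner vertex, and both are
    kept. *)
Lemma FF_kept v Z : FF v Z != 0 -> v \in kept /\ {subset Z <= kept}.
Proof.
have gd := Ps_good; have dj := Ps_disj.
have qk P j : P \in Ps -> j <= (size (pqs P)).+1 ->
    [|| j <= 3, j == size (pqs P) | j == (size (pqs P)).+1] -> pv P j \in kept.
  move=> PP jm jj; have [PQ l] := longsP PP; have [_ _ [wK uK] _] := ok_paths ok PQ.
  have [->|j0] := eqVneq j 0; first by rewrite pv0 kept_K.
  have [->|j1] := eqVneq j (size (pqs P)).+1; first by rewrite pvm kept_K.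
  by rewrite -kept_pv //; lia.
rewrite /fin; case E: (pof Ps v) => [P|].
  have [PP vP] := pofS E; have [PQ l] := longsP PP; have [_ _ [wK uK] _] := ok_paths ok PQ.
  have k1 : pv P 1 \in kept by apply: qk => //; clear -l; lia.
  have k2 : pv P 2 \in kept by apply: qk => //; clear -l; lia.
  have k3 : pv P 3 \in kept by apply: qk => //; clear -l; lia.
  have kx : px P \in kept by apply: qk => //; clear -l; lia.
  have kw := kept_K wK; have ku := kept_K uK.
  rewrite /gad; case: ifP => [/eqP-> |_].
    case: ifP => [/eqP-> _|_]; first by split=> // z; rewrite in_set2 => /orP[]/eqP->.
    case: ifP => [/eqP-> _|_] //; split=> // z; by rewrite inE => /eqP->.
  case: ifP => [/eqP-> |_] //; case: ifP => // /eqP -> _; split=> // z.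
  rewrite !in_setU !in_opt => /orP[/orP[]|/orP[]] /andP[_ /eqP->] //.
case: ifP => // vC nz; split.
  have [vK|vK] := boolP (v \in K); first exact: kept_K.
  have [P PQ vP] := ok_cover ok vC vK; have [j jm Ev] := pqsP vP.
  rewrite Ev -kept_pv //; case: leqP => //= l; exfalso.
  have PP : P \in Ps by rewrite mem_filter l.
  by rewrite (pofP dj PP vP) in E.
move=> z zZ; have [zC vz] := F_supp nz zZ.
have [zK|zK] := boolP (z \in K); first exact: kept_K.
have [P PQ zP] := ok_cover ok zC zK; have [j jm Ez] := pqsP zP.
rewrite Ez -kept_pv //; case: leqP => //= l.
have PP : P \in Ps by rewrite mem_filter l.
have vo : ~~ onpath Ps v by rewrite /onpath E.
have [] := off_end super_sym gd dj PP jm vo vC; first by rewrite -Ez.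
  by move=> [_ ->].
by move=> [_ ->]; rewrite eqxx orbT.
Qed.

Definition adds := \sum_(P <- Ps) (2 * pbig F P).+1.
Definition subs := elim_gain its lam (d_par d) (d_r d).

Definition kf (v : 'I_#|kept|) (Z : {set 'I_#|kept|}) : nat :=
  FF (enum_val v) [set enum_val x | x in Z].

Lemma FF_self v (Z : {set V}) : v \in Z -> FF v Z = 0.
Proof.
move=> vZ; apply/eqP; apply: contraT; rewrite /fin; case E: (pof Ps v) => [P|]; last first.
  by case: ifP => // _ nz; have [_] := F_supp nz vZ; rewrite super_irr.
have [PP vP] := pofS E; have [_ l] := longsP PP.
have gd := Ps_good; have dj := Ps_disj.
have zi k i : 0 < k <= size (pqs P) -> i <= (size (pqs P)).+1 -> k != i -> (pv P k == pv P i) = false.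
  by move=> km im i1; apply: (pv_neq gd dj) => //; lia.
rewrite /gad; case: ifP => [/eqP Ev|_].
  case: (Z =P [set pv P 2; pv P 3]) => [EZ|_].
    by move: vZ; rewrite EZ Ev in_set2 /px !zi //; clear -l; lia.
  case: (Z =P [set pu P]) => [EZ|_] //.
  by move: vZ; rewrite EZ Ev in_set1 /px -(pvm P) zi //; clear -l; lia.
case: ifP => [/eqP Ev|_] //; case: ifP => // /eqP EZ.
have z1 i : i <= (size (pqs P)).+1 -> i != 1 -> (v == pv P i) = false.
  by move=> im i1; rewrite Ev zi //; clear -l i1; lia.
by move: vZ; rewrite {1}EZ !in_setU !in_opt -(pv0 P) /px !z1 ?andbF //; clear -l; lia.
Qed.

Lemma kf_self v (Z : {set 'I_#|kept|}) : v \in Z -> kf v Z = 0.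
Proof. by move=> vZ; apply: FF_self; apply: imset_f. Qed.

Definition kinst : instance :=
  Instance kf_self (target I + Posz adds - Posz subs)%R.

(** Removes the arcs at dead vertices and off the superstructure, since [fw] expects a [normal]
    digraph. *)
Definition restrict (Pa : V -> {set V}) v : {set V} :=
  if v \in C then Pa v :&: nbrs A C v else set0.

Definition kforward (Pa : V -> {set V}) : 'I_#|kept| -> {set 'I_#|kept|} :=
  pull (fw Ps (restrict Pa)).

Definition kbackward (Pa : 'I_#|kept| -> {set 'I_#|kept|}) : V -> {set V} :=
  undo its lam (d_par d) (d_r d) (bw A C F Ps (push Pa)).

Lemma kforwardP (D : rel V) : solution D ->
  solution (I := kinst) (dig (kforward (parents D))).
Proof.
case=> /ptree_polytree pt le; have [irr asy dg] := pt.
have gd := Ps_good; have dj := Ps_disj; have un := Ps_uniq.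
have pt1 : ptree (restrict (parents D)).
  by apply: ptree_sub pt => v; rewrite /restrict; case: ifP; rewrite ?subsetIl ?sub0set.
have nr : normal A C (restrict (parents D)).
  move=> a b; rewrite /restrict; case: ifP; rewrite !inE // => bC /and3P[_ -> ab].
  by rewrite super_sym.
have pt2 := fw_ptree super_sym gd dj un nr pt1.
have Ep' (Pa : 'I_#|kept| -> {set 'I_#|kept|}) v : parents (dig Pa) v = Pa v.
  by apply/setP=> x; rewrite inE.
split.
  apply/ptree_polytree; apply: (ptree_sub _ (pull_ptree kept pt2)) => v.
  by rewrite Ep'.
apply: Order.le_trans (_ : (_ <= Posz (\sum_v FF v (fw Ps (restrict (parents D)) v)))%R) _ => /=.
  have := fw_score F super_sym gd dj un nr pt1.
  have := elim_forward super_sym super_irr itsA (ok_elim ok) asy.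
  have : atotal its lam C (parents D) <= \sum_(v in C) F v (restrict (parents D) v).
    apply: leq_sum => v vC; rewrite /restrict vC.
    have [->//|nz] := eqVneq (F v (parents D v :&: C)) 0.
    rewrite (_ : parents D v :&: nbrs A C v = parents D v :&: C) //.
    apply/setP=> x; rewrite !inE; apply: andb_id2l => Dx; apply: andb_idr => xC.
    by have [] := @F_supp v _ x nz; rewrite ?inE ?Dx.
  have : atotal its lam setT (parents D) = score D.
    rewrite /atotal /score big_mkcond; apply: eq_bigr => v _.
    by rewrite inE setIT its_score.
  move: le; exact: chain_forward.
rewrite /score /= (sum_kept (kept := kept)); last first.
  by move=> v; apply: contraNeq => /FF_kept[].
apply: leq_sum => v _; rewrite /kf Ep' pull_f.
have [->//|nz] := eqVneq (FF (enum_val v) (fw Ps (restrict (parents D)) (enum_val v))) 0.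
have [_ sub] := FF_kept nz; rewrite (_ : _ :&: kept = fw Ps (restrict (parents D)) (enum_val v)) //.
by apply/setIidPl/subsetP.
Qed.

Lemma kbackwardP (D : rel 'I_#|kept|) : solution (I := kinst) D ->
  solution (dig (kbackward (parents D))).
Proof.
case=> /ptree_polytree pt le; have gd := Ps_good; have dj := Ps_disj; have un := Ps_uniq.
have pt1 : ptree (push (parents D)) by apply: push_ptree pt.
have pt2 : ptree (bw A C F Ps (push (parents D))).
  by apply: bw_ptree => //; [apply: super_sym|apply: super_irr].
have bn : normal A C (bw A C F Ps (push (parents D))).
  by apply: bw_normal => //; apply: super_sym.
have sub x y : x \in bw A C F Ps (push (parents D)) y -> x \in C /\ y \in C by case/bn.
have [pt3 le3] := undoP super_sym super_irr itsA (ok_elim ok) sub pt2.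
have Ep' (Pa : V -> {set V}) v : parents (dig Pa) v = Pa v by apply/setP=> x; rewrite inE.
split.
  by apply/ptree_polytree; apply: (ptree_sub _ pt3) => v; rewrite Ep'.
have e4 := bw_score F_supp gd dj un pt1.
have e3 : atotal its lam setT (kbackward (parents D)) = score (dig (kbackward (parents D))).
  rewrite /atotal /score big_mkcond; apply: eq_bigr => v _.
  by rewrite inE setIT its_score Ep'.
have e2 : atotal its lam C (bw A C F Ps (push (parents D))) =
    \sum_(v in C) F v (bw A C F Ps (push (parents D)) v).
  by apply: eq_bigr => v vC; congr (F v _); apply/setIidPl/subsetP => x /sub[].
have e1 : \sum_v FF v (push (parents D) v) = score (I := kinst) D.
  rewrite (sum_kept (kept := kept)); last by move=> v; apply: contraNeq => /FF_kept[].
  by apply: eq_bigr => v _; rewrite push_f.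
exact: (chain_backward le le3 e1 e2 e3 e4).
Qed.

Lemma kyes : yes_instance I <-> yes_instance kinst.
Proof.
split=> -[D sD]; first by exists (dig (kforward (parents D))); apply: kforwardP.
by exists (dig (kbackward (parents D))); apply: kbackwardP.
Qed.

(** A path keeps at most its first three vertices and its last one, so [count_kept] applies to a
    minimum feedback edge set and gives 14k. *)
Lemma ksize k : feedback_edge_number A k -> #|kept| <= 24 * k.
Proof.
move=> [[Fe fes <-] _]; apply: (@leq_trans (14 * #|Fe|)); last by rewrite leq_mul2r orbT.
apply: (count_kept super_sym super_irr fes (ok_KC ok) (ok_RK ok) (ok_deg2 ok)
  (ok_deg3 ok) (ok_degR ok) (ok_discR ok) (ok_uniq ok) (ok_disj ok) (ok_paths ok)).
move=> v vk; have [|vK] := boolP (v \in K); first by left.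
right; move: (vk); rewrite inE /keep => /andP[vC]; rewrite (negbTE vK) /= => /hasP[P PQ /andP[vP _]].
exists P => //; have [j jm Ev] := pqsP vP; move: vk; rewrite Ev -kept_pv //.
have [->|j1] := eqVneq j 1; first by constructor 1.
have [->|j2] := eqVneq j 2; first by constructor 2.
have [->|j3] := eqVneq j 3; first by constructor 3.
move=> H; constructor 4; rewrite /px; congr (pv P _); lia.
Qed.

End Kernel.

(** * Programs *)

Notation C_ := Const.
Notation G_ := Get.
Notation X_ := var.
Notation "p ;; q" := (PSeq p q) (at level 60, right associativity).
Notation put := PPut.
Notation setv a e := (PPut a (Const 0) e).
Notation when e p := (PIf e p PSkip).
Notation for_ := PFor.
Notation "e1 +' e2" := (Add e1 e2) (at level 50, left associativity).
Notation "e1 -' e2" := (Defs.Sub e1 e2) (at level 50, left associativity).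
Notation incr a := (PPut a (Const 0) (Add (var a) (Const 1))).
Notation maxe e1 e2 := (Add e1 (Defs.Sub e2 e1)).

(* Input slots (a header or an entry of a score list) are numbered from 0 to
   [aIT] - 1, with owner [aOWN], value [aVAL] and incidence matrix [aMM]; [aCODE]
   is the parent set among the alive vertices as a sum of powers of two. [aPP] is
   the superstructure, [aALV] and [aDEG] describe the remaining graph, [aORD]
   lists the leaves in order of elimination. In the core, [aNB1] is a neighbour
   and [aNBS] the sum of all neighbours, so that a vertex of degree 2 knows both.
   A path is named by its first vertex; [aWW], [aXX], [aUU], [aZ1], [aZ2] give the
   vertex before it, its last vertex, the vertex after it, and its second and
   third vertices; [aW] is the table of [tab]. *)
Notation aIN := 2 (only parsing). Notation aNV := 4 (only parsing).
Notation aIT := 5 (only parsing). Notation aHDR := 6 (only parsing).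
Notation aOWN := 7 (only parsing). Notation aVAL := 8 (only parsing).
Notation aMM := 9 (only parsing). Notation aBASE := 10 (only parsing).
Notation aPOW := 11 (only parsing). Notation aPP := 12 (only parsing).
Notation aDEG := 13 (only parsing). Notation aALV := 14 (only parsing).
Notation aCODE := 15 (only parsing). Notation aLOSS := 16 (only parsing).
Notation aLAM := 17 (only parsing). Notation aPAR := 18 (only parsing).
Notation aORD := 19 (only parsing). Notation aNO := 20 (only parsing).
Notation aSUBS := 21 (only parsing). Notation aNB1 := 22 (only parsing).
Notation aNBS := 23 (only parsing). Notation aG := 24 (only parsing).
Notation aKK := 28 (only parsing). Notation aPID := 29 (only parsing).
Notation aPOS := 30 (only parsing). Notation aPRV := 31 (only parsing).
Notation aLEN := 32 (only parsing). Notation aXX := 33 (only parsing).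
Notation aUU := 34 (only parsing). Notation aWW := 35 (only parsing).
Notation aZ1 := 36 (only parsing). Notation aZ2 := 37 (only parsing).
Notation aW := 38 (only parsing). Notation aBB := 46 (only parsing).
Notation aADDS := 47 (only parsing). Notation aKEPT := 48 (only parsing).
Notation aNEW := 49 (only parsing). Notation aNK := 50 (only parsing).
Notation aOLD := 51 (only parsing). Notation aNRM := 52 (only parsing).
Notation aWIN := 53 (only parsing). Notation aCNT := 54 (only parsing).
Notation aID := 55 (only parsing). Notation aALL := 56 (only parsing).
Notation t0 := 60 (only parsing). Notation t1 := 61 (only parsing).
Notation t2 := 62 (only parsing). Notation t3 := 63 (only parsing).
Notation t4 := 64 (only parsing). Notation t5 := 65 (only parsing).
Notation t6 := 66 (only parsing). Notation t7 := 67 (only parsing).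
Notation c0 := 80 (only parsing). Notation c1 := 81 (only parsing).
Notation aSP := 100 (only parsing). Notation aSN := 101 (only parsing).
Notation aSV := 102 (only parsing). Notation aSR := 103 (only parsing).
Notation aOFF := 104 (only parsing).
Notation aDM := 110 (only parsing). Notation aDP := 111 (only parsing).
Notation aDL := 112 (only parsing). Notation aOP := 113 (only parsing).
Notation aSZ := 114 (only parsing). Notation aZP := 115 (only parsing).
Notation u0 := 120 (only parsing). Notation u1 := 121 (only parsing).
Notation u2 := 122 (only parsing). Notation u3 := 123 (only parsing).
Notation u4 := 124 (only parsing). Notation u5 := 125 (only parsing).
Notation u6 := 126 (only parsing).
Notation c2 := 130 (only parsing). Notation c3 := 131 (only parsing).

Definition ix r c := G_ aBASE r +' c.
Definition eadj a b := G_ aPP (ix a b) +' G_ aPP (ix b a).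

(* Moves [aSP] past the encoding of an instance that starts there. *)
Definition c_skip : cmd :=
  Seq (Put aSN (C_ 0) (G_ 0 (X_ aSP)))
 (Seq (Put aSP (C_ 0) (X_ aSP +' C_ 3))
 (Seq (Put aSV (C_ 0) (C_ 0))
 (While (X_ aSN -' X_ aSV)
   (Seq (Put aSR (C_ 0) (G_ 0 (X_ aSP)))
   (Seq (Put aSP (C_ 0) (X_ aSP +' C_ 1))
   (Seq (While (X_ aSR)
          (Seq (Put aSP (C_ 0) (X_ aSP +' G_ 0 (X_ aSP +' C_ 1) +' C_ 2))
               (Put aSR (C_ 0) (X_ aSR -' C_ 1))))
        (Put aSV (C_ 0) (X_ aSV +' C_ 1)))))))).

(** The instance to be analysed need not start the input: in [c_bwd] it comes second. Copying it
    makes its positions start at 0 in every case. *)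
Definition p_copy :=
  for_ c2 (put aIN (X_ c2) (G_ 0 (X_ aOFF +' X_ c2))).

Definition p_tables :=
  setv t0 (C_ 0) ;; setv t1 (C_ 1) ;;
  for_ c0 (put aBASE (X_ c0) (X_ t0) ;; setv t0 (X_ t0 +' X_ aN) ;;
           put aPOW (X_ c0) (X_ t1) ;; setv t1 (X_ t1 +' X_ t1)).

(* t0: position, t1: headers read, t2: entries to read, t3: elements to read,
   t4: a list length comes next. *)
Definition p_parse_step :=
  setv t5 (G_ aIN (X_ t0)) ;; incr t0 ;;
  PIf (X_ t3)
    (put aMM (ix (X_ aIT -' C_ 1) (X_ t5)) (C_ 1) ;;
     put aPP (ix (X_ t1 -' C_ 1) (X_ t5)) (C_ 1) ;;
     put aCODE (X_ aIT -' C_ 1) (G_ aCODE (X_ aIT -' C_ 1) +' G_ aPOW (X_ t5)) ;;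
     setv t3 (X_ t3 -' C_ 1))
  (PIf (X_ t4) (setv t3 (X_ t5) ;; setv t4 (C_ 0))
  (PIf (X_ t2)
    (put aVAL (X_ aIT) (X_ t5) ;; put aOWN (X_ aIT) (X_ t1 -' C_ 1) ;;
     incr aIT ;; setv t2 (X_ t2 -' C_ 1) ;; setv t4 (C_ 1))
    (put aHDR (X_ aIT) (C_ 1) ;; put aOWN (X_ aIT) (X_ t1) ;; incr aIT ;;
     incr t1 ;; setv t2 (X_ t5)))).

Definition p_parse :=
  setv aNV (G_ aIN (C_ 0)) ;; setv t0 (C_ 3) ;; setv t1 (C_ 0) ;;
  for_ c0 (when (elt (X_ t0) (X_ aN)) p_parse_step).

Definition p_degrow :=
  for_ c1 (when (eand (elt (X_ c1) (X_ aNV)) (eadj (X_ c0) (X_ c1)))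
    (put aDEG (X_ c0) (G_ aDEG (X_ c0) +' C_ 1))).

(** The conjunct [C_ 1] is always true; it gives the guard the shape that the loop rule [forV_ind]
    handles. *)
Definition p_deg :=
  for_ c0 (when (eand (elt (X_ c0) (X_ aNV)) (C_ 1))
    (put aALV (X_ c0) (C_ 1) ;; put aALL (X_ c0) (C_ 1) ;; put aID (X_ c0) (X_ c0) ;;
     p_degrow)).

Definition eval_item i := G_ aVAL i -' G_ aLOSS i.

(** [t0] receives one plus the vertex found, so that 0 means that no leaf is left. *)
Definition p_find :=
  setv t0 (C_ 0) ;;
  for_ c1 (when (eand (elt (X_ c1) (X_ aNV))
             (eand (G_ aALV (X_ c1)) (elt (G_ aDEG (X_ c1)) (C_ 2))))
    (setv t0 (X_ c1 +' C_ 1))).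

Definition p_attach :=
  setv t2 (X_ t1) ;;
  for_ c1 (when (eand (elt (X_ c1) (X_ aNV))
             (eand (G_ aALV (X_ c1)) (eadj (X_ t1) (X_ c1))))
    (setv t2 (X_ c1))).

(** The parent sets of a leaf contain no living vertex but its attachment vertex, so one membership
    test sorts the slots into two kinds. *)
Definition p_gain :=
  setv t3 (C_ 0) ;; setv t4 (C_ 0) ;;
  for_ c1 (when (eand (elt (X_ c1) (X_ aIT)) (eeq (G_ aOWN (X_ c1)) (X_ t1)))
    (setv t5 (eval_item (X_ c1)) ;;
     PIf (G_ aMM (ix (X_ c1) (X_ t2))) (setv t4 (maxe (X_ t4) (X_ t5)))
                                       (setv t3 (maxe (X_ t3) (X_ t5))))).

(** Keeping the code of the alive part of each set up to date takes constant time per slot. Equality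
    of two such parts is then a comparison of two numbers. *)
Definition p_charge :=
  for_ c1 (when (eand (elt (X_ c1) (X_ aIT)) (G_ aMM (ix (X_ c1) (X_ t1))))
    (put aCODE (X_ c1) (G_ aCODE (X_ c1) -' G_ aPOW (X_ t1)) ;;
     put aLOSS (X_ c1) (G_ aLOSS (X_ c1) +' G_ aLAM (X_ t1)))).

Definition p_undeg :=
  for_ c1 (when (eand (elt (X_ c1) (X_ aNV)) (eadj (X_ t1) (X_ c1)))
    (put aDEG (X_ c1) (G_ aDEG (X_ c1) -' C_ 1))).

Definition p_elim :=
  p_attach ;; p_gain ;;
  put aLAM (X_ t1) (X_ t4 -' X_ t3) ;; put aPAR (X_ t1) (X_ t2) ;;
  setv aSUBS (X_ aSUBS +' maxe (X_ t3) (X_ t4)) ;;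
  p_charge ;; put aALV (X_ t1) (C_ 0) ;; p_undeg ;;
  put aORD (X_ aNO) (X_ t1) ;; incr aNO.

(** Each round scans all vertices for a leaf again; N rounds of linear work stay within the
    quadratic bound. *)
Definition p_leaf :=
  for_ c0 (p_find ;; when (X_ t0) (setv t1 (X_ t0 -' C_ 1) ;; p_elim)).

Definition p_corerow :=
  for_ c1 (when (eand (elt (X_ c1) (X_ aNV))
             (eand (G_ aALV (X_ c1)) (eadj (X_ c0) (X_ c1))))
    (put aNB1 (X_ c0) (X_ c1) ;; put aNBS (X_ c0) (G_ aNBS (X_ c0) +' X_ c1))).

Definition p_core :=
  for_ c0 (when (eand (elt (X_ c0) (X_ aNV)) (G_ aALV (X_ c0)))
    (put aKK (X_ c0) (enot (enot (elt (C_ 2) (G_ aDEG (X_ c0))))) ;; p_corerow)).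

Definition p_put_G k :=
  put (aG + k) (X_ t0) (maxe (G_ (aG + k) (X_ t0)) (X_ t1)).

(** The arrays from [aG] on are indexed by two bits, the membership of the first and of the second
    neighbour. The results have this meaning for vertices of degree two only. *)
Definition p_scores :=
  for_ c0 (when (eand (elt (X_ c0) (X_ aIT)) (C_ 1))
    (setv t0 (G_ aOWN (X_ c0)) ;; setv t1 (eval_item (X_ c0)) ;;
     setv t2 (G_ aNB1 (X_ t0)) ;; setv t3 (G_ aNBS (X_ t0) -' X_ t2) ;;
     PIf (G_ aMM (ix (X_ c0) (X_ t2)))
       (PIf (G_ aMM (ix (X_ c0) (X_ t3))) (p_put_G 3) (p_put_G 2))
       (PIf (G_ aMM (ix (X_ c0) (X_ t3))) (p_put_G 1) (p_put_G 0)))).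

Definition wix (a b c : bool) := aW + (4 * a + 2 * b + c).

(* t0: start, t1: current vertex, t2: previous vertex, t3: number of vertices *)
Definition egl l r :=
  G_ (aG + (2 * nat_of_bool l + r)) (X_ t1).

(* Writes in t4, .., t7 the scores of t1 without parent, with parent the next
   vertex, with parent t2, and with both. *)
Definition p_local :=
  PIf (eeq (G_ aNB1 (X_ t1)) (X_ t2))
    (setv t4 (egl false false) ;; setv t5 (egl false true) ;;
     setv t6 (egl true false) ;; setv t7 (egl true true))
    (setv t4 (egl false false) ;; setv t5 (egl true false) ;;
     setv t6 (egl false true) ;; setv t7 (egl true true)).

Definition eloc (l r : bool) := X_ (t4 + (2 * l + r)).
Definition eW a b c v := G_ (wix a b c) v.

Definition bools := [:: false; true].
Definition seqp (ps : seq prog) : prog := foldr PSeq PSkip ps.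

Definition p_tab0 :=
  seqp [seq seqp [seq put (wix a b false) (X_ t1) (eloc b a +' C_ 1) ;;
                      put (wix a b true) (X_ t1) (C_ 0) | b <- bools] | a <- bools].

Definition p_addmax w e y :=
  when e (put w (X_ t1) (maxe (G_ w (X_ t1)) (e +' y))).

Definition tab_block a b c :=
  put (wix a b c) (X_ t1) (C_ 0) ;;
  p_addmax (wix a b c) (eW false b c (X_ t2)) (eloc true a) ;;
  p_addmax (wix a b c) (eW true b c (X_ t2)) (eloc false a) ;;
  (if c then p_addmax (wix a b c)
     (maxe (eW false b false (X_ t2)) (eW false b true (X_ t2))) (eloc false a)
   else PSkip).

Definition triples := [:: (false, false, false); (false, false, true);
  (false, true, false); (false, true, true); (true, false, false);
  (true, false, true); (true, true, false); (true, true, true)].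

Definition p_tabS := seqp [seq tab_block t.1.1 t.1.2 t.2 | t <- triples].

Definition esumW v :=
  foldr Add (C_ 0) [seq G_ (aW + k) v | k <- iota 0 8].

Definition p_mark :=
  put aPID (X_ t1) (X_ t0 +' C_ 1) ;; put aPRV (X_ t1) (X_ t2) ;; incr t3 ;;
  put aPOS (X_ t1) (X_ t3) ;;
  when (eeq (X_ t3) (C_ 2)) (put aZ1 (X_ t0) (X_ t1)) ;;
  when (eeq (X_ t3) (C_ 3)) (put aZ2 (X_ t0) (X_ t1)).

Definition p_next :=
  setv t4 (G_ aNBS (X_ t1) -' X_ t2) ;; setv t2 (X_ t1) ;; setv t1 (X_ t4).

Definition p_step :=
  when (enot (G_ aKK (X_ t1)))
    (p_mark ;; p_local ;; PIf (eeq (X_ t3) (C_ 1)) p_tab0 p_tabS ;; p_next).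

Definition p_start :=
  setv t0 (X_ t1) ;; put aWW (X_ t0) (X_ t2) ;; setv t3 (C_ 0).

Definition p_finish :=
  put aLEN (X_ t0) (X_ t3) ;; put aXX (X_ t0) (X_ t2) ;; put aUU (X_ t0) (X_ t1) ;;
  put aBB (X_ t0) (esumW (X_ t2)) ;;
  when (elt (C_ 3) (X_ t3))
    (setv aADDS (X_ aADDS +' G_ aBB (X_ t0) +' G_ aBB (X_ t0) +' C_ 1)).

Definition p_walk := p_start ;; for_ c1 p_step ;; p_finish.

Definition efree v := eand (G_ aALV v) (eand (enot (G_ aKK v)) (enot (G_ aPID v))).

(** Paths are started at free vertices next to [K]. The vertices that remain free form components
    without any vertex of [K], that is cycles, and [p_paths2] opens each of them by moving one
    vertex into [K]. *)
Definition p_paths1 :=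
  for_ c0 (when (eand (elt (X_ c0) (X_ aNV)) (efree (X_ c0)))
    (setv t1 (X_ c0) ;;
     PIf (G_ aKK (G_ aNB1 (X_ c0)))
       (setv t2 (G_ aNB1 (X_ c0)) ;; p_walk)
       (setv t2 (G_ aNBS (X_ c0) -' G_ aNB1 (X_ c0)) ;;
        when (G_ aKK (X_ t2)) p_walk))).

Definition p_paths2 :=
  for_ c0 (when (eand (elt (X_ c0) (X_ aNV)) (efree (X_ c0)))
    (put aKK (X_ c0) (C_ 1) ;; setv t2 (X_ c0) ;; setv t1 (G_ aNB1 (X_ c0)) ;; p_walk)).

Definition elen v := G_ aLEN (G_ aPID v -' C_ 1).

Definition p_keep :=
  for_ c0 (when (eand (elt (X_ c0) (X_ aNV)) (G_ aALV (X_ c0)))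
    (when (G_ aKK (X_ c0) +' elt (elen (X_ c0)) (C_ 4)) (put aNRM (X_ c0) (C_ 1)) ;;
     when (G_ aNRM (X_ c0) +' elt (G_ aPOS (X_ c0)) (C_ 4)
           +' eeq (G_ aPOS (X_ c0)) (elen (X_ c0)))
       (put aKEPT (X_ c0) (C_ 1) ;; put aNEW (X_ c0) (X_ aNK) ;;
        put aOLD (X_ aNK) (X_ c0) ;; incr aNK))).

(** A tournament among the slots with the same owner and the same alive part: the largest value
    wins, and the first slot in case of a tie. The winners of a vertex form its new score list. *)
Definition p_win :=
  for_ c0 (when (eand (elt (X_ c0) (X_ aIT))
             (eand (G_ aNRM (G_ aOWN (X_ c0))) (eval_item (X_ c0))))
    (setv t0 (C_ 1) ;;
     for_ c1 (when (eand (elt (X_ c1) (X_ aIT))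
         (eand (eeq (G_ aOWN (X_ c1)) (G_ aOWN (X_ c0)))
         (eand (eeq (G_ aCODE (X_ c1)) (G_ aCODE (X_ c0)))
           (elt (eval_item (X_ c0)) (eval_item (X_ c1)) +'
            eand (eeq (eval_item (X_ c0)) (eval_item (X_ c1))) (elt (X_ c1) (X_ c0))))))
       (setv t0 (C_ 0))) ;;
     put aWIN (X_ c0) (X_ t0) ;;
     put aCNT (G_ aOWN (X_ c0)) (G_ aCNT (G_ aOWN (X_ c0)) +' X_ t0))).

Definition p_analysis :=
  p_tables ;; p_parse ;; p_deg ;; p_leaf ;; p_core ;; p_scores ;;
  p_paths1 ;; p_paths2 ;; p_keep ;; p_win.

(** ** Output of the kernel *)

Definition emit e := put 1 (X_ aOP) e ;; incr aOP.
Definition emits es := seqp [seq emit e | e <- es].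

(* The length is written last, at the position kept in [aZP]. *)
Definition emit_set t e :=
  setv aZP (X_ aOP) ;; emit (C_ 0) ;; setv aSZ (C_ 0) ;;
  for_ c3 (when t (emit e ;; incr aSZ)) ;;
  put 1 (X_ aZP) (X_ aSZ).

Definition enew v := G_ aNEW v.

Definition gadget_y v : seq expr :=
  C_ 8 :: flatten [seq
    let: (a, b, cn) := t in
    let val := eW a b (~~ cn) (G_ aXX v) in
    (if a then val +' G_ aBB v else val) :: C_ (b + cn + 2 * a) ::
    (if b then [:: enew (G_ aWW v)] else [::]) ++
    (if cn then [:: enew (G_ aXX v)] else [::]) ++
    (if a then [:: enew (G_ aZ1 v); enew (G_ aZ2 v)] else [::])
   | t <- triples].

Definition gadget_x v : seq expr :=
  [:: C_ 2; G_ aBB v +' G_ aBB v; C_ 2; enew (G_ aZ1 v); enew (G_ aZ2 v);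
      G_ aBB v; C_ 1; enew (G_ aUU v)].

Definition p_emit_header :=
  when (G_ aKEPT (X_ u0))
    (PIf (G_ aNRM (X_ u0)) (emit (G_ aCNT (X_ u0)))
    (PIf (eeq (G_ aPOS (X_ u0)) (C_ 1)) (emits (gadget_y (X_ u0)))
    (PIf (eeq (G_ aPOS (X_ u0)) (elen (X_ u0)))
       (emits (gadget_x (G_ aPID (X_ u0) -' C_ 1))) (emit (C_ 0))))).

Definition p_emit_item :=
  when (G_ aWIN (X_ c2))
    (emit (eval_item (X_ c2)) ;;
     emit_set (eand (G_ aMM (ix (X_ c2) (X_ c3))) (G_ aALV (X_ c3))) (enew (X_ c3))).

(* u1 - u2 is the new target. *)
Definition p_emit :=
  PIf (G_ aIN (C_ 1))
    (setv u1 (X_ aADDS) ;; setv u2 (G_ aIN (C_ 2) +' X_ aSUBS))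
    (setv u1 (G_ aIN (C_ 2) +' X_ aADDS) ;; setv u2 (X_ aSUBS)) ;;
  setv aOP (C_ 0) ;;
  emits [:: X_ aNK; enot (enot (elt (X_ u1) (X_ u2)));
            (X_ u1 -' X_ u2) +' (X_ u2 -' X_ u1)] ;;
  for_ c2 (when (eand (elt (X_ c2) (X_ aIT)) (C_ 1))
    (setv u0 (G_ aOWN (X_ c2)) ;;
     PIf (G_ aHDR (X_ c2)) p_emit_header p_emit_item)).

(** ** Digraphs *)

(* Reads a digraph at position [aDP] of the input into the matrix [aDM]; there
   are [nv] rows, and vertex i of the input stands for [m] i. *)
Definition p_read_dig nv m :=
  for_ c2 (when (eand (elt (X_ c2) nv) (C_ 1))
    (setv aDL (G_ 0 (X_ aDP)) ;; incr aDP ;;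
     for_ c3 (when (elt (X_ c3) (X_ aDL))
       (put aDM (ix (G_ m (X_ c2)) (G_ m (G_ 0 (X_ aDP)))) (C_ 1) ;; incr aDP)))).

Definition p_write_dig k m :=
  setv aOP (C_ 0) ;;
  for_ c2 (when (eand (elt (X_ c2) (X_ aNV)) (G_ k (X_ c2)))
    (emit_set (eand (eand (elt (X_ c3) (X_ aNV)) (G_ k (X_ c3)))
                    (G_ aDM (ix (X_ c2) (X_ c3)))) (G_ m (X_ c3)))).

Definition p_restrict :=
  for_ c2 (for_ c3
    (when (enot (eand (eadj (X_ c2) (X_ c3)) (eand (G_ aALV (X_ c2)) (G_ aALV (X_ c3)))))
       (put aDM (ix (X_ c2) (X_ c3)) (C_ 0)))).

Definition elong v :=
  eand (elt (X_ c2) (X_ aNV))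
 (eand (G_ aALV v) (eand (enot (G_ aKK v))
   (eand (eeq (G_ aPOS v) (C_ 1)) (elt (C_ 3) (G_ aLEN v))))).

Definition ein p q := G_ aDM (ix q p).

(* u3: whether all inner edges are used. *)
Definition p_cut :=
  for_ c3 (when (elt (C_ 1) (G_ aPOS (X_ u5)))
    (setv u6 (G_ aPRV (X_ u5)) ;;
     when (enot (ein (X_ u5) (X_ u6) +' ein (X_ u6) (X_ u5))) (setv u3 (C_ 0)) ;;
     put aDM (ix (X_ u5) (X_ u6)) (C_ 0) ;; put aDM (ix (X_ u6) (X_ u5)) (C_ 0) ;;
     setv u5 (X_ u6))).

(* u1: the end bit at u. *)
Definition p_fwinit :=
  setv u4 (G_ aXX (X_ c2)) ;; setv u1 (ein (G_ aUU (X_ c2)) (X_ u4)) ;;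
  setv u3 (C_ 1) ;; setv u5 (X_ u4).

Definition p_fwends :=
  put aDM (ix (X_ u4) (G_ aUU (X_ c2))) (C_ 0) ;;
  when (X_ u3) (put aDM (ix (X_ c2) (X_ u4)) (C_ 1)) ;;
  PIf (X_ u1)
    (put aDM (ix (X_ u4) (G_ aUU (X_ c2))) (C_ 1) ;;
     put aDM (ix (X_ c2) (G_ aZ1 (X_ c2))) (C_ 1) ;;
     put aDM (ix (X_ c2) (G_ aZ2 (X_ c2))) (C_ 1))
    (put aDM (ix (X_ u4) (G_ aZ1 (X_ c2))) (C_ 1) ;;
     put aDM (ix (X_ u4) (G_ aZ2 (X_ c2))) (C_ 1)).

Definition p_forward :=
  for_ c2 (when (elong (X_ c2)) (p_fwinit ;; p_cut ;; p_fwends)).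

Notation aBA := 140 (only parsing). Notation aBq := 141 (only parsing).
Notation aBC := 142 (only parsing).

(** The three bits are saved before [p_mask] erases the arcs of the gadgets. *)
Definition p_bits :=
  for_ c2 (when (elong (X_ c2))
    (put aBA (X_ c2) (ein (G_ aUU (X_ c2)) (G_ aXX (X_ c2))) ;;
     put aBq (X_ c2) (ein (G_ aWW (X_ c2)) (X_ c2)) ;;
     put aBC (X_ c2) (enot (ein (G_ aXX (X_ c2)) (X_ c2))))).

Definition p_mask :=
  for_ c2 (for_ c3
    (when (enot (eand (eadj (X_ c2) (X_ c3))
             (eand (G_ aNRM (X_ c2)) (eand (G_ aALV (X_ c2)) (G_ aALV (X_ c3))))))
       (put aDM (ix (X_ c2) (X_ c3)) (C_ 0)))).

(* t1: current vertex, t2: the vertex before it; u1, u3: the bits a and c. *)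
Definition p_pick (a b c : bool) :=
  PIf (eand (eW false b c (X_ t2))
            (eeq (eW false b c (X_ t2) +' eloc true a) (eW a b c (X_ t1))))
    (put aDM (ix (X_ t1) (X_ t2)) (C_ 1) ;; setv u1 (C_ 0))
  (PIf (eand (eW true b c (X_ t2))
             (eeq (eW true b c (X_ t2) +' eloc false a) (eW a b c (X_ t1))))
    (put aDM (ix (X_ t2) (X_ t1)) (C_ 1) ;; setv u1 (C_ 1))
    (setv u1 (C_ 0) ;;
     setv u3 (enot (enot (elt (eW false b false (X_ t2)) (eW false b true (X_ t2))))))).

Definition p_picks :=
  PIf (X_ u1)
    (PIf (X_ u2) (PIf (X_ u3) (p_pick true true true) (p_pick true true false))
                 (PIf (X_ u3) (p_pick true false true) (p_pick true false false)))
    (PIf (X_ u2) (PIf (X_ u3) (p_pick false true true) (p_pick false true false))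
                 (PIf (X_ u3) (p_pick false false true) (p_pick false false false))).

Definition p_backstep :=
  when (elt (C_ 1) (G_ aPOS (X_ t1)))
    (setv t2 (G_ aPRV (X_ t1)) ;; p_local ;; p_picks ;; setv t1 (X_ t2)).

Definition p_bkinit :=
  setv t1 (G_ aXX (X_ c2)) ;; setv u1 (G_ aBA (X_ c2)) ;;
  setv u2 (G_ aBq (X_ c2)) ;; setv u3 (G_ aBC (X_ c2)) ;;
  when (X_ u1) (put aDM (ix (X_ t1) (G_ aUU (X_ c2))) (C_ 1)) ;;
  when (X_ u2) (put aDM (ix (X_ c2) (G_ aWW (X_ c2))) (C_ 1)).

Definition p_backtrack :=
  for_ c2 (when (elong (X_ c2)) (p_bkinit ;; for_ c3 p_backstep)).

(** Inverse of [p_charge]: codes and losses refer again to the vertices that were alive just before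
    [t1] was eliminated, as [leaf_in] requires. *)
Definition p_uncharge :=
  for_ c3 (when (eand (elt (X_ c3) (X_ aIT)) (G_ aMM (ix (X_ c3) (X_ t1))))
    (put aCODE (X_ c3) (G_ aCODE (X_ c3) +' G_ aPOW (X_ t1)) ;;
     put aLOSS (X_ c3) (G_ aLOSS (X_ c3) -' G_ aLAM (X_ t1)))).

Definition p_rowcode :=
  setv u5 (C_ 0) ;;
  for_ c3 (when (eand (elt (X_ c3) (X_ aNV)) (G_ aDM (ix (X_ t2) (X_ c3))))
    (setv u5 (X_ u5 +' G_ aPOW (X_ c3)))).

Definition p_lookup :=
  setv u3 (C_ 0) ;; setv u4 (C_ 0) ;;
  for_ c3 (when (eand (elt (X_ c3) (X_ aIT)) (eeq (G_ aOWN (X_ c3)) (X_ t2)))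
    (when (eeq (G_ aCODE (X_ c3)) (X_ u5)) (setv u3 (maxe (X_ u3) (eval_item (X_ c3)))) ;;
     when (eeq (G_ aCODE (X_ c3)) (X_ u5 +' G_ aPOW (X_ t1)))
       (setv u4 (maxe (X_ u4) (eval_item (X_ c3)))))).

Definition p_reattach :=
  when (enot (eeq (X_ t1) (X_ t2)))
    (PIf (elt (X_ u3) (X_ u4 -' G_ aLAM (X_ t1)))
       (put aDM (ix (X_ t2) (X_ t1)) (C_ 1))
       (when (G_ aLAM (X_ t1)) (put aDM (ix (X_ t1) (X_ t2)) (C_ 1)))).

Definition p_undo :=
  for_ c2 (when (elt (X_ c2) (X_ aNO))
    (setv t1 (G_ aORD (X_ aNO -' C_ 1 -' X_ c2)) ;; setv t2 (G_ aPAR (X_ t1)) ;;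
     p_uncharge ;; p_rowcode ;; p_lookup ;; p_reattach)).

(** ** The three algorithms *)

Definition p_kernel := p_copy ;; p_analysis ;; p_emit.
Definition p_fwd :=
  p_copy ;; p_analysis ;; p_read_dig (X_ aNV) aID ;; p_restrict ;; p_forward ;;
  p_write_dig aKEPT aNEW.
Definition p_bwd :=
  p_copy ;; p_analysis ;; p_read_dig (X_ aNK) aOLD ;; p_bits ;; p_mask ;;
  p_backtrack ;; p_undo ;; p_write_dig aALL aID.

(** The input does not state its length. A genuine [While] program finds it in linear time, and only
    then do the bounded loops have their bound. *)
Definition c_kernel := Seq c_skip (Seq (Put aN (C_ 0) (X_ aSP)) (compile p_kernel)).
Definition c_fwd :=
  Seq c_skip (Seq (Put aN (C_ 0) (X_ aSP))
    (Seq c_skip (Seq (Put aDP (C_ 0) (X_ aSP)) (compile p_fwd)))).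
Definition c_bwd :=
  Seq c_skip (Seq (Put aOFF (C_ 0) (X_ aSP))
    (Seq c_skip (Seq (Put aN (C_ 0) (X_ aSP -' X_ aOFF))
      (Seq (Put aDP (C_ 0) (X_ aSP)) (compile p_bwd))))).

(** * Correctness of the programs *)

Lemma wf_kernel : wf p_kernel && (depth p_kernel == 2) && (aN \notin writes p_kernel).
Proof. by vm_compute. Qed.
Lemma wf_fwd : wf p_fwd && (aN \notin writes p_fwd).
Proof. by vm_compute. Qed.
Lemma wf_bwd : wf p_bwd && (aN \notin writes p_bwd).
Proof. by vm_compute. Qed.

Lemma idx_inj N i j x y : x < N -> y < N ->
  (i * N + x == j * N + y) = (i == j) && (x == y).
Proof.
move=> xN yN; apply/eqP/andP => [E|[/eqP-> /eqP->]//].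
have N0 : 0 < N by lia.
have := congr1 (fun k => k %/ N) E; rewrite !divnMDl // !divn_small // !addn0 => Eij.
by move: E; rewrite Eij => /addnI->.
Qed.

(** * Slots of the input word and parsing *)

Section Analysis.
Variables (I : instance) (L : 'I_(nvert I) -> seq (seq 'I_(nvert I) * nat)).
Hypothesis HL : forall v, nonzero_list v (L v).
Notation n := (nvert I).
Notation V := 'I_n.
Notation A := (superstructure I).

Definition slot := (V * option (seq V * nat))%type.
(** Headers are slots as well. As items they have the value 0, which changes no score, and in the
    output pass they mark the place where the list of a vertex begins. *)
Definition vslots v : seq slot := (v, None) :: [seq (v, Some p) | p <- L v].
Definition slots : seq slot := flatten [seq vslots v | v <- enum V].
Definition slot_word (sl : slot) : seq nat :=
  if sl.2 is Some p then p.2 :: vlist_word p.1 else [:: size (L sl.1)].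
Definition item (sl : slot) : V * {set V} * nat :=
  if sl.2 is Some p then (sl.1, [set x in p.1], p.2) else (sl.1, set0, 0).
Definition its := [seq item sl | sl <- slots].

Definition word : seq nat :=
  [:: n; nat_of_bool (target I < 0)%R; absz (target I)] ++
  flatten [seq slot_word sl | sl <- slots].
Arguments word : simpl never.
Notation N := (size word).

Lemma word_encodes :
  word = [:: n; nat_of_bool (target I < 0)%R; absz (target I)]
         ++ flatten [seq nonzero_list_word (L v) | v <- enum V].
Proof.
congr (_ ++ _); rewrite /slots; elim: (enum V) => //= v s IH.
rewrite map_cat flatten_cat IH; congr (_ :: _); congr (_ ++ _).
by elim: (L v) => //= p l ->.
Qed.

Lemma its_score lam v Z : ascore its lam setT v Z = fscore v Z.
Proof.
have [ua us memL vals] := HL v.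
have E sl : ascore_item lam setT v Z (item sl) =
    if sl.2 is Some p then (if (sl.1 == v) && ([set x in p.1] == Z) then p.2 else 0) else 0.
  rewrite /ascore_item /item; case: (sl.2) => [p|] /=; last by case: ifP.
  by rewrite setIT (_ : _ :\: _ = set0) ?big_set0 ?subn0 // setDT.
rewrite /ascore /its big_map (eq_bigr _ (fun sl _ => E sl)) /slots.
rewrite big_flatten big_map big_enum /= (bigD1 v) //= [X in maxn _ X]big1 ?maxn0; last first.
  by move=> u uv; rewrite big_cons big_map /= max0n big1 // => p _; rewrite (negbTE uv).
rewrite big_cons big_map /= max0n eqxx /=.
have [ZL|ZL] := boolP (Z \in [seq [set x in p.1] | p <- L v]); last first.
  have := memL Z; rewrite (negbTE ZL) inE => /esym/negbT; rewrite negbK => /eqP->.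
  rewrite big1_seq // => p /andP[_ pL]; case: eqP => // E'.
  by case/negP: ZL; rewrite -E'; apply: map_f.
case/mapP: ZL us vals => p pL -> us /allP vals; rewrite (bigD1_seq p) //=; last exact: map_uniq us.
rewrite eqxx big1_seq ?maxn0; first by have /eqP := vals p pL.
move=> q /andP[qp qL]; case: eqP => // E'; case/eqP: qp.
elim: (L v) us pL qL => //= a l IH /andP[al ul]; rewrite !inE.
move=> /predU1P[Ep|pl] /predU1P[Eq|ql]; [by rewrite Ep Eq| | |exact: IH].
  by case/negP: al; apply/mapP; exists q; rewrite // -Ep E'.
by case/negP: al; apply/mapP; exists p; rewrite // -Eq E'.
Qed.

Lemma its_super i x : i \in its -> x \in i.1.2 -> A i.1.1 x.
Proof.
case/mapP=> sl slS ->; rewrite /item; case E: (sl.2) => [p|] /=; rewrite inE // => xp.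
have pL : p \in L sl.1.
  move: slS; rewrite /slots => /flattenP[t /mapP[v _ ->]].
  rewrite inE => /predU1P[E'|/mapP[q qL E']]; first by rewrite E' in E.
  by move: E; rewrite E' /= => -[<-].
rewrite /superstructure orbC; apply/orP; left; apply/bigcupP; exists [set x in p.1].
  by have [_ _ <- _] := HL sl.1; apply/mapP; exists p.
by rewrite inE.
Qed.

Definition has_par (a b : V) (i : V * {set V} * nat) := (i.1.1 == a) && (b \in i.1.2).

Lemma super_its a b : A a b =
  has (has_par a b) its || has (has_par b a) its.
Proof.
have H a' b' : (b' \in potential_parents a') = has (has_par a' b') its.
  apply/bigcupP/hasP => [[Z ZG bZ]|[i /mapP[sl slS ->]]].
    have [_ _ memL _] := HL a'; move: ZG; rewrite -memL => /mapP[p pL EZ].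
    exists (item (a', Some p)); last by rewrite /has_par /= eqxx -EZ.
    apply: map_f; apply/flattenP; exists (vslots a'); first by rewrite map_f ?mem_enum.
    by rewrite inE map_f ?orbT.
  rewrite /has_par /item; case E: (sl.2) => [p|] /=; rewrite ?inE ?andbF // => /andP[/eqP Ea bp].
  exists [set x in p.1]; last by rewrite inE.
  have [_ _ <- _] := HL a'; apply/mapP; exists p => //.
  move: slS; rewrite /slots => /flattenP[t /mapP[v _ ->]].
  rewrite inE => /predU1P[E'|/mapP[q qL E']]; first by rewrite E' in E.
  by move: E Ea; rewrite E' /= => -[<-] <-.
by rewrite /superstructure !H orbC.
Qed.

Lemma size_slots : n <= size slots.
Proof.
rewrite -[n]size_enum_ord -(size_map fst slots); apply: uniq_leq_size (enum_uniq _) _ => v _.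
apply/mapP; exists (v, None) => //; apply/flattenP; exists (vslots v).
  by rewrite map_f ?mem_enum.
by rewrite mem_head.
Qed.

Lemma size_word : size slots + 3 <= N.
Proof.
rewrite /word size_cat addnC /= leq_add2l; elim: slots => //= sl s IH.
by rewrite size_cat -add1n leq_add //; case: (sl) => o [p|].
Qed.

Lemma nN : n + 3 <= N.
Proof. have := size_slots; have := size_word; lia. Qed.

Lemma ordN (v : V) : v < N.
Proof. have := ltn_ord v; have := nN; lia. Qed.

Record init_ok (s : memory) : Prop := InitOk {
  in_IN : forall i, s aIN i = nth 0 word i;
  in_N : s aN 0 = N;
  in_0 : forall a i, 3 < a < 90 -> s a i = 0 }.

Lemma tables_ok s (s' := denote p_tables s) : s aN 0 = N ->
  forall i, i < N -> s' aBASE i = i * N /\ s' aPOW i = 2 ^ i.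
Proof.
rewrite /s' /p_tables !denE => HN.
set s1 := update _ _ _ _; have HN1 : s1 aN 0 = N by rewrite /s1 /update /=.
pose Inv k (s : memory) := s t0 0 = k * N /\ s t1 0 = 2 ^ k /\
  forall i, i < k -> s aBASE i = i * N /\ s aPOW i = 2 ^ i.
suff : Inv (s1 aN 0) (denote (for_ c0 (put aBASE (X_ c0) (X_ t0) ;; setv t0 (X_ t0 +' X_ aN) ;;
           put aPOW (X_ c0) (X_ t1) ;; setv t1 (X_ t1 +' X_ t1))) s1).
  by rewrite HN1 => -[_ []].
apply: for_ind => //; rewrite /Inv.
move=> k s2 kN _ Hc HN2 [H0 [H1 H]]; rewrite !denE /update /= Hc H0 H1 HN2 HN1.
split; first by rewrite mulSn addnC.
split; first by rewrite expnS mul2n addnn.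
move=> i; rewrite ltnS leq_eqVlt; case: eqP => [-> _|_] //=; exact: H.
Qed.

(** ** Parsing *)

Definition has_el (a b : V) (sl : slot) :=
  (sl.1 == a) && (if sl.2 is Some p then b \in p.1 else false).

Definition slot_code (sl : slot) :=
  if sl.2 is Some p then \sum_(x <- p.1) 2 ^ x else 0.

Record srow (s : memory) (i : nat) (sl : slot) : Prop := SRow {
  sr_hdr : s aHDR i = (if sl.2 is None then 1 else 0);
  sr_own : s aOWN i = sl.1;
  sr_val : s aVAL i = (if sl.2 is Some p then p.2 else 0);
  sr_mm : forall x : V, s aMM (i * N + x) = (if sl.2 is Some p then x \in p.1 else false);
  sr_code : s aCODE i = slot_code sl }.

Record rep (s : memory) (ps : seq slot) : Prop := Rep {
  rp_it : s aIT 0 = size ps;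
  rp_row : forall ps1 sl ps2, ps = ps1 ++ sl :: ps2 -> srow s (size ps1) sl;
  rp_fresh : forall i, size ps <= i ->
    [/\ s aHDR i = 0, s aVAL i = 0, s aCODE i = 0 & forall x : V, s aMM (i * N + x) = 0];
  rp_pp : forall a b : V, s aPP (a * N + b) = has (has_el a b) ps }.

(** The form of the slots still to be read, when [v] headers have been read and [r] entries of the
    current list are due. *)
Fixpoint ctl (v r : nat) (ss : seq slot) : Prop :=
  match ss with
  | [::] => True
  | (o, None) :: t => [/\ r = 0, o = v :> nat & ctl v.+1 (size (L o)) t]
  | (o, Some p) :: t => [/\ 0 < r, v = o.+1 & ctl v r.-1 t]
  end.

Lemma ctl_slots : ctl 0 0 slots.
Proof.
have H vs k : map val vs = iota k (size vs) -> ctl k 0 (flatten [seq vslots v | v <- vs]).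
  elim: vs k => //= v vs IH k [Ev Evs]; split=> //.
  rewrite -Ev in Evs *; move/IH: Evs; move: (flatten _) => rest Hr.
  suff H l : ctl v.+1 (size l) ([seq (v, Some p) | p <- l] ++ rest) by exact: H.
  by elim: l => //= p l ->.
by apply: H; rewrite val_enum_ord size_enum_ord.
Qed.


Definition wrest (ss : seq slot) := flatten [seq slot_word sl | sl <- ss].

(** The states of the parser: in front of a slot, between the value and the length of an entry, and
    among its elements. An entry without elements goes directly from the second state to the
    first. *)
Variant pst (s : memory) (rest : seq nat) : Prop :=
  | PstA ps ss of rep s ps & slots = ps ++ ss & rest = wrest ss & s t3 0 = 0 &
      s t4 0 = 0 & ctl (s t1 0) (s t2 0) ss
  | PstB ps o p ss of rep s (rcons ps (o, Some ([::], p.2))) &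
      slots = ps ++ (o, Some p) :: ss & rest = vlist_word p.1 ++ wrest ss &
      s t3 0 = 0 & s t4 0 = 1 & ctl (s t1 0) (s t2 0) ss & s t1 0 = o.+1
  | PstC ps o p l1 l2 ss of rep s (rcons ps (o, Some (l1, p))) &
      slots = ps ++ (o, Some (l1 ++ l2, p)) :: ss &
      rest = map (@nat_of_ord n) l2 ++ wrest ss & s t3 0 = size l2 & 0 < size l2 &
      s t4 0 = 0 & ctl (s t1 0) (s t2 0) ss & s t1 0 = o.+1.

Lemma rep_rcons s s' ps sl : rep s ps -> s' aIT 0 = (size ps).+1 ->
  srow s' (size ps) sl ->
  (forall i, i != size ps -> [/\ s' aHDR i = s aHDR i, s' aOWN i = s aOWN i, s' aVAL i = s aVAL i,
     s' aCODE i = s aCODE i & forall x : V, s' aMM (i * N + x) = s aMM (i * N + x)]) ->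
  (forall a b : V, s' aPP (a * N + b) = (s aPP (a * N + b) != 0) || has_el a b sl) ->
  rep s' (rcons ps sl).
Proof.
move=> [R1 R2 R3 R4] Hit Hrow Hne Hpp; split.
- by rewrite size_rcons.
- move=> ps1 sl' ps2; case/lastP: ps2 => [|ps2 sl2].
    by rewrite cats1 => /rcons_inj[<- <-].
  rewrite -rcons_cons -rcons_cat => /rcons_inj[E _]; have [a b c d e] := R2 _ _ _ E.
  have ne : size ps1 != size ps by rewrite E size_cat /=; lia.
  by have [h1 h2 h3 h4 h5] := Hne _ ne; split; rewrite ?h1 ?h2 ?h3 ?h4 // => x; rewrite h5.
- move=> i; rewrite size_rcons => im; have ne : i != size ps by lia.
  have [h1 h2 h3 h4 h5] := Hne _ ne; have [|a b c e] := R3 i; first by lia.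
  by split; rewrite ?h1 ?h3 ?h4 // => x; rewrite h5.
- by move=> a b; rewrite Hpp R4 has_rcons orbC; case: has_el; case: has.
Qed.

Lemma rep_last s s' ps sl sl' : rep s (rcons ps sl) -> s' aIT 0 = s aIT 0 ->
  srow s' (size ps) sl' ->
  (forall i, i != size ps -> [/\ s' aHDR i = s aHDR i, s' aOWN i = s aOWN i, s' aVAL i = s aVAL i,
     s' aCODE i = s aCODE i & forall x : V, s' aMM (i * N + x) = s aMM (i * N + x)]) ->
  (forall a b : V, s' aPP (a * N + b) = (s aPP (a * N + b) != 0) || has_el a b sl') ->
  (forall a b : V, has_el a b sl -> has_el a b sl') ->
  rep s' (rcons ps sl').
Proof.
move=> [R1 R2 R3 R4] Hit Hrow Hne Hpp Hi; split.
- by rewrite Hit R1 !size_rcons.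
- move=> ps1 sl1 ps2; case/lastP: ps2 => [|ps2 sl2].
    by rewrite cats1 => /rcons_inj[<- <-].
  rewrite -rcons_cons -rcons_cat => /rcons_inj[E _].
  have [|a b c d e] := R2 ps1 sl1 (rcons ps2 sl); first by rewrite E -rcons_cons -rcons_cat.
  have ne : size ps1 != size ps by rewrite E size_cat /=; lia.
  by have [h1 h2 h3 h4 h5] := Hne _ ne; split; rewrite ?h1 ?h2 ?h3 ?h4 // => x; rewrite h5.
- move=> i; rewrite size_rcons => im; have ne : i != size ps by lia.
  have [h1 h2 h3 h4 h5] := Hne _ ne; have [|a b c e] := R3 i; first by rewrite size_rcons.
  by split; rewrite ?h1 ?h3 ?h4 // => x; rewrite h5.
- move=> a b; rewrite Hpp R4 !has_rcons; have := Hi a b.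
  by case: (has_el a b sl); case: (has_el a b sl') => //=; [move=> /(_ isT)|rewrite orbT|case: has].
Qed.

Lemma rep_eq s s' ps :
  (forall a j, a \in [:: 5; 6; 7; 8; 9; 12; 15] -> s' a j = s a j) ->
  rep s ps -> rep s' ps.
Proof.
move=> E [R1 R2 R3 R4]; split; rewrite ?E //.
- by move=> ps1 sl ps2 /R2[a b c e f]; split; rewrite ?E // => x; rewrite E.
- by move=> i /R3[a b c e]; split; rewrite ?E // => x; rewrite E.
- by move=> a b; rewrite E.
Qed.

Ltac arrs := let H := fresh in
  move=> ? ?; rewrite !inE => H; repeat (case/orP: H => [/eqP->|H] //);
  by move/eqP: H => ->.

Lemma pst_eq s s' rest :
  (forall a j, a \in [:: 5; 6; 7; 8; 9; 12; 15; 61; 62; 63; 64] -> s' a j = s a j) ->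
  pst s rest -> pst s' rest.
Proof.
move=> E; have R ps : rep s ps -> rep s' ps.
  by apply: rep_eq => a j; rewrite !inE => H; apply: E; rewrite !inE; move: H; do !(case/orP=> [->|]; rewrite ?orbT //); move=> ->; rewrite ?orbT.
case=> [ps ss /R*|ps o p ss /R*|ps o p l1 l2 ss /R*]; [apply: PstA|apply: PstB|apply: PstC];
  rewrite ?E //; eassumption.
Qed.

Lemma parse_step s x rest :
  (forall i, i < N -> s aBASE i = i * N /\ s aPOW i = 2 ^ i) ->
  s aIN (s t0 0) = x -> pst s (x :: rest) -> pst (denote p_parse_step s) rest.
Proof.
move=> HB Hx; rewrite /p_parse_step; case=> [ps ss R Es Er H3 H4 Hc|ps o p ss R Es Er H3 H4 Hc H1|].
- case: ss Es Er Hc => [//|[o [p|]] ss] Es /= [Ex Er] [Hr Hv Hc].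
    rewrite !denE !trE /update /= H3 H4 /= -lt0n Hr Hx Ex Hv /=.
    apply: (PstB (ps := ps) (o := o) (p := p) (ss := ss)); rewrite ?H3 ?eqxx //=.
    + have [R1 R2 R3 R4] := R; apply: (rep_rcons R) => //=.
      - by rewrite R1 addn1.
      - have [h1 h2 h3 h4] := R3 _ (leqnn _); split=> //=; rewrite ?R1 ?eqxx ?subn1 //.
        by rewrite h3 /slot_code /= big_nil.
      - by move=> i ne; rewrite R1 (negbTE ne).
      - by move=> a b; rewrite R4 /has_el /= andbF orbF; case: has.
    + by rewrite subn1.
  rewrite !denE !trE /update /= H3 H4 Hr /= Hx.
  apply: (PstA (ps := rcons ps (o, None)) (ss := ss)) => //=.
  + have [R1 R2 R3 R4] := R; apply: (rep_rcons R) => //=.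
    - by rewrite R1 addn1.
    - by have [h1 h2 h3 h4] := R3 _ (leqnn _); split=> //=; rewrite ?R1 ?eqxx.
    - by move=> i ne; rewrite R1 (negbTE ne).
    - by move=> a b; rewrite R4 /has_el /= andbF orbF; case: has.
  + by rewrite cat_rcons.
  + by rewrite addn1 Ex.
- move: Er => /= [Ex Er]; rewrite !denE !trE /update /= H3 H4 /= Hx.
  case: p R Es Ex Er => [[|y l] v] /= R Es Ex Er.
    apply: (PstA (ps := rcons ps (o, Some ([::], v))) (ss := ss)) => //=; last by rewrite cat_rcons.
    by apply: rep_eq R; arrs.
  apply: (PstC (ps := ps) (o := o) (p := v) (l1 := [::]) (l2 := y :: l) (ss := ss)) => //=.
  by apply: rep_eq R; arrs.
- move=> ps o p l1 l2 ss R Es Er H3 l0 H4 Hc H1.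
  case: l2 Es Er H3 l0 => [//|y l2] Es /= [Ex Er] H3 _.
  rewrite !denE !trE /update /= H3 /= Hx Ex H1 subn1 /=.
  have oN := ordN o; have yN := ordN y.
  have sN : size ps < N.
    have zs : size ps < size slots by rewrite Es size_cat /= addnS ltnS leq_addr.
    have := size_word; clear -zs; lia.
  have [R1 R2 R3 R4] := R; have It : s aIT 0 - 1 = size ps by rewrite R1 size_rcons subn1.
  have [B1 _] := HB _ sN; have [B2 _] := HB _ oN; have [_ B3] := HB _ yN.
  have R' : rep (fun b j => if (b == t3) && (j == 0) then size l2 else
     if (b == aCODE) && (j == size ps) then s aCODE (size ps) + 2 ^ y else
     if (b == aPP) && (j == o * N + y) then 1 else
     if (b == aMM) && (j == size ps * N + y) then 1 else s b j)
     (rcons ps (o, Some (rcons l1 y, p))).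
    have [h1 h2 h3 h4 h5] := R2 ps (o, Some (l1, p)) [::] (esym (cats1 _ _)).
    apply: (rep_last R) => //=.
    + split=> //=; rewrite ?eqxx ?h5 //=.
        move=> z; rewrite idx_inj ?ordN // eqxx /= mem_rcons inE h4 /=.
        by rewrite -(inj_eq val_inj); case: eqP.
      (* The code grows by one power of two per element read; it is the code of a set because the
         lists are duplicate-free. *)
      by rewrite /slot_code /= -cats1 big_cat big_seq1.
    + move=> i ne; rewrite (negbTE ne); split=> // z.
      by rewrite idx_inj ?ordN // (negbTE ne).
    + move=> a b; rewrite idx_inj ?ordN // R4 has_rcons /has_el /= mem_rcons inE.
      rewrite -(inj_eq val_inj o a) -(inj_eq val_inj b y) eq_sym /=.
      by case: (nat_of_ord o == a); case: (nat_of_ord b == y); case: (b \in l1); case: has.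
    + by move=> a b; rewrite /has_el /= mem_rcons inE => /andP[-> ->]; rewrite orbT.
  rewrite It subn1 /= B1 B2 B3.
  case: l2 Er H3 Es R' => [|z l2] Er H3 Es R'.
    apply: (PstA (ps := rcons ps (o, Some (rcons l1 y, p))) (ss := ss)) => //=.
    + by apply: rep_eq R'; arrs.
    + by rewrite cat_rcons Es cats1.
  apply: (PstC (ps := ps) (o := o) (p := p) (l1 := rcons l1 y) (l2 := z :: l2) (ss := ss)) => //=.
  + by apply: rep_eq R'; arrs.
  + by rewrite cat_rcons.
Qed.

Notation slot_at i := (tnth (in_tuple slots) i).
Notation item_at i := (item (slot_at i)).

Definition scode (Z : {set V}) := \sum_(x in Z) 2 ^ x.

(** The part of the memory that is final after parsing. Every later program leaves [base_arrays]
    alone, so it is carried along by frame lemmas. *)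
Record base (s : memory) : Prop := Base {
  b_N : s aN 0 = N;
  b_IN : forall i, s aIN i = nth 0 word i;
  b_NV : s aNV 0 = n;
  b_IT : s aIT 0 = size slots;
  b_BASE : forall i, i < N -> s aBASE i = i * N;
  b_POW : forall i, i < N -> s aPOW i = 2 ^ i;
  b_HDR : forall i, (s aHDR (nat_of_ord i) != 0) = ((slot_at i).2 == None);
  b_OWN : forall i, s aOWN (nat_of_ord i) = (slot_at i).1;
  b_VAL : forall i, s aVAL (nat_of_ord i) = (item_at i).2;
  b_MM : forall (i : 'I_(size slots)) (x : V), s aMM (i * N + x) = (x \in (item_at i).1.2);
  b_PP : forall a b : V, (s aPP (a * N + b) + s aPP (b * N + a) != 0) = A a b }.

Definition base_arrays := [:: 2; 3; 4; 5; 6; 7; 8; 9; 10; 11; 12].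

Lemma base_eq s s' : (forall a j, a \in base_arrays -> s' a j = s a j) -> base s -> base s'.
Proof.
move=> E [b1 b2 b3 b4 b5 b6 b7 b8 b9 b10 b11].
by split; intros; rewrite !E //; auto.
Qed.

Lemma base_frame p s : all (fun a => a \notin writes p) base_arrays -> base s -> base (denote p s).
Proof. by move=> /allP H; apply: base_eq => a j /H; apply: frame. Qed.

Lemma slot_lt (i : 'I_(size slots)) : i < N.
Proof. have := ltn_ord i; have := size_word; lia. Qed.

Definition lamm (s : memory) (v : V) : nat := s aLAM v.
Definition parm (s : memory) (v : V) : V := insubd v (s aPAR v).

(* r lists the dead vertices, last one first. *)
Record leafst (s : memory) (r : seq V) : Prop := LeafSt {
  l_base : base s;
  l_alv : forall v : V, s aALV v = (v \in alive r);
  l_alv0 : forall v, n <= v -> s aALV v = 0;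
  l_deg : forall v : V, s aDEG v = #|nbrs A (alive r) v|;
  l_code : forall i, s aCODE (nat_of_ord i) = scode ((item_at i).1.2 :&: alive r);
  l_loss : forall i, s aLOSS (nat_of_ord i) = \sum_(x in (item_at i).1.2 :\: alive r) lamm s x;
  l_par : forall v, v \in r -> s aPAR v < n;
  l_no : s aNO 0 = size r;
  l_ord : forall j, j < size r -> s aORD j = nth 0 (map (@nat_of_ord n) (rev r)) j;
  l_uniq : uniq r;
  l_elim : elim_seq its A (lamm s) (parm s) r;
  l_subs : s aSUBS 0 = elim_gain its (lamm s) (parm s) r }.

Lemma slot_split (i : 'I_(size slots)) :
  slots = take i slots ++ slot_at i :: drop i.+1 slots.
Proof. by rewrite (tnth_nth (slot_at i)) /= -drop_nth // cat_take_drop. Qed.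

Lemma slot_uniq i p : (slot_at i).2 = Some p -> uniq p.1.
Proof.
move=> E; have := mem_tnth i (in_tuple slots); rewrite /= => /flattenP[t /mapP[v _ ->]].
have [/allP ua _ _ _] := HL v.
rewrite inE => /predU1P[E'|/mapP[q qL E']]; first by rewrite E' in E.
by move: E; rewrite E' => -[<-]; apply: ua.
Qed.

Lemma parse_ok s (s' := denote p_parse s) : s aN 0 = N ->
  (forall i, s aIN i = nth 0 word i) ->
  (forall a i, 3 < a < 90 -> a \notin [:: t0; t1; c0; aBASE; aPOW] -> s a i = 0) ->
  (forall i, i < N -> s aBASE i = i * N /\ s aPOW i = 2 ^ i) ->
  rep s' slots /\ s' aNV 0 = n.
Proof.
move=> HN HI H0 HB; rewrite /s' /p_parse !denE; set s1 := update _ _ _ _.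
have HN1 : s1 aN 0 = N by rewrite /s1 /update /=.
(* Reading starts behind the three words of the head, so the last three rounds of the loop are idle;
   this is the role of [minn]. *)
pose Inv k (s2 : memory) := exists pre rest,
  [/\ word = pre ++ rest, s2 t0 0 = size pre, size pre = minn N (3 + k) & pst s2 rest].
pose lp := for_ c0 (when (elt (X_ t0) (X_ aN)) p_parse_step).
split; last by rewrite frame // /s1 /update /= HI /word.
have N3 : 3 <= N by have := nN; clear; lia.
have z3 : size (take 3 word) = 3 by rewrite size_takel.
have : Inv (s1 aN 0) (denote lp s1).
  apply: for_ind => //.
    exists (take 3 word), (drop 3 word); split; rewrite ?cat_take_drop ?z3 //.
    apply: (@PstA _ _ [::] slots); rewrite /s1 /update /=; last 3 first.
    - by rewrite (H0 t3).
    - by rewrite (H0 t4).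
    - by rewrite (H0 t2) //; apply: ctl_slots.
    - split=> /=; [by rewrite (H0 aIT)|by move=> ps1 sl ps2; case: ps1| |].
        by move=> i _; split=> [| | |x]; rewrite ?(H0 aHDR) ?(H0 aVAL) ?(H0 aCODE) ?(H0 aMM).
      by move=> a b; rewrite (H0 aPP).
    - by [].
    - by rewrite drop0.
  move=> k s2 kN Hf Hc HN2 [pre [rest [Ew Ht Hs Hp]]].
  rewrite denote_if denote_skip tr_lt /= Ht HN2 HN1.
  case: ltnP => [lt|ge]; last first.
    exists pre, rest; split=> //.
      by rewrite Hs; move: ge; rewrite Hs; clear; lia.
    by apply: pst_eq Hp; arrs.
  case: rest Ew Hp => [|x rest] Ew Hp.
    by move: lt; rewrite Ew cats0 ltnn.
  exists (rcons pre x), rest; split.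
  - by rewrite cat_rcons.
  - have <- : s2 t0 0 + 1 = size (rcons pre x) by rewrite Ht size_rcons addn1.
    rewrite /p_parse_step [LHS]update_other // !denote_seq denote_if.
    by case: ifP => _; [|rewrite denote_if; case: ifP => _; [|rewrite denote_if; case: ifP => _]];
      rewrite !denE /update /=.
  - by rewrite size_rcons Hs; move: lt; rewrite Hs; clear; lia.
  - have HB2 i : i < N -> s2 aBASE i = i * N /\ s2 aPOW i = 2 ^ i.
      by move=> iN; rewrite !Hf // /s1 /update /=; apply: HB.
    have Hx : s2 aIN (s2 t0 0) = x.
      by rewrite Hf // /s1 /update /= HI Ht Ew nth_cat ltnn subnn.
    by apply: pst_eq (parse_step HB2 Hx Hp); arrs.
rewrite HN1 => -[pre [rest [Ew Ht Hs Hp]]].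
have {Ew} Er : rest = [::].
  have := congr1 size Ew; rewrite size_cat Hs; case: rest {Ew Hp} => //= x rest.
  by move: N3; clear; lia.
rewrite {}Er in Hp; case: Hp => [ps ss R Es Er _ _ _|ps o p ss _ _ //|ps o p l1 l2 ss _ _].
- case: ss Es Er => [|sl ss] Es Er; first by rewrite Es cats0.
  by move: Er; rewrite /wrest /=; case: (sl) => ? [p|].
- by case: l2.
Qed.

Lemma base_loop s s2 (W : seq nat) : base s -> (forall a j, a \notin W -> s2 a j = s a j) ->
  all (fun a => a \notin W) base_arrays -> base s2.
Proof. by move=> B Hf /allP H; apply: base_eq B => a j /H; apply: Hf. Qed.

Lemma eval_ix s e1 e2 : base s -> eval s e1 < N ->
  eval s (ix e1 e2) = eval s e1 * N + eval s e2.
Proof. by move=> B H; rewrite /ix /= (b_BASE B). Qed.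

Lemma tr_eadj s e1 e2 (a b : V) : base s -> eval s e1 = a -> eval s e2 = b ->
  tr s (eadj e1 e2) = A a b.
Proof.
move=> B E1 E2; rewrite /tr; have -> : eval s (eadj e1 e2) =
    s aPP (eval s (ix e1 e2)) + s aPP (eval s (ix e2 e1)) by [].
by rewrite !eval_ix ?E1 ?E2 ?ordN // (b_PP B).
Qed.

Section Loops.
Variables (Inv : nat -> memory -> Prop) (c : nat) (e : expr) (p : prog) (s : memory).
Hypotheses (B : base s) (wfp : wf (for_ c p)).
Hypothesis bp : all (fun a => a \notin c :: writes p) base_arrays.
Hypothesis ext : forall j s1 x, Inv j s1 -> Inv j (update s1 c 0 x).
Hypothesis I0 : Inv 0 s.

(** All loops run up to N, and the guard makes the rounds from [m] on idle. The invariant is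
    therefore followed at the index [minn k m]. *)
Lemma loop_ind m bnd :
  (forall s1, base s1 -> s1 bnd 0 = m) -> bnd != c -> m <= N ->
  (forall k s1, k < m -> base s1 -> (forall a j : nat, a \notin c :: writes p -> s1 a j = s a j) ->
     s1 c 0 = k -> Inv k s1 -> Inv k.+1 (if tr s1 e then denote p s1 else s1)) ->
  Inv m (denote (for_ c (when (eand (elt (X_ c) (X_ bnd)) e) p)) s).
Proof.
move=> Hb bc mN IS.
suff : (fun k s1 => Inv (minn k m) s1) (s aN 0)
    (denote (for_ c (when (eand (elt (X_ c) (X_ bnd)) e) p)) s).
  by rewrite /= (b_N B) (minn_idPr mN).
apply: (@for_ind (fun k s1 => Inv (minn k m) s1)).
- by move: wfp; rewrite /= cats0 andbT.
- by rewrite min0n; apply: ext.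
move=> k s1 kN; rewrite /= cats0 => Hf Hc HN IH; apply: ext.
have B1 := base_loop B Hf bp.
rewrite !denE !trE /= Hc (Hb _ B1).
have [km|km] /= := ltnP k m; last first.
  by rewrite (minn_idPr _) ?(leq_trans km) //; move: IH; rewrite (minn_idPr km).
by rewrite (minn_idPl km); apply: IS => //; move: IH; rewrite (minn_idPl (ltnW km)).
Qed.

Lemma forV_ind :
  (forall (v : V) s1, base s1 -> (forall a j : nat, a \notin c :: writes p -> s1 a j = s a j) ->
     s1 c 0 = v -> Inv v s1 -> Inv v.+1 (if tr s1 e then denote p s1 else s1)) ->
  aNV != c -> Inv n (denote (for_ c (when (eand (elt (X_ c) (X_ aNV)) e) p)) s).
Proof.
move=> IS cN; apply: loop_ind => //; first by move=> s1 /b_NV.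
  by have := nN; clear; lia.
by move=> k s1 kn B1 Hf Hc IH; apply: (IS (Ordinal kn)).
Qed.

Lemma forI_ind :
  (forall (i : 'I_(size slots)) s1, base s1 ->
     (forall a j : nat, a \notin c :: writes p -> s1 a j = s a j) ->
     s1 c 0 = i -> Inv i s1 -> Inv i.+1 (if tr s1 e then denote p s1 else s1)) ->
  aIT != c -> Inv (size slots) (denote (for_ c (when (eand (elt (X_ c) (X_ aIT)) e) p)) s).
Proof.
move=> IS cN; apply: loop_ind => //; first by move=> s1 /b_IT.
  by have := size_word; clear; lia.
by move=> k s1 kn B1 Hf Hc IH; apply: (IS (Ordinal kn)).
Qed.

End Loops.

Lemma card_ltS (P : pred V) (v : V) :
  #|[set b : V | P b & b < v.+1]| = #|[set b : V | P b & b < v]| + P v.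
Proof.
rewrite (cardsD1 v) !inE ltnSn andbT addnC; congr (_ + _).
apply: eq_card => b; rewrite !inE -(inj_eq val_inj) /=.
by case: (P b) => /=; rewrite ?andbF //; clear; lia.
Qed.

Lemma card_lt0 (P : pred V) : #|[set b : V | P b & b < 0]| = 0.
Proof. by apply/eqP; rewrite cards_eq0; apply/eqP/setP=> b; rewrite !inE andbF. Qed.

Lemma card_ltn (P : pred V) : #|[set b : V | P b & b < n]| = #|[set b | P b]|.
Proof. by apply: eq_card => b; rewrite !inE ltn_ord andbT. Qed.

Lemma degrow_ok s (v : V) : base s -> s c0 0 = v -> s aDEG v = 0 ->
  forall j, denote p_degrow s aDEG j = if j == v then #|nbrs A setT v| else s aDEG j.
Proof.
move=> B Hv H0; rewrite /p_degrow.
pose Inv k (s2 : memory) := forall j, s2 aDEG j =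
  if j == v then #|[set b : V | A v b & b < k]| else s aDEG j.
have : Inv n (denote p_degrow s).
  apply: (forV_ind (Inv := Inv)) => //.
    by move=> j; rewrite card_lt0; case: eqP => // ->.
  move=> b s1 B1 Hf Hc IH; have Hv1 : s1 c0 0 = v by rewrite Hf.
  rewrite (tr_eadj (a := v) (b := b)) // => j; rewrite card_ltS.
  case: (A v b) => /=; last by rewrite addn0; apply: IH.
  rewrite denE /update /= Hv1; case: (eqVneq j (nat_of_ord v)) => [_|nj].
    by rewrite (IH v) eqxx.
  by rewrite (IH j) (negbTE nj).
by move=> H j; rewrite H card_ltn; case: eqP => // _; apply: eq_card => b; rewrite !inE.
Qed.

Lemma start_ok s (s' := denote (p_tables ;; p_parse ;; p_deg) s) : init_ok s ->
  [/\ leafst s' [::], forall a i, 21 < a < 55 -> s' a i = 0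
    & forall v : V, s' aID v = v /\ s' aALL v = 1].
Proof.
move=> [HI HN H0]; rewrite /s' !denote_seq; set s1 := denote p_tables s.
have HN1 : s1 aN 0 = N by rewrite /s1 frame.
have HI1 i : s1 aIN i = nth 0 word i by rewrite /s1 frame.
have HZ1 a i : 3 < a < 90 -> a \notin [:: t0; t1; c0; aBASE; aPOW] -> s1 a i = 0.
  move=> ar an; rewrite /s1 frame ?H0 //; move: an; rewrite /p_tables /=.
  by rewrite !inE !negb_or => /and5P[-> -> -> -> ->].
have HB1 i : i < N -> s1 aBASE i = i * N /\ s1 aPOW i = 2 ^ i by apply: tables_ok.
have [R HNV] := parse_ok HN1 HI1 HZ1 HB1; set s2 := denote p_parse s1 in R HNV *.
have HZ2 a i : 3 < a < 90 -> a \notin writes p_tables ++ writes p_parse -> s2 a i = 0.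
  move=> ar; rewrite mem_cat negb_or => /andP[an1 an2].
  by rewrite /s2 frame // /s1 frame // H0.
set s3 := denote p_deg s2.
have row i : srow s2 (nat_of_ord i) (slot_at i).
  have := rp_row R (slot_split i); rewrite size_takel //; exact: ltnW.
have B2 : base s2.
  split=> //.
  - by rewrite /s2 frame.
  - by move=> i; rewrite /s2 frame.
  - by rewrite (rp_it R).
  - by move=> i iN; rewrite /s2 frame //; case: (HB1 i iN).
  - by move=> i iN; rewrite /s2 frame //; case: (HB1 i iN).
  - by move=> i; rewrite (sr_hdr (row i)); case: (slot_at i).2.
  - by move=> i; rewrite (sr_own (row i)).
  - by move=> i; rewrite (sr_val (row i)) /item; case: (slot_at i).2.
  - by move=> i x; rewrite (sr_mm (row i)) /item; case: (slot_at i).2 => [p|] /=; rewrite inE.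
  - move=> a b; rewrite !(rp_pp R) super_its /its !has_map.
    have HE a' b' : has (has_el a' b') slots = has (preim item (has_par a' b')) slots.
      by apply: eq_has => -[o [p|]]; rewrite /has_el /has_par /= inE.
    by rewrite -!HE; case: has; case: has.
pose Inv k (s4 : memory) :=
  (forall v : V, if v < k then [/\ s4 aALV v = 1, s4 aALL v = 1, s4 aID v = v & s4 aDEG v = #|nbrs A setT v|]
                 else s4 aDEG v = 0) /\ (forall v, n <= v -> s4 aALV v = 0).
have [H3 H3'] : Inv n s3.
  rewrite /s3 /p_deg; apply: (forV_ind (Inv := Inv)) => //.
    by split=> [v|v _]; rewrite ?ltn0 HZ2.
  move=> v s4 B4 Hf Hc [IH IH0]; rewrite /tr /= !denE /= Hc; set s5 := update _ _ _ _.
  have B5 : base s5.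
    by apply: (base_loop (W := [:: aALV; aALL; aID]) B4) => // a j; rewrite !inE !negb_or /s5 => /and3P[? ? ?]; rewrite !update_other.
  have Hc5 : s5 c0 0 = v by rewrite /s5 /update /=.
  have D5 : s5 aDEG v = 0 by rewrite /s5 /update /=; have := IH v; rewrite ltnn.
  have Hd := degrow_ok B5 Hc5 D5.
  have Ho a j : a \in [:: aALV; aALL; aID] -> denote p_degrow s5 a j = s5 a j.
    by rewrite !inE => Ha; apply: frame; rewrite !inE; move: Ha; clear; lia.
  split=> [x|x xn]; last first.
    rewrite Ho // /s5 /update /= ifF; first exact: IH0.
    by apply/eqP => E; move: xn; rewrite E leqNgt ltn_ord.
  rewrite ltnS leq_eqVlt Hd !Ho // /s5 /update /= Hc.
  have := IH x; have [Ex _|nx] := eqVneq (nat_of_ord x) v => /=; last by case: ifP.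
  have {}Ex : x = v by apply: val_inj.
  by subst x; split.
have Z3 a i : 16 < a < 55 -> s3 a i = 0.
  move=> ar; rewrite /s3 frame ?HZ2 //.
  - by move: ar; clear; lia.
  - by rewrite /p_tables /p_parse /p_parse_step /= !inE; move: ar; clear; lia.
  - by rewrite /p_deg /p_degrow /= !inE; move: ar; clear; lia.
have E0 : alive [::] = setT :> {set V} by apply/setP=> x; rewrite !inE.
split; last 2 first.
- by move=> a i ar; apply: Z3; move: ar; clear; lia.
- by move=> v; have := H3 v; rewrite ltn_ord => -[].
split=> //; rewrite ?E0.
- by apply: base_frame B2.
- by move=> v; have := H3 v; rewrite ltn_ord inE => -[].
- by move=> v; have := H3 v; rewrite ltn_ord => -[].
- move=> i; rewrite /s3 frame // (sr_code (row i)) setIT /item /slot_code.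
  case E: (slot_at i).2 => [p|] /=; last by rewrite /scode big_set0.
  by rewrite /scode big_uniq ?(slot_uniq E) //=; apply: eq_bigl => x; rewrite inE.
- move=> i; rewrite setDT big_set0 /s3 frame // HZ2 //.
- by rewrite Z3.
- by rewrite Z3.
Qed.

End Analysis.

(** * Correctness of the elimination of leaves *)

Section LeafLoop.
Variables (I : instance) (L : 'I_(nvert I) -> seq (seq 'I_(nvert I) * nat)).
Hypothesis HL : forall v, nonzero_list v (L v).
Notation n := (nvert I).
Notation V := 'I_n.
Notation A := (superstructure I).
Notation slots := (slots L).
Notation its := (its L).
Notation word := (word L).
Notation N := (size word).
Notation base := (base L).
Notation leafst := (leafst L).
Notation slot_at i := (tnth (in_tuple slots) i).
Notation item_at i := (item (slot_at i)).

Lemma find_ok s r : leafst s r ->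
  if denote p_find s t0 0 is v.+1 then
    exists w : V, [/\ w = v :> nat, w \in alive r & #|nbrs A (alive r) w| < 2]
  else forall w : V, w \in alive r -> 1 < #|nbrs A (alive r) w|.
Proof.
move=> H; have B := l_base H; rewrite /p_find denote_seq; set s0 := denote (setv _ _) s.
have B0 : base s0 by apply: base_frame B.
have E0 : s0 t0 0 = 0 by [].
pose Inv k (s1 : memory) := if s1 t0 0 is v.+1 then
    exists w : V, [/\ w = v :> nat, w \in alive r & #|nbrs A (alive r) w| < 2]
  else forall w : V, w < k -> w \in alive r -> 1 < #|nbrs A (alive r) w|.
have : Inv n (denote (for_ c1 (when (eand (elt (X_ c1) (X_ aNV))
             (eand (G_ aALV (X_ c1)) (elt (G_ aDEG (X_ c1)) (C_ 2))))
    (setv t0 (X_ c1 +' C_ 1)))) s0).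
  apply: (forV_ind (Inv := Inv) B0) => //.
  move=> v s1 B1 Hf Hc IH; rewrite !trE /= Hc !Hf // {1 2}/s0 !denE /update /= (l_alv H) (l_deg H).
  have [vr|vr] := boolP (v \in alive r) => /=.
    case: ltnP => dv; first by rewrite /Inv /update /= Hc addn1; exists v.
    move: IH; rewrite /Inv; case: (s1 t0 0) => [|//] IH w; rewrite ltnS leq_eqVlt.
    by case/orP=> [/eqP/val_inj->|/IH].
  move: IH; rewrite /Inv; case: (s1 t0 0) => [|//] IH w; rewrite ltnS leq_eqVlt.
  by case/orP=> [/eqP/val_inj->|/IH] //; rewrite (negbTE vr).
by rewrite /Inv; case: (denote _ _ t0 0) => // IH w; apply: IH.
Qed.

Lemma attach_ok s r (v : V) : leafst s r -> s t1 0 = v -> v \in alive r ->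
  #|nbrs A (alive r) v| < 2 ->
  exists u : V, [/\ denote p_attach s t2 0 = u, u \in alive r
    & forall x, x \in alive r -> A v x -> x = u].
Proof.
move=> H Hv vr dv; have B := l_base H; rewrite /p_attach denote_seq.
set s0 := denote (setv _ _) s.
have B0 : base s0 by apply: base_frame B.
pose Inv k (s1 : memory) := exists u : V, [/\ s1 t2 0 = u, u \in alive r
    & u = v /\ (forall x : V, x < k -> x \in alive r -> ~~ A v x) \/ A v u].
have : Inv n (denote (for_ c1 (when (eand (elt (X_ c1) (X_ aNV))
             (eand (G_ aALV (X_ c1)) (eadj (X_ t1) (X_ c1))))
    (setv t2 (X_ c1)))) s0).
  apply: (forV_ind (Inv := Inv) B0) => //.
    by exists v; split=> //; left.
  move=> w s1 B1 Hf Hc [u [Eu ur IH]]; have Hv1 : s1 t1 0 = v by rewrite Hf // /s0 denE /update /=.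
  rewrite tr_and (tr_eadj (a := v) (b := w) B1) // trE /= Hc Hf // /s0 denE /update /= (l_alv H).
  have [wr|wr] := boolP (w \in alive r) => /=; last first.
    exists u; split=> //; case: IH => [[-> IH]|]; last by right.
    left; split=> // x; rewrite ltnS leq_eqVlt; case/orP=> [/eqP/val_inj->|/IH] //.
    by rewrite (negbTE wr).
  have [vw|vw] := boolP (A v w).
    by exists w; rewrite denE /update /= Hc; split=> //; right.
  exists u; split=> //; case: IH => [[-> IH]|]; last by right.
  by left; split=> // x; rewrite ltnS leq_eqVlt; case/orP=> [/eqP/val_inj->|/IH].
case=> u [Eu ur IH]; exists u; split=> // x xr vx; case: IH => [[_ IH]|vu].
  by have := IH x (ltn_ord x) xr; rewrite vx.
apply/eqP; apply: contraTT dv => xu; rewrite -leqNgt; apply/card_gt1P.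
by exists x, u; rewrite !in_nbrs xr ur vx vu.
Qed.

Lemma gain_ok s r (v u : V) : leafst s r -> s t1 0 = v -> s t2 0 = u ->
  v \in alive r -> u \in alive r -> (forall x, x \in alive r -> A v x -> x = u) ->
  denote p_gain s t3 0 = ascore its (lamm s) (alive r) v set0 /\
  denote p_gain s t4 0 = ascore its (lamm s) (alive r) v [set u].
Proof.
move=> H Hv Hu vr ur Hx; have B := l_base H; rewrite /p_gain !denote_seq.
set s0 := denote (setv t4 _) _.
have B0 : base s0 by do 2 apply: base_frame => //.
pose cont Z (i : 'I_(size slots)) := ascore_item (lamm s) (alive r) v Z (item_at i).
pose Inv k (s1 : memory) :=
  s1 t3 0 = \max_(i < size slots | i < k) cont set0 i /\
  s1 t4 0 = \max_(i < size slots | i < k) cont [set u] i.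
have E Z : ascore its (lamm s) (alive r) v Z = \max_(i < size slots | i < size slots) cont Z i.
  rewrite /ascore /its big_map (big_tnth _ _ slots); apply: eq_bigl => i.
  by rewrite ltn_ord.
suff [-> ->] : Inv (size slots) (denote (for_ c1 (when (eand (elt (X_ c1) (X_ aIT)) (eeq (G_ aOWN (X_ c1)) (X_ t1)))
    (setv t5 (eval_item (X_ c1)) ;;
     PIf (G_ aMM (ix (X_ c1) (X_ t2))) (setv t4 (maxe (X_ t4) (X_ t5)))
                                       (setv t3 (maxe (X_ t3) (X_ t5)))))) s0).
  by rewrite !E.
apply: (forI_ind (Inv := Inv) B0) => //.
  by split; rewrite /s0 !denE /update /= big_pred0.
have maxS (f : 'I_(size slots) -> nat) (i : 'I_(size slots)) :
    \max_(j < size slots | j < i.+1) f j = maxn (\max_(j < size slots | j < i) f j) (f i).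
  rewrite (bigD1 i) //= maxnC; congr (maxn _ _); apply: eq_bigl => j.
  by rewrite -(inj_eq val_inj) /=; clear; lia.
move=> i s1 B1 Hf Hc [IH3 IH4].
have Hv1 : s1 t1 0 = v by rewrite Hf // /s0 !denE /update /=.
have Hu1 : s1 t2 0 = u by rewrite Hf // /s0 !denE /update /=.
have HL1 : s1 aLOSS i = s aLOSS i by rewrite Hf // /s0 !denE /update /=.
rewrite !trE /= Hc Hv1 (b_OWN B1) /Inv !maxS -IH3 -IH4 /cont /ascore_item.
have [Ev|nv] := eqVneq (nat_of_ord (slot_at i).1) v; last first.
  rewrite (_ : ((item_at i).1.1 == v) = false) /= ?maxn0 //; apply/eqP => E'.
  by case/eqP: nv; rewrite -E' /item; case: (slot_at i).2.
have Eo : (item_at i).1.1 = v.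
  by apply: val_inj; rewrite /= -Ev /item; case: (slot_at i).2.
rewrite Eo eqxx /= denote_seq; set s2 := denote (setv t5 _) s1.
have T2 : tr s2 (G_ aMM (ix (X_ c1) (X_ t2))) = (u \in (item_at i).1.2).
  have B2 : base s2 by apply: base_frame B1.
  have E2 : eval s2 (ix (X_ c1) (X_ t2)) = i * N + u.
    by rewrite (eval_ix _ B2) /s2 denote_put /update /= ?Hc ?Hu1 ?slot_lt.
  by rewrite trE E2 (b_MM B2); case: (u \in _).
rewrite denote_if T2.
(* As [v] has no living neighbour but [u], the alive part of its parent sets is empty or
   [[set u]]. *)
have sub : (item_at i).1.2 :&: alive r \subset [set u].
  apply/subsetP => x; rewrite !in_setI in_set1 => /andP[xi xr]; apply/eqP/Hx => //.
  by rewrite -Eo; apply: (its_super HL) => //; apply/mapP; exists (slot_at i) => //; apply: mem_tnth.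
have Eval : s1 aVAL i - s1 aLOSS i = (item_at i).2 - \sum_(x in (item_at i).1.2 :\: alive r) lamm s x.
  by rewrite (b_VAL B1) HL1 (l_loss H).
have [ui|ui] := boolP (u \in (item_at i).1.2) => /=.
  have -> : (item_at i).1.2 :&: alive r = [set u].
    by apply/eqP; rewrite eqEsubset sub sub1set inE ui.
  rewrite eqxx (_ : ([set u] == set0) = false); last first.
    by apply/eqP => /setP/(_ u); rewrite !inE eqxx.
  by rewrite maxn0 /s2 !denote_put /update /= Hc Eval maxnE.
have -> : (item_at i).1.2 :&: alive r = set0.
  apply/setP=> x; rewrite in_set0; apply/negP => xi; have := subsetP sub x xi.
  by rewrite in_set1 => /eqP Ex; move: xi; rewrite Ex inE (negbTE ui).
rewrite eqxx (_ : (set0 == [set u]) = false); last first.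
  by apply/eqP => /setP/(_ u); rewrite !inE eqxx.
by rewrite maxn0 /s2 !denote_put /update /= Hc Eval maxnE.
Qed.

Lemma charge_ok s (v : V) : base s -> s t1 0 = v ->
  (forall i, denote p_charge s aCODE (nat_of_ord i) =
     s aCODE i - (if v \in (item_at i).1.2 then 2 ^ v else 0)) /\
  (forall i, denote p_charge s aLOSS (nat_of_ord i) =
     s aLOSS i + (if v \in (item_at i).1.2 then s aLAM v else 0)).
Proof.
move=> B Hv.
pose Inv k (s1 : memory) := forall i : 'I_(size slots),
  s1 aCODE i = s aCODE i - (if (i < k) && (v \in (item_at i).1.2) then 2 ^ v else 0) /\
  s1 aLOSS i = s aLOSS i + (if (i < k) && (v \in (item_at i).1.2) then s aLAM v else 0).
suff H : Inv (size slots) (denote p_charge s).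
  by split=> i; have [E1 E2] := H i; rewrite ?E1 ?E2 ltn_ord.
apply: (forI_ind (Inv := Inv) B) => //; first by move=> i; rewrite ltn0 /= subn0 addn0.
move=> i s1 B1 Hf Hc IH; have Hv1 : s1 t1 0 = v by rewrite Hf.
have E2 : eval s1 (ix (X_ c1) (X_ t1)) = i * N + v by rewrite (eval_ix _ B1) /= ?Hc ?Hv1 ?slot_lt.
rewrite trE E2 (b_MM B1) => j.
have [vi|vi] := boolP (v \in (item_at i).1.2) => /=; last first.
  have [-> ->] := IH j; rewrite (ltnS j i) (leq_eqVlt j i); case: (eqVneq (nat_of_ord j) i) => [Ej|//].
  by rewrite (val_inj Ej) (negbTE vi) !andbF.
rewrite !denE /update /= Hc Hv1 (Hf aPOW) // (Hf aLAM) // (b_POW B) ?ordN // (ltnS j i) (leq_eqVlt j i).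
have [Ej|nj] := eqVneq (nat_of_ord j) i; last by rewrite /=; apply: IH.
have {}Ej : j = i by apply: val_inj.
by subst j; have [-> ->] := IH i; rewrite ltnn /= vi subn0 addn0.
Qed.

Lemma undeg_ok s (v : V) : base s -> s t1 0 = v ->
  forall w : V, denote p_undeg s aDEG w = s aDEG w - A v w.
Proof.
move=> B Hv.
pose Inv k (s1 : memory) := forall w : V, s1 aDEG w = s aDEG w - ((w < k) && A v w).
suff H : Inv n (denote p_undeg s) by move=> w; rewrite H ltn_ord.
apply: (forV_ind (Inv := Inv) B) => //; first by move=> w; rewrite ltn0 subn0.
move=> w s1 B1 Hf Hc IH; have Hv1 : s1 t1 0 = v by rewrite Hf.
rewrite (tr_eadj (a := v) (b := w) B1) // => x; rewrite ltnS leq_eqVlt.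
have [Ex|nx] := eqVneq (nat_of_ord x) w.
  have {}Ex : x = w by apply: val_inj.
  by subst x; case: (boolP (A v w)) => vw; rewrite ?denE /update /= ?Hc ?eqxx IH ltnn ?subn0.
by case: (A v w); rewrite ?denE /update /= ?Hc ?(negbTE nx) IH.
Qed.

Lemma leafst_eq s s' r : (forall a j, 1 < a < 22 -> s' a j = s a j) ->
  leafst s r -> leafst s' r.
Proof.
move=> E [b1 b2 b3 b4 b5 b6 b7 b8 b9 b10 b11 b12].
have EL : {in r, lamm s =1 lamm s'} by move=> x _; rewrite /lamm E.
have EP : {in r, parm s =1 parm s'} by move=> x _; rewrite /parm E.
have [e1 e2] := elim_seq_ext EL EP b11.
split=> //.
- by apply: base_eq b1 => a j; rewrite !inE => Ha; apply: E; move: Ha; clear; lia.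
- by move=> v; rewrite E.
- by move=> v; rewrite E //; apply: b3.
- by move=> v; rewrite E.
- by move=> i; rewrite E.
- by move=> i; rewrite E // b6; apply: eq_bigr => x _; rewrite /lamm E.
- by move=> v; rewrite E //; apply: b7.
- by rewrite E.
- by move=> j; rewrite E //; apply: b9.
- by rewrite E // b12.
Qed.

Lemma leafst_frame p s r : all (fun a => a \notin writes p) (iota 2 20) ->
  leafst s r -> leafst (denote p s) r.
Proof.
move=> /allP H; apply: leafst_eq => a j ar; apply: frame; apply: H.
by rewrite mem_iota; move: ar; clear; lia.
Qed.

Lemma scodeD1 (Z : {set V}) v : v \in Z -> scode (Z :\ v) = scode Z - 2 ^ v.
Proof. by move=> vZ; rewrite /scode (big_setD1 v vZ) /= addKn. Qed.

(** The loss and the attachment of [v] are written while [v] is alive, so the history [r] survives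
    by [elim_seq_ext]; codes, losses and degrees are then corrected for the death of [v]. *)
Lemma elim_ok s r (v : V) : leafst s r -> s t1 0 = v -> v \in alive r ->
  #|nbrs A (alive r) v| < 2 -> leafst (denote p_elim s) (v :: r).
Proof.
move=> H Hv vr dv; rewrite /p_elim; do 9 rewrite denote_seq; set s1 := denote p_attach s.
have [u [Eu ur Hu]] := attach_ok H Hv vr dv; rewrite -/s1 in Eu.
have H1 : leafst s1 r by apply: leafst_frame H.
have Hv1 : s1 t1 0 = v by rewrite /s1 frame.
have [g0 g1] := gain_ok H1 Hv1 Eu vr ur Hu; set s2 := denote p_gain s1 in g0 g1 *.
have H2 : leafst s2 r by apply: leafst_frame H1.
have Hv2 : s2 t1 0 = v by rewrite /s2 frame.
have Hu2 : s2 t2 0 = u by rewrite /s2 frame.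
have E12 x Z : ascore its (lamm s1) (alive r) x Z = ascore its (lamm s2) (alive r) x Z.
  by apply: ascore_lam => y _; rewrite /lamm /s2 frame.
rewrite !E12 in g0 g1; clearbody s2; clear E12.
set s3 := denote (setv aSUBS _) _.
have B3 : base s3 by do 3 apply: base_frame => //; exact: (l_base H2).
have Hv3 : s3 t1 0 = v by rewrite /s3 !denE /update /=.
have E3 a j : a \notin [:: aLAM; aPAR; aSUBS] -> s3 a j = s2 a j.
  by rewrite !inE !negb_or => /and3P[? ? ?]; rewrite /s3 !denE !update_other.
have L3 x : s3 aLAM x = if x == v then s2 t4 0 - s2 t3 0 else s2 aLAM x.
  by rewrite /s3 !denE /update /= Hv2.
have P3 x : s3 aPAR x = if x == v then nat_of_ord u else s2 aPAR x.
  by rewrite /s3 !denE /update /= Hv2 Hu2.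
have U3 : s3 aSUBS 0 = s2 aSUBS 0 + maxn (s2 t3 0) (s2 t4 0).
  by rewrite /s3 !denE /update /= maxnE.
have [C4 L4] := charge_ok B3 Hv3; set s4 := denote p_charge s3 in C4 L4 *.
have E43 a j : a \notin [:: c1; aCODE; aLOSS] -> s4 a j = s3 a j.
  by rewrite !inE !negb_or => /and3P[? ? ?]; rewrite /s4 frame // /p_charge /= !inE !negb_or; apply/and3P.
clearbody s3 s4.
set s5 := denote (put aALV _ _) s4.
have B4 : base s4 by apply: (base_loop (W := [:: c1; aCODE; aLOSS]) B3).
have Hv5 : s5 t1 0 = v by rewrite /s5 denE /update /= E43.
have B5 : base s5 by apply: base_frame.
have D6 := undeg_ok B5 Hv5; set s6 := denote p_undeg s5 in D6 *.
have Hv6 : s6 t1 0 = v by rewrite /s6 frame.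
have B6 : base s6 by apply: base_frame.
have A6 w : s6 aALV w = if w == v then 0 else s4 aALV w.
  by rewrite /s6 frame // /s5 denE /update /= E43 // Hv3.
have D5 w : s5 aDEG w = s4 aDEG w by rewrite /s5 denE update_other.
have E64 a j : a \notin [:: aDEG; c1; aALV] -> s6 a j = s4 a j.
  rewrite !inE !negb_or => /and3P[? ? ?]; rewrite /s6 frame; last by rewrite /p_undeg /= !inE !negb_or; apply/andP.
  by rewrite /s5 denE update_other.
clearbody s6; set s7 := denote (incr aNO) _.
have E7 a j : a \notin [:: aORD; aNO] -> s7 a j = s6 a j.
  by rewrite !inE !negb_or => /andP[? ?]; rewrite /s7 !denE !update_other.
have lam7 x : lamm s7 x = if x == v then s2 t4 0 - s2 t3 0 else lamm s2 x.
  by rewrite /lamm E7 // E64 // E43 // L3 -(inj_eq val_inj).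
have par7 x : parm s7 x = if x == v then u else parm s2 x.
  rewrite /parm E7 // E64 // E43 // P3 -(inj_eq val_inj) /=.
  by case: eqP => // _; apply: val_inj; rewrite val_insubd ltn_ord.
have vnr : v \notin r by move: vr; rewrite !inE.
have nvr x : x \in r -> (x == v) = false by move=> xr; apply: contraNF vnr => /eqP <-.
have EL : {in r, lamm s2 =1 lamm s7} by move=> x xr; rewrite lam7 nvr.
have EP : {in r, parm s2 =1 parm s7} by move=> x xr; rewrite par7 nvr.
have [e1 e2] := elim_seq_ext EL EP (l_elim H2).
have Es x Z : ascore its (lamm s7) (alive r) x Z = ascore its (lamm s2) (alive r) x Z.
  by apply: ascore_lam => y; rewrite !inE negbK => yr; rewrite lam7 nvr.
have O7 j : s7 aORD j = if j == s2 aNO 0 then nat_of_ord v else s2 aORD j.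
  have En : s6 aNO 0 = s2 aNO 0 by rewrite E64 // E43 // E3.
  by rewrite /s7 !denE /update /= En Hv6; case: eqP => // _; rewrite E64 // E43 // E3.
split.
- by do 2 apply: base_frame => //.
- move=> w; rewrite E7 // A6.
  rewrite alive_cons in_setD1 -(inj_eq val_inj) /=; case: eqP => //= _.
  by rewrite E43 // E3 // (l_alv H2).
- move=> w nw; rewrite E7 // A6 ifF.
    by rewrite E43 // E3 // (l_alv0 H2).
  by apply/eqP => E; move: nw; rewrite E leqNgt ltn_ord.
- move=> w; rewrite E7 // D6 D5 E43 // E3 // (l_deg H2) alive_cons.
  by rewrite (nbrsD1 A w vr) (super_sym v w) addnK.
- move=> i; rewrite E7 // E64 // C4 E3 // (l_code H2) alive_cons setIDA.
  case: ifP => vi; first by rewrite scodeD1 // inE vi.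
  rewrite subn0; congr scode; apply/setP=> x; rewrite !inE.
  by case: (eqVneq x v) => [->|]; rewrite ?vi ?andbF.
- move=> i; rewrite E7 // E64 // L4 E3 // (l_loss H2) L3 eqxx alive_cons.
  rewrite [RHS](bigID (pred1 v)) /= addnC; congr (_ + _); last first.
    apply: eq_big => [x|x]; first by rewrite !inE; case: (eqVneq x v) => [->|_] //=; rewrite ?vnr ?andbT ?andbF //; move: vr; rewrite !inE => ->.
    by rewrite !inE => /andP[xr _]; rewrite lam7 nvr //; move: xr; rewrite negbK.
  case: ifP => vi.
    rewrite (big_pred1 v) ?lam7 ?eqxx // => x; rewrite !inE; case: (eqVneq x v) => [->|_]; rewrite ?andbF //.
    by rewrite vi.
  by rewrite big_pred0 // => x; rewrite !inE; case: (eqVneq x v) => [->|_]; rewrite ?vi ?andbF.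
- move=> w; rewrite E7 // E64 // E43 // P3 inE -(inj_eq val_inj) /=; case: eqP => //= _.
  exact: (l_par H2).
- by rewrite /s7 !denE /update /= E64 // E43 // E3 // (l_no H2) addn1.
- move=> j; rewrite /= ltnS O7 (l_no H2) rev_cons map_rcons nth_rcons size_map size_rev leq_eqVlt.
  by case: eqP => [-> _|_] /=; [rewrite ltnn|move=> jr; rewrite jr (l_ord H2)].
- by rewrite /= vnr (l_uniq H2).
- split=> //; rewrite par7 eqxx; split=> //.
  by rewrite !Es lam7 eqxx g0 g1.
- rewrite /s7 !denE !update_other // E64 // E43 // U3 (l_subs H2) g0 g1 /= e2 addnC.
  by rewrite /gain par7 eqxx !Es.
Qed.

Lemma leaf_ok s : leafst s [::] -> exists2 r, leafst (denote p_leaf s) r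
  & forall v, v \in alive r -> 1 < #|nbrs A (alive r) v|.
Proof.
move=> H0; have B := l_base H0.
pose Inv k (s1 : memory) := exists2 r, leafst s1 r &
  k <= size r \/ forall v, v \in alive r -> 1 < #|nbrs A (alive r) v|.
have : Inv (s aN 0) (denote p_leaf s).
  apply: for_ind => //.
    by exists [::]; [apply: leafst_eq H0 => a j ar; rewrite update_other //; move: ar; clear; lia|left].
  move=> k s1 kN Hf Hc HN1 [r H1 Hr]; rewrite denote_seq denote_if denote_skip trE.
  have := find_ok H1; set s2 := denote p_find s1.
  have H2 : leafst s2 r by apply: leafst_frame H1.
  have upd x r' : leafst x r' -> leafst (update x c0 0 k.+1) r'.
    by apply: leafst_eq => a j ar; rewrite update_other //; move: ar; clear; lia.
  case E: (s2 t0 0) => [|w] /= => [Hn|[v [Ev vr dv]]].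
    by exists r; [apply: upd|right].
  case: Hr => [kr|Hr]; last by have := Hr v vr; rewrite ltnNge -ltnS dv.
  exists (v :: r); last by left.
  apply: upd; rewrite denote_seq; apply: elim_ok => //.
    by apply: leafst_frame H2.
  by rewrite denE /update /= E subn1 Ev.
rewrite (b_N B) => -[r H1 [Nr|Hr]]; last by exists r.
(* N successful rounds would have eliminated N distinct vertices, but there are fewer. *)
exfalso; have u1 := uniq_leq_size (l_uniq H1) (fun x _ => mem_enum V x).
rewrite size_enum_ord in u1; have := leq_trans (nN L) (leq_trans Nr u1); clear; lia.
Qed.

End LeafLoop.

(** * Degrees, neighbours and local scores in the core *)

Section Core.
Variables (I : instance) (L : 'I_(nvert I) -> seq (seq 'I_(nvert I) * nat)).
Hypothesis HL : forall v, nonzero_list v (L v).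
Notation n := (nvert I).
Notation V := 'I_n.
Notation A := (superstructure I).
Notation slots := (slots L).
Notation its := (its L).
Notation word := (word L).
Notation N := (size word).
Notation base := (base L).
Notation leafst := (leafst L).
Notation slot_at i := (tnth (in_tuple slots) i).
Notation item_at i := (item (slot_at i)).

Lemma ascoreE lam S v Z : ascore its lam S v Z =
  \max_(i < size slots | i < size slots) ascore_item lam S v Z (item_at i).
Proof.
rewrite /ascore /its big_map (big_tnth _ _ slots); apply: eq_bigl => i.
by rewrite ltn_ord.
Qed.

Lemma max_ordS m (f : 'I_m -> nat) (i : 'I_m) :
  \max_(j < m | j < i.+1) f j = maxn (\max_(j < m | j < i) f j) (f i).
Proof.
rewrite (bigD1 i) //= maxnC; congr (maxn _ _); apply: eq_bigl => j.
by rewrite -(inj_eq val_inj) /=; clear; lia.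
Qed.

Lemma corerow_ok s r (v : V) : leafst s r -> s c0 0 = v -> s aNBS v = 0 ->
  let s' := denote p_corerow s in
  [/\ forall j : nat, j != v -> s' aNBS j = s aNBS j /\ s' aNB1 j = s aNB1 j,
      s' aNBS v = \sum_(b in nbrs A (alive r) v) b
    & (exists2 b : V, b \in nbrs A (alive r) v & s' aNB1 v = b) \/ nbrs A (alive r) v = set0].
Proof.
move=> H Hv H0 s'; have B := l_base H.
pose Inv k (s1 : memory) :=
  [/\ forall j : nat, j != v -> s1 aNBS j = s aNBS j /\ s1 aNB1 j = s aNB1 j,
      s1 aNBS v = \sum_(b in nbrs A (alive r) v | b < k) b
    & (exists2 b : V, b \in nbrs A (alive r) v & s1 aNB1 v = b) \/
      (forall b : V, b \in nbrs A (alive r) v -> k <= b)].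
have : Inv n s'.
  apply: (forV_ind (Inv := Inv) B) => //.
    split=> //; last by right.
    by rewrite H0 big_pred0 // => b; rewrite ltn0 andbF.
  move=> w s1 B1 Hf Hc [h1 h2 h3]; have Hv1 : s1 c0 0 = v by rewrite Hf.
  rewrite tr_and (tr_eadj (a := v) (b := w) B1) // trE /= Hc Hf // (l_alv H).
  have -> : ((w \in alive r : nat) != 0) && A v w = (w \in nbrs A (alive r) v).
    by rewrite in_nbrs; case: (w \in alive r).
  have sumS : \sum_(b in nbrs A (alive r) v | b < w.+1) b =
      \sum_(b in nbrs A (alive r) v | b < w) b + (if w \in nbrs A (alive r) v then w : nat else 0).
    have [wn|wn] := boolP (w \in nbrs A (alive r) v).
      rewrite (bigD1 w) /= ?wn ?ltnSn // addnC; congr (_ + _); apply: eq_bigl => b.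
      by rewrite -(inj_eq val_inj) /= -andbA; case: (b \in _) => //=; clear; lia.
    rewrite addn0; apply: eq_bigl => b; case: (boolP (b \in _)) => //= bn.
    have : (nat_of_ord b) != w by apply: contraNneq wn => /val_inj <-.
    by clear; lia.
  have [wn|wn] := boolP (w \in nbrs A (alive r) v); last first.
    split=> //; first by rewrite sumS (negbTE wn) addn0.
    case: h3; [by left|move=> h3; right => b bn; rewrite ltn_neqAle h3 // andbT].
    by apply: contraNneq wn => /val_inj->.
  rewrite !denE /Inv /update /= Hc Hv1 sumS wn -h2 eqxx; split=> //.
    by move=> j nj; rewrite (negbTE nj); apply: h1.
  by left; exists w.
case=> h1 h2 h3; split=> //; first by rewrite h2; apply: eq_bigl => b; rewrite ltn_ord andbT.
case: h3; first by left.
by move=> h3; right; apply/setP=> b; rewrite in_set0; apply/negP => /h3; rewrite leqNgt ltn_ord.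
Qed.

Lemma core_ok s r : leafst s r -> (forall a i, 21 < a < 55 -> s a i = 0) ->
  let s' := denote p_core s in
  [/\ forall v, n <= v -> s' aKK v = 0,
      forall v : V, s' aKK v = (v \in alive r) && (2 < #|nbrs A (alive r) v|)
    & forall v : V, v \in alive r -> s' aNBS v = \sum_(b in nbrs A (alive r) v) b /\
        ((exists2 b : V, b \in nbrs A (alive r) v & s' aNB1 v = b) \/ nbrs A (alive r) v = set0)].
Proof.
move=> H Z s'; have B := l_base H.
pose Inv k (s1 : memory) :=
  [/\ forall v, n <= v -> s1 aKK v = 0,
      forall v : V, s1 aKK v = (v < k) && (v \in alive r) && (2 < #|nbrs A (alive r) v|)
    & forall v : V, if v < k then v \in alive r -> s1 aNBS v = \sum_(b in nbrs A (alive r) v) b /\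
        ((exists2 b : V, b \in nbrs A (alive r) v & s1 aNB1 v = b) \/ nbrs A (alive r) v = set0)
        else s1 aNBS v = 0].
have [h1 h2 h3] : Inv n s'.
  apply: (forV_ind (Inv := Inv) B) => //.
    by split=> v; rewrite ?Z.
  move=> v s1 B1 Hf Hc [h1 h2 h3]; rewrite trE /= Hc Hf // (l_alv H).
  have [va|va] := boolP (v \in alive r) => /=; last first.
    split=> // x; rewrite (ltnS x v) (leq_eqVlt x v); have [/val_inj Ex|nx] := eqVneq (nat_of_ord x) v => //=.
    - by rewrite h2 Ex (negbTE va) !andbF.
    - by rewrite Ex (negbTE va).
    - exact: h3.
  rewrite denote_seq; set s2 := denote (put _ _ _) s1.
  have E2 a j : a != aKK -> s2 a j = s1 a j by move=> ?; rewrite /s2 denE update_other.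
  have K2 j : s2 aKK j = if j == v then (2 < #|nbrs A (alive r) v|) : nat else s1 aKK j.
    rewrite /s2 denE /update /= Hc; case: eqP => // _.
    rewrite Hf // (l_deg H); case: ltnP => l; last by rewrite (eqP l).
    by case: (_ - 2) (subn_gt0 2 #|nbrs A (alive r) v|) => [|m]; rewrite ?l.
  have H2 : leafst s2 r.
    apply: leafst_eq H => a j ar; rewrite E2; last by move: ar; clear; lia.
    by apply: Hf; rewrite /p_corerow /= !inE; move: ar; clear; lia.
  have [||g1 g2 g3] := @corerow_ok s2 r v H2.
  - by rewrite E2.
  - by rewrite E2 //; have := h3 v; rewrite ltnn.
  set s3 := denote p_corerow s2 in g1 g2 g3 *.
  have K3 j : s3 aKK j = s2 aKK j by rewrite /s3 frame.
  clearbody s2 s3; split.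
  - move=> x xn; rewrite K3 K2 ifF ?h1 //; apply/eqP => E; move: xn; rewrite E leqNgt ltn_ord //.
  - move=> x; rewrite K3 K2 (ltnS x v) (leq_eqVlt x v).
    have [/val_inj ->|nx] := eqVneq (nat_of_ord x) v => /=; first by rewrite va.
    exact: h2.
  - move=> x; rewrite (ltnS x v) (leq_eqVlt x v).
    have [/val_inj ->|nx] //= := eqVneq (nat_of_ord x) v.
    by have [-> ->] := g1 _ nx; rewrite !E2 //; apply: h3.
by split=> // v; [rewrite h2 ltn_ord|have := h3 v; rewrite ltn_ord].
Qed.

Lemma put_GE k s a j : denote (p_put_G k) s a j =
  if (a == 24 + k) && (j == s t0 0) then maxn (s (24 + k) j) (s t1 0) else s a j.
Proof.
rewrite /p_put_G denE /update /= maxnE; case: eqP => //= ->.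
by case: eqP => // ->; lia.
Qed.

(* What the core programs compute at a vertex v of degree 2. *)
Definition nb2 (s : memory) (S : {set V}) (v a b : V) :=
  [/\ nbrs A S v = [set a; b], a != b, s aNB1 v = a & s aNBS v = a + b].

Lemma nb2_ex (s : memory) r (v : V) : v \in alive r -> #|nbrs A (alive r) v| = 2 ->
  s aNBS v = \sum_(b in nbrs A (alive r) v) b ->
  (exists2 b : V, b \in nbrs A (alive r) v & s aNB1 v = b) \/ nbrs A (alive r) v = set0 ->
  exists a b, nb2 s (alive r) v a b.
Proof.
move=> va /eqP/cards2P[a [b [ab E]]]; rewrite E => hs [[x]|]; last first.
  by move/setP/(_ a); rewrite !inE eqxx.
rewrite !inE => /orP[]/eqP-> h1; [exists a, b|exists b, a]; split=> //.
- by rewrite hs big_setU1 /= ?inE // big_set1.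
- by rewrite E setUC.
- by rewrite eq_sym.
- by rewrite hs big_setU1 /= ?inE // big_set1 addnC.
Qed.

Lemma opt2_eq (a b : V) (l r l' r' : bool) : a != b ->
  (opt l a :|: opt r b == opt l' a :|: opt r' b) = (l == l') && (r == r').
Proof.
move=> ab; apply/eqP/andP => [E|[/eqP-> /eqP->]//].
have := congr1 (fun Z : {set V} => (a \in Z, b \in Z)) E.
rewrite !inE !in_opt !eqxx (negbTE ab) eq_sym (negbTE ab) !andbT !andbF !orbF => -[-> ->].
by rewrite !eqxx.
Qed.

Lemma scores_ok s r : leafst s r -> (forall k v, k < 4 -> s (24 + k) v = 0) ->
  let s' := denote p_scores s in
  forall v a b, v \in alive r -> nb2 s (alive r) v a b ->
  forall l h : bool, s' (24 + (2 * l + h)) v =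
    ascore its (lamm s) (alive r) v (opt l a :|: opt h b).
Proof.
move=> H Z s'; have B := l_base H.
pose Inv k (s1 : memory) := forall v a b, v \in alive r -> nb2 s (alive r) v a b ->
  forall l h : bool, s1 (24 + (2 * l + h)) v =
    \max_(i < size slots | i < k) ascore_item (lamm s) (alive r) v (opt l a :|: opt h b) (item_at i).
suff IN : Inv (size slots) s' by move=> v a b va nb l h; rewrite ascoreE; apply: IN.
apply: (forI_ind (Inv := Inv) B) => //.
- by move=> j s1 x IH v a b va nb l h; rewrite update_other ?(IH v a b va nb) //; case: (l); case: (h).
- by move=> v a b _ _ l h; rewrite big_pred0 // Z //; case: (l); case: (h).
move=> i s1 B1 Hf Hc IH; have -> : tr s1 (C_ 1) = true by [].
set o := (slot_at i).1.
pose s2 := denote (setv t0 (G_ aOWN (X_ c0)) ;; setv t1 (eval_item (X_ c0)) ;;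
     setv t2 (G_ aNB1 (X_ t0)) ;; setv t3 (G_ aNBS (X_ t0) -' X_ t2)) s1.
pose x2 := s aNB1 o; pose x3 := s aNBS o - s aNB1 o.
have E2 a j : a \notin [:: t0; t1; t2; t3] -> s2 a j = s1 a j.
  by rewrite !inE !negb_or => /and4P[? ? ? ?]; rewrite /s2 !denE !update_other.
have T0 : s2 t0 0 = o by rewrite /s2 !denE /update /= Hc (b_OWN B1).
have T1 : s2 t1 0 = (item_at i).2 - \sum_(x in (item_at i).1.2 :\: alive r) lamm s x.
  by rewrite /s2 !denE /update /= Hc (b_VAL B1) (Hf aLOSS) // (l_loss H).
have T2 : s2 t2 0 = x2 by rewrite /s2 !denE /update /= Hc (b_OWN B1) (Hf aNB1).
have T3 : s2 t3 0 = x3 by rewrite /s2 !denE /update /= Hc (b_OWN B1) (Hf aNB1) // (Hf aNBS).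
have Ed : denote (setv t0 (G_ aOWN (X_ c0)) ;; setv t1 (eval_item (X_ c0)) ;;
     setv t2 (G_ aNB1 (X_ t0)) ;; setv t3 (G_ aNBS (X_ t0) -' X_ t2) ;;
     PIf (G_ aMM (ix (X_ c0) (X_ t2)))
       (PIf (G_ aMM (ix (X_ c0) (X_ t3))) (p_put_G 3) (p_put_G 2))
       (PIf (G_ aMM (ix (X_ c0) (X_ t3))) (p_put_G 1) (p_put_G 0))) s1 =
  denote (PIf (G_ aMM (ix (X_ c0) (X_ t2)))
       (PIf (G_ aMM (ix (X_ c0) (X_ t3))) (p_put_G 3) (p_put_G 2))
       (PIf (G_ aMM (ix (X_ c0) (X_ t3))) (p_put_G 1) (p_put_G 0))) s2 by [].
rewrite {}Ed; clearbody s2.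
have B2 : base s2 by apply: (base_loop (W := [:: t0; t1; t2; t3]) B1).
have C2 : s2 c0 0 = i by rewrite E2.
have M2 j : s2 aMM j = s aMM j by rewrite E2 // Hf.
pose l' := s aMM (i * N + x2) != 0; pose h' := s aMM (i * N + x3) != 0.
have Tl : tr s2 (G_ aMM (ix (X_ c0) (X_ t2))) = l'.
  by rewrite trE (eval_ix _ B2) /= C2 ?slot_lt // T2 M2.
have Th : tr s2 (G_ aMM (ix (X_ c0) (X_ t3))) = h'.
  by rewrite trE (eval_ix _ B2) /= C2 ?slot_lt // T3 M2.
have Ed a j : denote (PIf (G_ aMM (ix (X_ c0) (X_ t2)))
       (PIf (G_ aMM (ix (X_ c0) (X_ t3))) (p_put_G 3) (p_put_G 2))
       (PIf (G_ aMM (ix (X_ c0) (X_ t3))) (p_put_G 1) (p_put_G 0))) s2 a j =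
    denote (p_put_G (2 * l' + h')) s2 a j.
  by rewrite denote_if Tl; case: (l'); rewrite denote_if Th; case: (h').
move=> v a b va nb l h; rewrite Ed put_GE T0 T1 max_ordS -(IH v a b va nb l h).
rewrite !E2; try by [case: (l); case: (h)|case: (l'); case: (h')].
rewrite eqn_add2l (_ : (2 * l + h == 2 * l' + h') = (l == l') && (h == h')); last first.
  by case: (l); case: (h); case: (l'); case: (h').
have Eo : (item_at i).1.1 = o by rewrite /o /item; case: (slot_at i).2.
rewrite /ascore_item Eo; have [/val_inj Ev|nv] := eqVneq (nat_of_ord v) o; last first.
  rewrite andbF (_ : (o == v) = false) ?maxn0 //.
  by apply/eqP => E; case/eqP: nv; rewrite E.
subst v; rewrite eqxx andbT /=; have [En ab h1 h2] := nb.
(* Parents are neighbours in the superstructure, so on a vertex of degree two the two membership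
   bits determine the alive part. *)
have -> : (item_at i).1.2 :&: alive r = opt l' a :|: opt h' b.
  have El : l' = (a \in (item_at i).1.2).
    by rewrite /l' /x2 h1 (b_MM B); case: (_ \in _).
  have Eh : h' = (b \in (item_at i).1.2).
    by rewrite /h' /x3 h1 h2 addKn (b_MM B); case: (_ \in _).
  apply/setP=> x; rewrite !inE !in_opt El Eh.
  have xn : (x \in nbrs A (alive r) o) = (x == a) || (x == b) by rewrite En !inE.
  have [->|xa] := eqVneq x a.
    rewrite (negbTE ab) andbF orbF andbT; apply: andb_idr => _.
    by have : a \in nbrs A (alive r) o; [rewrite En !inE eqxx|rewrite in_nbrs !inE => /andP[]].
  have [->|xb] := eqVneq x b.
    rewrite andbF andbT; apply: andb_idr => _.
    by have : b \in nbrs A (alive r) o; [rewrite En !inE eqxx orbT|rewrite in_nbrs !inE => /andP[]].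
  rewrite !andbF; apply/negP => /andP[xi xr].
  move: xn; rewrite (negbTE xa) (negbTE xb) in_nbrs => /negbT/negP; apply.
  have -> : x \in alive r by rewrite !inE.
  rewrite -Eo; apply: (its_super HL) => //.
  by apply/mapP; exists (slot_at i) => //; apply: mem_tnth.
rewrite opt2_eq // [_ == l]eq_sym [_ == h]eq_sym.
by case: ifP => [/andP[/eqP-> /eqP->]|]; rewrite ?maxn0.
Qed.

Record corest (s : memory) (r : seq V) : Prop := CoreSt {
  c_leaf : leafst s r;
  c_deg2 : forall v, v \in alive r -> 1 < #|nbrs A (alive r) v|;
  c_nb : forall v, v \in alive r -> #|nbrs A (alive r) v| = 2 -> exists a b,
    nb2 s (alive r) v a b /\ forall l h : bool, s (24 + (2 * l + h)) v =
      ascore its (lamm s) (alive r) v (opt l a :|: opt h b) }.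

Lemma corest_eq s s' r : (forall a j, 1 < a < 28 -> s' a j = s a j) ->
  corest s r -> corest s' r.
Proof.
move=> E [h1 h2 h3]; split=> //.
  by apply: leafst_eq h1 => a j ar; apply: E; move: ar; clear; lia.
move=> v va d2; have [a [b [[n1 n2 n3 n4] n5]]] := h3 v va d2; exists a, b; split.
  by split=> //; rewrite E.
move=> l h; rewrite E; last by case: (l); case: (h).
by rewrite n5; apply: ascore_lam => y _; rewrite /lamm E.
Qed.

Lemma to_core_ok s : init_ok L s ->
  let s' := denote p_scores (denote p_core (denote p_leaf (denote p_deg (denote p_parse (denote p_tables s))))) in
  exists r, [/\ corest s' r, forall v, n <= v -> s' aKK v = 0,
    forall v : V, s' aKK v = (v \in alive r) && (2 < #|nbrs A (alive r) v|),
    forall a i, 28 < a < 55 -> s' a i = 0 & forall v : V, s' aID v = v /\ s' aALL v = 1].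
Proof.
move=> H; have := start_ok HL H; rewrite /= 2!denote_seq.
set s1 := denote p_deg _ => -[H1 Z1 ID1].
have [r H2 d2] := leaf_ok HL H1; set s2 := denote p_leaf s1 in H2 *.
have Z2 a i : 21 < a < 55 -> s2 a i = 0.
  move=> ar; rewrite /s2 frame ?Z1 //.
  by rewrite /p_leaf /p_find /p_elim /p_attach /p_gain /p_charge /p_undeg /= !inE; move: ar; clear; lia.
have ID2 (v : V) : s2 aID v = v /\ s2 aALL v = 1 by rewrite /s2 !frame.
clearbody s2.
have [k1 k2 k3] := core_ok H2 Z2; set s3 := denote p_core s2 in k1 k2 k3 *.
have H3 : leafst s3 r by apply: leafst_frame H2.
have Z3 a i : 23 < a < 55 -> a != aKK -> s3 a i = 0.
  move=> ar ak; rewrite /s3 frame ?Z2 //; first by move: ar; clear; lia.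
  by rewrite /p_core /p_corerow /= !inE; move: ar ak; clear; lia.
have ID3 (v : V) : s3 aID v = v /\ s3 aALL v = 1 by rewrite /s3 !frame.
clearbody s3.
have G := scores_ok H3 _; set s4 := denote p_scores s3 in G *.
exists r; split.
- split=> //; first by apply: leafst_frame H3.
  move=> v va dv; have [k4 k5] := k3 v va; have [a [b nb]] := nb2_ex va dv k4 k5.
  exists a, b; split; first by case: nb => *; split; rewrite // /s4 frame.
  move=> l h; rewrite (G _ _ _ _ va nb); last by move=> k w k4'; rewrite Z3 //; move: k4'; clear; lia.
  by apply: ascore_lam => y _; rewrite /lamm /s4 frame.
- by move=> v vn; rewrite /s4 frame // k1.
- by move=> v; rewrite /s4 frame.
- move=> a i ar; rewrite /s4 frame ?Z3 //; try by move: ar; clear; lia.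
  by rewrite /p_scores /p_put_G /= !inE; move: ar; clear; lia.
- by move=> v; rewrite /s4 !frame.
Qed.

End Core.

(** * The programs that fill the tables *)

Lemma tab_ext g g' i a b c : (forall j l h, j <= i -> g j l h = g' j l h) ->
  tab g i a b c = tab g' i a b c.
Proof.
elim: i a c => [|i IH] a c H /=; first by rewrite H.
by rewrite !IH ?H // => j l h ji; apply: H; apply: leqW.
Qed.

Lemma wixE a b c : [/\ 37 < wix a b c < 46, wix a b c != t1, wix a b c != t2 &
  [/\ wix a b c != t4, wix a b c != t5, wix a b c != t6 & wix a b c != t7]].
Proof. by case: a; case: b; case: c. Qed.

Lemma wix_inj a b c a' b' c' : (wix a b c == wix a' b' c') = [&& a == a', b == b' & c == c'].
Proof. by case: a; case: b; case: c; case: a'; case: b'; case: c'. Qed.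

Lemma addmaxE w e y (s : memory) x j : denote (p_addmax w e y) s x j =
  if (x == w) && (j == s t1 0) then maxn (s w (s t1 0)) (addp (eval s e) (eval s y)) else s x j.
Proof.
rewrite /p_addmax denote_if denote_skip denote_put /tr /addp.
have [E|nE] /= := eqVneq (eval s e) 0.
  by rewrite maxn0; case: ifP => // /andP[/eqP-> /eqP->].
by rewrite /update /= -maxnE.
Qed.

Definition tabv (s : memory) (a b c : bool) :=
  let x := s t2 0 in
  maxn (maxn (addp (s (wix false b c) x) (s (t4 + (2 * true + a)) 0))
             (addp (s (wix true b c) x) (s (t4 + (2 * false + a)) 0)))
       (if c then addp (maxn (s (wix false b false) x) (s (wix false b true) x))
                       (s (t4 + (2 * false + a)) 0) else 0).

(** The block reads the finished row at [t2] and writes the row at [t1]. Since the two vertices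
    differ, the blocks for the eight triples do not disturb each other, whatever their order. *)
Lemma tab_blockE a b c (s : memory) x j : s t1 0 != s t2 0 ->
  denote (tab_block a b c) s x j =
    if (x == wix a b c) && (j == s t1 0) then tabv s a b c else s x j.
Proof.
move=> ne; have [_ w1 w2 [w4 w5 w6 w7]] := wixE a b c.
rewrite /tab_block; set w := wix a b c in w1 w2 w4 w5 w6 w7 *.
pose ag (s1 : memory) M := forall x j, s1 x j = if (x == w) && (j == s t1 0) then M else s x j.
have agx s1 M y : ag s1 M -> s1 y (s t2 0) = s y (s t2 0).
  by move=> H; rewrite H [_ == s t1 0]eq_sym (negbTE ne) andbF.
have ag2 s1 M : ag s1 M -> s1 t2 0 = s t2 0 by move=> H; rewrite H eq_sym (negbTE w2).
have agl s1 M (l : bool) : ag s1 M -> s1 (t4 + (2 * l + a)) 0 = s (t4 + (2 * l + a)) 0.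
  move=> H; rewrite H (_ : (_ == w) = false) // /w; clear.
  by case: l; case: a; case: b; case: c.
have step s1 M e y : ag s1 M ->
    ag (denote (p_addmax w e y) s1) (maxn M (addp (eval s1 e) (eval s1 y))).
  move=> H z k; have E1 : s1 t1 0 = s t1 0 by rewrite H eq_sym (negbTE w1).
  rewrite addmaxE E1 [s1 w _]H !eqxx /=; case: ifP => // nz; by rewrite H nz.
rewrite denote_seq; set s1 := denote (put _ _ _) s.
have H1 : ag s1 0 by move=> z k; rewrite /s1 denote_put /update /=.
clearbody s1; rewrite denote_seq; set s2 := denote _ s1.
have H2 := step _ _ (eW false b c (X_ t2)) (eloc true a) H1; rewrite -/s2 in H2.
rewrite max0n /eW /eloc /= (ag2 _ _ H1) (agx _ _ _ H1) in H2.
have := agl _ _ true H1; rewrite /= => El1; rewrite El1 in H2.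
clearbody s2; rewrite denote_seq; set s3 := denote _ s2.
have H3 := step _ _ (eW true b c (X_ t2)) (eloc false a) H2; rewrite -/s3 in H3.
rewrite /eW /eloc /= (ag2 _ _ H2) (agx _ _ _ H2) in H3.
have := agl _ _ false H2; rewrite /= => El2; rewrite El2 in H3.
clearbody s3.
have [c1|c0] := boolP c; last first.
  by rewrite denote_skip H3 /tabv (negbTE c0) maxn0.
have H4 := step _ _ (maxe (eW false b false (X_ t2)) (eW false b true (X_ t2))) (eloc false a) H3.
rewrite H4 /eW /eloc /= (ag2 _ _ H3) !(agx _ _ _ H3) -maxnE.
have := agl _ _ false H3; rewrite /= => ->.
by rewrite /tabv c1.
Qed.

Lemma tabS_ok (s : memory) (s' := denote p_tabS s) : s t1 0 != s t2 0 ->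
  (forall a b c, s' (wix a b c) (s t1 0) = tabv s a b c) /\
  (forall x j, (j != s t1 0) || ~~ (37 < x < 46) -> s' x j = s x j).
Proof.
move=> ne.
have H l (s0 : memory) (s1 := denote (seqp [seq tab_block t.1.1 t.1.2 t.2 | t <- l]) s0) :
    s0 t1 0 != s0 t2 0 ->
    (forall a b c, s1 (wix a b c) (s0 t1 0) =
       if (a, b, c) \in l then tabv s0 a b c else s0 (wix a b c) (s0 t1 0)) /\
    (forall x j, (j != s0 t1 0) || ~~ (37 < x < 46) -> s1 x j = s0 x j).
  elim: l s0 @s1 => [|[[a b] c] l IH] s0 s1 ne0; first by [].
  rewrite /s1 /= denote_seq; set s2 := denote _ s0.
  have E2 x j := @tab_blockE a b c s0 x j ne0; rewrite -/s2 in E2.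
  have wr := wixE a b c.
  have F2 x j : (j != s0 t1 0) || ~~ (37 < x < 46) -> s2 x j = s0 x j.
    rewrite E2; case: ifP => // /andP[/eqP-> /eqP->]; rewrite eqxx orFb.
    by case: wr => ->.
  clearbody s2.
  have e1 : s2 t1 0 = s0 t1 0 by rewrite F2 // orbT.
  have e2 : s2 t2 0 = s0 t2 0 by rewrite F2 // orbT.
  have ne2 : s2 t1 0 != s2 t2 0 by rewrite e1 e2.
  have [h1 h2] := IH s2 ne2; rewrite e1 in h1 h2.
  have Et a' b' c' : tabv s2 a' b' c' = tabv s0 a' b' c'.
    rewrite /tabv e2 !(F2 _ (s0 t2 0)) 1?eq_sym ?ne0 //.
    by rewrite !(F2 (t4 + _)) //; rewrite orbC; case: (a').
  split=> [a' b' c'|x j xj]; last by rewrite h2 // F2.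
  rewrite h1 Et inE E2 wix_inj eqxx andbT !xpair_eqE -andbA.
  case: ((a', b', c') \in l); rewrite ?orbT ?orbF //.
  by case: ifP => // /and3P[/eqP-> /eqP-> /eqP->].
have [h1 h2] := H triples s ne; split=> // a b c; apply: (etrans (h1 a b c)); rewrite ifT //.
by case: a; case: b; case: c.
Qed.

Lemma tab0_ok (s : memory) (s' := denote p_tab0 s) :
  (forall a b c : bool, s' (wix a b c) (s t1 0) = if c then 0 else s (t4 + (2 * b + a)) 0 + 1) /\
  (forall x j, (j != s t1 0) || ~~ (37 < x < 46) -> s' x j = s x j).
Proof.
split=> [a b c|x j].
  by rewrite /s' /p_tab0 /= !denE /update /=; case: a; case: b; case: c; rewrite /= ?eqxx.
have [Ej|nj] := eqVneq j (s t1 0) => /= [xr|_].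
  by rewrite /s' frame // /p_tab0 /wix /= !inE; move: xr; clear; lia.
by rewrite /s' /p_tab0 /= !denE /update /= (negbTE nj) !andbF.
Qed.

Lemma when_putE e a e1 e2 s b j : denote (when e (put a e1 e2)) s b j =
  if [&& tr s e, b == a & j == eval s e1] then eval s e2 else s b j.
Proof. by rewrite denote_if; case: (tr s e). Qed.

Lemma set2_eq (T : finType) (a b p q : T) : [set a; b] = [set p; q] -> a != b ->
  p = a /\ q = b \/ p = b /\ q = a.
Proof.
move=> /setP E ab; have := E p; have := E q; rewrite !inE !eqxx !orbT /=.
have := E a; have := E b; rewrite !inE !eqxx !orbT /= => h1 h2 h3 h4.
case/orP: h4 => /eqP Ep; case/orP: h3 => /eqP Eq; subst p q; [|by left|by right|].
  by move: h1; rewrite ![b == a]eq_sym (negbTE ab).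
by move: h2; rewrite (negbTE ab).
Qed.

(** * Walking along the paths of the core *)

Section Walk.
Variables (I : instance) (L : 'I_(nvert I) -> seq (seq 'I_(nvert I) * nat)).
Hypothesis HL : forall v, nonzero_list v (L v).
Notation n := (nvert I).
Notation V := 'I_n.
Notation A := (superstructure I).
Notation slots := (slots L).
Notation its := (its L).
Notation word := (word L).
Notation N := (size word).
Notation base := (base L).
Notation leafst := (leafst L).
Notation corest := (corest L).
Variables (r : seq V) (lam : V -> nat).
Notation C := (alive r).
Notation F := (ascore its lam C).
Implicit Types (K : {set V}) (P Q : V * seq V * V) (Qs : seq (V * seq V * V)).

Lemma local_ok s (v p q : V) (s' := denote p_local s) :
  corest s r -> (forall x, lamm s x = lam x) -> v \in C ->
  nbrs A C v = [set p; q] -> p != q -> s t1 0 = v -> s t2 0 = p ->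
  (forall l h : bool, s' (64 + (2 * l + h)) 0 = F v (opt l p :|: opt h q)) /\ s aNBS v - p = q.
Proof.
move=> cs El vC En pq H1 H2.
have d2 : #|nbrs A C v| = 2 by rewrite En cards2 pq.
have [a [b [[Eab ab nb1 nbs] G]]] := c_nb cs vC d2.
have EF Z : ascore its (lamm s) C v Z = F v Z by apply: ascore_lam => x _.
have [] := set2_eq (etrans (esym Eab) En) ab => -[Ep Eq]; subst p q.
  split; last by rewrite nbs addKn.
  move=> l h; rewrite -EF -G /s' /p_local denote_if trE /= H1 H2 nb1 eqxx.
  by case: l; case: h; rewrite !denE /update /= H1.
split; last by rewrite nbs addnK.
move=> l h; rewrite setUC -EF -G /s' /p_local denote_if trE /= H1 H2 nb1.
rewrite (_ : (nat_of_ord a == b) = false); last by apply/eqP => /val_inj E; rewrite E eqxx in ab.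
by case: l; case: h; rewrite !denE /update /= H1.
Qed.

Definition done Qs (v : V) := has (fun P => v \in pqs P) Qs.

Definition inner K P := [/\ 0 < size (pqs P), uniq (pqs P), pw P \in K /\ pu P \in K,
  (forall v, v \in pqs P -> v \notin K)
  & forall j, j < size (pqs P) -> pv P j.+1 \in C /\
      nbrs A C (pv P j.+1) = [set pv P j; pv P j.+2]].

Definition vrow (s : memory) (y : nat) P j := [/\ s aPID (pv P j.+1) = y.+1,
  s aPOS (pv P j.+1) = j.+1, s aPRV (pv P j.+1) = pv P j
  & forall a b c, s (wix a b c) (pv P j.+1) = tab (gpath F P) j a b c].

Record prow (s : memory) P : Prop := PRow {
  r_row : forall j, j < size (pqs P) -> vrow s (pv P 1) P j;
  r_len : s aLEN (pv P 1) = size (pqs P);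
  r_xx : s aXX (pv P 1) = px P;
  r_uu : s aUU (pv P 1) = pu P;
  r_ww : s aWW (pv P 1) = pw P;
  r_bb : s aBB (pv P 1) = pbig F P;
  r_z1 : 1 < size (pqs P) -> s aZ1 (pv P 1) = pv P 2;
  r_z2 : 2 < size (pqs P) -> s aZ2 (pv P 1) = pv P 3 }.

Record pathst (s : memory) K Qs : Prop := PathSt {
  q_core : corest s r;
  q_lam : forall v, lamm s v = lam v;
  q_KC : K \subset C;
  q_KK : forall v : V, (s aKK v != 0) = (v \in K);
  q_deg : forall v, v \in C -> v \notin K -> #|nbrs A C v| = 2;
  q_pid : forall v : V, (s aPID v != 0) = done Qs v;
  q_in : forall P, P \in Qs -> inner K P;
  q_row : forall P, P \in Qs -> prow s P;
  q_disj : forall P Q v, P \in Qs -> Q \in Qs -> v \in pqs P -> v \in pqs Q -> P = Q;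
  q_uniq : uniq Qs;
  q_adds : s aADDS 0 = \sum_(P <- Qs | 3 < size (pqs P)) (2 * pbig F P).+1 }.

Lemma prow_eq (s s' : memory) P : (forall a (j : V), 28 < a < 47 -> j \in pqs P -> s' a (nat_of_ord j) = s a j) ->
  0 < size (pqs P) -> prow s P -> prow s' P.
Proof.
move=> E m0 [h1 h2 h3 h4 h5 h6 h7 h8]; have y : pv P 1 \in pqs P by apply: pv_in.
split=> [j jm| | | | | |m1|m2]; try by rewrite E //; auto.
have jP : pv P j.+1 \in pqs P by apply: pv_in.
have [g1 g2 g3 g4] := h1 j jm; split; rewrite ?E // => a b c.
by rewrite E //; case: (wixE a b c) => /andP[] l1 l2 *; rewrite (leq_trans _ l1) // (leq_trans l2).
Qed.

Lemma pathst_eq s s' K Qs : (forall a j, 1 < a < 48 -> s' a j = s a j) ->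
  pathst s K Qs -> pathst s' K Qs.
Proof.
move=> E [h1 h2 h3 h4 h5 h6 h7 h8 h9 h10 h11]; split=> //.
- by apply: corest_eq h1 => a j ar; apply: E; move: ar; clear; lia.
- by move=> v; rewrite /lamm E //; apply: h2.
- by move=> v; rewrite E.
- by move=> v; rewrite E.
- move=> P PQ; apply: prow_eq (h8 P PQ); last by case: (h7 P PQ).
  by move=> a j ar _; apply: E; move: ar; clear; lia.
- by rewrite E.
Qed.

(** The two neighbours of a finished inner vertex are inner vertices or ends of its path. In
    contrapositive form: a walk through free vertices never runs into an older path. *)
Lemma done_adj s K Qs v x : pathst s K Qs -> done Qs v -> x \in C -> A v x ->
  (x \in K) || done Qs x.
Proof.
move=> H /hasP[P PQ vP] xC vx; have [m0 un [wK uK] off nb] := q_in H PQ.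
have [j jm Ev] := pqsP vP; case: j jm Ev => // j jm Ev.
have [_ En] := nb j jm; have : x \in nbrs A C (pv P j.+1) by rewrite in_nbrs xC -Ev.
have H' i : i <= (size (pqs P)).+1 -> (pv P i \in K) || done Qs (pv P i).
  move=> im; have [->|i0] := eqVneq i 0; first by rewrite pv0 wK.
  have [->|i1] := eqVneq i (size (pqs P)).+1; first by rewrite pvm uK.
  apply/orP; right; apply/hasP; exists P => //; apply: pv_in; move: im i0 i1; clear; lia.
by rewrite En !inE => /orP[]/eqP->; apply: H'; move: jm; clear; lia.
Qed.

Lemma pv_last (w u : V) qs : pv (w, qs, u) (size qs) = last w qs.
Proof.
rewrite /pv /= -rcons_cons nth_rcons /= ltnSn; exact: (nth_last w (w :: qs)).
Qed.

Lemma pv_ext (w cur nx : V) qs i : i <= (size qs).+1 ->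
  pv (w, rcons qs cur, nx) i = pv (w, qs, cur) i.
Proof.
by move=> im; rewrite /pv /= -rcons_cons nth_rcons /= size_rcons ltnS im.
Qed.

Section Loop.
Variables (s : memory) (K : {set V}) (Qs : seq (V * seq V * V)) (y w : V).
Hypothesis H : pathst s K Qs.
Hypothesis wK : w \in K.

(** The walk has left [qs] behind and stands at [cur]. Treating [cur] as the end of a provisional
    path lets all statements on paths apply during the walk. *)
Record wst (s1 : memory) (qs : seq V) (cur : V) (P := (w, qs, cur)) : Prop := WSt {
  w_low : forall a j, 1 < a < 29 -> s1 a j = s a j;
  w_t0 : s1 t0 0 = y;
  w_t1 : s1 t1 0 = cur;
  w_t2 : s1 t2 0 = last w qs;
  w_t3 : s1 t3 0 = size qs;
  w_cur : cur \in C;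
  w_adj : A (last w qs) cur;
  w_first : pv P 1 = y;
  w_uniq : uniq qs;
  w_in : forall v, v \in qs -> [/\ v \in C, v \notin K & ~~ done Qs v];
  w_curd : (cur \in K) || ~~ done Qs cur;
  w_nb : forall j, j < size qs ->
    nbrs A C (pv P j.+1) = [set pv P j; pv P j.+2] /\ pv P j != pv P j.+2;
  w_row : forall j, j < size qs -> vrow s1 y P j;
  w_z1 : 1 < size qs -> s1 aZ1 y = pv P 2;
  w_z2 : 2 < size qs -> s1 aZ2 y = pv P 3;
  w_other : forall a j : nat, 28 < a < 46 -> (forall v, v \in y :: qs -> j != v) -> s1 a j = s a j }.

Lemma step_next s1 qs cur : wst s1 qs cur -> cur \notin K ->
  cur \notin qs /\ exists nx, [/\ nbrs A C cur = [set last w qs; nx], last w qs != nx,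
    nx \in C, A cur nx & (nx \in K) || ~~ done Qs nx].
Proof.
move=> W cK; have cC := w_cur W; have cd := q_deg H cC cK.
have lC : last w qs \in C.
  case/lastP: qs W => [|qs q] W; first exact: (subsetP (q_KC H)).
  by rewrite last_rcons; case: (@w_in _ _ _ W q); rewrite // mem_rcons mem_head.
have nd : ~~ done Qs cur by have := w_curd W; rewrite (negbTE cK).
split; last first.
  have ln : last w qs \in nbrs A C cur by rewrite in_nbrs lC super_sym (w_adj W).
  have /eqP/cards2P[a [b [ab Eab]]] := cd.
  have mk nx : nbrs A C cur = [set last w qs; nx] -> last w qs != nx -> exists nx,
      [/\ nbrs A C cur = [set last w qs; nx], last w qs != nx,
      nx \in C, A cur nx & (nx \in K) || ~~ done Qs nx].
    move=> En ne; exists nx; have : nx \in nbrs A C cur by rewrite En !inE eqxx orbT.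
    rewrite in_nbrs => /andP[nC cn]; split=> //; rewrite orbC -implybE; apply/implyP => dn.
    have := done_adj H dn cC; rewrite super_sym => /(_ cn).
    by rewrite (negbTE cK) (negbTE nd).
  have : (last w qs == a) || (last w qs == b) by move: ln; rewrite Eab !inE.
  case/orP=> /eqP E; first by apply: (mk b); rewrite E.
  by apply: (mk a); rewrite E; [rewrite Eab setUC|rewrite eq_sym].
apply/negP => cq; have [j jm Ec] := @pqsP _ (w, qs, cur) cur cq; move: (jm) => /= jm'.
case: j jm jm' Ec => // j jm jm' Ec; have [En ne] := w_nb W jm'.
rewrite -Ec in En; have : last w qs \in nbrs A C cur by rewrite in_nbrs lC super_sym (w_adj W).
rewrite En -(pv_last w cur) !inE.
have jl : j < size qs := jm'.
have m0 : 0 < size qs by move: jl; clear; lia.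
have lq : pv (w, qs, cur) (size qs) \in qs by apply: (@pv_in _ (w, qs, cur)); rewrite /= m0 leqnn.
have inj i k : 0 < i <= size qs -> 0 < k <= size qs -> pv (w, qs, cur) i = pv (w, qs, cur) k -> i = k.
  move=> im km; have il : i.-1 < size qs by move: im; clear; lia.
  have kl : k.-1 < size qs by move: km; clear; lia.
  rewrite !pvE //= => /eqP; rewrite nth_uniq ?(w_uniq W) // => /eqP; move: im km; clear; lia.
have Em : cur = pv (w, qs, cur) (size qs).+1 by rewrite (pvm (w, qs, cur)).
case/orP=> /eqP E.
  case: j jm jm' jl Ec En ne E => [|j] jm jm' jl Ec En ne E.
    by have [_ + _] := w_in W lq; rewrite E pv0 wK.
  have Es : size qs = j.+1 by apply: inj E; [rewrite m0 leqnn|exact: ltnW].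
  by rewrite Es ltnn in jl.
have [E1|E1] := eqVneq j.+1 (size qs).
  by have := w_adj W; rewrite -(pv_last w cur) -E1 -Ec super_irr.
have E2 : size qs = j.+2 by apply: inj E; [rewrite m0 leqnn|move: jl E1; clear; lia].
have j2 : j.+1 < size qs by rewrite E2.
by have [_] := w_nb W j2; rewrite -Ec {1}Em E2 eqxx.
Qed.

Lemma step_ok s1 qs cur : wst s1 qs cur -> cur \notin K ->
  exists nx, wst (denote p_step s1) (rcons qs cur) nx.
Proof.
move=> W cK; have [cq [nx [En ne nC cn nd]]] := step_next W cK; exists nx.
have [Wlow Wt0 Wt1 Wt2 Wt3 Wc Wa Wf Wu Wi Wd Wn Wr Wz1 Wz2 Wo] := W.
have Tk : tr s1 (enot (G_ aKK (X_ t1))).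
  by rewrite trE trE /= Wt1 Wlow // negbK; have := q_KK H cur; rewrite (negbTE cK) => /negbFE.
rewrite /p_step denote_if Tk.
do 3 rewrite denote_seq; set s2 := denote p_mark s1; set m := size qs in Wt3 Wz1 Wz2.
have S2 a j : a \notin [:: aPID; aPRV; t3; aPOS; aZ1; aZ2] -> s2 a j = s1 a j.
  by move=> an; rewrite /s2 frame // /p_mark /= !inE; move: an; rewrite !inE; clear; lia.
have P2 j : s2 aPID j = if j == cur then y.+1 else s1 aPID j.
  rewrite /s2 /p_mark !denE !trE /update /= Wt1 Wt0 Wt3; case: ifP => _; case: ifP => _ /=; rewrite ?addn1 //.
have R2 j : s2 aPRV j = if j == cur then (last w qs : nat) else s1 aPRV j.
  by rewrite /s2 /p_mark !denE !trE /update /= Wt1 Wt2 Wt3; case: ifP => _; case: ifP => _ /=.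
have T2 : s2 t3 0 = m.+1.
  by rewrite /s2 /p_mark !denE !trE /update /= Wt3 addn1; case: ifP => _; case: ifP => _ /=.
have O2 j : s2 aPOS j = if j == cur then m.+1 else s1 aPOS j.
  by rewrite /s2 /p_mark !denE !trE /update /= Wt1 Wt3 addn1; case: ifP => _; case: ifP => _ /=.
have Z12 j : s2 aZ1 j = if (j == y) && (m == 1) then cur : nat else s1 aZ1 j.
  rewrite /s2 /p_mark; do 5 rewrite denote_seq.
  rewrite !when_putE !trE /= !when_putE /= ?andbF /= !denE /update /= Wt1 Wt0 Wt3 addn1 !eqSS.
  by rewrite andbC.
have Z22 j : s2 aZ2 j = if (j == y) && (m == 2) then cur : nat else s1 aZ2 j.
  rewrite /s2 /p_mark; do 5 rewrite denote_seq.
  rewrite !when_putE !trE /= !when_putE /= ?andbF /= !denE /update /= Wt1 Wt0 Wt3 addn1 !eqSS.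
  by rewrite andbC.
clearbody s2.
have C2 : corest s2 r.
  apply: corest_eq (q_core H) => a j ar; rewrite S2 ?Wlow //; first by move: ar; clear; lia.
  by rewrite !inE; move: ar; clear; lia.
have L2 x : lamm s2 x = lam x by rewrite /lamm S2 // Wlow //; apply: (q_lam H).
have [||Gl Nx] := local_ok C2 L2 Wc En ne; [by rewrite S2|by rewrite S2|].
set s3 := denote p_local s2 in Gl *.
have S3 a j : ~~ (63 < a < 68) -> s3 a j = s2 a j.
  by move=> an; rewrite /s3 frame // /p_local /= !inE; move: an; clear; lia.
clearbody s3.
set s4 := denote _ s3.
have lcur : (cur == last w qs) = false.
  by apply/eqP => E; have := Wa; rewrite -E super_irr.
have T1 : s3 t1 0 = cur by rewrite S3 // S2.
have T2' : s3 t2 0 = last w qs by rewrite S3 // S2.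
have ne3 : s3 t1 0 != s3 t2 0.
  by rewrite T1 T2'; apply/eqP => /val_inj E; rewrite E eqxx in lcur.
have Q3 : s3 t3 0 = m.+1 by rewrite S3.
pose P' := (w, rcons qs cur, nx); pose P := (w, qs, cur).
have pvE' i : i <= m.+1 -> pv P' i = pv P i by move=> im; apply: pv_ext.
have pvc : pv P' m.+1 = cur by rewrite pvE' // (pvm P).
have pvx : pv P' m.+2 = nx by have := pvm P'; rewrite /= size_rcons.
have pvl : pv P' m = last w qs by rewrite pvE' // pv_last.
have Eg j l h : j < m -> gpath F P' j l h = gpath F P j l h.
  by move=> jm; rewrite /gpath !pvE' //; move: jm; clear; lia.
have Eg' l h : gpath F P' m l h = s3 (64 + (2 * l + h)) 0 by rewrite Gl /gpath pvc pvx pvl.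
(* The last vertex left behind already had [cur] as its right neighbour, so appending [nx] changes
   no earlier row. *)
have Et j a b c : j < m -> tab (gpath F P') j a b c = tab (gpath F P) j a b c.
  by move=> jm; apply: tab_ext => i l h ij; apply: Eg; apply: leq_ltn_trans jm.
have [W4 S4] : (forall a b c, s4 (wix a b c) cur = tab (gpath F P') m a b c) /\
    (forall a (j : nat), (j != cur) || ~~ (37 < a < 46) -> s4 a j = s3 a j).
  rewrite /s4 denote_if trE /= Q3 eqSS -T1; have [m0|m0] := eqVneq m 0.
    have [h1 h2] := tab0_ok s3; split=> // a b c; rewrite h1 m0 /=; case: c => //.
    by have := Eg' b a; rewrite m0 => ->; rewrite addn1.
  have [h1 h2] := tabS_ok ne3; split=> // a b c; rewrite h1 /tabv T2'.
  have m1 : m.-1 < m by move: m0; clear; lia.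
  have El : last w qs = pv P m.-1.+1 :> V by rewrite prednK ?lt0n // pv_last.
  have Wt a' b' c' : s3 (wix a' b' c') (last w qs) = tab (gpath F P') m.-1 a' b' c'.
    have [_ _ _ h4] := Wr _ m1; rewrite Et // -h4 El S3; last by case: (a'); case: (b'); case: (c').
    by rewrite S2 //; case: (a'); case: (b'); case: (c').
  rewrite !Wt -!Eg'.
  have -> : tab (gpath F P') m a b c = tab (gpath F P') m.-1.+1 a b c by rewrite prednK ?lt0n.
  by rewrite [RHS]/= prednK ?lt0n.
set s5 := denote p_next s4.
have S5 a j : a \notin [:: t4; t2; t1] -> s5 a j = s4 a j.
  by rewrite !inE !negb_or => /and3P[? ? ?]; rewrite /s5 /p_next !denE !update_other.
have T15 : s5 t1 0 = nx.
  by rewrite /s5 /p_next !denE /update /= !S4 ?orbT // T1 T2' S3 // -[RHS]Nx.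
have T25 : s5 t2 0 = cur by rewrite /s5 /p_next !denE /update /= !S4 ?orbT.
clearbody s4 s5.
have U5 a (j : nat) : 28 < a < 46 -> j != cur -> s5 a j = s2 a j.
  move=> ar jc; rewrite S5; last by rewrite !inE; move: ar; clear; lia.
  by rewrite S4 ?jc // S3 //; move: ar; clear; lia.
have U5' a j : ~~ (37 < a < 46) -> ~~ (59 < a < 68) -> s5 a j = s2 a j.
  move=> ar ar'; rewrite S5; last by rewrite !inE; move: ar'; clear; lia.
  by rewrite S4 ?ar ?orbT // S3 //; move: ar'; clear; lia.
have qc (v : V) : v \in qs -> (nat_of_ord v == cur) = false.
  by move=> vq; apply/eqP => /val_inj E; rewrite -E vq in cq.
have yq : (y == cur) || (y \in qs).
  have := Wf; case E: (qs) => [|q qs'] /= <-; first by rewrite /pv /= eqxx.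
  by rewrite /pv /= mem_head orbT.
split.
- move=> a j ar; rewrite U5'; try by move: ar; clear; lia.
  by rewrite S2 ?Wlow // !inE; move: ar; clear; lia.
- by rewrite S5 // S4 ?orbT // S3 // S2.
- by [].
- by rewrite last_rcons.
- by rewrite S5 // S4 ?orbT // Q3 size_rcons.
- by [].
- by rewrite last_rcons.
- by rewrite -/P' pvE' ?Wf.
- by rewrite rcons_uniq cq.
- move=> v; rewrite mem_rcons inE => /predU1P[->|/Wi//]; split=> //.
  by move: Wd; rewrite (negbTE cK).
- by [].
- move=> j; rewrite size_rcons ltnS leq_eqVlt -/P' => /predU1P[->|jm].
    by rewrite pvc pvx pvl En.
  by rewrite !pvE' //; [apply: Wn|move: jm; clear; lia..].
- move=> j; rewrite size_rcons ltnS leq_eqVlt -/P' => /predU1P[->|jm].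
    rewrite /vrow pvc pvl; split; try by rewrite U5' // ?P2 ?O2 ?R2 eqxx.
    move=> a b c; rewrite S5 ?W4 //; by case: (a); case: (b); case: (c).
  have [g1 g2 g3 g4] := Wr j jm; rewrite /vrow !pvE'; try by move: jm; clear; lia.
  have jc : (nat_of_ord (pv P j.+1) == cur) = false by apply: qc; apply: (@pv_in _ P).
  split; try by rewrite U5' // ?P2 ?O2 ?R2 jc.
  move=> a b c; rewrite U5 ?jc ?Et ?S2 //; by case: (a); case: (b); case: (c).
- rewrite size_rcons ltnS -/P' => m1; rewrite U5' // Z12 eqxx /=.
  have [Em|m1'] := eqVneq m 1; first by rewrite -Em pvc.
  by rewrite pvE' ?Wz1 //; move: m1 m1'; clear; lia.
- rewrite size_rcons ltnS -/P' => m1; rewrite U5' // Z22 eqxx /=.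
  have [Em|m1'] := eqVneq m 2; first by rewrite -Em pvc.
  by rewrite pvE' ?Wz2 //; move: m1 m1'; clear; lia.
- move=> a j ar nj.
  have jc : j != cur by apply: nj; rewrite !inE mem_rcons mem_head orbT.
  have jy : j != y by apply: nj; rewrite mem_head.
  have -> : s5 a j = s2 a j by apply: U5.
  have jo : s1 a j = s a j.
    apply: Wo => // v vq; apply: nj; move: vq; rewrite !inE mem_rcons inE => /orP[->|->] //.
    by rewrite !orbT.
  rewrite -jo; have [an|an] := boolP (a \in [:: aPID; aPRV; t3; aPOS; aZ1; aZ2]); last exact: S2.
  move: an ar; rewrite !inE => /or4P[/eqP->|/eqP->|/eqP->//|/or3P[/eqP->|/eqP->|/eqP->]] _.
  + by rewrite P2 (negbTE jc).
  + by rewrite R2 (negbTE jc).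
  + by rewrite O2 (negbTE jc).
  + by rewrite Z12 (negbTE jy).
  + by rewrite Z22 (negbTE jy).
Qed.

End Loop.

Lemma walk_ok s K Qs (y w : V) : pathst s K Qs -> s t1 0 = y -> s t2 0 = w ->
  y \in C -> y \notin K -> ~~ done Qs y -> w \in K -> A w y ->
  exists P, [/\ pathst (denote p_walk s) K (P :: Qs), pv P 1 = y, pw P = w
    & forall v, v \in pqs P -> ~~ done Qs v].
Proof.
move=> H H1 H2 yC yK yd wK wy; have B := l_base (c_leaf (q_core H)).
rewrite /p_walk; do 2 rewrite denote_seq; set s0 := denote p_start s.
have S0 a j : a \notin [:: t0; aWW; t3] -> s0 a j = s a j.
  by rewrite !inE !negb_or => /and3P[? ? ?]; rewrite /s0 /p_start !denE !update_other.
have W0 j : s0 aWW j = if j == y then w : nat else s aWW j by rewrite /s0 /p_start !denE /update /= H1 H2.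
have T00 : s0 t0 0 = y by rewrite /s0 /p_start !denE /update /=.
have T30 : s0 t3 0 = 0 by rewrite /s0 /p_start !denE /update /=.
clearbody s0.
pose Inv k (s1 : memory) := exists qs cur, wst s K Qs y w s1 qs cur /\
  (k = size qs \/ cur \in K).
have upd k s1 qs cur : wst s K Qs y w s1 qs cur -> wst s K Qs y w (update s1 c1 0 k) qs cur.
  case=> h1 h2 h3 h4 h5 h6 h7 h8 h9 h10 h11 h12 h13 h14 h15 h16.
  split=> //; try by [rewrite update_other | move=> ?; rewrite update_other //; auto].
  - by move=> a j ar; rewrite update_other ?h1 //; move: ar; clear; lia.
  - move=> j jm; have [g1 g2 g3 g4] := h13 j jm; split; rewrite ?update_other // => a b c.
    by rewrite update_other //; case: (a); case: (b); case: (c).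
  - by move=> a j ar nj; rewrite update_other ?h16 //; move: ar; clear; lia.
have IN : Inv (s0 aN 0) (denote (for_ c1 p_step) s0).
  apply: for_ind => //.
    exists [::], y; split; last by left.
    apply: upd; split=> //.
    - by move=> a j ar; rewrite S0 // !inE; move: ar; clear; lia.
    - by rewrite S0.
    - by rewrite S0.
    - by rewrite yd orbT.
    - move=> a j ar nj; have [->|aw] := eqVneq a aWW; last by rewrite S0 // !inE; move: ar aw; clear; lia.
      by rewrite W0 (negbTE (nj y _)) // mem_head.
  move=> k s1 kN Hf Hc HN1 [qs [cur [W Wk]]].
  have [cK|cK] := boolP (cur \in K).
    exists qs, cur; split; last by right.
    apply: upd; rewrite /p_step denote_if denote_skip.
    have -> // : tr s1 (enot (G_ aKK (X_ t1))) = false.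
    by rewrite trE trE /= (w_t1 W) (w_low W) //; have := q_KK H cur; rewrite cK => ->.
  case: Wk => [Wk|Wk]; last by rewrite Wk in cK.
  have [nx W'] := step_ok H wK W cK; exists (rcons qs cur), nx; split; first exact: upd.
  by left; rewrite size_rcons Wk.
set s1 := denote (for_ c1 p_step) s0 in IN *.
have F1 a j : a \notin writes (for_ c1 p_step) -> s1 a j = s0 a j by apply: frame.
clearbody s1; case: IN => qs [u [W Wk]].
(* N rounds without meeting [K] would have visited N distinct vertices, more than there are. *)
have {Wk} uK : u \in K.
  case: Wk => // Wk; have us := uniq_leq_size (w_uniq W) (fun x _ => mem_enum V x).
  rewrite size_enum_ord -Wk S0 // (b_N B) in us.
  by exfalso; have := leq_trans (nN L) us; clear; lia.
have [Wlow Wt0 Wt1 Wt2 Wt3 Wc Wa Wf Wu Wi Wd Wn Wr Wz1 Wz2 Wo] := W.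
pose P := (w, qs, u); exists P.
have m0 : 0 < size qs.
  by case: (qs) Wf => // E; move: yK; rewrite -E /pv /= uK.
have Ex : px P = last w qs by rewrite /px /= pv_last.
have yq : y \in qs by rewrite -Wf; apply: (@pv_in _ P); rewrite /= m0.
have Ebig : eval s1 (esumW (X_ t2)) = pbig F P.
  have m1 : (size qs).-1 < size qs by move: m0; clear; lia.
  have [_ _ _ h4] := Wr _ m1; rewrite prednK // -/P in h4.
  have h a b c : s1 (wix a b c) (last w qs) = ptab F P a b c by rewrite /ptab -h4 -Ex.
  have h' k a b c : 38 + k = wix a b c -> s1 (38 + k) (last w qs) = ptab F P a b c by move=> ->.
  rewrite /esumW /= Wt2 (h' 0 false false false) // (h' 1 false false true) //.
  rewrite (h' 2 false true false) // (h' 3 false true true) // (h' 4 true false false) //.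
  rewrite (h' 5 true false true) // (h' 6 true true false) // (h' 7 true true true) //.
  by rewrite /pbig !big_bool /=; clear; lia.
set s2 := denote p_finish s1.
have S2 a j : a \notin [:: aLEN; aXX; aUU; aBB; aADDS] -> s2 a j = s1 a j.
  by move=> an; rewrite /s2 frame // /p_finish /= !inE; move: an; rewrite !inE; clear; lia.
have E2 j : [/\ s2 aLEN j = if j == y then size qs else s1 aLEN j,
    s2 aXX j = if j == y then last w qs : nat else s1 aXX j,
    s2 aUU j = if j == y then u : nat else s1 aUU j
  & s2 aBB j = if j == y then pbig F P else s1 aBB j].
  have Eb (t : memory) : (forall a, (37 < a < 46) || (a == t2) -> t a =1 s1 a) ->
      eval t (esumW (X_ t2)) = pbig F P.
    by move=> Et; rewrite -Ebig /esumW /= !Et.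
  rewrite /s2 /p_finish; do 4 rewrite denote_seq; rewrite denote_if denote_skip.
  set b := tr _ _; rewrite (denote_put aBB) Eb; last first.
    by move=> a ar k; rewrite !denE !update_other //; move: ar; clear; lia.
  by case: b; rewrite !denE /update /= Wt0 Wt3 Wt2 Wt1.
have A2 : s2 aADDS 0 = s1 aADDS 0 + (if 3 < size qs then (2 * pbig F P).+1 else 0).
  have Eb (t : memory) : (forall a, (37 < a < 46) || (a == t2) -> t a =1 s1 a) ->
      eval t (esumW (X_ t2)) = pbig F P.
    by move=> Et; rewrite -Ebig /esumW /= !Et.
  rewrite /s2 /p_finish; do 4 rewrite denote_seq; rewrite denote_if denote_skip.
  rewrite trE (denote_put aBB) Eb; last first.
    by move=> a ar k; rewrite !denE !update_other //; move: ar; clear; lia.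
  rewrite !denE /update /= Wt0 Wt3; case: ifP => _ /=; rewrite ?eqxx //; clear; lia.
clearbody s2.
have low a j : 1 < a < 29 -> s2 a j = s a j.
  by move=> ar; rewrite S2 ?Wlow // !inE; move: ar; clear; lia.
have oth a (j : nat) : 28 < a < 47 -> (forall v, v \in qs -> j != v) -> s2 a j = s a j.
  move=> ar nj; have jy : j != y by apply: nj.
  have nj' v : v \in y :: qs -> j != v by rewrite inE => /predU1P[->|/nj].
  have s1E : s1 a j = s a j.
    have [a46|a46] := eqVneq a 46; last by apply: Wo => //; move: ar a46; clear; lia.
    by rewrite a46 F1 // S0.
  rewrite -s1E; have [e1 e2 e3 e4] := E2 j; rewrite (negbTE jy) in e1 e2 e3 e4.
  have [an|an] := boolP (a \in [:: aLEN; aXX; aUU; aBB; aADDS]); last exact: S2.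
  by move: an ar; rewrite !inE => /or4P[/eqP->|/eqP->|/eqP->|/orP[/eqP->|/eqP->]].
split=> //; last by move=> v vq; case: (Wi v vq).
have inP : inner K P.
  split=> //; first by move=> v /Wi[].
  move=> j jm; split; last by case: (Wn j jm).
  by have [] := Wi (pv P j.+1) _; first by apply: (@pv_in _ P).
split.
- by apply: corest_eq (q_core H) => a j ar; apply: low; move: ar; clear; lia.
- by move=> v; rewrite /lamm low //; apply: (q_lam H).
- exact: (q_KC H).
- by move=> v; rewrite low // (q_KK H).
- exact: (q_deg H).
- move=> v; rewrite /done /= -/(done Qs v); have [vq|vq] := boolP (v \in qs) => /=.
    have [j jm Ev] := @pqsP _ P v vq; case: j jm Ev => // j jm ->.
    by have [g1 _ _ _] := Wr j jm; rewrite S2 // g1.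
  rewrite oth ?(q_pid H) // => x xq; apply: contraNneq vq => /val_inj-> //.
- by move=> Q; rewrite inE => /predU1P[->|/(q_in H)].
- move=> Q; rewrite inE => /predU1P[->|QQ]; last first.
    apply: prow_eq (q_row H QQ); last by case: (q_in H QQ).
    move=> a j ar jQ; apply: oth => // v vq; apply/eqP => /val_inj E; subst v.
    by have [_ _ /negP] := Wi _ vq; apply; apply/hasP; exists Q.
  have [e1 e2 e3 e4] := E2 y; rewrite eqxx in e1 e2 e3 e4.
  have Ef : pv P 1 = y := Wf.
  split; rewrite ?Ef ?Ex //.
  + move=> j jm; have [g1 g2 g3 g4] := Wr j jm; split; rewrite ?S2 ?Ef // => a b c.
    by rewrite S2 //; case: (a); case: (b); case: (c).
  + by rewrite S2 // F1 // W0 eqxx.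
  + by move=> m1; rewrite S2 // Wz1.
  + by move=> m1; rewrite S2 // Wz2.
- have dd Q v : Q \in Qs -> v \in qs -> v \in pqs Q -> False.
    by move=> QQ vq vQ; have [_ _ /negP] := Wi _ vq; apply; apply/hasP; exists Q.
  move=> Q R v; rewrite !inE => /predU1P[->|QQ] /predU1P[->|RR] //=.
  + by move=> vq /(dd _ _ RR vq).
  + by move=> vQ vq; case: (dd _ _ QQ vq vQ).
  + exact: (q_disj H).
- rewrite /= (q_uniq H) andbT; apply/negP => PQ; have [_ _ /negP] := Wi _ yq; apply.
  by apply/hasP; exists P.
- rewrite A2 F1 // S0 // (q_adds H) big_cons /=; case: ifP => _; rewrite ?addn0 // addnC //.
Qed.


Lemma done_head P Qs v : v \in pqs P -> done (P :: Qs) v.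
Proof. by move=> vP; rewrite /done /= vP. Qed.

Lemma done_tail P Qs v : done Qs v -> done (P :: Qs) v.
Proof. by move=> vP; rewrite /done /= -/(done Qs v) vP orbT. Qed.

Lemma upd_path s K Qs c k : 47 < c -> pathst s K Qs -> pathst (update s c 0 k) K Qs.
Proof.
by move=> c47; apply: pathst_eq => a j ar; rewrite update_other //; move: c47 ar; clear; lia.
Qed.

Lemma tr_free s K Qs (v : V) : pathst s K Qs -> s c0 0 = v ->
  tr s (efree (X_ c0)) = [&& v \in C, v \notin K & ~~ done Qs v].
Proof.
move=> H Hc; rewrite /efree !trE /= Hc (l_alv (c_leaf (q_core H))) (q_KK H) (q_pid H).
by case: (v \in C).
Qed.

Lemma paths1_ok s K : pathst s K [::] ->
  exists2 Qs, pathst (denote p_paths1 s) K Qs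
  & forall v x, v \in C -> v \notin K -> x \in K -> A v x -> done Qs v.
Proof.
move=> H; have B := l_base (c_leaf (q_core H)).
pose Inv k (s1 : memory) := exists2 Qs, pathst s1 K Qs
  & forall v x : V, v < k -> v \in C -> v \notin K -> x \in K -> A v x -> done Qs v.
suff [Qs H1 H2] : Inv n (denote p_paths1 s) by exists Qs => // v x; apply: H2.
apply: (forV_ind (Inv := Inv) B) => //.
- by move=> j s1 x [Qs h1 h2]; exists Qs => //; apply: upd_path.
- by exists [::].
move=> v s1 B1 Hf Hc [Qs H1 IH].
have keep_ Qs' (s' : memory) : pathst s' K Qs' -> (forall x, done Qs x -> done Qs' x) ->
    (forall x, v \in C -> v \notin K -> x \in K -> A v x -> done Qs' v) -> Inv v.+1 s'.
  move=> H' mono Hv; exists Qs' => // u x; rewrite ltnS leq_eqVlt => /orP[/eqP/val_inj->|uv].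
    exact: Hv.
  by move=> uC uK xK ux; apply: mono; apply: IH ux.
rewrite (tr_free H1 Hc); case: ifP => [/and3P[vC vK vd]|fr]; last first.
  by apply: (keep_ Qs) => // x vC vK _ _; move: fr; rewrite vC vK /= => /negbFE.
rewrite denote_seq; set s2 := denote (setv t1 _) s1.
have H2 : pathst s2 K Qs by apply: upd_path.
have [a [b [[En ab nb1 nbs] _]]] := c_nb (q_core H2) vC (q_deg H2 vC vK).
have E2 : s2 c0 0 = v by rewrite /s2 denE update_other.
have T2 : s2 t1 0 = v by rewrite /s2 denE /update /= Hc.
have aN : a \in nbrs A C v by rewrite En !inE eqxx.
have bN : b \in nbrs A C v by rewrite En !inE eqxx orbT.
clearbody s2.
have go (s3 : memory) (w : V) : pathst s3 K Qs -> s3 t1 0 = v -> s3 t2 0 = w -> w \in K ->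
    w \in nbrs A C v -> Inv v.+1 (denote p_walk s3).
  move=> H3 h1 h2 wK; rewrite in_nbrs => /andP[_ vw].
  have [|P [H4 Ev _ _]] := walk_ok H3 h1 h2 vC vK vd wK; first by rewrite super_sym.
  apply: (keep_ (P :: Qs) _ H4) => [x|x _ _ _ _]; first exact: done_tail.
  by apply: done_head; rewrite -Ev; apply: pv_in; have [-> _ _ _ _] := q_in H4 (mem_head _ _).
rewrite denote_if trE /= E2 nb1 (q_KK H2); case: ifP => aK.
  rewrite denote_seq; apply: (go _ a) => //; first exact: upd_path.
  by rewrite denE /update /= E2.
rewrite denote_seq; set s3 := denote (setv t2 _) s2.
have T3 : s3 t2 0 = b by rewrite /s3 denE /update /= E2 nb1 nbs addKn.
have H3 : pathst s3 K Qs by apply: upd_path.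
have T13 : s3 t1 0 = v by rewrite /s3 denE update_other.
clearbody s3.
rewrite denote_if trE /= T3 (q_KK H3) denote_skip; case: ifP => bK; first exact: (go _ b).
apply: (keep_ Qs) => // x _ _ xK vx; exfalso.
have : x \in nbrs A C v by rewrite in_nbrs vx andbT; apply: (subsetP (q_KC H3)).
by rewrite En !inE => /orP[]/eqP E; rewrite E ?aK ?bK in xK.
Qed.

(** By [k_cl] the free vertices form a union of components of the core. A vertex chosen among them
    is therefore not connected to the vertices chosen before, and this keeps [k_disc] true. *)
Record splitK K0 K R Qs : Prop := SplitK {
  k_K : K = K0 :|: R;
  k_R : forall v, v \in R -> (v \in C) && (v \notin K0);
  k_cl : forall v x, v \in C -> v \notin K -> ~~ done Qs v -> x \in K -> ~~ A v x;
  k_disc : forall a b, a \in R -> b \in R -> connect (inC A C) a b -> a = b }.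

Lemma paths2_ok s K0 Qs0 : pathst s K0 Qs0 ->
  (forall v x, v \in C -> v \notin K0 -> x \in K0 -> A v x -> done Qs0 v) ->
  exists K R Qs, [/\ pathst (denote p_paths2 s) K Qs, splitK K0 K R Qs
    & forall v, v \in C -> v \notin K -> done Qs v].
Proof.
move=> H cl; have B := l_base (c_leaf (q_core H)).
pose Inv k (s1 : memory) := exists K R Qs, [/\ pathst s1 K Qs, splitK K0 K R Qs
    & forall v : V, v < k -> v \in C -> v \notin K -> done Qs v].
suff [K [R [Qs [h1 h2 h3]]]] : Inv n (denote p_paths2 s).
  by exists K, R, Qs; split=> // v; apply: h3.
apply: (forV_ind (Inv := Inv) B) => //.
- by move=> j s1 x [K [R [Qs [h1 h2 h3]]]]; exists K, R, Qs; split=> //; apply: upd_path.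
- exists K0, set0, Qs0; split=> //; split.
  + by rewrite setU0.
  + by move=> v; rewrite inE.
  + move=> v x vC vK vd xK; apply/negP => vx; case/negP: vd; exact: cl vx.
  + by move=> a b; rewrite inE.
move=> v s1 B1 Hf Hc [K [R [Qs [H1 SK IH]]]].
have [kK kR kcl kd] := SK.
rewrite (tr_free H1 Hc); case: ifP => [/and3P[vC vK vd]|fr]; last first.
  exists K, R, Qs; split=> // x; rewrite ltnS leq_eqVlt => /orP[/eqP/val_inj->|xv]; last exact: IH.
  by move=> vC vK; move: fr; rewrite vC vK /= => /negbFE.
have [a [b [[En ab nb1 nbs] _]]] := c_nb (q_core H1) vC (q_deg H1 vC vK).
have aN : a \in nbrs A C v by rewrite En !inE eqxx.
have : (a \in C) && A v a by rewrite -in_nbrs.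
case/andP=> aC va.
rewrite denote_seq; set s2 := denote (put aKK _ _) s1; pose K' := v |: K.
have S2 x j : x != aKK -> s2 x j = s1 x j by move=> xk; rewrite /s2 denE update_other.
have K2 j : s2 aKK j = if j == v then 1 else s1 aKK j by rewrite /s2 denE /update /= Hc.
have inK' P : P \in Qs -> inner K' P.
  move=> PQ; have [m0 un [wK uK] off nb] := q_in H1 PQ; split=> //.
    by rewrite !inE wK uK !orbT.
  move=> x xP; rewrite !inE negb_or (off x xP) andbT; apply: contraNneq vd => <-.
  by apply/hasP; exists P.
have H2 : pathst s2 K' Qs.
  have [h1 h2 h3 h4 h5 h6 h7 h8 h9 h10 h11] := H1; split=> //.
  - by apply: corest_eq h1 => x j ar; apply: S2; move: ar; clear; lia.
  - by apply/subsetP=> x; rewrite in_setU1 => /predU1P[->|/(subsetP h3)].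
  - move=> x; rewrite K2 !inE -h4; have [/val_inj->|nx] := eqVneq (nat_of_ord x) v; first by rewrite eqxx.
    by rewrite (_ : (x == v) = false) //; apply: contraNF nx => /eqP->.
  - by move=> x xC; rewrite !inE negb_or => /andP[_]; apply: h5.
  - move=> P PQ; apply: prow_eq (h8 P PQ); last by case: (h7 P PQ).
    by move=> x j xr _; apply: S2; move: xr; clear; lia.
rewrite denote_seq; set s3 := denote (setv t2 _) s2; rewrite denote_seq; set s4 := denote (setv t1 _) s3.
have H4 : pathst s4 K' Qs by do 2 apply: upd_path => //.
have T1 : s4 t1 0 = a by rewrite /s4 /s3 !denE /update /= !S2 // Hc.
have T2 : s4 t2 0 = v by rewrite /s4 /s3 !denE /update /= S2.
have aK : a \notin K by apply/negP => aK; have := kcl v a vC vK vd aK; rewrite va.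
have aK' : a \notin K'.
  by rewrite !inE negb_or aK andbT; apply: contraTneq va => ->; rewrite super_irr.
have ad : ~~ done Qs a.
  apply/negP => ad; have := done_adj H1 ad vC; rewrite super_sym => /(_ va).
  by rewrite (negbTE vK) (negbTE vd).
have vK' : v \in K' by rewrite !inE eqxx.
clearbody s2 s3 s4.
have [P [H5 Ea Ew Pd]] := walk_ok H4 T1 T2 aC aK' ad vK' va.
have [m0 un [_ uK] off nb] := q_in H5 (mem_head _ _).
have pxP : px P \in pqs P by apply: pv_in; rewrite m0 leqnn.
have mm : (size (pqs P)).-1.+1 = size (pqs P) by rewrite prednK.
have [xC xnb] := nb (size (pqs P)).-1 ltac:(by rewrite mm).
rewrite mm pvm in xC xnb.
have xu : A (px P) (pu P).
  by have : pu P \in nbrs A C (px P); [rewrite xnb !inE eqxx orbT|rewrite in_nbrs => /andP[]].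
(* Inside a component without older vertices of [K], the only vertex of [K] at which the walk can
   stop is [v] itself: the path closes a cycle. *)
have Eu : pu P = v.
  apply/eqP; move: uK; rewrite !inE => /predU1P[->//|uK]; exfalso.
  have xK : px P \notin K by have := off _ pxP; rewrite !inE negb_or => /andP[].
  by have := kcl (px P) (pu P) xC xK (Pd _ pxP) uK; rewrite xu.
have ddone x : x \in nbrs A C v -> done (P :: Qs) x.
  rewrite En !inE => /orP[]/eqP->; apply: done_head.
    by rewrite -Ea; apply: pv_in; rewrite m0.
  have : px P \in nbrs A C v by rewrite in_nbrs xC super_sym -Eu xu.
  rewrite En !inE => /orP[]/eqP E; last by rewrite -E.
  (* If the walk came back to [v] through [a], it would have [a] as its only inner vertex, with [v]
     as its only neighbour, against degree two. *)
  have m1 : size (pqs P) = 1.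
    have e : (size (pqs P)).-1 = 0.
      by move: E; rewrite -Ea /px !pvE ?m0 ?leqnn // => /eqP; rewrite nth_uniq ?mm //= => /eqP.
    by rewrite -mm e.
  have := q_deg H4 aC aK'; have [_] := nb 0 m0; rewrite Ea pv0 Ew => ->.
  have -> : pv P 2 = v by have := pvm P; rewrite m1 Eu.
  by rewrite setUid cards1.
exists K', (v |: R), (P :: Qs); split=> //.
- split.
  + by rewrite /K' kK setUCA.
  + move=> x; rewrite in_setU1 => /predU1P[->|/kR//].
    by move: vC vK; rewrite kK !inE negb_or => -> /andP[->].
  + move=> x z xCx; rewrite !inE negb_or => /andP[xv xK] xd.
    move=> /predU1P[->|zK]; last first.
      by apply: kcl => //; apply: contra xd; apply: done_tail.
    apply/negP => xvA; case/negP: xd; apply: ddone; rewrite in_nbrs super_sym xvA andbT.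
    exact: xCx.
  + pose U := [pred x | [&& x \in C, x \notin K & ~~ done Qs x]].
    have clU : closed (inC A C) U.
      have h x z : inC A C x z -> x \in U -> z \in U.
        move=> /and3P[xz xC' zC] /and3P[_ xK xd]; apply/and3P; split=> //.
          by apply/negP => zK; have := kcl x z xC' xK xd zK; rewrite xz.
        apply/negP => zd; have := done_adj H1 zd xC'; rewrite super_sym => /(_ xz).
        by rewrite (negbTE xK) (negbTE xd).
      move=> x z xz; apply/idP/idP; first exact: h.
      by apply: h; move: xz; rewrite /inC super_sym => /and3P[-> -> ->].
    have vU : v \in U by rewrite inE /= vC vK.
    have RU x : x \in R -> x \in U = false by move=> xR; rewrite inE /= kK !inE xR orbT /= andbF.
    move=> x z; rewrite !inE => /predU1P[->|xR] /predU1P[->|zR] //; last exact: kd.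
      by move=> /(closed_connect clU); rewrite vU RU.
    by move=> /(closed_connect clU); rewrite vU RU.
- move=> x; rewrite ltnS leq_eqVlt => /orP[/eqP/val_inj->|xv].
    by rewrite vK'.
  move=> xC'; rewrite !inE negb_or => /andP[_ xK]; apply: done_tail; exact: IH.
Qed.

End Walk.

(** * The decomposition found by the analysis *)

Section Analysis.
Variables (I : instance) (L : 'I_(nvert I) -> seq (seq 'I_(nvert I) * nat)).
Hypothesis HL : forall v, nonzero_list v (L v).
Notation n := (nvert I).
Notation V := 'I_n.
Notation A := (superstructure I).
Notation its := (its L).

Record anast (s : memory) (d : dec I) : Prop := AnaSt {
  a_path : pathst L (d_r d) (d_lam d) s (d_K d) (d_Q d);
  a_par : forall v, parm s v = d_par d v;
  a_ok : dec_ok its d;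
  a_id : forall v : V, s aID v = v /\ s aALL v = 1 }.

Lemma writes_paths1 : all (fun a => [|| 1 < a < 29, 28 < a < 48 | 59 < a < 90]) (writes p_paths1).
Proof. by vm_compute. Qed.

Lemma writes_paths2 : all (fun a => [|| 1 < a < 29, 28 < a < 48 | 59 < a < 90]) (writes p_paths2).
Proof. by vm_compute. Qed.

Lemma paths_ok s : init_ok L s ->
  let s' := denote p_paths2 (denote p_paths1 (denote p_scores (denote p_core
    (denote p_leaf (denote p_deg (denote p_parse (denote p_tables s))))))) in
  exists2 d, anast s' d & forall a i, 47 < a < 55 -> s' a i = 0.
Proof.
move=> /(to_core_ok HL); set s1 := denote p_scores _ => -[r [cs kn k1 Z ID]] s'.
clearbody s1; pose lam : V -> nat := lamm s1; pose K0 := [set v in alive r | 2 < #|nbrs A (alive r) v|].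
have Hp : pathst L r lam s1 K0 [::].
  split=> //.
  - by apply/subsetP=> v; rewrite inE => /andP[].
  - by move=> v; rewrite k1 [v \in K0]in_set; case: (_ && _).
  - move=> v vC; rewrite inE vC /= -leqNgt => d2; apply/eqP; rewrite eqn_leq d2.
    exact: (c_deg2 cs).
  - by move=> v; rewrite Z.
  - by rewrite Z // big_nil.
have [Qs1 H1 cl] := paths1_ok Hp.
have [K [R [Qs [H2 SK cov]]]] := paths2_ok H1 cl.
have fr a i : ~~ (1 < a < 29) -> ~~ (28 < a < 48) -> ~~ (59 < a < 90) -> s' a i = s1 a i.
  move=> l1 l2 l3; rewrite /s' frame; last first.
    by apply/negP => /(allP writes_paths2); rewrite /= (negbTE l1) (negbTE l2) (negbTE l3).
  by rewrite frame //; apply/negP => /(allP writes_paths1); rewrite /= (negbTE l1) (negbTE l2) (negbTE l3).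
exists (Dec r lam (parm s1) K R Qs); last first.
  by move=> a i ar; rewrite fr ?Z //; move: ar; clear; lia.
have [kK kR kcl kd] := SK.
split=> //.
- by move=> v; rewrite /parm /s' !frame.
- split=> //=.
  + exact: (l_elim (c_leaf cs)).
  + exact: (c_deg2 cs).
  + exact: (q_KC H2).
  + by rewrite kK subsetUr.
  + move=> v; rewrite kK in_setU => /orP[|->//]; rewrite inE => /andP[] //.
  + by move=> v /kR/andP[vC vK]; apply: (q_deg Hp).
  + exact: (q_uniq H2).
  + exact: (q_disj H2).
  + move=> P /(q_in H2)[m0 un wu off nb]; split=> // j /nb[pC En]; split=> // x xC.
    by have /setP/(_ x) := En; rewrite in_nbrs xC in_set2.
  + by move=> P v /(q_in H2)[_ _ _ off _]; apply: off.
  + by move=> v vC vK; have /hasP[P PQ vP] := cov v vC vK; exists P.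
- by move=> v; rewrite !fr.
Qed.

End Analysis.

(** ** Output *)

Definition agree_off (X : seq nat) (s s' : memory) := forall a j, a \notin X -> s' a j = s a j.

Lemma agree_trans X s1 s2 s3 : agree_off X s1 s2 -> agree_off X s2 s3 -> agree_off X s1 s3.
Proof. by move=> h1 h2 a j aX; rewrite h2 // h1. Qed.

Lemma agree_sub X Y s s' : all (mem Y) X -> agree_off X s s' -> agree_off Y s s'.
Proof. by move=> /allP XY H a j aY; apply: H; apply: contra aY => /XY. Qed.

Lemma agree_frame X p s : all (mem X) (writes p) -> agree_off X s (denote p s).
Proof. by move=> /allP XY a j aX; apply: frame; apply: contra aX => /XY. Qed.

Lemma base_agree I L X s s' : all (fun a => a \notin X) base_arrays -> agree_off X s s' ->
  @base I L s -> base L s'.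
Proof. by move=> /allP h H; apply: base_eq => a j /h; apply: H. Qed.

Fixpoint earrays (e : expr) : seq nat :=
  match e with
  | Const _ => [::]
  | Get a e1 => a :: earrays e1
  | Add e1 e2 | Defs.Sub e1 e2 => earrays e1 ++ earrays e2
  end.

Lemma eval_off X s s' e : agree_off X s s' -> all (fun a => a \notin X) (earrays e) ->
  eval s' e = eval s e.
Proof.
move=> H; elim: e => [//|a e IH|e1 IH1 e2 IH2|e1 IH1 e2 IH2] /=.
- by case/andP=> aX eX; rewrite IH // H.
- by rewrite all_cat => /andP[h1 h2]; rewrite IH1 ?IH2.
- by rewrite all_cat => /andP[h1 h2]; rewrite IH1 ?IH2.
Qed.

Definition outst (s : memory) (w : seq nat) :=
  s aOP 0 = size w /\ forall i, i < size w -> s 1 i = nth 0 w i.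

Lemma outst_off s s' w : (forall a j, a \in [:: 1; aOP] -> s' a j = s a j) -> outst s w -> outst s' w.
Proof. by move=> E [h1 h2]; split=> [|i iw]; rewrite E ?h1 ?h2. Qed.

Lemma emit_ok s w e : outst s w -> outst (denote (emit e) s) (rcons w (eval s e)).
Proof.
move=> [h1 h2]; split; first by rewrite !denE /update /= h1 addn1 size_rcons.
move=> i; rewrite size_rcons ltnS leq_eqVlt nth_rcons !denE /update /= h1.
by case: eqP => [->|_] /=; [rewrite ltnn|move=> iw; rewrite iw h2].
Qed.

Lemma emits_off es s : agree_off [:: 1; aOP] s (denote (emits es) s).
Proof.
elim: es s => [|e es IH] s; first by [].
rewrite /emits /= denote_seq; apply: agree_trans (IH _).
exact: agree_frame.
Qed.

Lemma emits_ok es s w : outst s w ->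
  all (fun e => all (fun a => a \notin [:: 1; aOP]) (earrays e)) es ->
  outst (denote (emits es) s) (w ++ [seq eval s e | e <- es]).
Proof.
elim: es s w => [|e es IH] s w H /=; first by rewrite cats0.
case/andP=> eX esX; rewrite /emits /= denote_seq.
have := IH _ _ (emit_ok e H) esX; rewrite cat_rcons; congr (outst _ (_ ++ _ :: _)).
have Ea : agree_off [:: 1; aOP] s (denote (emit e) s) by exact: agree_frame.
elim: es esX {IH} => //= x es' IH' /andP[h1 h2].
by rewrite IH' // (eval_off Ea h1).
Qed.

Definition tmp_out := [:: 1; aOP; aSZ; aZP; c3].

(** The reserved cell for the length counts as a written 0 during the loop and receives its value at
    the end, so the invariant carries [rcons w 0]. *)
Lemma emit_set_ok s w T E (t : nat -> bool) (f : nat -> nat) (m := s aN 0)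
    (s' := denote (emit_set T E) s) (l := [seq f k | k <- iota 0 m & t k]) :
  (forall s1 k, agree_off tmp_out s s1 -> s1 c3 0 = k -> k < m ->
     tr s1 T = t k /\ (t k -> eval s1 E = f k)) ->
  outst s w -> outst s' (w ++ size l :: l) /\ agree_off tmp_out s s'.
Proof.
move=> HT Hw; split; last exact: agree_frame.
rewrite /s' /emit_set denote_seq; set s1 := denote _ s; rewrite denote_seq; set s2 := denote (emit _) s1.
rewrite denote_seq; set s3 := denote _ s2.
have Hw1 : outst s1 w by apply: outst_off Hw => a j; rewrite !inE => /orP[]/eqP->; rewrite /s1 denE update_other.
have Z1 : s1 aZP 0 = size w by rewrite /s1 denE /update /=; case: Hw.
have Hw3 : outst s3 (rcons w 0).
  by apply: outst_off (emit_ok (C_ 0) Hw1) => a j; rewrite !inE => /orP[]/eqP->; rewrite /s3 denE update_other.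
have Z3 : s3 aZP 0 = size w by rewrite /s3 denE update_other // /s2 frame.
have S3 : s3 aSZ 0 = 0 by rewrite /s3 denE /update.
have A3 : agree_off tmp_out s s3.
  apply: (agree_trans (s2 := s1)); first exact: agree_frame.
  by apply: (agree_trans (s2 := s2)); apply: agree_frame.
clearbody s3; clear s2 s1 Hw1 Z1.
have N3 : s3 aN 0 = m by rewrite A3.
pose lk k := [seq f k | k <- iota 0 k & t k].
pose Inv k (x : memory) := [/\ outst x (rcons w 0 ++ lk k), x aSZ 0 = size (lk k), x aZP 0 = size w
  & agree_off tmp_out s x].
rewrite denote_seq; set s4 := denote (for_ c3 _) s3.
have : Inv (s3 aN 0) s4.
  apply: for_ind => //.
    split; rewrite ?cats0 //.
    by move=> a j aX; rewrite update_other ?A3 //; apply: contraNneq aX => ->.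
  move=> k x; rewrite N3 => km _ Hc _ [Ho Hs Hz Ha].
  have lkS : lk k.+1 = if t k then rcons (lk k) (f k) else lk k.
    by rewrite /lk -addn1 iotaD filter_cat map_cat /= add0n; case: (t k); rewrite ?cats0 // cats1.
  have [Ht Hv] := HT x k Ha Hc km.
  have up y : Inv k.+1 y -> Inv k.+1 (update y c3 0 k.+1).
    move=> [g1 g2 g3 g4]; split; rewrite ?update_other //.
    by move=> a j aX; rewrite update_other ?g4 //; apply: contraNneq aX => ->.
  apply: up; rewrite denote_if Ht denote_skip; case Etk: (t k); last first.
    by split=> //; rewrite lkS Etk.
  rewrite denote_seq; set y := denote (emit E) x.
  have Hy : outst y (rcons w 0 ++ lk k.+1).
    by rewrite lkS Etk -rcons_cat -Hv // /y; apply: emit_ok.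
  have Sy : y aSZ 0 = size (lk k) by rewrite /y frame.
  have Zy : y aZP 0 = size w by rewrite /y frame.
  have Ay : agree_off tmp_out s y by apply: agree_trans Ha _; apply: agree_frame.
  clearbody y; split.
  - by apply: outst_off Hy => a j; rewrite !inE => /orP[]/eqP->; rewrite denE update_other.
  - by rewrite denE /update /= Sy lkS Etk size_rcons addn1.
  - by rewrite denE update_other.
  - by apply: agree_trans Ay _; apply: agree_frame.
rewrite N3 => -[[Ho1 Ho2] Hs Hz _]; rewrite -/(lk m) in l *; clearbody s4.
rewrite denote_put /= Hs Hz; split.
  by rewrite update_other // Ho1 !size_cat size_rcons /= addSnnS.
move=> i; rewrite size_cat /= => iw; rewrite /update /= nth_cat.
have [->|nw] := eqVneq i (size w); first by rewrite ltnn subnn.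
rewrite Ho2; last by rewrite size_cat size_rcons addSnnS.
rewrite cat_rcons nth_cat; case: ltnP => // wi.
by case Ei: (i - size w) => [|k] //; exfalso; move: Ei wi nw; clear; lia.
Qed.

Lemma iota_enum n m (t : nat -> bool) (f : nat -> nat) : n <= m ->
  (forall k, n <= k -> t k = false) ->
  [seq f k | k <- iota 0 m & t k] = [seq f (nat_of_ord x) | x <- enum 'I_n & t (nat_of_ord x)].
Proof.
move=> nm t0; rewrite -(subnKC nm) iotaD filter_cat map_cat add0n.
rewrite (_ : [seq k <- iota n _ | t k] = [::]) ?cats0; last first.
  rewrite -(filter_pred0 (iota n (m - n))); apply: eq_in_filter => k.
  by rewrite mem_iota => /andP[nk _]; rewrite t0.
by rewrite -(val_enum_ord n) filter_map -map_comp; congr map; apply: eq_filter.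
Qed.

Lemma card_ord_ltS m (P : pred 'I_m) (v : 'I_m) :
  #|[set b : 'I_m | P b & b < v.+1]| = #|[set b : 'I_m | P b & b < v]| + P v.
Proof.
rewrite (cardsD1 v) !inE ltnSn andbT addnC; congr (_ + _).
apply: eq_card => b; rewrite !inE -(inj_eq val_inj) /=.
by case: (P b) => /=; rewrite ?andbF //; clear; lia.
Qed.

Lemma sum_pow2_lt n (f : nat -> bool) : \sum_(i < n) f i * 2 ^ i < 2 ^ n.
Proof.
elim: n => [|n IH]; first by rewrite big_ord0.
rewrite big_ord_recr /= expnS; move: IH; case: (f n) => /=; lia.
Qed.

Lemma sum_pow2_inj n (f g : nat -> bool) :
  \sum_(i < n) f i * 2 ^ i = \sum_(i < n) g i * 2 ^ i -> forall i, i < n -> f i = g i.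
Proof.
elim: n => [|n IH] // E i; rewrite !big_ord_recr /= in E.
have lf := sum_pow2_lt n f; have lg := sum_pow2_lt n g.
have Efg : f n = g n by move: E lf lg; case: (f n); case: (g n) => //=; lia.
rewrite ltnS leq_eqVlt => /predU1P[->//|]; apply: IH.
by move: E; rewrite Efg => /addIn.
Qed.

(** * Kept vertices, their numbering, and the tournament *)

Section Keep.
Variables (I : instance) (L : 'I_(nvert I) -> seq (seq 'I_(nvert I) * nat)).
Hypothesis HL : forall v, nonzero_list v (L v).
Notation n := (nvert I).
Notation V := 'I_n.
Notation A := (superstructure I).
Notation slots := (slots L).
Notation its := (its L).
Notation word := (word L).
Notation N := (size word).
Notation base := (base L).
Notation leafst := (leafst L).
Notation slot_at i := (tnth (in_tuple slots) i).
Notation item_at i := (item (slot_at i)).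
Variable d : dec I.
Notation anast := (fun s => anast L s d).
Notation lam := (d_lam d).
Notation C := (alive (d_r d)).
Notation K := (d_K d).
Notation Qs := (d_Q d).
Notation Ps := (longs d).
Notation F := (ascore its lam C).
Notation kept := (kept d).

Lemma scode_inj (Y Z : {set V}) : scode Y = scode Z -> Y = Z.
Proof.
have E (X : {set V}) : scode X = \sum_(i < n) [exists x : V, (x == i :> nat) && (x \in X)] * 2 ^ i.
  rewrite /scode big_mkcond; apply: eq_bigr => i _.
  have -> : [exists x : V, (x == i :> nat) && (x \in X)] = (i \in X).
    by apply/existsP/idP => [[x /andP[/eqP/val_inj->]]//|iX]; exists i; rewrite eqxx.
  by case: (i \in X); rewrite ?mul1n.
rewrite !E => H; apply/setP => x.
have := sum_pow2_inj (f := fun i => [exists x : V, (x == i :> nat) && (x \in Y)])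
  (g := fun i => [exists x : V, (x == i :> nat) && (x \in Z)]) H (ltn_ord x).
have e (X : {set V}) : [exists y : V, (y == x :> nat) && (y \in X)] = (x \in X).
  by apply/existsP/idP => [[y /andP[/eqP/val_inj->]]//|xX]; exists x; rewrite eqxx.
by rewrite !e.
Qed.

(** The vertices that keep their own score list: those of the core that lie inside no long path. *)
Definition nrm (v : V) := (v \in C) && ~~ onpath Ps v.

Lemma on_path s v : anast s -> v \in C -> v \notin K -> exists P j,
  [/\ P \in Qs, j < size (pqs P), v = pv P j.+1, s aPOS v = j.+1 & s aPID v = (pv P 1).+1].
Proof.
move=> H vC vK; have [P PQ vP] := ok_cover (a_ok H) vC vK.
have [j jm Ev] := pqsP vP; case: j jm Ev => // j jm Ev; exists P, j; split=> //;
by have [h1 h2 _ _] := r_row (q_row (a_path H) PQ) jm; rewrite Ev.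
Qed.

Lemma onpath_pv s P j : anast s -> P \in Qs -> j < size (pqs P) ->
  onpath Ps (pv P j.+1) = (3 < size (pqs P)).
Proof.
move=> H PQ jm; have jP : pv P j.+1 \in pqs P by apply: pv_in.
apply/idP/idP => [|l]; rewrite /onpath.
  case E: (pof Ps (pv P j.+1)) => [Q|] // _; have [QP jQ] := pofS E.
  by have [QQ l] := longsP QP; rewrite (ok_disj (a_ok H) PQ QQ jP jQ).
by rewrite (pofP (Ps_disj (a_ok H)) (P := P)) // mem_filter l.
Qed.

Lemma anast_eq s s' : (forall a j, 1 < a < 48 -> s' a j = s a j) ->
  (forall a j, a \in [:: aID; aALL] -> s' a j = s a j) -> anast s -> anast s'.
Proof.
move=> E E' [h1 h2 h3 h4]; split=> //.
- exact: pathst_eq h1.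
- by move=> v; rewrite -h2 /parm E.
- by move=> v; rewrite !E'.
Qed.

Record keepst (s : memory) : Prop := KeepSt {
  e_ana : anast s;
  e_nrm : forall v : V, s aNRM v = nrm v;
  e_kept : forall v : V, s aKEPT v = (v \in kept);
  e_nk : s aNK 0 = #|kept|;
  e_old : forall i : 'I_#|kept|, s aOLD i = enum_val i;
  e_new : forall i : 'I_#|kept|, s aNEW (enum_val i) = i }.

Lemma keep_ok s : anast s -> (forall a i, 47 < a < 55 -> s a i = 0) ->
  keepst (denote p_keep s).
Proof.
move=> H Z; have B := l_base (c_leaf (q_core (a_path H))).
(* The program numbers the kept vertices in increasing order; at the end this list is [enum kept],
   so the numbering agrees with [enum_val]. *)
pose lk k := [seq v <- take k (enum V) | v \in kept].
pose Inv k (s1 : memory) := [/\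
  forall v : V, s1 aNRM v = (v < k) && nrm v,
  forall v : V, s1 aKEPT v = (v < k) && (v \in kept),
  s1 aNK 0 = size (lk k)
  & forall l1 x l2, lk k = l1 ++ x :: l2 -> s1 aOLD (size l1) = x /\ s1 aNEW x = size l1].
have lkS (v : V) : lk v.+1 = if v \in kept then rcons (lk v) v else lk v.
  rewrite /lk (take_nth v) ?size_enum_ord // filter_rcons.
  by rewrite (_ : nth v (enum V) v = v) //; apply: val_inj; rewrite /= nth_enum_ord.
have : Inv n (denote p_keep s).
  apply: (forV_ind (Inv := Inv) B) => //.
    split; [by move=> v; rewrite Z|by move=> v; rewrite Z|by rewrite Z // /lk take0|].
    by move=> l1 x l2; rewrite /lk take0; case: l1.
  move=> v s1 B1 Hf Hc [h1 h2 h3 h4]; rewrite trE /= Hc Hf //.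
  have H1 : anast s1.
    apply: anast_eq H => a j ar; apply: Hf; rewrite !inE; move: ar; first by clear; lia.
    by rewrite !inE => /orP[]/eqP->.
  rewrite (l_alv (c_leaf (q_core (a_path H)))); case vC: (v \in C) => /=; last first.
    have nv : nrm v = false by rewrite /nrm vC.
    have kv : v \in kept = false by rewrite inE /keep vC.
    have lt x : (x < v.+1) = (x == v :> nat) || (x < v) by rewrite ltnS leq_eqVlt.
    split=> //; rewrite ?lkS ?kv // => x; rewrite lt; have [/val_inj->|nx] //= := eqVneq (nat_of_ord x) v.
    - by rewrite h1 nv !andbF.
    - by rewrite h2 kv !andbF.
  set cnd1 := (G_ aKK (X_ c0) +' elt (elen (X_ c0)) (C_ 4)).
  have T1 : tr s1 cnd1 = nrm v.
    rewrite /cnd1 /nrm vC !trE /= Hc (q_KK (a_path H1)).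
    have [vK|vK] := boolP (v \in K) => /=; first by rewrite (offK (a_ok H1) vK).
    have [P [j [PQ jm Ev Ep Ei]]] := on_path H1 (idP vC) vK.
    by rewrite Ei subn1 /= (r_len (q_row (a_path H1) PQ)) Ev (onpath_pv H1) // -leqNgt.
  rewrite denote_seq; set s2 := denote (when cnd1 _) s1.
  have N2 x : s2 aNRM x = if x == v then nrm v : nat else s1 aNRM x.
    rewrite /s2 when_putE T1 eqxx /= Hc; case: (nrm v) => //=.
    case: eqP => // ->; rewrite h1 ltnn //.
  have S2 a x : a != aNRM -> s2 a x = s1 a x.
    by move=> an; rewrite /s2 when_putE (negbTE an) andbF.
  clearbody s2.
  set cnd2 := (G_ aNRM (X_ c0) +' elt (G_ aPOS (X_ c0)) (C_ 4) +' eeq (G_ aPOS (X_ c0)) (elen (X_ c0))).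
  have Hc2 : s2 c0 0 = v by rewrite S2.
  have T2 : tr s2 cnd2 = (v \in kept).
    rewrite /cnd2 !trE /= Hc2 N2 eqxx !S2 //.
    have [vK|vK] := boolP (v \in K).
      by rewrite (kept_K (a_ok H1) vK) /nrm vC (offK (a_ok H1) vK).
    have [P [j [PQ jm Ev Ep Ei]]] := on_path H1 (idP vC) vK.
    rewrite Ei subn1 /= (r_len (q_row (a_path H1) PQ)) Ep /nrm vC {1}Ev (onpath_pv H1) //.
    have -> : (v \in kept) = (pv P j.+1 \in kept) by rewrite Ev.
    rewrite -(kept_pv (a_ok H1) PQ) // -leqNgt /=.
    by case: (size (pqs P) <= 3).
  rewrite denote_if T2 denote_skip.
  have lt (x : V) : (x < v.+1) = (x == v :> nat) || (x < v) by rewrite ltnS leq_eqVlt.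
  have n2 (x : V) : s2 aNRM x = (x < v.+1) && nrm x.
    rewrite N2 lt; have [/val_inj->|nx] //= := eqVneq (nat_of_ord x) v.
  case kv: (v \in kept); last first.
    split.
    - exact: n2.
    - move=> x; rewrite S2 // lt h2; have [/val_inj->|nx] //= := eqVneq (nat_of_ord x) v.
      by rewrite kv andbF.
    - by rewrite S2 // lkS kv.
    - by move=> l1 x l2; rewrite lkS kv => E; rewrite !S2 //; apply: h4 E.
  set s3 := denote _ s2.
  have S3 a x : a \notin [:: aKEPT; aNEW; aOLD; aNK] -> s3 a x = s2 a x.
    by rewrite !inE !negb_or => /and4P[? ? ? ?]; rewrite /s3 !denE !update_other.
  have K3 x : s3 aKEPT x = if x == v then 1 else s2 aKEPT x by rewrite /s3 !denE /update /= Hc2.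
  have W3 x : s3 aNEW x = if x == v then s2 aNK 0 else s2 aNEW x by rewrite /s3 !denE /update /= Hc2.
  have O3 x : s3 aOLD x = if x == s2 aNK 0 then v : nat else s2 aOLD x by rewrite /s3 !denE /update /= Hc2.
  have M3 : s3 aNK 0 = s2 aNK 0 + 1 by rewrite /s3 !denE /update /=.
  clearbody s3; split.
  - by move=> x; rewrite S3.
  - move=> x; rewrite K3 lt S2 // h2; have [/val_inj->|nx] //= := eqVneq (nat_of_ord x) v.
    by rewrite kv.
  - by rewrite M3 S2 // h3 lkS kv size_rcons addn1.
  - move=> l1 x l2; rewrite lkS kv O3 W3 !S2 // h3.
    case/lastP: l2 => [|l2 z]; first by rewrite cats1 => /rcons_inj[-> ->]; rewrite !eqxx.
    rewrite -rcons_cons -rcons_cat => /rcons_inj[E _]; have [e1 e2] := h4 _ _ _ E.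
    have -> : (size l1 == size (lk v)) = false by rewrite E size_cat /=; clear; lia.
    have xl : x \in lk v by rewrite E mem_cat mem_head orbT.
    have xv : x < v.
      move: xl; rewrite mem_filter => /andP[_]; move/(map_f (@nat_of_ord n)).
      rewrite map_take val_enum_ord take_iota mem_iota => /andP[_]; clear; lia.
    by rewrite (_ : (nat_of_ord x == v) = false) //; move: xv; clear; lia.
case=> h1 h2 h3 h4.
have lkn : lk n = enum kept.
  by rewrite /lk take_oversize ?size_enum_ord // [in RHS]/enum_mem -enumT.
have sp (i : 'I_#|kept|) : enum kept = take i (enum kept) ++ enum_val i :: drop i.+1 (enum kept).
  rewrite (enum_val_nth (enum_val i)) -drop_nth ?cat_take_drop //.
  by rewrite -cardE.
have st (i : 'I_#|kept|) : size (take i (enum kept)) = i by rewrite size_takel // -cardE ltnW.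
split.
- apply: anast_eq H => a j ar; apply: frame; rewrite /p_keep /= !inE; move: ar; first by clear; lia.
  by rewrite !inE => /orP[]/eqP->.
- by move=> v; rewrite h1 ltn_ord.
- by move=> v; rewrite h2 ltn_ord.
- by rewrite h3 lkn -cardE.
- by move=> i; have [] := h4 _ _ _ (etrans lkn (sp i)); rewrite st.
- by move=> i; have [] := h4 _ _ _ (etrans lkn (sp i)); rewrite st.
Qed.

Definition ival (i : 'I_(size slots)) :=
  (item_at i).2 - \sum_(x in (item_at i).1.2 :\: C) lam x.
Definition iset (i : 'I_(size slots)) := (item_at i).1.2 :&: C.
Definition iown (i : 'I_(size slots)) : V := (slot_at i).1.
(** Among the slots with the same owner and alive part this is a strict total order, so exactly one
    of them is unbeaten. *)
Definition beats (j i : 'I_(size slots)) :=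
  [&& iown j == iown i, iset j == iset i & (ival i < ival j) || (ival i == ival j) && (j < i)].
Definition win (i : 'I_(size slots)) :=
  [&& nrm (iown i), 0 < ival i & ~~ [exists j, beats j i]].

Lemma ana_val s (i : 'I_(size slots)) : anast s -> s aVAL i - s aLOSS i = ival i.
Proof.
move=> H; rewrite (b_VAL (l_base (c_leaf (q_core (a_path H))))) (l_loss (c_leaf (q_core (a_path H)))).
by congr (_ - _); apply: eq_bigr => x _; rewrite (q_lam (a_path H)).
Qed.

Lemma ana_code s (i j : 'I_(size slots)) : anast s ->
  (s aCODE i == s aCODE j) = (iset i == iset j).
Proof.
move=> H; rewrite !(l_code (c_leaf (q_core (a_path H)))).
by apply/eqP/eqP => [/scode_inj //|E]; rewrite -/(iset i) -/(iset j) E.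
Qed.

Definition p_win1 :=
  for_ c1 (when (eand (elt (X_ c1) (X_ aIT))
         (eand (eeq (G_ aOWN (X_ c1)) (G_ aOWN (X_ c0)))
         (eand (eeq (G_ aCODE (X_ c1)) (G_ aCODE (X_ c0)))
           (elt (eval_item (X_ c0)) (eval_item (X_ c1)) +'
            eand (eeq (eval_item (X_ c0)) (eval_item (X_ c1))) (elt (X_ c1) (X_ c0))))))
       (setv t0 (C_ 0))).

Lemma win1_ok s (i : 'I_(size slots)) : anast s -> s c0 0 = i -> s t0 0 = 1 ->
  denote p_win1 s t0 0 = ~~ [exists j, beats j i].
Proof.
move=> H Hc T; have B := l_base (c_leaf (q_core (a_path H))).
pose Inv k (s1 : memory) := s1 t0 0 = ~~ [exists j : 'I_(size slots), (j < k) && beats j i].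
suff -> : Inv (size slots) (denote p_win1 s).
  by congr (nat_of_bool (~~ _)); apply: eq_existsb => j; rewrite ltn_ord.
apply: (forI_ind (Inv := Inv) B) => //.
  by rewrite /Inv T (_ : [exists j, _] = false) //; apply/existsP => -[].
move=> j s1 B1 Hf Hc1 IH.
have H1 : anast s1.
  apply: anast_eq H => a k ar; apply: Hf; rewrite !inE; move: ar; first by clear; lia.
  by rewrite !inE => /orP[]/eqP->.
have Hc0 : s1 c0 0 = i by rewrite Hf.
have -> : tr s1 (eand (eeq (G_ aOWN (X_ c1)) (G_ aOWN (X_ c0)))
         (eand (eeq (G_ aCODE (X_ c1)) (G_ aCODE (X_ c0)))
           (elt (eval_item (X_ c0)) (eval_item (X_ c1)) +'
            eand (eeq (eval_item (X_ c0)) (eval_item (X_ c1))) (elt (X_ c1) (X_ c0))))) = beats j i.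
  rewrite !trE /= Hc1 Hc0 !(ana_val _ H1) (ana_code _ _ H1) !(b_OWN B1) /beats.
  by congr (_ && _); apply/eqP/eqP => [/val_inj|->].
have ES : [exists k : 'I_(size slots), (k < j.+1) && beats k i] =
    [exists k : 'I_(size slots), (k < j) && beats k i] || beats j i.
  apply/existsP/orP => [[k /andP[]]|[/existsP[k /andP[kj bk]]|bj]].
  - by rewrite ltnS leq_eqVlt => /orP[/eqP/val_inj->|kj bk]; [right|left; apply/existsP; exists k; rewrite kj].
  - by exists k; rewrite ltnS ltnW.
  - by exists j; rewrite ltnSn.
rewrite /Inv ES; case: (beats j i); last by rewrite orbF.
by rewrite orbT denE /update.
Qed.

Record winst (s : memory) : Prop := WinSt {
  n_keep : keepst s;
  n_win : forall i : 'I_(size slots), s aWIN i = win i;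
  n_cnt : forall v : V, s aCNT v = #|[set i | win i & iown i == v]| }.

Lemma keepst_eq s s' : (forall a j, 1 < a < 53 -> s' a j = s a j) ->
  (forall a j, a \in [:: aID; aALL] -> s' a j = s a j) -> keepst s -> keepst s'.
Proof.
move=> E E' [h1 h2 h3 h4 h5 h6]; split.
- by apply: anast_eq h1 => // a j ar; apply: E; move: ar; clear; lia.
- by move=> v; rewrite E.
- by move=> v; rewrite E.
- by rewrite E.
- by move=> i; rewrite E.
- by move=> i; rewrite E.
Qed.

Lemma win_ok s : keepst s -> (forall i, s aWIN i = 0) -> (forall i, s aCNT i = 0) ->
  winst (denote p_win s).
Proof.
move=> H Z1 Z2; have B := l_base (c_leaf (q_core (a_path (e_ana H)))).
pose Inv k (s1 : memory) := (forall i : 'I_(size slots), s1 aWIN i = (i < k) && win i) /\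
  (forall v : V, s1 aCNT v = #|[set i : 'I_(size slots) | win i && (iown i == v) & i < k]|).
have : Inv (size slots) (denote p_win s).
  apply: (forI_ind (Inv := Inv) B) => //.
    split=> [i|v]; rewrite ?Z1 ?Z2 //; apply/esym/eqP; rewrite cards_eq0; apply/eqP/setP=> i.
    by rewrite !inE andbF.
  move=> i s1 B1 Hf Hc [h1 h2].
  have H1 : keepst s1.
    apply: keepst_eq H => a j ar; apply: Hf; rewrite /= !inE; move: ar; first by clear; lia.
    by rewrite !inE => /orP[]/eqP->.
  have H1' := e_ana H1.
  have -> : tr s1 (eand (G_ aNRM (G_ aOWN (X_ c0))) (eval_item (X_ c0))) = nrm (iown i) && (0 < ival i).
    rewrite tr_and trE /= Hc (b_OWN B1) (e_nrm H1) /tr /= Hc (ana_val _ H1') lt0n.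
    by rewrite -/(iown i); case: (nrm _).
  have lt (x : 'I_(size slots)) : (x < i.+1) = (x == i :> nat) || (x < i) by rewrite ltnS leq_eqVlt.
  have Hstep (s' : memory) : (forall j, s' aWIN j = if j == i :> nat then win i : nat else s1 aWIN j) ->
      (forall v : V, s' aCNT v = if v == iown i then s1 aCNT v + win i else s1 aCNT v) -> Inv i.+1 s'.
    move=> e1 e2; split=> [j|v].
      by rewrite e1 lt; have [/val_inj->|nj] //= := eqVneq (nat_of_ord j) i.
    rewrite e2 (card_ord_ltS (fun j => win j && (iown j == v))) -h2.
    by rewrite [v == _]eq_sym; case: eqP => _; rewrite ?andbT ?andbF ?addn0.
  case nv: (nrm (iown i) && (0 < ival i)); last first.
    have wi : win i = false by rewrite /win andbA nv.
    apply: Hstep => [j|v]; rewrite wi ?addn0; last by case: ifP.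
    by case: eqP => // ->; rewrite h1 ltnn.
  rewrite denote_seq; set s2 := denote (setv t0 _) s1; rewrite denote_seq.
  have H2 : anast s2.
    by apply: anast_eq H1' => a j ar; rewrite /s2 denE update_other //; move: ar; rewrite ?inE; clear; lia.
  have S2 a j : a != t0 -> s2 a j = s1 a j by move=> at0; rewrite /s2 denE update_other.
  have := win1_ok (i := i) H2; rewrite S2 // => /(_ Hc); rewrite {1}/s2 denE /update /= => /(_ erefl).
  rewrite -/p_win1; set s3 := denote p_win1 s2 => T3.
  have S3 a j : a \notin [:: c1; t0] -> s3 a j = s1 a j.
    by move=> an; rewrite /s3 frame ?S2 //; move: an; rewrite !inE; clear; lia.
  have wi : ~~ [exists j, beats j i] = win i by rewrite /win andbA nv.
  rewrite wi in T3; clearbody s3.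
  have C3 : s3 c0 0 = i by rewrite S3.
  have O3 : s3 aOWN i = iown i by rewrite S3 // (b_OWN B1).
  apply: Hstep => [j|v]; rewrite !denE /update /= C3 T3 ?O3 S3 //.
  by rewrite S3 // (inj_eq val_inj); case: eqP => // ->.
case=> h1 h2; split.
- apply: keepst_eq H => a j ar; apply: frame; rewrite /p_win /= !inE; move: ar; first by clear; lia.
  by rewrite !inE => /orP[]/eqP->.
- by move=> i; rewrite h1 ltn_ord.
- by move=> v; rewrite h2; apply: eq_card => i; rewrite !inE ltn_ord andbT.
Qed.

End Keep.

Lemma analysis_ok I (L : 'I_(nvert I) -> seq (seq 'I_(nvert I) * nat)) s :
  (forall v, nonzero_list v (L v)) -> init_ok L s ->
  exists d, winst L d (denote p_analysis s).
Proof.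
move=> HL Hs; rewrite /p_analysis; do 9 rewrite denote_seq.
have [d H Z] := paths_ok HL Hs; exists d.
set s1 := denote p_paths2 _ in H Z *; clearbody s1.
apply: win_ok; first by apply: keep_ok H Z.
  by move=> i; rewrite frame // Z.
by move=> i; rewrite frame // Z.
Qed.

(** A list made of consecutive blocks with distinct keys is recovered by filtering for each key in
    turn. This turns the single pass over the slots into one list per vertex. *)
Lemma group_filter (T U X : eqType) (f : T -> U) (key : U -> X) (g : X -> seq U)
    (l : seq T) (vs : seq X) : uniq vs -> (forall v u, u \in g v -> key u = v) ->
  map f l = flatten [seq g v | v <- vs] ->
  l = flatten [seq [seq i <- l | key (f i) == v] | v <- vs] /\
  forall v, v \in vs -> map f [seq i <- l | key (f i) == v] = g v.
Proof.
move=> + gk; elim: vs l => [|v vs IH] l /=; first by case: l.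
case/andP=> vvs uvs E; set m := size (g v).
have E1 : map f (take m l) = g v by rewrite map_take E take_size_cat.
have E2 : map f (drop m l) = flatten [seq g v | v <- vs] by rewrite map_drop E drop_size_cat.
have k1 i : i \in take m l -> key (f i) = v.
  by move=> il; apply: gk; rewrite -E1; apply: map_f.
have k2 i : i \in drop m l -> key (f i) \in vs.
  move=> il; have : f i \in flatten [seq g v | v <- vs] by rewrite -E2 map_f.
  by case/flattenP=> t /mapP[x xv ->] /gk ->.
have [F1 F2] := IH _ uvs E2.
have Fl x : [seq i <- l | key (f i) == x] =
    (if x == v then take m l else [::]) ++ [seq i <- drop m l | key (f i) == x].
  rewrite -{1}(cat_take_drop m l) filter_cat; congr (_ ++ _); case: eqP => [->|nx].
    by rewrite (eq_in_filter (a2 := predT)) ?filter_predT // => i /k1->; rewrite eqxx.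
  rewrite (eq_in_filter (a2 := pred0)) ?filter_pred0 // => i /k1->.
  by apply/eqP => E'; apply: nx.
have Fv : [seq i <- drop m l | key (f i) == v] = [::].
  rewrite (eq_in_filter (a2 := pred0)) ?filter_pred0 // => i /k2 iv.
  by apply: contraNF vvs => /eqP <-.
have Fx : [seq [seq i <- l | key (f i) == x] | x <- vs] =
    [seq [seq i <- drop m l | key (f i) == x] | x <- vs].
  apply/eq_in_map => x xv; rewrite Fl (_ : (x == v) = false) //.
  by apply: contraNF vvs => /eqP <-.
split.
  by rewrite Fl eqxx Fv cats0 Fx -F1 cat_take_drop.
move=> x; rewrite inE => /predU1P[->|xv]; first by rewrite Fl eqxx Fv cats0.
rewrite Fl (_ : (x == v) = false) ?F2 //.
by apply: contraNF vvs => /eqP <-.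
Qed.

Lemma flatten_filter_map (T U : eqType) (l : seq T) (p : pred T) (f : T -> seq U) :
  flatten [seq (if p i then f i else [::]) | i <- l] = flatten [seq f i | i <- l & p i].
Proof. by elim: l => //= x l ->; case: (p x). Qed.

Lemma size_flatten_map (T U : Type) (f : T -> seq U) (l : seq T) B :
  (forall x, size (f x) <= B) -> size (flatten [seq f x | x <- l]) <= size l * B.
Proof. by move=> H; elim: l => //= x l IH; rewrite size_cat mulSn leq_add. Qed.

(** * The output encodes the kernel instance *)

Section Emit.
Variables (I : instance) (L : 'I_(nvert I) -> seq (seq 'I_(nvert I) * nat)).
Hypothesis HL : forall v, nonzero_list v (L v).
Notation n := (nvert I).
Notation V := 'I_n.
Notation A := (superstructure I).
Notation slots := (slots L).
Notation its := (its L).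
Notation word := (word L).
Notation N := (size word).
Notation base := (base L).
Notation slot_at i := (tnth (in_tuple slots) i).
Notation item_at i := (item (slot_at i)).
Variable d : dec I.
Hypothesis ok : dec_ok its d.
Notation winst := (winst L d).
Notation lam := (d_lam d).
Notation C := (alive (d_r d)).
Notation K := (d_K d).
Notation Qs := (d_Q d).
Notation Ps := (longs d).
Notation F := (ascore its lam C).
Notation FF := (fin C F Ps).
Notation kept := (kept d).
Notation V' := 'I_#|kept|.
Notation KI := (kinst (its_super HL) ok).

(** The analogue of [nonzero_list] in the numbering of the original instance, in which the program
    thinks; [rename] performs the change of numbering. *)
Definition vlist (v : V) (M : seq (seq V * nat)) :=
  [/\ all (fun p => uniq p.1) M, uniq [seq [set x in p.1] | p <- M],
      [seq [set x in p.1] | p <- M] =i [set Z | FF v Z != 0]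
    & all (fun p => p.2 == FF v [set x in p.1]) M].

Definition nw (v' : V') (x : V) : V' := enum_rank_in (enum_valP v') x.

Lemma nwK v' x : x \in kept -> enum_val (nw v' x) = x.
Proof. exact: enum_rankK_in. Qed.

Lemma vlist_kept v M p x : vlist v M -> p \in M -> x \in p.1 -> x \in kept.
Proof.
move=> [_ _ mem _] pM xp; have : [set x in p.1] \in [set Z | FF v Z != 0].
  by rewrite -mem; apply/mapP; exists p.
by rewrite inE => /(FF_kept (its_super HL) ok)[_ /(_ x)]; apply; rewrite inE.
Qed.

Definition rename v' (M : seq (seq V * nat)) := [seq (map (nw v') p.1, p.2) | p <- M].

Lemma vlist_nonzero v' M : vlist (enum_val v') M -> nonzero_list (I := KI) v' (rename v' M).
Proof.
move=> vl; have [un us mem va] := vl.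
have kp p x : p \in M -> x \in p.1 -> x \in kept by apply: vlist_kept vl.
have im p : p \in M ->
    [set enum_val x | x in [set y in map (nw v') p.1]] = [set x in p.1].
  move=> pM; apply/setP=> x; rewrite [RHS]inE; apply/imsetP/idP => [[y]|xp].
    by rewrite inE => /mapP[z zp ->] ->; rewrite nwK ?(kp p).
  by exists (nw v' x); rewrite ?inE ?map_f // nwK ?(kp p).
have vinj : injective (fun Z : {set V'} => [set enum_val x | x in Z]).
  by apply: imset_inj; apply: enum_val_inj.
split.
- rewrite all_map; apply/allP => p pM /=; rewrite map_inj_in_uniq ?(allP un) //.
  move=> x y xp yp /(congr1 enum_val); rewrite !nwK ?(kp p) //.
- apply: (map_uniq (f := fun Z : {set V'} => [set enum_val x | x in Z])).
  rewrite /rename -!map_comp (_ : map _ M = [seq [set x in p.1] | p <- M]) //.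
  by apply/eq_in_map => p pM; apply: im.
- move=> Z; rewrite inE /= /kf; set Y := [set enum_val x | x in Z].
  have -> : (FF (enum_val v') Y != 0) = (Y \in [seq [set x in p.1] | p <- M]) by rewrite mem inE.
  rewrite /rename -map_comp; apply/mapP/mapP => -[p pM E]; exists p => //.
    by rewrite /Y E im.
  by apply: vinj; rewrite -/Y E /= im.
- rewrite all_map; apply/allP => p pM /=; rewrite /kf im //.
  exact: (allP va).
Qed.

Definition vword (s : memory) (M : seq (seq V * nat)) : seq nat :=
  size M :: flatten [seq p.2 :: size p.1 :: [seq s aNEW (nat_of_ord x) | x <- p.1] | p <- M].

Lemma vwordE s v' (M : seq (seq V * nat)) : keepst L d s -> (forall p x, p \in M -> x \in p.1 -> x \in kept) ->
  nonzero_list_word (rename v' M) = vword s M.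
Proof.
move=> H kp; rewrite /nonzero_list_word /vword /rename size_map -map_comp; congr (_ :: flatten _).
apply/eq_in_map => p pM; rewrite /= /vlist_word size_map -map_comp; congr (_ :: _ :: _).
by apply/eq_in_map => x xp /=; rewrite -(e_new H) nwK ?(kp p).
Qed.

Definition mlist_nrm (v : V) := [seq (enum (iset d i), ival d i) |
  i <- enum 'I_(size slots) & win d i && (iown i == v)].

Lemma item_own (i : 'I_(size slots)) : (item_at i).1.1 = iown i.
Proof. by rewrite /iown /item; case: (slot_at i).2. Qed.

Lemma win_score (i : 'I_(size slots)) : win d i -> F (iown i) (iset d i) = ival d i.
Proof.
case/and3P=> _ _ /existsPn nb; rewrite ascoreE; apply/eqP; rewrite eqn_leq; apply/andP; split.
  apply/bigmax_leqP => j _; rewrite /ascore_item item_own; case: ifP => // /andP[o z].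
  by have := nb j; rewrite /beats o /iset z /= negb_or -leqNgt => /andP[].
apply: (leq_trans _ (leq_bigmax_cond i (ltn_ord i))).
by rewrite /ascore_item item_own !eqxx.
Qed.

(** Among the slots of [v] that show [Z], take those of largest value, and of these the first. *)
Lemma score_win (v : V) Z : nrm d v -> F v Z != 0 ->
  exists i : 'I_(size slots), [/\ win d i, iown i = v & iset d i = Z].
Proof.
move=> nv; rewrite ascoreE => nz.
pose P (i : 'I_(size slots)) := (iown i == v) && (iset d i == Z).
have [i0 P0 v0] : exists2 i, P i & 0 < ival d i.
  have : [exists i : 'I_(size slots), ascore_item lam C v Z (item_at i) != 0].
    apply: contraNT nz => /existsPn al; rewrite big1 // => i _.
    by apply/eqP; have := al i; rewrite negbK.
  case/existsP=> i; rewrite /ascore_item item_own; case: ifP => // Pi; exists i => //.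
  by rewrite lt0n.
pose i1 := [arg max_(i > i0 | P i) ival d i].
have [P1 m1] : P i1 /\ forall j, P j -> ival d j <= ival d i1.
  by rewrite /i1; case: arg_maxnP.
pose P2 i := P i && (ival d i == ival d i1).
have P21 : P2 i1 by rewrite /P2 P1 eqxx.
pose i2 := [arg min_(i < i1 | P2 i) (i : nat)].
have [/andP[Pi2 /eqP v2] m2] : P2 i2 /\ forall j, P2 j -> i2 <= j.
  by rewrite /i2; case: arg_minnP.
have /andP[/eqP o2 /eqP z2] := Pi2.
exists i2; split=> //; apply/and3P; split; rewrite ?o2 //.
  by rewrite v2 (leq_trans v0) ?m1.
apply/existsPn => j; rewrite /beats o2 z2 v2; apply/negP => /and3P[oj zj].
have Pj : P j by rewrite /P oj.
case/orP=> [|/andP[/eqP vj ji]]; first by rewrite ltnNge m1.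
by have := m2 j; rewrite /P2 Pj -vj eqxx => /(_ isT); rewrite leqNgt ji.
Qed.

Lemma FF_nrm (v : V) Z : nrm d v -> FF v Z = F v Z.
Proof. by rewrite /nrm /onpath negbK /fin => /andP[vC /eqP->]; rewrite vC. Qed.

Lemma mlist_nrm_ok v : nrm d v -> vlist v (mlist_nrm v).
Proof.
move=> nv.
have wP p : p \in mlist_nrm v -> exists i : 'I_(size slots), [/\ win d i, iown i = v & p = (enum (iset d i), ival d i)].
  by case/mapP=> i; rewrite mem_filter => /andP[/andP[wi /eqP oi] _] ->; exists i.
have sE (X : {set V}) : [set x in enum X] = X by apply/setP=> x; rewrite inE mem_enum.
split.
- by apply/allP => p /wP[i [_ _ ->]] /=; apply: enum_uniq.
- rewrite -map_comp map_inj_in_uniq; first exact/filter_uniq/enum_uniq.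
  move=> i j.
  rewrite !mem_filter => /andP[/andP[/and3P[_ _ /existsPn wi] /eqP oi] _].
  case/andP=> /andP[/and3P[_ _ /existsPn wj] /eqP oj] _ /=; rewrite !sE => E.
  apply: val_inj; have := wi j; have := wj i.
  rewrite /beats oi oj E !eqxx /= !negb_or !negb_and /=.
  by case: (ltngtP (ival d i) (ival d j)) => //= _; case: ltngtP.
- move=> Z; rewrite inE FF_nrm //; apply/mapP/idP => [[p /wP[i [wi oi ->]] ->] /=|].
    by rewrite sE -oi win_score // -lt0n; case/and3P: wi.
  move=> /(score_win nv)[i [wi oi zi]]; exists (enum (iset d i), ival d i); last by rewrite /= sE.
  by apply/mapP; exists i => //; rewrite mem_filter wi oi eqxx mem_enum.
- by apply/allP => p /wP[i [wi oi ->]] /=; rewrite sE FF_nrm // -oi win_score.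
Qed.

Definition mlist_y (P : V * seq V * V) := [seq
  let: (a, b, cn) := t in
  ((if b then [:: pw P] else [::]) ++ (if cn then [:: px P] else [::]) ++
     (if a then [:: pv P 2; pv P 3] else [::]),
   if a then ptab F P a b (~~ cn) + pbig F P else ptab F P a b (~~ cn)) | t <- triples].

Definition mlist_x (P : V * seq V * V) :=
  [:: ([:: pv P 2; pv P 3], 2 * pbig F P); ([:: pu P], pbig F P)].

Definition mlist (v : V) : seq (seq V * nat) :=
  if nrm d v then mlist_nrm v
  else if pof Ps v is Some P then
    if v == pv P 1 then mlist_y P else if v == px P then mlist_x P else [::]
  else [::].

Section Long.
Variable P : V * seq V * V.
Hypothesis PP : P \in Ps.

Lemma long_neq i j : i != j -> 0 < i <= size (pqs P) -> j <= (size (pqs P)).+1 ->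
  (pv P i == pv P j) = false.
Proof. exact: (pv_neq (Ps_good ok) (Ps_disj ok)). Qed.

Lemma long4 : 3 < size (pqs P). Proof. by case: (longsP PP). Qed.

Lemma ptab_gt0 a b c : 0 < ptab F P a b c.
Proof. by apply: tab_gt0; rewrite orbC; have := long4; case: (size _) => [|[]]. Qed.

Lemma pbig_gt0 : 0 < pbig F P.
Proof. move: (ptab_gt0 true true true); rewrite /pbig !big_bool /=; clear; lia. Qed.

Lemma gad_pof v : v \in pqs P -> forall Z, FF v Z = gad F P v Z.
Proof. by move=> vP Z; rewrite /fin (pofP (Ps_disj ok) PP vP). Qed.

Lemma long_dist : let m := size (pqs P) in
  [/\ (pv P 1 == px P) = false, (pv P 2 == pv P 3) = false, (pw P == px P) = false,
      (pw P == pv P 2) = false & (pw P == pv P 3) = false] /\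
  [/\ (px P == pv P 2) = false, (px P == pv P 3) = false, (pu P == pv P 2) = false
    & (pu P == pv P 3) = false].
Proof.
move=> m; have m4 := long4; rewrite -/m in m4.
have h i j : i != j -> 0 < i <= m -> j <= m.+1 -> (pv P i == pv P j) = false by exact: long_neq.
have Eu : pu P = pv P m.+1 by rewrite pvm.
rewrite -(pv0 P) Eu /px -/m; split; split; rewrite ?[pv P 0 == _]eq_sym ?[pv P m.+1 == _]eq_sym;
  apply: h; move: m4; clear; lia.
Qed.

Lemma mlist_x_ok : vlist (px P) (mlist_x P).
Proof.
have m4 := long4; have [[_ d23 _ _ _] [_ _ u2 u3]] := long_dist.
have xP : px P \in pqs P by apply: pv_in; move: m4; clear; lia.
have s2 : [set x in [:: pv P 2; pv P 3]] = [set pv P 2; pv P 3] by apply/setP=> x; rewrite !inE.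
have s1 : [set x in [:: pu P]] = [set pu P] by apply/setP=> x; rewrite !inE.
have ne : ([set pu P] == [set pv P 2; pv P 3]) = false.
  by apply/eqP => /setP/(_ (pu P)); rewrite !inE eqxx u2 u3.
have b0 := pbig_gt0.
have E Z : FF (px P) Z = gad F P (px P) Z by exact: gad_pof.
split.
- by rewrite /= !inE d23.
- by rewrite /= s2 s1 !inE eq_sym ne.
- move=> Z; rewrite /= s2 s1 !inE E /gad eqxx; case: eqP => [->|_] /=.
    by rewrite -lt0n muln_gt0.
  by case: (Z == _); rewrite // -lt0n b0.
- by rewrite /= s2 s1 !E /gad !eqxx ne !eqxx.
Qed.

Definition yset (t : bool * bool * bool) : {set V} := let: (a, b, cn) := t in
  opt b (pw P) :|: opt cn (px P) :|: (opt a (pv P 2) :|: opt a (pv P 3)).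

Lemma mem_yset a b cn : [/\ (pv P 2 \in yset (a, b, cn)) = a,
  (pw P \in yset (a, b, cn)) = b & (px P \in yset (a, b, cn)) = cn].
Proof.
have [[_ d23 wx w2 w3] [x2 x3 _ _]] := long_dist.
rewrite /yset !inE !in_opt !eqxx ![pv P 2 == _]eq_sym ![px P == pw P]eq_sym x2 x3 w2 w3 wx.
by rewrite ![pv P 3 == _]eq_sym d23 !andbT !andbF !orbF.
Qed.

Lemma FF_y Z : FF (pv P 1) Z =
  if Z == yset (pv P 2 \in Z, pw P \in Z, px P \in Z)
  then ptab F P (pv P 2 \in Z) (pw P \in Z) (px P \notin Z) + (if pv P 2 \in Z then pbig F P else 0)
  else 0.
Proof.
have [[y1 _ _ _ _] _] := long_dist; have m4 := long4.
rewrite gad_pof; last by apply: pv_in; move: m4; clear; lia.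
by rewrite /gad y1 eqxx.
Qed.

Lemma mlist_y_ok : vlist (pv P 1) (mlist_y P).
Proof.
have [[_ d23 wx w2 w3] [x2 x3 _ _]] := long_dist.
have sE a b cn : [set x in (if b then [:: pw P] else [::]) ++ (if cn then [:: px P] else [::]) ++
     (if a then [:: pv P 2; pv P 3] else [::])] = yset (a, b, cn).
  apply/setP=> x; rewrite /yset !inE !mem_cat !in_opt.
  by case: a; case: b; case: cn; rewrite /= ?inE /= ?orbF ?orbA.
have Ev a b cn : FF (pv P 1) (yset (a, b, cn)) =
    ptab F P a b (~~ cn) + (if a then pbig F P else 0).
  by rewrite FF_y; have [-> -> ->] := mem_yset a b cn; rewrite eqxx.
have Es : [seq [set x in p.1] | p <- mlist_y P] = [seq yset t | t <- triples].
  by rewrite /mlist_y -map_comp; apply: eq_map => -[[a b] cn] /=; rewrite sE.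
have yinj : injective yset.
  move=> [[a b] cn] [[a' b'] cn'] E; have [h1 h2 h3] := mem_yset a b cn.
  by have [g1 g2 g3] := mem_yset a' b' cn'; 
  congr (_, _, _); [rewrite -h1 E g1|rewrite -h2 E g2|rewrite -h3 E g3].
have tr a b c : (a, b, c) \in triples by case: a; case: b; case: c.
split.
- rewrite /mlist_y all_map; apply/allP => -[[a b] cn] _ /=.
  by case: a; case: b; case: cn; rewrite /= ?inE ?negb_or ?wx ?w2 ?w3 ?x2 ?x3 ?d23.
- by rewrite Es map_inj_uniq.
- move=> Z; rewrite Es [RHS]inE; apply/mapP/idP => [[[[a b] cn] _ ->]|].
    by rewrite Ev -lt0n (leq_trans (ptab_gt0 a b (~~ cn))) ?leq_addr.
  rewrite FF_y; case: ifP => // /eqP E _.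
  by exists (pv P 2 \in Z, pw P \in Z, px P \in Z); [exact: tr|exact: E].
- rewrite /mlist_y all_map; apply/allP => -[[a b] cn] _ /=.
  by rewrite sE Ev; case: (a); rewrite ?addn0.
Qed.

End Long.

Lemma mlist_ok v : v \in kept -> vlist v (mlist v).
Proof.
move=> vk; rewrite /mlist; case nv: (nrm d v); first exact: mlist_nrm_ok.
have vC : v \in C by move: vk; rewrite inE /keep => /andP[].
move: nv; rewrite /nrm vC /onpath negbK; case E: (pof Ps v) => [P|] // _.
have [PP vP] := pofS E.
case: eqP => [->|n1]; first exact: mlist_y_ok.
case: eqP => [->|n2]; first exact: mlist_x_ok.
split=> // Z; rewrite inE (gad_pof PP vP) /gad.
by rewrite (introF eqP n1) (introF eqP n2).
Qed.

Lemma nrm_kept v : nrm d v -> v \in kept.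
Proof.
case/andP=> vC no; have [vK|vK] := boolP (v \in K); first exact: (kept_K ok).
have [P PQ vP] := ok_cover ok vC vK; have [j jm Ev] := pqsP vP.
rewrite Ev -(kept_pv ok PQ) //; case: leqP => //= l.
have PP : P \in Ps by rewrite mem_filter l.
by move: no; rewrite /onpath (pofP (Ps_disj ok) PP vP).
Qed.

Definition item_word (s : memory) (i : 'I_(size slots)) : seq nat :=
  ival d i :: size (enum (iset d i)) :: [seq s aNEW (nat_of_ord x) | x <- enum (iset d i)].

(** A header announces the number of winners of its vertex or, for a gadget vertex, writes the whole
    list; an entry writes itself if it has won. Gadget vertices have no winners, so nothing follows
    their headers. *)
Definition out (s : memory) (i : 'I_(size slots)) : seq nat :=
  if (slot_at i).2 is None then
    if iown i \in kept then
      if nrm d (iown i) then [:: s aCNT (iown i)] else vword s (mlist (iown i))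
    else [::]
  else if win d i then item_word s i else [::].

(** The 33 is the length of the list of the first gadget vertex: one word for the number of entries,
    two for each of the eight entries, and sixteen elements in all. *)
Lemma out_size s i : size (out s i) <= N + 33.
Proof.
have := nN L; move: (size word) => NN nn; rewrite /out; case: (slot_at i).2 => [p|].
  case: ifP => // _; rewrite /item_word /= size_map -cardE; apply: (@leq_trans n.+2).
    by rewrite !ltnS; have := max_card (mem (iset d i)); rewrite card_ord.
  by move: nn; clear; lia.
case: ifP => // _; case nv: (nrm d (iown i)); first by rewrite /=; clear; lia.
rewrite /mlist nv.
by case: (pof Ps _) => [P|]; [case: ifP => _; [|case: ifP => _]|]; rewrite /vword /mlist_y /mlist_x /=; clear; lia.
Qed.

Lemma out_vertex s (v : V) : winst s ->
  flatten [seq out s i | i <- enum 'I_(size slots) & iown i == v] =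
    if v \in kept then vword s (mlist v) else [::].
Proof.
move=> H.
have E0 : [seq slot_at i | i <- enum 'I_(size slots)] = flatten [seq vslots L v | v <- enum V].
  by rewrite -/slots -[RHS](map_tnth_enum (in_tuple slots)).
have gk (u : V) (sl : slot I) : sl \in vslots L u -> sl.1 = u.
  by rewrite inE => /predU1P[->|/mapP[p _ ->]].
have [_ G] := group_filter (key := fst) (enum_uniq V) gk E0.
have {}G := G v (mem_enum V v).
have El : [seq i <- enum 'I_(size slots) | iown i == v] =
  [seq i <- enum 'I_(size slots) | (slot_at i).1 == v] by [].
rewrite El; case Eq: [seq i <- _ | _] G => [|h tl] //= -[Eh Et].
have ow i : i \in h :: tl -> iown i = v by rewrite -Eq mem_filter => /andP[/eqP].
have Hs i : i \in tl -> (slot_at i).2 != None.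
  by move=> it; have := map_f (fun i => slot_at i) it; rewrite Et => /mapP[p _ ->].
(* A header has value 0 and thus never wins. *)
have hw : win d h = false.
  by rewrite /win /ival Eh /= andbF.
have Eo i : i \in tl -> out s i = if win d i then item_word s i else [::].
  by move=> /Hs; rewrite /out; case: (slot_at i).2.
rewrite {1}/out Eh /= (ow h) ?mem_head //.
have Et' : flatten [seq out s i | i <- tl] = flatten [seq item_word s i | i <- tl & win d i].
  rewrite -flatten_filter_map; congr flatten; apply/eq_in_map => i it; exact: Eo.
rewrite Et'; case nv: (nrm d v).
  rewrite nrm_kept // /mlist nv /vword /mlist_nrm size_map -map_comp.
  have Ef : [seq i <- enum 'I_(size slots) | win d i && (iown i == v)] = [seq i <- tl | win d i].
    by rewrite filter_predI El Eq /= hw.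
  rewrite Ef; congr (_ :: _); rewrite (n_cnt H) -Ef cardE; congr size.
  by rewrite [LHS]/enum_mem -enumT; apply: eq_filter => i; rewrite !inE.
have -> : [seq i <- tl | win d i] = [::].
  rewrite (eq_in_filter (a2 := pred0)) ?filter_pred0 // => i it.
  by rewrite /win (ow i) ?nv // inE it orbT.
by rewrite cats0.
Qed.

Lemma enum_kept : [seq v <- enum V | v \in kept] = [seq enum_val v' | v' <- enum V'].
Proof.
have -> : [seq v <- enum V | v \in kept] = enum kept by rewrite enumT /enum_mem.
have [x0 _|E] := pickP (mem kept); last first.
  have k0 : #|kept| = 0 by apply: eq_card0 => x; have := E x.
  have e1 : size (enum kept) = 0 by rewrite -cardE.
  have e2 : size (enum V') = 0 by rewrite size_enum_ord k0.
  by rewrite (size0nil e1) (size0nil e2).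
apply: (@eq_from_nth _ x0); first by rewrite size_map size_enum_ord -cardE.
move=> i; rewrite -cardE => ik; rewrite (nth_map (Ordinal ik)) ?size_enum_ord //.
rewrite (enum_val_nth x0); congr (nth _ _ _).
by rewrite nth_enum_ord.
Qed.

Lemma out_all s : winst s ->
  flatten [seq out s i | i <- enum 'I_(size slots)] =
  flatten [seq nonzero_list_word (rename v' (mlist (enum_val v'))) | v' <- enum V'].
Proof.
move=> H.
have E0 : [seq slot_at i | i <- enum 'I_(size slots)] = flatten [seq vslots L v | v <- enum V].
  by rewrite -/slots -[RHS](map_tnth_enum (in_tuple slots)).
have gk (u : V) (sl : slot I) : sl \in vslots L u -> sl.1 = u.
  by rewrite inE => /predU1P[->|/mapP[p _ ->]].
have [G _] := group_filter (key := fst) (enum_uniq V) gk E0.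
rewrite {1}G map_flatten -map_comp.
have -> : flatten (flatten [seq (map (out s) \o (fun v => [seq i <- enum 'I_(size slots) |
    (slot_at i).1 == v])) v | v <- enum V]) =
    flatten [seq (if v \in kept then vword s (mlist v) else [::]) | v <- enum V].
  elim: (enum V) => //= v l IH; rewrite flatten_cat IH -out_vertex //.
rewrite flatten_filter_map enum_kept.
rewrite -map_comp; congr flatten; apply/eq_map => v' /=; rewrite (vwordE (s := s)) //; first exact: n_keep.
by move=> p x; apply: vlist_kept; apply: mlist_ok; apply: enum_valP.
Qed.

Definition tmp_emit := [:: 1; aOP; aSZ; aZP; c2; c3; u0; u1; u2].

Lemma winst_eq s s' : (forall a j, 1 < a < 57 -> s' a j = s a j) -> winst s -> winst s'.
Proof.
move=> E [h1 h2 h3]; split.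
- apply: keepst_eq h1 => a j ar; apply: E; first by move: ar; clear; lia.
  by move: ar; rewrite !inE; clear; lia.
- by move=> i; rewrite E.
- by move=> v; rewrite E.
Qed.

Lemma winst_off X s s' : agree_off X s s' -> all (fun a => ~~ (1 < a < 57)) X -> winst s -> winst s'.
Proof.
move=> H /allP hX; apply: winst_eq => a j ar; apply: H; apply/negP => /hX.
by rewrite ar.
Qed.

Lemma vword_off s s' M : (forall j, s' aNEW j = s aNEW j) -> vword s' M = vword s M.
Proof.
move=> E; rewrite /vword; congr (_ :: flatten _); apply: eq_map => p; congr (_ :: _ :: _).
by apply: eq_map => x; rewrite E.
Qed.

Lemma header_ok s w (i : 'I_(size slots)) : winst s -> outst s w -> s u0 0 = iown i ->
  (slot_at i).2 = None ->
  outst (denote p_emit_header s) (w ++ out s i).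
Proof.
move=> H Hw Hu Hn; have Hk := n_keep H; have Ha := e_ana Hk.
rewrite /p_emit_header /out Hn denote_if trE /= Hu (e_kept Hk).
case kv: (iown i \in kept); last by rewrite denote_skip cats0.
rewrite denote_if trE /= Hu (e_nrm Hk); case nv: (nrm d (iown i)).
  by have := emit_ok (G_ aCNT (X_ u0)) Hw; rewrite /= Hu cats1.
have vC : iown i \in C by move: kv; rewrite inE /keep => /andP[].
rewrite /mlist nv; move: nv; rewrite /nrm vC /onpath negbK; case E: (pof Ps _) => [P|] // _.
have [PP vP] := pofS E; have [PQ l] := longsP PP.
have [j jm Ev] := pqsP vP; case: j jm Ev => // j jm Ev.
have R := q_row (a_path Ha) PQ; have [r1 r2 _ _] := r_row R jm.
have [[y1 _ _ _ _] _] := long_dist PP.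
have Wx a b c : s (wix a b c) (px P) = ptab F P a b c.
  have m1 : (size (pqs P)).-1 < size (pqs P) by move: l; clear; lia.
  have [_ _ _ h] := r_row R m1; rewrite /ptab -h /px; congr (s _ (pv P _)).
  by move: l; clear; lia.
have pe i1 j1 : 0 < i1 <= size (pqs P) -> 0 < j1 <= size (pqs P) -> (pv P i1 == pv P j1) = (i1 == j1).
  exact: (pv_eq (Ps_good ok) PP).
have jm1 : 0 < j.+1 <= size (pqs P) by [].
have one : 0 < 1 <= size (pqs P) by move: l; clear; lia.
have mm : 0 < size (pqs P) <= size (pqs P) by move: l; clear; lia.
have Z1 : s aZ1 (pv P 1) = pv P 2 by apply: (r_z1 R); move: l; clear; lia.
have Z2 : s aZ2 (pv P 1) = pv P 3 by apply: (r_z2 R); move: l; clear; lia.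
rewrite denote_if trE /= Hu Ev r2 (pe j.+1 1) // eqSS.
have [j0|j0] := eqVneq j 0.
  have := emits_ok (es := gadget_y (X_ u0)) Hw isT; rewrite /mlist_y /vword.
  congr (outst _ (_ ++ _)).
  rewrite j0 in Ev; rewrite /= Hu Ev (r_xx R) (r_ww R) (r_bb R) Z1 Z2.
  by rewrite !Wx.
rewrite denote_if trE /= Hu Ev r2 r1 subn1 /= (r_len R) /px pe // -/(px P).
case: eqP => jx; last first.
  by have := emit_ok (C_ 0) Hw; rewrite /vword /= cats1.
have := emits_ok (es := gadget_x (G_ aPID (X_ u0) -' C_ 1)) Hw isT; rewrite /mlist_x /vword.
congr (outst _ (_ ++ _)).
by rewrite /= Hu Ev r1 subn1 /= (r_uu R) (r_bb R) Z1 Z2 mul2n addnn.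
Qed.

Lemma item_ok s w (i : 'I_(size slots)) : winst s -> outst s w -> s c2 0 = i ->
  (slot_at i).2 != None ->
  outst (denote p_emit_item s) (w ++ out s i).
Proof.
move=> H Hw Hc Hn; have Hk := n_keep H; have Ha := e_ana Hk.
have lf := c_leaf (q_core (a_path Ha)); have B := l_base lf.
rewrite /p_emit_item /out denote_if trE /= Hc (n_win H).
have -> : (if (slot_at i).2 is None then if iown i \in kept then
      if nrm d (iown i) then [:: s aCNT (iown i)] else vword s (mlist (iown i))
    else [::] else if win d i then item_word s i else [::]) = if win d i then item_word s i else [::].
  by move: Hn; case: (slot_at i).2.
case wi: (win d i); last by rewrite denote_skip cats0.
rewrite denote_seq; set s1 := denote (emit _) s.
have H1 : outst s1 (rcons w (ival d i)).
  by have := emit_ok (eval_item (X_ c2)) Hw; rewrite /= Hc (ana_val _ Ha).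
have A1 : agree_off [:: 1; aOP] s s1 by exact: agree_frame.
have B1 : base s1 by apply: base_agree A1 B.
pose t k := (k < n) && (k \in [seq nat_of_ord x | x <- enum (iset d i)]).
have N1 : s1 aN 0 = N by exact: (b_N B1).
have := emit_set_ok (T := eand (G_ aMM (ix (X_ c2) (X_ c3))) (G_ aALV (X_ c3)))
  (E := enew (X_ c3)) (t := t) (f := fun k => s aNEW k) _ H1.
rewrite N1 => -[|Ho _].
  move=> s2 k A2 Hc3 kN; split; last by rewrite /= Hc3 A2 ?A1.
  have B2 : base s2 by apply: base_agree A2 B1.
  have C2 : s2 c2 0 = i by rewrite A2 // A1.
  have al : s2 aALV k = s aALV k by rewrite A2 // A1.
  rewrite !trE /= -/(ix _ _) Hc3 al (b_BASE B2) /= C2 ?slot_lt //.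
  rewrite /t; case: ltnP => kn; last by rewrite (l_alv0 lf) // andbF.
  rewrite (b_MM B2 i (Ordinal kn)) (l_alv lf (Ordinal kn)).
  have -> : (k \in [seq nat_of_ord x | x <- enum (iset d i)]) = (Ordinal kn \in iset d i).
    by rewrite -[k]/(nat_of_ord (Ordinal kn)) mem_map ?mem_enum //; apply: val_inj.
  by rewrite /iset in_setI; case: (_ \in (item_at i).1.2) => //=; case: (_ \in C).
move: Ho; rewrite cat_rcons (iota_enum (n := n)).
- rewrite /item_word; have -> : [seq x <- enum V | t (nat_of_ord x)] = enum (iset d i).
    rewrite [in RHS]/enum_mem -enumT; apply: eq_filter => x.
    by rewrite /t ltn_ord mem_map ?mem_enum //; apply: val_inj.
  by rewrite size_map.
- by have := nN L; clear; lia.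
- by move=> k nk; rewrite /t ltnNge nk.
Qed.

Lemma target_word (s : memory) : winst s ->
  exists s1, denote p_emit s = denote (for_ c2 (when (eand (elt (X_ c2) (X_ aIT)) (C_ 1))
    (setv u0 (G_ aOWN (X_ c2)) ;; PIf (G_ aHDR (X_ c2)) p_emit_header p_emit_item))) s1 /\
  agree_off tmp_emit s s1 /\ outst s1 [:: nvert KI; nat_of_bool (target KI < 0)%R; absz (target KI)].
Proof.
move=> H; have Hk := n_keep H; have Ha := e_ana Hk; have B := l_base (c_leaf (q_core (a_path Ha))).
rewrite /p_emit; do 3 rewrite denote_seq; set s1 := denote (PIf _ _ _) s; set s2 := denote (setv aOP _) s1.
eexists; split; first by [].
have A1 : agree_off tmp_emit s s1 by exact: agree_frame.
have A2 : agree_off tmp_emit s s2 by apply: agree_trans A1 _; apply: agree_frame.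
split; first by apply: agree_trans A2 _; apply: agree_sub (emits_off _ _).
have O2 : outst s2 [::] by split; rewrite ?/s2 ?denE.
have := emits_ok (es := [:: X_ aNK; enot (enot (elt (X_ u1) (X_ u2)));
            (X_ u1 -' X_ u2) +' (X_ u2 -' X_ u1)]) O2 isT; rewrite /=.
have Hadds : s aADDS 0 = adds its d.
  by rewrite (q_adds (a_path Ha)) /adds /longs big_filter.
have Hsubs : s aSUBS 0 = subs its d.
  rewrite (l_subs (c_leaf (q_core (a_path Ha)))) /subs.
  have EL : {in d_r d, lamm s =1 lam} by move=> x _; apply: (q_lam (a_path Ha)).
  have EP : {in d_r d, parm s =1 d_par d} by move=> x _; apply: (a_par Ha).
  by have [_ ->] := elim_seq_ext EL EP (l_elim (c_leaf (q_core (a_path Ha)))).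
have In1 : s aIN 1 = (target I < 0)%R by rewrite (b_IN B).
have In2 : s aIN 2 = absz (target I) by rewrite (b_IN B).
have NK : s2 aNK 0 = #|kept| by rewrite A2 // (e_nk Hk).
have U1 : s2 u1 0 = (if (target I < 0)%R then 0 else absz (target I)) + adds its d.
  rewrite /s2 denE update_other // /s1 denote_if trE /= In1.
  by case: (target I < 0)%R; rewrite !denE /update /= ?In2 Hadds.
have U2 : s2 u2 0 = (if (target I < 0)%R then absz (target I) else 0) + subs its d.
  rewrite /s2 denE update_other // /s1 denote_if trE /= In1.
  by case: (target I < 0)%R; rewrite !denE /update /= ?In2 Hsubs.
rewrite NK U1 U2; congr (outst _ [:: _; _; _]) => /=.
- by move: (adds its d) (subs its d); clear; case: ifP; case: (target I); lia.
- by move: (adds its d) (subs its d); clear; case: ifP; case: (target I); lia.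
Qed.

Lemma emit_instance s : winst s ->
  exists w', [/\ encodes_instance KI w', size w' <= 3 + size slots * (N + 33)
    & forall i, i < size w' -> denote p_emit s 1 i = nth 0 w' i].
Proof.
move=> H; have [s1 [-> [A1 O1]]] := target_word H.
set hd := [:: _; _; _] in O1.
exists (hd ++ flatten [seq nonzero_list_word (rename v' (mlist (enum_val v'))) | v' <- enum V']); split.
- exists (fun v' => rename v' (mlist (enum_val v'))) => // v'.
  by apply: vlist_nonzero; apply: mlist_ok; apply: enum_valP.
- rewrite -(out_all H) size_cat (_ : size hd = 3) // leq_add2l.
  by apply: leq_trans (size_flatten_map _ (out_size s)) _; rewrite size_enum_ord.
rewrite -(out_all H).
have B := l_base (c_leaf (q_core (a_path (e_ana (n_keep H))))).
have B1 : base s1 by apply: base_agree A1 B.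
pose Inv k (x : memory) := agree_off tmp_emit s x /\
  outst x (hd ++ flatten [seq out s i | i <- take k (enum 'I_(size slots))]).
suff [_ [_ h]] : Inv (size slots) (denote (for_ c2 (when (eand (elt (X_ c2) (X_ aIT)) (C_ 1))
    (setv u0 (G_ aOWN (X_ c2)) ;; PIf (G_ aHDR (X_ c2)) p_emit_header p_emit_item))) s1).
  by move=> i iw; rewrite h take_oversize ?size_enum_ord.
apply: (forI_ind (Inv := Inv) B1) => //.
- move=> j x k [h1 h2]; split; last first.
    by apply: outst_off h2 => a l; rewrite !inE => /orP[]/eqP->; rewrite update_other.
  by move=> a l al; rewrite update_other ?h1 //; apply: contraNneq al => ->.
- by split=> //; rewrite take0 cats0.
move=> i x Bx _ Hc [h1 h2]; have -> : tr x (C_ 1) = true by [].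
rewrite denote_seq; set y := denote (setv u0 _) x.
have Ay : agree_off tmp_emit s y by apply: agree_trans h1 _; apply: agree_frame.
have Oy : outst y (hd ++ flatten [seq out s i | i <- take i (enum 'I_(size slots))]).
  by apply: outst_off h2 => a l; rewrite !inE => /orP[]/eqP->; rewrite /y denE update_other.
have Uy : y u0 0 = iown i by rewrite /y denE /update /= Hc (b_OWN Bx).
have Cy : y c2 0 = i by rewrite /y denE update_other.
have By : base y by apply: base_agree Ay B.
have Hy : winst y by apply: winst_off Ay _ H.
split; first by apply: agree_trans Ay _; apply: agree_frame.
have Eo : out y i = out s i.
  rewrite /out /item_word (vword_off (s := s)); last by move=> j; apply: Ay.
  rewrite Ay //; case: (slot_at i).2 => // _; case: ifP => // _; congr (_ :: _ :: _).
  by apply: eq_map => z; rewrite Ay.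
rewrite (take_nth i) ?size_enum_ord // (_ : nth i _ i = i); last by apply: val_inj; rewrite /= nth_enum_ord.
rewrite map_rcons -cats1 flatten_cat (_ : flatten [:: out s i] = out s i); last by rewrite /= cats0.
rewrite catA -Eo.
rewrite denote_if tr_get (_ : eval y (X_ c2) = i); last exact: Cy.
rewrite (b_HDR By); case: eqP => hdr; first exact: header_ok.
by apply: item_ok => //; apply/eqP.
Qed.

End Emit.

(** * Reading, clearing and writing digraphs *)

Section Dig.
Variables (I : instance) (L : 'I_(nvert I) -> seq (seq 'I_(nvert I) * nat)).
Notation n := (nvert I).
Notation V := 'I_n.
Notation A := (superstructure I).
Notation word := (word L).
Notation N := (size word).
Notation base := (base L).

Definition dmst (s : memory) (Pa : V -> {set V}) :=
  forall x y : V, (s aDM (y * N + x) != 0) = (x \in Pa y).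

Lemma cell_eq (x y x' y' : V) : (y * N + x == y' * N + x') = (y == y') && (x == x').
Proof. by rewrite idx_inj ?ordN // !(inj_eq val_inj). Qed.

Definition tmp_read := [:: aDM; aDP; aDL; c2; c3].

(** [M] translates the numbering of the input digraph into that of the original instance: the
    identity for the forward, and [enum_val] for the backward transformation. *)
Lemma read_ok s k (p : 'I_k -> seq 'I_k) (M : 'I_k -> V) m nv pos
    (dd := flatten [seq vlist_word (p v) | v <- enum 'I_k]) (s' := denote (p_read_dig nv m) s) :
  base s -> k <= N -> (forall i, uniq (p i)) ->
  (forall s1, agree_off tmp_read s s1 -> eval s1 nv = k) -> m \notin tmp_read ->
  (forall i : 'I_k, s m i = M i) -> s aDP 0 = pos ->
  (forall q, q < size dd -> s 0 (pos + q) = nth 0 dd q) ->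
  (forall x y : V, s aDM (y * N + x) = 0) ->
  agree_off tmp_read s s' /\
  forall x y : V, (s' aDM (y * N + x) != 0) =
    [exists i, [exists j, [&& M i == y, M j == x & j \in p i]]].
Proof.
move=> B kN un Hnv mX HM Hpos Hdd HD; split; first exact: agree_frame.
pose fl j := flatten [seq vlist_word (p v) | v <- take j (enum 'I_k)].
pose Inv j (x : memory) := [/\ agree_off tmp_read s x, x aDP 0 = pos + size (fl j)
  & forall a b : V, (x aDM (b * N + a) != 0) =
      [exists i : 'I_k, [exists j', [&& (i < j), M i == b, M j' == a & j' \in p i]]]].
suff : Inv (s aN 0) s'.
  rewrite (b_N B) => -[_ _ H] x y; rewrite H; apply: eq_existsb => i; apply: eq_existsb => j.
  by rewrite (leq_trans (ltn_ord i) kN).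
have upd j x l : Inv j x -> Inv j (update x c2 0 l).
  move=> [h1 h2 h3]; split; rewrite ?update_other // => a q aX.
  by rewrite update_other ?h1 //; apply: contraNneq aX => ->.
apply: for_ind => //.
  apply: upd; split=> //; first by rewrite Hpos /fl take0 addn0.
  by move=> a b; rewrite HD; apply/esym/negbTE/existsPn => i; apply/existsPn.
move=> j x jN _ Hc _ H; apply: upd; have [Ax Px Dx] := H.
rewrite denote_if !trE /= Hc Hnv // andbT; case: ltnP => jk; last first.
  rewrite denote_skip; split=> //; first by rewrite Px /fl !take_oversize // size_enum_ord // leqW.
  move=> a b; rewrite Dx; apply: eq_existsb => i; apply: eq_existsb => j'.
  by rewrite !(leq_trans (ltn_ord i)) // leqW.
set i0 := Ordinal jk.
have Et : take j.+1 (enum 'I_k) = rcons (take j (enum 'I_k)) i0.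
  rewrite (take_nth i0) ?size_enum_ord //; congr rcons; apply: val_inj.
  by rewrite /= nth_enum_ord.
have Ef : fl j.+1 = fl j ++ vlist_word (p i0).
  by rewrite /fl Et map_rcons -cats1 flatten_cat /= cats0.
have Ed : dd = fl j.+1 ++ flatten [seq vlist_word (p v) | v <- drop j.+1 (enum 'I_k)].
  by rewrite /fl -flatten_cat -map_cat cat_take_drop.
have rd q : q < size (vlist_word (p i0)) -> s 0 (pos + (size (fl j) + q)) = nth 0 (vlist_word (p i0)) q.
  move=> ql; rewrite Hdd; last by rewrite Ed Ef !size_cat -addnA ltn_add2l ltn_addr.
  rewrite Ed Ef -catA nth_cat (_ : (size (fl j) + q < size (fl j)) = false).
    by rewrite addKn nth_cat ql.
  by rewrite ltnNge leq_addr.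
set len := size (p i0).
have lk : len <= k by have := max_card (mem (p i0)); rewrite (card_uniqP (un i0)) card_ord.
do 2 rewrite denote_seq; set x1 := denote (setv aDL _) x; set x2 := denote (incr aDP) x1.
have D2 : x2 aDL 0 = len.
  rewrite /x2 /x1 !denE /update /= Px Ax //.
  by have := rd 0 isT; rewrite addn0 => ->.
have P2 : x2 aDP 0 = pos + (size (fl j)).+1 by rewrite /x2 /x1 !denE /update /= Px addn1 addnS.
have A2 : agree_off tmp_read s x2.
  by apply: agree_trans Ax _; apply: (agree_trans (s2 := x1)); apply: agree_frame.
have C2 : x2 c2 0 = j by rewrite /x2 /x1 !denE !update_other.
have M2 q : x2 aDM q = x aDM q by rewrite /x2 /x1 !denE !update_other.
clearbody x1 x2.
pose Jnv c (z : memory) := [/\ agree_off tmp_read s z, z aDP 0 = pos + (size (fl j)).+1 + minn c len,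
  z aDL 0 = len, z c2 0 = j
  & forall a b : V, (z aDM (b * N + a) != 0) = (x aDM (b * N + a) != 0) ||
      [&& M i0 == b & has (fun j' => M j' == a) (take c (p i0))]].
have updJ c z l : Jnv c z -> Jnv c (update z c3 0 l).
  move=> [h1 h2 h3 h4 h5]; split; rewrite ?update_other // => a q aX.
  by rewrite update_other ?h1 //; apply: contraNneq aX => ->.
have : Jnv (x2 aN 0) (denote (for_ c3 (when (elt (X_ c3) (X_ aDL))
    (put aDM (ix (G_ m (X_ c2)) (G_ m (G_ 0 (X_ aDP)))) (C_ 1) ;; incr aDP))) x2).
  apply: for_ind => //.
    apply: updJ; split=> //; first by rewrite min0n addn0.
    by move=> a b; rewrite M2 take0 /= andbF orbF.
  move=> c z cN _ Hc3 _ [h1 h2 h3 h4 h5]; apply: updJ.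
  rewrite denote_if trE /= Hc3 h3; case: ltnP => cl; last first.
    rewrite denote_skip; split=> //; first by rewrite h2 !(minn_idPr _) // leqW.
    by move=> a b; rewrite h5 !take_oversize // leqW.
  rewrite (minn_idPl (ltnW cl)) in h2.
  have Bz : base z by apply: base_agree h1 B.
  pose jj := nth i0 (p i0) c.
  have Ej : z 0 (z aDP 0) = jj.
    rewrite h1 // h2 -addnA addSnnS rd; last by rewrite /= size_map ltnS.
    by rewrite /= (nth_map i0).
  have Mi : z m j = M i0 by rewrite h1 // -[j]/(nat_of_ord i0) HM.
  have Mj : z m jj = M jj by rewrite h1 // HM.
  split; last 1 first.
  - move=> a b; rewrite denE denote_put update_other // denote_put /update.
    rewrite (eval_ix _ Bz) /= h4 Mi ?ordN // Ej Mj cell_eq [b == _]eq_sym [a == _]eq_sym.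
    rewrite (take_nth i0) // has_rcons -/jj.
    by move: (h5 a b) => /=; case: (M i0 == b); case: (M jj == a) => //= h; rewrite ?orbT // h.
  - by apply: agree_trans h1 _; apply: agree_frame.
  - by rewrite !denE /update /= h2 (minn_idPl cl) addn1 !addnS.
  - by rewrite !denE !update_other.
  - by rewrite !denE !update_other.
rewrite A2 // (b_N B) => -[h1 h2 h3 h4 h5]; split=> //.
- rewrite h2 Ef size_cat /= size_map (minn_idPr _) ?(leq_trans lk) //.
  by rewrite -/len; clear; lia.
- move=> a b; rewrite h5 Dx take_oversize ?(leq_trans lk) //; apply/orP/existsP.
    case=> [/existsP[i /existsP[j' /and4P[ij h6 h7 h8]]]|/andP[h6 /hasP[j' j'p h7]]].
      by exists i; apply/existsP; exists j'; rewrite ltnS ltnW // h6 h7.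
    by exists i0; apply/existsP; exists j'; rewrite ltnSn h6 h7.
  case=> i /existsP[j' /and4P[]]; rewrite ltnS leq_eqVlt => /predU1P[Ei|ij] h6 h7 h8.
    have Ei' : i = i0 by apply: val_inj.
    by subst i; right; rewrite h6; apply/hasP; exists j'.
  by left; apply/existsP; exists i; apply/existsP; exists j'; rewrite ij h6 h7.
Qed.

Lemma clear_ok s T (t : V -> V -> bool) (Pa : V -> {set V})
    (p := for_ c2 (for_ c3 (when T (put aDM (ix (X_ c2) (X_ c3)) (C_ 0))))) :
  base s -> dmst s Pa ->
  (forall s1 (x y : V), agree_off [:: aDM; c2; c3] s s1 -> s1 c2 0 = y -> s1 c3 0 = x ->
     tr s1 T = ~~ t y x) ->
  agree_off [:: aDM; c2; c3] s (denote p s) /\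
  dmst (denote p s) (fun y => [set x in Pa y | t y x]).
Proof.
move=> B Hd HT; split; first exact: agree_frame.
(* The cells treated so far: the rows before [i], and in row [i] the columns before [j]. *)
pose bf (i j : nat) (y x : V) := (y < i) || (y == i :> nat) && (x < j).
pose Inv i j (z : memory) := agree_off [:: aDM; c2; c3] s z /\
  forall x y : V, (z aDM (y * N + x) != 0) = (x \in Pa y) && (bf i j y x ==> t y x).
have updI c i j z l : c \in [:: c2; c3] -> Inv i j z -> Inv i j (update z c 0 l).
  move=> cX [h1 h2]; split=> [a q aX|x y].
    by rewrite update_other ?h1 //; apply: contraNneq aX => ->; rewrite inE cX orbT.
  by rewrite update_other //; move: cX; rewrite !inE => /orP[]/eqP->.
have : Inv (s aN 0) 0 (denote p s).
  apply: (@for_ind (fun i z => Inv i 0 z)) => //.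
    apply: (updI) => //; split=> // x y; rewrite Hd /bf ltn0 /=.
    by rewrite ltn0 andbF andbT.
  move=> i z iN _ Hc HNz H; apply: (updI) => //.
  have : Inv i (z aN 0) (denote (for_ c3 (when T (put aDM (ix (X_ c2) (X_ c3)) (C_ 0)))) z) /\ True.
    have : (fun j q => Inv i j q /\ q c2 0 = i) (z aN 0)
        (denote (for_ c3 (when T (put aDM (ix (X_ c2) (X_ c3)) (C_ 0)))) z).
      apply: (@for_ind (fun j q => Inv i j q /\ q c2 0 = i)) => //.
        by split; rewrite ?update_other //; apply: (updI).
      move=> j q jN _ Hc3 _ [[h1 h2] h3]; split; last first.
        by rewrite update_other // frame.
      apply: (updI) => //; have Bq : base q by apply: base_agree h1 B.
      have bS (y x : V) : bf i j.+1 y x = bf i j y x || (y == i :> nat) && (x == j :> nat).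
        rewrite /bf (ltnS x j) (leq_eqVlt x j).
        by case: (y < i); case: (nat_of_ord y == i); case: (nat_of_ord x == j); rewrite //= ?orbT ?orbF.
      have iN' : i < N by rewrite -(b_N B).
      split; first by apply: agree_trans h1 _; apply: agree_frame.
      move=> x y; rewrite bS denote_if denote_skip.
      have [/andP[/eqP Ey /eqP Ex]|nxy] := boolP ((y == i :> nat) && (x == j :> nat)).
        rewrite orbT /= (HT q x y h1) ?h3 ?Hc3 //.
        case tv: (t y x) => /=; last first.
          by rewrite andbF denote_put /update (eval_ix _ Bq) /= h3 // Hc3 -Ey -Ex eqxx.
        by rewrite h2 tv implybT.
      rewrite orbF; case: ifP => _; rewrite ?h2 // denote_put /update (eval_ix _ Bq) /= h3 // Hc3.
      have jN' : j < N by rewrite -(b_N B) -HNz.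
      by rewrite idx_inj ?ordN // (negbTE nxy) h2.
    by case.
  case=> -[h1 h2] _; split=> // x y; rewrite h2; congr (_ && (_ ==> _)).
  by rewrite /bf (ltnS y i) (leq_eqVlt y i) ltn0 andbF orbF HNz (b_N B) ordN andbT orbC.
rewrite (b_N B) => -[_ h] x y; rewrite h inE; congr (_ && _).
by rewrite /bf ordN.
Qed.

Lemma write_ok s k m (kp : pred V) (mm : V -> nat) (Pa : V -> {set V})
    (s' := denote (p_write_dig k m) s) :
  base s -> dmst s Pa -> k \notin c2 :: tmp_out -> m \notin c2 :: tmp_out ->
  (forall v : V, (s k v != 0) = kp v) -> (forall v : V, s m v = mm v) ->
  outst s' (flatten [seq size l :: l | l <-
    [seq [seq mm x | x <- enum V & kp x && (x \in Pa v)] | v <- enum V & kp v]]).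
Proof.
move=> B Hd kX mX Hk Hm; rewrite /s' /p_write_dig denote_seq; set s1 := denote _ s.
pose X := c2 :: tmp_out.
have A1 : agree_off X s s1 by exact: agree_frame.
have B1 : base s1 by apply: base_agree A1 B.
pose row v := [seq mm x | x <- enum V & kp x && (x \in Pa v)].
pose Inv j (z : memory) := agree_off X s z /\
  outst z (flatten [seq size l :: l | l <- [seq row v | v <- take j (enum V) & kp v]]).
suff [_] : Inv n (denote (for_ c2 (when (eand (elt (X_ c2) (X_ aNV)) (G_ k (X_ c2)))
    (emit_set (eand (eand (elt (X_ c3) (X_ aNV)) (G_ k (X_ c3)))
                    (G_ aDM (ix (X_ c2) (X_ c3)))) (G_ m (X_ c3))))) s1).
  by rewrite take_oversize // size_enum_ord.
apply: (forV_ind (Inv := Inv) B1) => //.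
- move=> j z l [h1 h2]; split.
    by move=> a q aX; rewrite update_other ?h1 //; apply: contraNneq aX => ->; rewrite mem_head.
  by apply: outst_off h2 => a q; rewrite !inE => /orP[]/eqP->; rewrite update_other.
- by split=> //; rewrite take0; split; rewrite // /s1 denE.
move=> v z Bz _ Hc [h1 h2]; rewrite trE /= Hc h1 // Hk.
have Et : take v.+1 (enum V) = rcons (take v (enum V)) v.
  rewrite (take_nth v) ?size_enum_ord //; congr rcons; apply: val_inj.
  by rewrite /= nth_enum_ord.
rewrite /Inv Et filter_rcons; case kv: (kp v) => //.
rewrite map_rcons map_rcons -cats1 flatten_cat /= cats0.
pose t q := [exists x : V, [&& x == q :> nat, kp x & x \in Pa v]].
have tE (x : V) : t x = kp x && (x \in Pa v).
  apply/existsP/idP => [[y /andP[/eqP/val_inj->]]//|H]; exists x.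
  by rewrite eqxx.
have := emit_set_ok (T := eand (eand (elt (X_ c3) (X_ aNV)) (G_ k (X_ c3)))
                    (G_ aDM (ix (X_ c2) (X_ c3)))) (E := G_ m (X_ c3)) (t := t)
  (f := fun q => s m q) _ h2.
rewrite (b_N Bz) => -[|Ho Ha].
  move=> y q Ay Hq qN; have By : base y by apply: base_agree Ay Bz.
  have Ay' : agree_off X s y by apply: agree_trans h1 _; apply: agree_sub Ay.
  split; last by move=> _; rewrite /= Hq Ay'.
  have Ec : y c2 0 = v by rewrite Ay.
  have Ei : eval y (ix (X_ c2) (X_ c3)) = v * N + q by rewrite (eval_ix _ By) /= ?Ec ?Hq ?ordN.
  rewrite !trE Ei /= Hq (b_NV By) !Ay' //.
  case: ltnP => qn /=; last first.
    by apply/esym/negbTE/existsPn => x; apply/negP => /andP[/eqP E _]; move: qn; rewrite -E leqNgt ltn_ord.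
  have := tE (Ordinal qn); rewrite /= => ->.
  by rewrite (Hk (Ordinal qn)) (Hd (Ordinal qn) v).
split; first by apply: agree_trans h1 _; apply: agree_sub Ha.
move: Ho; rewrite (iota_enum (n := n)).
- have -> : [seq s m (nat_of_ord x) | x <- enum V & t (nat_of_ord x)] = row v.
    rewrite /row (eq_filter tE); apply: eq_map => x; exact: Hm.
  by [].
- by have := nN L; clear; lia.
- move=> q nq; apply/negbTE/existsPn => x; apply/negP => /andP[/eqP E _].
  by move: nq; rewrite -E leqNgt ltn_ord.
Qed.

End Dig.

(** * Transforming solutions along the long paths *)

Section Paths.
Variables (I : instance) (L : 'I_(nvert I) -> seq (seq 'I_(nvert I) * nat)).
Hypothesis HL : forall v, nonzero_list v (L v).
Notation n := (nvert I).
Notation V := 'I_n.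
Notation A := (superstructure I).
Notation its := (its L).
Notation word := (word L).
Notation N := (size word).
Notation base := (base L).
Variable d : dec I.
Hypothesis ok : dec_ok its d.
Notation winst := (winst L d).
Notation dmst := (dmst L).
Notation lam := (d_lam d).
Notation C := (alive (d_r d)).
Notation K := (d_K d).
Notation Qs := (d_Q d).
Notation Ps := (longs d).
Notation F := (ascore its lam C).

Lemma win_base s : winst s -> base s.
Proof. by move=> H; apply: (l_base (c_leaf (q_core (a_path (e_ana (n_keep H)))))). Qed.

Definition elong_tail := eand (G_ aALV (X_ c2)) (eand (enot (G_ aKK (X_ c2)))
   (eand (eeq (G_ aPOS (X_ c2)) (C_ 1)) (elt (C_ 3) (G_ aLEN (X_ c2))))).

Lemma tr_long s (v : V) : winst s -> s c2 0 = v ->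
  reflect (exists2 P, P \in Ps & v = pv P 1) (tr s elong_tail).
Proof.
move=> H Hc; have Ha := e_ana (n_keep H).
rewrite /elong_tail !trE /= Hc (l_alv (c_leaf (q_core (a_path Ha)))) (q_KK (a_path Ha)).
apply: (iffP idP) => [/and4P[vC vK /eqP p1 l]|[P PP Ev]].
  have {}vC : v \in C by move: vC; case: (v \in C).
  have [P [j [PQ jm Ev Ep Ei]]] := on_path Ha vC vK.
  have j0 : j = 0 by move: p1; rewrite Ep => -[].
  subst j; exists P => //; rewrite mem_filter PQ andbT.
  by move: l; rewrite Ev (r_len (q_row (a_path Ha) PQ)).
have [PQ l] := longsP PP; have m0 : 0 < size (pqs P) by move: l; clear; lia.
have [_ r2 _ _] := r_row (q_row (a_path Ha) PQ) m0.
have vP : v \in pqs P by rewrite Ev; apply: pv_in; rewrite m0.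
have vK := ok_offK ok PQ vP; have vC : v \in C by have [_ _ _ /(_ 0 m0)[]] := ok_paths ok PQ; rewrite Ev.
by rewrite vC vK {1 2}Ev r2 (r_len (q_row (a_path Ha) PQ)) l.
Qed.

Lemma start_inj P Q : P \in Ps -> Q \in Ps -> pv P 1 = pv Q 1 -> P = Q.
Proof.
move=> PP QP E; have lP := long4 PP; have lQ := long4 QP.
apply: (Ps_disj ok PP QP (v := pv P 1)); first by apply: pv_in; move: lP; clear; lia.
by rewrite E; apply: pv_in; move: lQ; clear; lia.
Qed.

(** A long path is recognised by its first vertex, so a guarded loop over the vertices is a loop
    over the long paths, ordered by first vertex. *)
Lemma forP_ind (Inv : nat -> memory -> Prop) p s : winst s ->
  wf (for_ c2 p) -> all (fun a => ~~ (1 < a < 57)) (writes p) ->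
  (forall j s1 x, Inv j s1 -> Inv j (update s1 c2 0 x)) -> Inv 0 s ->
  (forall P s1, P \in Ps -> winst s1 -> s1 c2 0 = pv P 1 -> Inv (pv P 1) s1 ->
     Inv (pv P 1).+1 (denote p s1)) ->
  (forall (v : V) s1, (forall P, P \in Ps -> v != pv P 1) -> Inv v s1 -> Inv v.+1 s1) ->
  Inv n (denote (for_ c2 (when (elong (X_ c2)) p)) s).
Proof.
move=> H wfp /allP wr ext I0 IS IK; have B := win_base H.
have wr' a : 1 < a < 57 -> a \notin c2 :: writes p.
  move=> ar; rewrite inE negb_or; apply/andP; split; first by move: ar; clear; lia.
  by apply/negP => /wr; rewrite ar.
apply: (forV_ind (Inv := Inv) (e := elong_tail) B) => //.
  by apply/allP => a; rewrite !inE => ab; apply: wr'; move: ab; clear; lia.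
move=> v s1 B1 Hf Hc IH.
have H1 : winst s1 by apply: winst_eq H => a j ar; apply: Hf; apply: wr'.
case: (tr_long H1 Hc) => [[P PP Ev]|no]; first by rewrite Ev; apply: IS; rewrite -?Ev.
by apply: IK => // P PP; apply/eqP => Ev; apply: no; exists P.
Qed.

Section OnePath.
Variable P : V * seq V * V.
Hypothesis PP : P \in Ps.
Notation m := (size (pqs P)).

Lemma pveq i j : 0 < i <= m -> 0 < j <= m -> (pv P i == pv P j) = (i == j).
Proof. exact: (pv_eq (Ps_good ok) PP). Qed.

Lemma pvneq i j : i != j -> 0 < i <= m -> j <= m.+1 -> (pv P i == pv P j) = false.
Proof. exact: (long_neq ok PP). Qed.

Lemma m4 : 3 < m. Proof. exact: (long4 PP). Qed.

Lemma m_le_N : m < N.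
Proof.
have [PQ _] := longsP PP; have [_ un _ _] := ok_paths ok PQ.
have := max_card (mem (pqs P)); rewrite (card_uniqP un) card_ord => mn.
by have := nN L; move: mn; clear; lia.
Qed.

Record prowst (s : memory) : Prop := PRowSt {
  p_prv : forall j, j < m -> s aPRV (pv P j.+1) = pv P j;
  p_pos : forall j, j < m -> s aPOS (pv P j.+1) = j.+1;
  p_xx : s aXX (pv P 1) = px P;
  p_uu : s aUU (pv P 1) = pu P;
  p_ww : s aWW (pv P 1) = pw P;
  p_z1 : s aZ1 (pv P 1) = pv P 2;
  p_z2 : s aZ2 (pv P 1) = pv P 3 }.

Lemma win_prow s : winst s -> prowst s.
Proof.
move=> H; have [PQ l] := longsP PP; have R := q_row (a_path (e_ana (n_keep H))) PQ.
split; rewrite ?(r_xx R) ?(r_uu R) ?(r_ww R) ?(r_z1 R) ?(r_z2 R) //.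
- by move=> j jm; have [] := r_row R jm.
- by move=> j jm; have [] := r_row R jm.
- by move: l; clear; lia.
- by move: l; clear; lia.
Qed.

Definition edge_ (i : nat) (x y : V) :=
  (x == pv P i.+1) && (y == pv P i.+2) || (x == pv P i.+2) && (y == pv P i.+1).

Lemma edge_inj i j x y : i.+1 < m -> j.+1 < m -> edge_ i x y -> edge_ j x y -> i = j.
Proof.
move=> im jm; have e a b : 0 < a <= m -> 0 < b <= m -> pv P a = pv P b -> a = b.
  by move=> am bm /eqP; rewrite pveq // => /eqP.
rewrite /edge_ => /orP[]/andP[/eqP-> /eqP->] /orP[]/andP[/eqP E1 /eqP E2];
  have := e _ _ _ _ E1; have := e _ _ _ _ E2; move: im jm; clear; lia.
Qed.

Definition tmp_cut := [:: aDM; u3; u5; u6; c3].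

Lemma cut_ok s (Q : V -> {set V}) (s' := denote p_cut s) : winst s -> dmst s Q ->
  s u5 0 = px P -> s u3 0 = 1 ->
  [/\ agree_off tmp_cut s s', (s' u3 0 != 0) = conn Q P
    & forall x y : V, (s' aDM (y * N + x) != 0) =
        (x \in Q y) && ~~ [exists i : 'I_m.-1, edge_ i x y]].
Proof.
move=> H Hd H5 H3; have B := win_base H; have mm := m4; have mN := m_le_N.
have R := win_prow H.
(* The position after [c] rounds: it descends from the last vertex of the path and rests at the
   first one. As m < N, the descent is complete after N rounds. *)
pose q c := m - minn c m.-1.
have q1 c : 0 < q c <= m by rewrite /q; move: mm; clear; lia.
pose Inv c (z : memory) := [/\ agree_off tmp_cut s z, z u5 0 = pv P (q c),
    (z u3 0 != 0) = [forall i : 'I_m.-1, (q c <= i.+1) ==> adj Q (pv P i.+1) (pv P i.+2)]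
  & forall x y : V, (z aDM (y * N + x) != 0) =
        (x \in Q y) && ~~ [exists i : 'I_m.-1, (q c <= i.+1) && edge_ i x y]].
have upd c z l : Inv c z -> Inv c (update z c3 0 l).
  move=> [h1 h2 h3 h4]; split; rewrite ?update_other // => a j aX.
  by rewrite update_other ?h1 //; apply: contraNneq aX => ->.
have : Inv (s aN 0) s'.
  apply: for_ind => //.
    apply: (upd); have q0 : q 0 = m by rewrite /q min0n subn0.
    split=> //; rewrite ?q0.
    - by rewrite H5.
    - by rewrite H3; apply/esym/forallP => i; apply/implyP; have := ltn_ord i; move: mm; clear; lia.
    - move=> x y; rewrite (Hd x y) (_ : [exists i, _] = false) ?andbT //.
      by apply/negbTE/existsPn => i; rewrite negb_and; have := ltn_ord i; move: mm; clear; lia.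
  move=> c z cN _ Hc _ [h1 h2 h3 h4]; apply: (upd).
  have Bz : base z by apply: base_agree h1 B.
  have qj : (q c).-1.+1 = q c by rewrite prednK //; case/andP: (q1 c).
  have qm : (q c).-1 < m by rewrite qj; case/andP: (q1 c).
  have Ez : z aPOS (z u5 0) = q c by rewrite h2 h1 // -qj (p_pos R).
  rewrite denote_if trE /= Ez denote_skip; case: (ltnP 1 (q c)) => qc; last first.
    have Eq : q c.+1 = q c by move: qc; rewrite /q; clear; lia.
    by split=> //; rewrite ?Eq.
  pose k := (q c).-2; have Ek : q c = k.+2 by rewrite /k; move: qc; clear; lia.
  have Eq : q c.+1 = k.+1 by move: Ek qc; rewrite /q; clear; lia.
  have km : k.+1 < m by move: (q1 c); rewrite Ek; clear; lia.
  have km' : k < m.-1 by move: km; clear; lia.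
  rewrite Ek in h2 h3 h4.
  do 4 rewrite denote_seq; set z1 := denote (setv u6 _) z.
  have Z6 : z1 u6 0 = pv P k.+1 by rewrite /z1 denE /update /= h2 h1 // (p_prv R).
  have S1 a j : a != u6 -> z1 a j = z a j by move=> au; rewrite /z1 denE update_other.
  have A1 : agree_off tmp_cut s z1 by apply: agree_trans h1 _; apply: agree_frame.
  have Z5 : z1 u5 0 = pv P k.+2 by rewrite S1.
  have D1 x : z1 aDM x = z aDM x by rewrite S1.
  have Z3 : z1 u3 0 = z u3 0 by rewrite S1.
  have B1 : base z1 by apply: base_agree A1 B.
  clearbody z1; set z2 := denote (when _ _) z1.
  have E56 (y : memory) : base y -> y u5 0 = pv P k.+2 -> y u6 0 = pv P k.+1 ->
      eval y (ix (X_ u5) (X_ u6)) = pv P k.+2 * N + pv P k.+1 /\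
      eval y (ix (X_ u6) (X_ u5)) = pv P k.+1 * N + pv P k.+2.
    by move=> By y5 y6; split; rewrite (eval_ix _ By) /= ?y5 ?y6 ?ordN.
  have [e56 e65] := E56 _ B1 Z5 Z6.
  have nex (i : 'I_m.-1) : (k.+2 <= i.+1) && edge_ i (pv P k.+1) (pv P k.+2) = false.
    apply/negP => /andP[ki ei]; have eK : edge_ k (pv P k.+1) (pv P k.+2) by rewrite /edge_ !eqxx.
    have im : i.+1 < m by have := ltn_ord i; clear; lia.
    by have E := edge_inj im km ei eK; move: ki; rewrite E ltnn.
  have nex' (i : 'I_m.-1) : (k.+2 <= i.+1) && edge_ i (pv P k.+2) (pv P k.+1) = false.
    by rewrite -[RHS](nex i) /edge_ orbC [X in _ && (X || _)]andbC [X in _ && (_ || X)]andbC.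
  have T2 : tr z1 (enot (ein (X_ u5) (X_ u6) +' ein (X_ u6) (X_ u5))) =
      ~~ adj Q (pv P k.+1) (pv P k.+2).
    rewrite trE tr_or /ein !tr_get e56 e65 !D1 !h4 /adj orbC.
    rewrite (_ : [exists i : 'I_m.-1, _ && edge_ i (pv P k.+1) _] = false); last first.
      by apply/negbTE/existsPn => i; rewrite nex.
    rewrite (_ : [exists i : 'I_m.-1, _ && edge_ i (pv P k.+2) _] = false) ?andbT //.
    by apply/negbTE/existsPn => i; rewrite nex'.
  have W2 : z2 u3 0 = if adj Q (pv P k.+1) (pv P k.+2) then z u3 0 else 0.
    by rewrite /z2 when_putE T2 /=; case: (adj _ _ _).
  have S2 a j : a != u3 -> z2 a j = z1 a j.
    by move=> au; rewrite /z2 when_putE (negbTE au) andbF.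
  have A2 : agree_off tmp_cut s z2 by apply: agree_trans A1 _; apply: agree_frame.
  have B2 : base z2 by apply: base_agree A2 B.
  clearbody z2; set z3 := denote (put aDM _ _) z2; set z4 := denote (put aDM _ _) z3.
  have Y5 : z2 u5 0 = pv P k.+2 by rewrite S2.
  have Y6 : z2 u6 0 = pv P k.+1 by rewrite S2.
  have [f56 f65] := E56 _ B2 Y5 Y6.
  have B3 : base z3 by apply: base_frame B2.
  have [g56 g65] : eval z3 (ix (X_ u5) (X_ u6)) = pv P k.+2 * N + pv P k.+1 /\
      eval z3 (ix (X_ u6) (X_ u5)) = pv P k.+1 * N + pv P k.+2.
    by apply: E56 => //; rewrite /z3 denote_put update_other.
  have D4 (x y : V) : z4 aDM (y * N + x) = if edge_ k x y then 0 else z aDM (y * N + x).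
    rewrite /z4 denote_put g65 /update /= cell_eq /z3 denote_put f56 /update /= cell_eq S2 // D1.
    rewrite /edge_ ![y == _]eq_sym ![x == _]eq_sym.
    by case: (pv P k.+1 == y); case: (pv P k.+2 == y); case: (pv P k.+1 == x); case: (pv P k.+2 == x).
  have A4 : agree_off tmp_cut s z4.
    by apply: agree_trans A2 _; apply: (agree_trans (s2 := z3)); apply: agree_frame.
  have S4 a j : a != aDM -> z4 a j = z2 a j by move=> ad; rewrite /z4 /z3 !denE !update_other.
  clearbody z4; split; rewrite ?Eq.
  - by apply: agree_trans A4 _; apply: agree_frame.
  - by rewrite denE /update /= S4.
  - rewrite denE update_other // S4 // W2.
    have -> : [forall i : 'I_m.-1, (k < i.+1) ==> adj Q (pv P i.+1) (pv P i.+2)] =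
        [forall i : 'I_m.-1, (k.+1 < i.+1) ==> adj Q (pv P i.+1) (pv P i.+2)] &&
        adj Q (pv P k.+1) (pv P k.+2).
      apply/forallP/andP => [al|[/forallP al ak] i].
        split; last by have := al (Ordinal km'); rewrite /= ltnSn.
        by apply/forallP => i; apply/implyP => ki; have := al i; rewrite ltnW.
      rewrite ltnS leq_eqVlt; apply/implyP => /predU1P[<-//|ki].
      by have := al i; rewrite ltnS ki.
    by rewrite -h3; case: (adj _ _ _); rewrite ?andbT ?andbF.
  - move=> x y; rewrite denE update_other // D4.
    have -> : [exists i : 'I_m.-1, (k < i.+1) && edge_ i x y] =
        [exists i : 'I_m.-1, (k.+1 < i.+1) && edge_ i x y] || edge_ k x y.
      apply/existsP/orP => [[i /andP[]]|[/existsP[i /andP[ki ei]]|ek]].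
      - rewrite ltnS leq_eqVlt => /predU1P[<- ek|ki ei]; [by right|left].
        by apply/existsP; exists i; rewrite ltnS ki.
      - by exists i; rewrite ltnW.
      - by exists (Ordinal km'); rewrite ltnSn.
    by case: ifP => ek; rewrite ?orbT ?orbF ?andbF // h4.
rewrite (b_N B) => -[h1 h2 h3 h4].
have qN : q N = 1 by rewrite /q; move: mN mm; clear; lia.
rewrite qN in h3 h4; split=> //.
Qed.

End OnePath.

(** ** Forward transformation *)

Section Forward.
Variable Pa : V -> {set V}.
Hypothesis nPa : normal A C Pa.

(** The digraph once the paths with first vertex below [k] have been transformed. Long paths are
    disjoint, so a step touches the rows of one path only. *)
Definition mix k (v : V) : {set V} :=
  if pof Ps v is Some P then if pv P 1 < k then fw Ps Pa v else Pa v else Pa v.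

Definition tmp_fw := [:: aDM; u1; u3; u4; u5; u6; c2; c3].

Lemma forward_step P s : P \in Ps -> winst s -> s c2 0 = pv P 1 -> dmst s (mix (pv P 1)) ->
  dmst (denote (p_fwinit ;; p_cut ;; p_fwends) s) (mix (pv P 1).+1).
Proof.
move=> PP H Hc Hd; have mm := m4 PP; have R := win_prow PP H.
have [[d1x d23 dwx dw2 dw3] [dx2 dx3 du2 du3]] := long_dist ok PP.
set m := size (pqs P) in mm.
do 2 rewrite denote_seq; set s1 := denote p_fwinit s.
have B := win_base H.
have A1 : agree_off tmp_fw s s1 by exact: agree_frame.
have H1 : winst s1 by apply: winst_off A1 _ H.
have U4 : s1 u4 0 = px P by rewrite /s1 /p_fwinit !denE /update /= Hc (p_xx R).
have mixP (v : V) : v \in pqs P -> mix (pv P 1) v = Pa v.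
  by move=> vP; rewrite /mix (pofP (Ps_disj ok) PP vP) ltnn.
have xP : px P \in pqs P by apply: pv_in; move: mm; rewrite -/m; clear; lia.
have yP : pv P 1 \in pqs P by apply: pv_in; move: mm; rewrite -/m; clear; lia.
pose a := pu P \in Pa (px P).
have U1 : (s1 u1 0 != 0) = a.
  by rewrite /s1 /p_fwinit !denE /update /= Hc (p_xx R) (p_uu R) (b_BASE B) ?ordN // Hd mixP.
have U3 : s1 u3 0 = 1 by rewrite /s1 /p_fwinit !denE /update /=.
have U5 : s1 u5 0 = px P by rewrite /s1 /p_fwinit !denE /update /= Hc (p_xx R).
have D1 : dmst s1 (mix (pv P 1)) by move=> x y; rewrite /s1 frame.
have C1 : s1 c2 0 = pv P 1 by rewrite /s1 frame.
clearbody s1; have [A2 W3 D2] := cut_ok PP H1 D1 U5 U3.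
set s2 := denote p_cut s1 in A2 W3 D2 *.
have H2 : winst s2 by apply: winst_off A2 _ H1.
have U42 : s2 u4 0 = px P by rewrite A2.
have U12 : (s2 u1 0 != 0) = a by rewrite A2.
have C2 : s2 c2 0 = pv P 1 by rewrite A2.
clearbody s2; have R2 := win_prow PP H2; have B2 := win_base H2.
have Ec : conn (mix (pv P 1)) P = conn Pa P.
  apply: eq_forallb => i; rewrite /adj !mixP //; apply: pv_in; have := ltn_ord i; rewrite -/m; clear; lia.
rewrite Ec in W3.
have ends (x y : V) : (denote p_fwends s2 aDM (y * N + x) != 0) =
    if a then [|| (y == px P) && (x == pu P), (y == pv P 1) && ((x == pv P 2) || (x == pv P 3)),
      (y == pv P 1) && (x == px P) && conn Pa P | (s2 aDM (y * N + x) != 0)]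
    else [|| (y == px P) && ((x == pv P 2) || (x == pv P 3)),
      (y == pv P 1) && (x == px P) && conn Pa P |
      ~~ ((y == px P) && (x == pu P)) && (s2 aDM (y * N + x) != 0)].
  rewrite /p_fwends; do 2 rewrite denote_seq; set z1 := denote (put _ _ _) s2.
  have ev (z : memory) : base z -> agree_off [:: aDM] s2 z ->
      [/\ eval z (ix (X_ u4) (G_ aUU (X_ c2))) = px P * N + pu P,
          eval z (ix (X_ c2) (X_ u4)) = pv P 1 * N + px P,
          eval z (ix (X_ c2) (G_ aZ1 (X_ c2))) = pv P 1 * N + pv P 2,
          eval z (ix (X_ c2) (G_ aZ2 (X_ c2))) = pv P 1 * N + pv P 3
        & eval z (ix (X_ u4) (G_ aZ1 (X_ c2))) = px P * N + pv P 2 /\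
          eval z (ix (X_ u4) (G_ aZ2 (X_ c2))) = px P * N + pv P 3].
    move=> Bz Az; have z4 : z u4 0 = px P by rewrite Az.
    have z2 : z c2 0 = pv P 1 by rewrite Az.
    have zu : z aUU (pv P 1) = pu P by rewrite Az // (p_uu R2).
    have z1' : z aZ1 (pv P 1) = pv P 2 by rewrite Az // (p_z1 R2).
    have z2' : z aZ2 (pv P 1) = pv P 3 by rewrite Az // (p_z2 R2).
    by split; [| | | |split]; rewrite (eval_ix _ Bz) /= ?z4 ?z2 ?zu ?z1' ?z2' ?ordN.
  have ag (z z' : memory) k e : agree_off [:: aDM] s2 z -> z' = denote (put aDM k e) z ->
      agree_off [:: aDM] s2 z' /\ base z'.
    move=> Az ->; have Az' : agree_off [:: aDM] s2 (denote (put aDM k e) z).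
      by apply: agree_trans Az _; apply: agree_frame.
    by split=> //; apply: base_agree Az' B2.
  have [e1 _ _ _ _] := ev _ B2 (fun _ _ _ => erefl).
  have [Az1 Bz1] := ag s2 z1 _ _ (fun _ _ _ => erefl) erefl.
  have D1' (x' y' : V) : z1 aDM (y' * N + x') = if (y' == px P) && (x' == pu P) then 0 else s2 aDM (y' * N + x').
    by rewrite /z1 denote_put e1 /update /= cell_eq.
  have Z3 : z1 u3 0 = s2 u3 0 by rewrite Az1.
  have Z1 : z1 u1 0 = s2 u1 0 by rewrite Az1.
  have [_ e2 _ _ _] := ev _ Bz1 Az1.
  clearbody z1; set z2 := denote (when _ _) z1.
  have Az2 : agree_off [:: aDM] s2 z2 by apply: agree_trans Az1 _; apply: agree_frame.
  have Bz2 : base z2 by apply: base_agree Az2 B2.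
  have D2' (x' y' : V) : (z2 aDM (y' * N + x') != 0) =
      (y' == pv P 1) && (x' == px P) && conn Pa P || (z1 aDM (y' * N + x') != 0).
    rewrite /z2 when_putE trE Z3 W3 e2 /= cell_eq.
    by case: (conn Pa P); rewrite ?andbT ?andbF //=; case: ifP.
  have Z12 : z2 u1 0 = s2 u1 0 by rewrite Az2.
  clearbody z2; rewrite denote_if trE Z12 U12; case: ifP => aa.
    do 2 rewrite denote_seq.
    have [f1 _ _ _ _] := ev _ Bz2 Az2; set z3 := denote _ z2.
    have [Az3 Bz3] := ag z2 z3 _ _ Az2 erefl; have [_ _ f3 _ _] := ev _ Bz3 Az3.
    set z4 := denote _ z3; have [Az4 Bz4] := ag z3 z4 _ _ Az3 erefl; have [_ _ _ f4 _] := ev _ Bz4 Az4.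
    rewrite denote_put f4 /update /= cell_eq /z4 denote_put f3 /update /= cell_eq.
    rewrite /z3 denote_put f1 /update /= cell_eq.
    have := D2' x y; rewrite D1'.
    by case: (y == pv P 1); case: (y == px P); case: (x == pu P); case: (x == pv P 2);
      case: (x == pv P 3); case: (x == px P); case: (conn Pa P) => //=; rewrite ?orbT.
  rewrite denote_seq; have [_ _ _ _ [f1 _]] := ev _ Bz2 Az2; set z3 := denote _ z2.
  have [Az3 Bz3] := ag z2 z3 _ _ Az2 erefl; have [_ _ _ _ [_ f2]] := ev _ Bz3 Az3.
  rewrite denote_put f2 /update /= cell_eq /z3 denote_put f1 /update /= cell_eq.
  have := D2' x y; rewrite D1'.
  by case: (y == pv P 1); case: (y == px P); case: (x == pu P); case: (x == pv P 2);
    case: (x == pv P 3); case: (x == px P); case: (conn Pa P) => //=; rewrite ?orbT.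
move=> x y; rewrite ends D2 /mix; have [yP'|yP'] := boolP (y \in pqs P); last first.
  have ne z : z \in pqs P -> (y == z) = false by move=> zP; apply: contraNF yP' => /eqP->.
  have ex : [exists i : 'I_m.-1, edge_ P i x y] = false.
    apply/negbTE/existsPn => i; rewrite /edge_ !ne ?andbF //; apply: pv_in; have := ltn_ord i; rewrite -/m; clear; lia.
  rewrite !ne // ex andbT /=.
  have : mix (pv P 1).+1 y = mix (pv P 1) y.
    rewrite /mix; case E: (pof Ps y) => [Q|] //; have [QP yQ] := pofS E; rewrite (ltnS (pv Q 1) (pv P 1)) (leq_eqVlt (pv Q 1) (pv P 1)).
    case: eqP => //= /val_inj Eq; exfalso; move: yP'; rewrite -(start_inj QP PP Eq) yQ //.
  by rewrite /mix => ->; case: (a).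
rewrite (pofP (Ps_disj ok) PP yP') ltnSn ltnn.
have [j jm Ey] := pqsP yP'; rewrite -/m in jm.
have pe i k : 0 < i <= m -> 0 < k <= m -> (pv P i == pv P k) = (i == k) by exact: pveq.
have pn i k : i != k -> 0 < i <= m -> k <= m.+1 -> (pv P i == pv P k) = false by exact: pvneq.
have one : 0 < 1 <= m by move: mm; clear; lia.
have mmm : 0 < m <= m by move: mm; clear; lia.
have y1 : (y == pv P 1) = (j == 1) by rewrite Ey pe.
have ym : (y == px P) = (j == m) by rewrite Ey /px pe.
(* Once the inner edges are cut, the only arcs into inner vertices come from the two ends of the
   path. *)
have base0 : (x \in Pa y) && ~~ [exists i : 'I_m.-1, edge_ P i x y] =
    [|| [&& j == 1, x == pw P & pw P \in Pa y] | [&& j == m, x == pu P & a]].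
  have [xy|xy] := boolP (x \in Pa y); last first.
    apply/esym/negbTE/negP => /orP[/and3P[_ /eqP Ex]|/and3P[/eqP Ej /eqP Ex]].
      by rewrite -Ex (negbTE xy).
    by rewrite /a -Ex -/m /px -/m -Ej -Ey (negbTE xy).
  case: j jm Ey y1 ym => // j jm Ey y1 ym.
  have := normal_on (@super_sym I) (Ps_good ok) nPa PP (jm : j < size (pqs P)).
  rewrite -Ey => /(_ x xy) Hx /=.
  have inn i : 0 < i <= m -> x = pv P i -> (i == j) || (i == j.+2) -> [exists i : 'I_m.-1, edge_ P i x y].
    move=> im Ex ij; apply/existsP; case/orP: ij => /eqP Ei.
      have ji : j.-1 < m.-1 by move: im jm; rewrite Ei; clear; lia.
      have j0 : 0 < j by move: im; rewrite Ei => /andP[].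
      by exists (Ordinal ji); rewrite /edge_ [nat_of_ord _]/= prednK // Ex Ey Ei !eqxx.
    have ji : j < m.-1 by move: im; rewrite Ei; clear; lia.
    by exists (Ordinal ji); rewrite /edge_ /= Ex Ei Ey !eqxx orbT.
  have out_ (z : V) : (forall i, 0 < i <= m -> (z == pv P i) = false) -> x = z ->
      [exists i : 'I_m.-1, edge_ P i x y] = false.
    move=> hz ->; apply/negbTE/existsPn => i; rewrite /edge_ !hz //; have := ltn_ord i; clear; lia.
  have wz i : 0 < i <= m -> (pw P == pv P i) = false.
    by move=> im; rewrite -(pv0 P) eq_sym pn //; move: im; clear; lia.
  have uz i : 0 < i <= m -> (pu P == pv P i) = false.
    by move=> im; rewrite -(pvm P) eq_sym pn //; move: im; rewrite -/m; clear; lia.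
  case: Hx => Ex.
    have [j0|j0] := eqVneq j 0.
      rewrite j0 pv0 in Ex; rewrite (out_ (pw P) wz Ex) j0 Ex eqxx /= -Ex xy eqxx //.
    rewrite (inn j) ?eqxx //; last by move: jm j0; clear; lia.
    rewrite eqSS (negbTE j0) /= Ex -(pvm P) pn; rewrite -/m ?andbF //; move: jm j0; clear; lia.
  have [jM|jM] := eqVneq j.+1 m.
    rewrite jM -/m pvm in Ex; rewrite (out_ (pu P) uz Ex) Ex eqxx /a -Ex /=.
    have -> : px P = y by rewrite Ey jM.
    by rewrite xy orbT.
  rewrite (inn j.+2) ?eqxx ?orbT //; last by move: jm jM; clear; lia.
  by rewrite /= orbF Ex -(pv0 P) pn ?andbF //; move: jm jM; clear; lia.
rewrite base0 y1 ym /fw (pofP (Ps_disj ok) PP yP') ym y1 -/a.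
have [->|j1] := eqVneq j 1.
  have m1 : (1 == m) = false by move: mm; clear; lia.
  rewrite m1 /= !inE !in_opt.
  by case: (a); case: (conn Pa P); case: (x == pw P); case: (x == px P); case: (x == pv P 2);
    case: (x == pv P 3); case: (pw P \in Pa y).
have [Ejm|jm'] := eqVneq j m => /=; last by rewrite inE; case: (a).
by case: (a); rewrite !inE ?andbF ?orbF //=; case: (x == pu P); rewrite ?orbT ?orbF.
Qed.

Lemma forward_ok s : winst s -> dmst s Pa -> dmst (denote p_forward s) (fw Ps Pa).
Proof.
move=> H Hd; pose Inv k (z : memory) := dmst z (mix k).
have : Inv n (denote p_forward s).
  apply: (forP_ind (Inv := Inv)) => //.
  - by move=> x y; rewrite Hd /mix; case: (pof Ps y).
  - by move=> P s1 PP H1 Hc; apply: forward_step.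
  move=> v s1 nv Hv x y; rewrite Hv /mix; case E: (pof Ps y) => [P|] //.
  have [PP _] := pofS E; rewrite (ltnS (pv P 1) v) (leq_eqVlt (pv P 1) v).
  case: (eqVneq (nat_of_ord (pv P 1)) v) => [/val_inj Ev|] //.
  by have := nv P PP; rewrite Ev eqxx.
move=> Hn x y; rewrite Hn /mix; case E: (pof Ps y) => [P|]; first by rewrite ltn_ord.
by rewrite /fw E.
Qed.

End Forward.

End Paths.

Section Back.
Variables (I : instance) (L : 'I_(nvert I) -> seq (seq 'I_(nvert I) * nat)).
Hypothesis HL : forall v, nonzero_list v (L v).
Notation n := (nvert I).
Notation V := 'I_n.
Notation A := (superstructure I).
Notation slots := (slots L).
Notation its := (its L).
Notation word := (word L).
Notation N := (size word).
Notation base := (base L).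
Notation slot_at i := (tnth (in_tuple slots) i).
Notation item_at i := (item (slot_at i)).
Variable d : dec I.
Hypothesis ok : dec_ok its d.
Notation winst := (winst L d).
Notation dmst := (dmst L).
Notation lam := (d_lam d).
Notation par := (d_par d).
Notation C := (alive (d_r d)).
Notation K := (d_K d).
Notation Qs := (d_Q d).
Notation Ps := (longs d).
Notation F := (ascore its lam C).

Variable Pa : V -> {set V}.

Definition bitst (s : memory) (P : V * seq V * V) :=
  [/\ (s aBA (pv P 1) != 0) = bka Pa P, (s aBq (pv P 1) != 0) = bkb Pa P
    & (s aBC (pv P 1) != 0) = bkc Pa P].

Definition tmp_bits := [:: aBA; aBq; aBC; c2].

Lemma bits_ok s (s' := denote p_bits s) : winst s -> dmst s Pa ->
  agree_off tmp_bits s s' /\ forall P, P \in Ps -> bitst s' P.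
Proof.
move=> H Hd; split; first exact: agree_frame.
pose Inv k (z : memory) := agree_off tmp_bits s z /\
  forall P, P \in Ps -> pv P 1 < k -> bitst z P.
suff [_ h] : Inv n s' by move=> P PP; apply: h.
apply: (forP_ind ok (Inv := Inv) H) => //.
- move=> j z x [h1 h2]; split; first by move=> a l al; rewrite update_other ?h1 //; apply: contraNneq al => ->.
  by move=> P PP /(h2 P PP)[b1 b2 b3]; split; rewrite update_other.
- move=> P z PP Hz Hc [h1 h2]; split; first by apply: agree_trans h1 _; apply: agree_frame.
  have R := win_prow PP Hz; have Bz := win_base Hz.
  have Dz (x y : V) : (z aDM (y * N + x) != 0) = (x \in Pa y) by rewrite h1.
  have bd (v : V) : z aBASE v = v * N by rewrite (b_BASE Bz) ?ordN.
  move=> Q QP; rewrite (ltnS (pv Q 1) (pv P 1)) (leq_eqVlt (pv Q 1) (pv P 1)).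
  have [/val_inj E|ne] /= := eqVneq (nat_of_ord (pv Q 1)) (pv P 1).
    have EQ := start_inj ok QP PP E; subst Q => _.
    rewrite /bitst !denE /update /= Hc !eqxx /= (p_xx R) (p_uu R) (p_ww R) !bd.
    split; rewrite ?Dz //.
    by rewrite -/(eval _ _); have := Dz (px P) (pv P 1); rewrite /bkc; case: (z aDM _) => [|k] /= <-.
  move=> lt; have [b1 b2 b3] := h2 Q QP lt.
  by rewrite /bitst !denE /update /= Hc (negbTE ne).
- move=> v z nv [h1 h2]; split=> // P PP; rewrite (ltnS (pv P 1) v) (leq_eqVlt (pv P 1) v).
  case: (eqVneq (nat_of_ord (pv P 1)) v) => [/val_inj Ev|_] /=; last exact: h2.
  by have := nv P PP; rewrite Ev eqxx.
Qed.

(** The rows of [bw] off the long paths; on the long paths it is empty, ready for the backtracking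
    to fill in. *)
Definition masked (y : V) : {set V} :=
  [set x in Pa y | [&& A y x, nrm d y, y \in C & x \in C]].

Lemma mask_ok s (s' := denote p_mask s) : winst s -> dmst s Pa ->
  agree_off [:: aDM; c2; c3] s s' /\ dmst s' masked.
Proof.
move=> H Hd; have B := win_base H.
apply: (clear_ok (t := fun y x => [&& A y x, nrm d y, y \in C & x \in C]) B Hd).
move=> s1 x y A1 H2 H3; have H1 : winst s1 by apply: winst_off A1 _ H.
have B1 := win_base H1; have lf := c_leaf (q_core (a_path (e_ana (n_keep H1)))).
rewrite tr_not !tr_and (tr_eadj (a := y) (b := x) B1) // !tr_get /= H2 H3.
rewrite (e_nrm (n_keep H1)) !(l_alv lf).
by case: (A y x) => //=; case: (nrm d y) => //=; case: (y \in C) => //=; case: (x \in C).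
Qed.

Lemma pick_stepE (g : nat -> bool -> bool -> nat) (a b c : bool) k (z : memory) (x1 x2 : V) :
  base z -> z t1 0 = x1 -> z t2 0 = x2 -> (z u3 0 != 0) = c ->
  (forall l h : bool, z (64 + (2 * l + h)) 0 = g k.+1 l h) ->
  (forall a1 b1 c1, z (wix a1 b1 c1) x2 = tab g k a1 b1 c1) ->
  (forall a1 b1 c1, z (wix a1 b1 c1) x1 = tab g k.+1 a1 b1 c1) ->
  let: (r, l, c') := bpick g b k a c in
  let z' := denote (p_pick a b c) z in
  [/\ (z' u1 0 != 0) = l, (z' u3 0 != 0) = c'
    & forall x y : V, (z' aDM (y * N + x) != 0) =
      [|| r && (x == x2) && (y == x1), l && (x == x1) && (y == x2) | (z aDM (y * N + x) != 0)]].
Proof.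
move=> Bz H1 H2 H3 Hl W2 W1; rewrite /p_pick /bpick.
have e12 : eval z (ix (X_ t1) (X_ t2)) = x1 * N + x2 by rewrite (eval_ix _ Bz) /= ?H1 ?H2 ?ordN.
have e21 : eval z (ix (X_ t2) (X_ t1)) = x2 * N + x1 by rewrite (eval_ix _ Bz) /= ?H1 ?H2 ?ordN.
have El l : eval z (eloc l a) = g k.+1 l a by rewrite /eloc /= Hl.
have ea e1 e2 : eval z (e1 +' e2) = eval z e1 + eval z e2 by [].
have ew a1 b1 c1 : eval z (eW a1 b1 c1 (X_ t2)) = tab g k a1 b1 c1 by rewrite -W2 -H2.
have ew1 a1 b1 c1 : eval z (eW a1 b1 c1 (X_ t1)) = tab g k.+1 a1 b1 c1 by rewrite -W1 -H1.
have trW a1 : tr z (eW a1 b c (X_ t2)) = (tab g k a1 b c != 0) by rewrite /tr ew.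
rewrite denote_if tr_and tr_eq trW ea ew ew1 El.
case: ifP => [_|_].
  rewrite denote_seq; split; first by rewrite denote_put /update.
    by rewrite !denote_put !update_other.
  move=> x y; rewrite denote_put update_other // denote_put /update e12 cell_eq.
  by case: (y == x1); case: (x == x2).
rewrite denote_if tr_and tr_eq trW ea ew ew1 El.
case: ifP => [_|_].
  rewrite denote_seq; split; first by rewrite denote_put /update.
    by rewrite !denote_put !update_other.
  move=> x y; rewrite denote_put update_other // denote_put /update e21 cell_eq.
  by case: (y == x2); case: (x == x1).
split; [by rewrite !denE /update| |by move=> x y; rewrite !denE !update_other].
rewrite denote_seq; set z1 := denote (setv u1 _) z.
have E1 b' c' : z1 (wix b' b c') x2 = tab g k b' b c'.
  by rewrite /z1 denE update_other ?W2 //; case: (b'); case: (b); case: (c').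
have T2 : z1 t2 0 = x2 by rewrite /z1 denE update_other.
rewrite denote_put /update; have -> : (u3 == u3) && (0 == eval z1 (C_ 0)) = true by [].
rewrite -/(tr z1 _) !tr_not negbK tr_lt /= T2 !E1 //.
Qed.

Lemma picksE s x j : denote p_picks s x j = denote (p_pick (s u1 0 != 0) (s u2 0 != 0) (s u3 0 != 0)) s x j.
Proof.
rewrite /p_picks denote_if trE; case: (s u1 0 != 0); rewrite denote_if trE;
by case: (s u2 0 != 0); rewrite denote_if trE; case: (s u3 0 != 0).
Qed.

(** The counterpart of [mix]: rows on a long path stay empty until that path has been treated. *)
Definition mixb k (v : V) : {set V} :=
  if pof Ps v is Some P then if pv P 1 < k then bw A C F Ps Pa v else set0 else masked v.

Definition tmp_bk := [:: aDM; t1; t2; t4; t5; t6; t7; u1; u2; u3; c2; c3].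

Section OneBack.
Variable P : V * seq V * V.
Hypothesis PP : P \in Ps.
Notation m := (size (pqs P)).
Notation g := (gpath F P).
Notation b := (bkb Pa P).
Notation bkt := (back g b m.-1 (bka Pa P) (bkc Pa P)).

Definition arcs (x y : V) (j : nat) :=
  (bkt j).1 && (x == pv P j.+1) && (y == pv P j.+2) || (bkt j).2 && (x == pv P j.+2) && (y == pv P j.+1).

Lemma backloop_ok s (D : V -> V -> bool) (s' := denote (for_ c3 p_backstep) s) : winst s ->
  s t1 0 = px P -> (s u1 0 != 0) = bka Pa P -> (s u2 0 != 0) = b -> (s u3 0 != 0) = bkc Pa P ->
  (forall x y : V, (s aDM (y * N + x) != 0) = D x y) ->
  forall x y : V, (s' aDM (y * N + x) != 0) = D x y || [exists j : 'I_m.-1, arcs x y j].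
Proof.
move=> H H1 Hu1 Hu2 Hu3 Hd; have B := win_base H; have mm := m4 PP; have mN := m_le_N ok PP.
have R := win_prow PP H; have [PQ _] := longsP PP.
pose q c := m - minn c m.-1.
have q1 c : 0 < q c <= m by rewrite /q; move: mm; clear; lia.
pose X := [:: aDM; t1; t2; t4; t5; t6; t7; u1; u3; c3].
(* The choices still to be made in the backtracking from the end of the path are those of a
   backtracking from the current position with the bits now in [u1] and [u3]. *)
pose Inv c (z : memory) := [/\ agree_off X s z, z t1 0 = pv P (q c),
   forall j, j < (q c).-1 -> bkt j = back g b (q c).-1 (z u1 0 != 0) (z u3 0 != 0) j
  & forall x y : V, (z aDM (y * N + x) != 0) =
        D x y || [exists j : 'I_m.-1, (q c <= j.+1) && arcs x y j]].
have upd c z l : Inv c z -> Inv c (update z c3 0 l).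
  move=> [h1 h2 h3 h4]; split; rewrite ?update_other // => a j aX.
  by rewrite update_other ?h1 //; apply: contraNneq aX => ->.
have : Inv (s aN 0) s'.
  apply: for_ind => //.
    apply: (upd); have q0 : q 0 = m by rewrite /q min0n subn0.
    split=> //; rewrite ?q0 //.
    - by move=> j _; rewrite Hu1 Hu3.
    - move=> x y; rewrite Hd (_ : [exists i, _] = false) ?orbF //.
      by apply/negbTE/existsPn => i; rewrite negb_and; have := ltn_ord i; move: mm; clear; lia.
  move=> c z cN _ Hc _ [h1 h2 h3 h4]; apply: (upd).
  have Hz : winst z by apply: winst_off h1 _ H.
  have qj : (q c).-1.+1 = q c by rewrite prednK //; case/andP: (q1 c).
  have qm : (q c).-1 < m by rewrite qj; case/andP: (q1 c).
  have Ez : z aPOS (z t1 0) = q c by rewrite h2 h1 // -qj (p_pos R).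
  rewrite /p_backstep denote_if trE /= Ez denote_skip; case: (ltnP 1 (q c)) => qc; last first.
    have Eq : q c.+1 = q c by move: qc; rewrite /q; clear; lia.
    by split=> //; rewrite ?Eq.
  pose k := (q c).-2; have Ek : q c = k.+2 by rewrite /k; move: qc; clear; lia.
  have Eq : q c.+1 = k.+1 by move: Ek qc; rewrite /q; clear; lia.
  have km : k.+1 < m by move: (q1 c); rewrite Ek; clear; lia.
  have km0 : k < m by apply: ltnW.
  have km' : k < m.-1 by move: km; clear; lia.
  rewrite Ek /= in h2 h3 h4.
  do 3 rewrite denote_seq; set z1 := denote (setv t2 _) z.
  have S1 a j : a != t2 -> z1 a j = z a j by move=> au; rewrite /z1 denE update_other.
  have Z2 : z1 t2 0 = pv P k.+1 by rewrite /z1 denE /update /= h2 h1 // (p_prv R).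
  have Z1 : z1 t1 0 = pv P k.+2 by rewrite S1.
  have A1 : agree_off X s z1 by apply: agree_trans h1 _; apply: agree_frame.
  have Hz1 : winst z1 by apply: winst_off A1 _ H.
  have [vC En] : pv P k.+2 \in C /\ nbrs A C (pv P k.+2) = [set pv P k.+1; pv P k.+3].
    by have [_ _ _ _ h] := q_in (a_path (e_ana (n_keep H))) PQ; apply: h.
  have vK : pv P k.+2 \notin K by apply: (ok_offK ok PQ); apply: pv_in; move: km; clear; lia.
  have ne : pv P k.+1 != pv P k.+3.
    by have := q_deg (a_path (e_ana (n_keep H))) vC vK; rewrite En cards2; case: eqP.
  clearbody z1.
  have pt := a_path (e_ana (n_keep Hz1)).
  have [Gl _] := local_ok (q_core pt) (q_lam pt) vC En ne Z1 Z2.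
  set z2 := denote p_local z1 in Gl *.
  have S2 a j : ~~ (63 < a < 68) -> z2 a j = z1 a j.
    by move=> an; rewrite /z2 frame // /p_local /= !inE; move: an; clear; lia.
  have A2 : agree_off X s z2 by apply: agree_trans A1 _; apply: agree_frame.
  have Hz2 : winst z2 by apply: winst_off A2 _ H.
  have T1 : z2 t1 0 = pv P k.+2 by rewrite S2.
  have T2 : z2 t2 0 = pv P k.+1 by rewrite S2.
  have V1 : z2 u1 0 = z u1 0 by rewrite S2 // S1.
  have V3 : z2 u3 0 = z u3 0 by rewrite S2 // S1.
  have V2 : (z2 u2 0 != 0) = b by rewrite A2.
  have D2 l : z2 aDM l = z aDM l by rewrite S2 // S1.
  clearbody z2.
  have Rz := q_row (a_path (e_ana (n_keep Hz2))) PQ.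
  have [_ _ _ Wk] := r_row Rz km0; have [_ _ _ Wk1] := r_row Rz km.
  set z3 := denote p_picks z2.
  have A3 : agree_off X s z3 by apply: agree_trans A2 _; apply: agree_frame.
  have := @pick_stepE g (z2 u1 0 != 0) (z2 u2 0 != 0) _ k z2 _ _ (win_base Hz2) T1 T2 erefl Gl Wk Wk1.
  rewrite V2 V1 V3; case Ep: (bpick g b k (z u1 0 != 0) (z u3 0 != 0)) => [[rr ll] cc] [].
  have P3 x j : denote (p_pick (z u1 0 != 0) b (z u3 0 != 0)) z2 x j = z3 x j.
    by rewrite /z3 picksE V1 V2 V3.
  rewrite !P3 => X1 X3 XD; have T23 : z3 t2 0 = pv P k.+1 by rewrite /z3 frame.
  clearbody z3.
  have bkk : bkt k = (rr, ll).
    by rewrite (h3 k) //= Ep eqxx.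
  split; rewrite ?Eq.
  - by apply: agree_trans A3 _; apply: agree_frame.
  - by rewrite denE /update /= T23.
  - move=> j jk; rewrite !denE !update_other // X1 X3 (h3 j) /=; last by apply: ltnW.
    by rewrite Ep (_ : (j == k) = false) //; move: jk; clear; lia.
  - move=> x y; rewrite denE update_other // -P3 XD D2 h4.
    have -> : [exists i : 'I_m.-1, (k < i.+1) && arcs x y i] =
        [exists i : 'I_m.-1, (k.+1 < i.+1) && arcs x y i] || arcs x y k.
      apply/existsP/orP => [[i /andP[]]|[/existsP[i /andP[ki ei]]|ek]].
      - rewrite ltnS leq_eqVlt => /predU1P[<- ek|ki ei]; [by right|left].
        by apply/existsP; exists i; rewrite ltnS ki.
      - by exists i; rewrite ltnW.
      - by exists (Ordinal km'); rewrite ltnSn.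
    have -> : arcs x y k = rr && (x == pv P k.+1) && (y == pv P k.+2) ||
        ll && (x == pv P k.+2) && (y == pv P k.+1) by rewrite /arcs bkk.
    by case: (rr && _ && _); case: (ll && _ && _); case: (D x y); rewrite /= ?orbT ?orbF.
rewrite (b_N B) => -[h1 h2 h3 h4] x y.
have qN : q N = 1 by rewrite /q; move: mN mm; clear; lia.
by rewrite h4 qN.
Qed.

Lemma backtrack_step s : winst s -> s c2 0 = pv P 1 -> bitst s P -> dmst s (mixb (pv P 1)) ->
  dmst (denote (p_bkinit ;; for_ c3 p_backstep) s) (mixb (pv P 1).+1).
Proof.
move=> H Hc [Ba Bb Bc] Hd; have mm := m4 PP; have R := win_prow PP H; have B := win_base H.
rewrite denote_seq; set s1 := denote p_bkinit s.
have A1 : agree_off tmp_bk s s1 by exact: agree_frame.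
have H1 : winst s1 by apply: winst_off A1 _ H.
have bd (v : V) : s aBASE v = v * N by rewrite (b_BASE B) ?ordN.
have E1 a j : a != aDM -> s1 a j = denote (setv t1 (G_ aXX (X_ c2)) ;; setv u1 (G_ aBA (X_ c2)) ;;
    setv u2 (G_ aBq (X_ c2)) ;; setv u3 (G_ aBC (X_ c2))) s a j.
  move=> ad; rewrite /s1 /p_bkinit; do 8 rewrite denote_seq.
  by do 2 (rewrite frame; last by rewrite /= inE).
have U1 : (s1 u1 0 != 0) = bka Pa P by rewrite E1 // !denE /update /= Hc.
have U2 : (s1 u2 0 != 0) = b by rewrite E1 // !denE /update /= Hc.
have U3 : (s1 u3 0 != 0) = bkc Pa P by rewrite E1 // !denE /update /= Hc.
have T1 : s1 t1 0 = px P by rewrite E1 // !denE /update /= Hc (p_xx R).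
have D1 (x y : V) : (s1 aDM (y * N + x) != 0) = [|| (x \in mixb (pv P 1) y),
    bka Pa P && (x == pu P) && (y == px P) | b && (x == pw P) && (y == pv P 1)].
  rewrite /s1 /p_bkinit; do 5 rewrite denote_seq; rewrite !when_putE !trE.
  set s0 := denote (setv u3 _) _.
  have E0 a j : a \notin [:: t1; u1; u2; u3] -> s0 a j = s a j.
    by rewrite !inE !negb_or => /and4P[? ? ? ?]; rewrite /s0 !denE !update_other.
  have F1 : s0 u1 0 = s aBA (pv P 1) by rewrite /s0 !denE /update /= Hc.
  have F2 : s0 u2 0 = s aBq (pv P 1) by rewrite /s0 !denE /update /= Hc.
  have F3 : s0 t1 0 = px P by rewrite /s0 !denE /update /= Hc (p_xx R).
  have B0 : base s0 by apply: (base_loop (W := [:: t1; u1; u2; u3]) B).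
  have C0 : s0 c2 0 = pv P 1 by rewrite E0.
  have G0 : s0 aUU (pv P 1) = pu P by rewrite E0 // (p_uu R).
  have G1 : s0 aWW (pv P 1) = pw P by rewrite E0 // (p_ww R).
  have D0 : s0 aDM (y * N + x) = s aDM (y * N + x) by rewrite E0.
  clearbody s0.
  have e1 : eval s0 (ix (X_ t1) (G_ aUU (X_ c2))) = px P * N + pu P.
    by rewrite (eval_ix _ B0) /= ?F3 ?C0 ?G0 ?ordN.
  set s9 := denote (when _ _) s0.
  have e2 : eval s9 (ix (X_ c2) (G_ aWW (X_ c2))) = pv P 1 * N + pw P.
    have A9 : agree_off [:: aDM] s0 s9 by apply: agree_frame.
    have B9 : base s9 by apply: base_agree A9 B0.
    have C9 : s9 c2 0 = pv P 1 by rewrite A9.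
    have G9 : s9 aWW (pv P 1) = pw P by rewrite A9.
    by rewrite (eval_ix _ B9) /= ?C9 ?G9 ?ordN.
  have F9 : s9 u2 0 = s0 u2 0 by rewrite /s9 frame.
  rewrite e1 e2 !cell_eq F9 F1 F2 Ba Bb D0 -(Hd x y).
  by case: (bka Pa P); case: b; case: (y == px P); case: (y == pv P 1); case: (x == pu P);
    case: (x == pw P) => //=; rewrite ?orbT ?orbF.
have := backloop_ok (D := fun x y => [|| (x \in mixb (pv P 1) y),
    bka Pa P && (x == pu P) && (y == px P) | b && (x == pw P) && (y == pv P 1)]) H1 T1 U1 U2 U3 D1.
set s2 := denote _ s1 => D2 x y; rewrite D2; clear D2 s2.
have [yP|yP] := boolP (y \in pqs P); last first.
  have ne z : z \in pqs P -> (y == z) = false by move=> zP; apply: contraNF yP => /eqP->.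
  have xP : px P \in pqs P by apply: pv_in; move: mm; clear; lia.
  have y1P : pv P 1 \in pqs P by apply: pv_in; move: mm; clear; lia.
  rewrite !ne // !andbF !orbF (_ : [exists j, _] = false); last first.
    apply/negbTE/existsPn => i; rewrite /arcs !ne ?andbF //; apply: pv_in; have := ltn_ord i; clear; lia.
  rewrite orbF /mixb; case E: (pof Ps y) => [Q|] //; have [QP yQ] := pofS E.
  rewrite (ltnS (pv Q 1) (pv P 1)) (leq_eqVlt (pv Q 1) (pv P 1)).
  case: (eqVneq (nat_of_ord (pv Q 1)) (pv P 1)) => [/val_inj Eq|_] //=.
  by move: yP; rewrite -(start_inj ok QP PP Eq) yQ.
rewrite /mixb (pofP (Ps_disj ok) PP yP) ltnn ltnSn in_set0 /=.
have [j jm Ey] := pqsP yP; case: j jm Ey => // j jm Ey.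
rewrite Ey; rewrite (bw_pv F (Ps_good ok) (Ps_disj ok) Pa PP) // inE !in_opt /bkl /bkr /bk.
have pe i k : 0 < i <= m -> 0 < k <= m -> (pv P i == pv P k) = (i == k).
  exact: (pv_eq (Ps_good ok) PP).
have one : 0 < 1 <= m by move: mm; clear; lia.
have mmm : 0 < m <= m by move: mm; clear; lia.
rewrite /px !pe // eqSS.
have -> : [exists i : 'I_m.-1, arcs x (pv P j.+1) i] =
    [&& 0 < j, (bkt j.-1).1 & x == pv P j] || [&& j.+1 != m, (bkt j).2 & x == pv P j.+2].
  apply/existsP/orP => [[i]|[/and3P[j0 bj /eqP->]|/and3P[j0 bj /eqP->]]].
  - have im : 0 < i.+1 <= m by have := ltn_ord i; clear; lia.
    have im2 : 0 < i.+2 <= m by have := ltn_ord i; clear; lia.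
    rewrite /arcs !pe // => /orP[/andP[/andP[bi /eqP->] /eqP[Ej]]|/andP[/andP[bi /eqP->] /eqP[Ej]]].
      by left; rewrite Ej /= bi eqxx.
    right; apply/and3P; split; [|by rewrite Ej|by rewrite Ej].
    by rewrite Ej; have := ltn_ord i; move: (nat_of_ord i) => i0; clear; lia.
  - have ji : j.-1 < m.-1 by move: jm j0; clear; lia.
    by exists (Ordinal ji); rewrite /arcs /= prednK // bj !eqxx.
  - have ji : j < m.-1 by move: jm j0; clear; lia.
    by exists (Ordinal ji); rewrite /arcs /= bj !eqxx orbT.
rewrite -!andbA (_ : (x == pu P) && (j.+1 == m) = (x == pv P j.+2) && (j.+1 == m)); last first.
  by case: (eqVneq j.+1 m) => [->|]; rewrite ?andbF // pvm.
rewrite (_ : (x == pw P) && (j == 0) = (x == pv P j) && (j == 0)); last first.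
  by case: (eqVneq j 0) => [->|]; rewrite ?andbF.
rewrite lt0n; move: (bkt j.-1).1 (bkt j).2 => b1 b2.
by case: (j == 0); case: (j.+1 == m); case: (x == pv P j); case: (x == pv P j.+2); case: b1; case: b2;
  case: (bka Pa P); case: b.
Qed.

End OneBack.

Lemma backtrack_ok s : winst s -> (forall P, P \in Ps -> bitst s P) -> dmst s masked ->
  dmst (denote p_backtrack s) (bw A C F Ps Pa).
Proof.
move=> H Hb Hd; pose Inv k (z : memory) := dmst z (mixb k) /\ agree_off tmp_bk s z.
have : Inv n (denote p_backtrack s).
  apply: (forP_ind ok (Inv := Inv) H) => //.
  - move=> j z x [h1 h2]; split=> // a l al; rewrite update_other ?h2 //; apply: contraNneq al => ->; exact: isT.
  - split=> // x y; rewrite Hd /mixb; case E: (pof Ps y) => [P|] //; rewrite ltn0 !inE /nrm /onpath E.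
    by rewrite !andbF.
  - move=> P z PP Hz Hc [h1 h2]; split; last by apply: agree_trans h2 _; apply: agree_frame.
    apply: backtrack_step => //; have [b1 b2 b3] := Hb P PP.
    by split; rewrite h2.
  move=> v z nv [h1 h2]; split=> // x y; rewrite h1 /mixb; case E: (pof Ps y) => [P|] //.
  have [PP _] := pofS E; rewrite (ltnS (pv P 1) v) (leq_eqVlt (pv P 1) v).
  case: (eqVneq (nat_of_ord (pv P 1)) v) => [/val_inj Ev|] //.
  by have := nv P PP; rewrite Ev eqxx.
move=> [Hn _] x y; rewrite Hn /mixb /bw; case E: (pof Ps y) => [P|]; first by rewrite ltn_ord.
rewrite /masked /nrm /onpath E inE /= andbT; case: ifP => yC; rewrite ?inE ?andbF //=.
by rewrite [A y x && _]andbC.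
Qed.

(** ** Reinsertion of the eliminated vertices *)

(** Codes and losses as they were when exactly the vertices of [R] were dead. *)
Definition codest (z : memory) (R : seq V) :=
  (forall i : 'I_(size slots), z aCODE i = scode ((item_at i).1.2 :&: alive R)) /\
  (forall i : 'I_(size slots), z aLOSS i = \sum_(x in (item_at i).1.2 :\: alive R) lam x).

Lemma uncharge_ok z (v : V) R (z' := denote p_uncharge z) : base z -> z t1 0 = v ->
  (forall x : V, z aLAM x = lam x) -> v \notin R -> codest z (v :: R) -> codest z' R.
Proof.
move=> B Hv HL' vR [h1 h2].
have vA : v \in alive R by rewrite !inE.
pose Inv k (x : memory) := forall i : 'I_(size slots),
  x aCODE i = z aCODE i + (if (i < k) && (v \in (item_at i).1.2) then 2 ^ v else 0) /\
  x aLOSS i = z aLOSS i - (if (i < k) && (v \in (item_at i).1.2) then lam v else 0).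
have IN : Inv (size slots) z'.
  apply: (forI_ind (Inv := Inv) B) => //; first by move=> i; rewrite ltn0 /= subn0 addn0.
  move=> i s1 B1 Hf Hc IH; have Hv1 : s1 t1 0 = v by rewrite Hf.
  have E2 : eval s1 (ix (X_ c3) (X_ t1)) = i * N + v by rewrite (eval_ix _ B1) /= ?Hc ?Hv1 ?slot_lt.
  rewrite trE E2 (b_MM B1) => j.
  have [vi|vi] := boolP (v \in (item_at i).1.2) => /=; last first.
    have [-> ->] := IH j; rewrite (ltnS j i) (leq_eqVlt j i); case: (eqVneq (nat_of_ord j) i) => [Ej|//].
    by rewrite (val_inj Ej) (negbTE vi) !andbF.
  rewrite !denE /update /= Hc Hv1 (Hf aPOW) // (Hf aLAM) // HL' (b_POW B) ?ordN // (ltnS j i) (leq_eqVlt j i).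
  have [Ej|nj] := eqVneq (nat_of_ord j) i; last by rewrite /=; apply: IH.
  have {}Ej : j = i by apply: val_inj.
  by subst j; have [-> ->] := IH i; rewrite ltnn /= vi subn0 addn0.
split=> i; have [e1 e2] := IN i.
  rewrite e1 ltn_ord h1 alive_cons setIDA /=; case: ifP => vi.
    by rewrite /scode [RHS](big_setD1 v) /= ?inE ?vi // addnC; move: vA; rewrite inE.
  rewrite addn0; congr scode; apply/setP=> x; rewrite !inE.
  by case: (eqVneq x v) => [->|]; rewrite ?vi ?andbF.
rewrite e2 ltn_ord h2 /= alive_cons; case: ifP => vi.
  rewrite (bigD1 v) /=; last by rewrite !inE eqxx vi.
  rewrite addKn; apply: eq_bigl => x; rewrite !inE; case: (eqVneq x v) => [->|]; rewrite ?andbF ?andbT //=.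
  by rewrite vR.
rewrite subn0; apply: eq_bigl => x; rewrite !inE; case: (eqVneq x v) => [->|] //=.
by rewrite vi !andbF.
Qed.

Lemma rowcode_ok z (u : V) (Q : V -> {set V}) : base z -> z t2 0 = u -> dmst z Q ->
  denote p_rowcode z u5 0 = scode (Q u).
Proof.
move=> B Hu Hd; rewrite /p_rowcode denote_seq; set z0 := denote (setv u5 _) z.
have B0 : base z0 by apply: base_frame B.
pose Inv k (s1 : memory) := s1 u5 0 = \sum_(x in Q u | x < k) 2 ^ x.
suff -> : Inv n (denote (for_ c3 (when (eand (elt (X_ c3) (X_ aNV)) (G_ aDM (ix (X_ t2) (X_ c3))))
    (setv u5 (X_ u5 +' G_ aPOW (X_ c3))))) z0).
  by rewrite /scode; apply: eq_bigl => x; rewrite ltn_ord andbT.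
apply: (forV_ind (Inv := Inv) B0) => //.
  by rewrite /Inv big_pred0 // => x; rewrite ltn0 andbF.
move=> v s1 B1 Hf Hc IH; have Hu1 : s1 t2 0 = u by rewrite Hf // /z0 denE update_other.
have E : eval s1 (ix (X_ t2) (X_ c3)) = u * N + v by rewrite (eval_ix _ B1) /= ?Hc ?Hu1 ?ordN.
rewrite tr_get E Hf // /z0 denE update_other // Hd.
have S : \sum_(x in Q u | x < v.+1) 2 ^ x = \sum_(x in Q u | x < v) 2 ^ x + (if v \in Q u then 2 ^ v else 0).
  have [vQ|vQ] := boolP (v \in Q u).
    rewrite (bigD1 v) /= ?vQ ?ltnSn // addnC; congr (_ + _); apply: eq_bigl => b.
    by rewrite -(inj_eq val_inj) /= -andbA; case: (b \in _) => //=; clear; lia.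
  rewrite addn0; apply: eq_bigl => b; case: (boolP (b \in _)) => //= bn.
  have : (nat_of_ord b) != v by apply: contraNneq vQ => /val_inj <-.
  by clear; lia.
rewrite /Inv S -IH; case: ifP => vQ; rewrite ?addn0 // denE /update /= Hc.
by rewrite (b_POW B1) ?ordN.
Qed.

Lemma lookup_ok z (v u : V) R (Z : {set V}) (z' := denote p_lookup z) : base z ->
  z t1 0 = v -> z t2 0 = u -> z u5 0 = scode Z -> v \notin Z -> codest z R ->
  z' u3 0 = ascore its lam (alive R) u Z /\ z' u4 0 = ascore its lam (alive R) u (v |: Z).
Proof.
move=> B H1 H2 H5 vZ [hc hl]; rewrite /z' /p_lookup; do 2 rewrite denote_seq.
set z0 := denote (setv u4 _) _.
have B0 : base z0 by do 2 apply: base_frame => //.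
have E0 a j : a \notin [:: u3; u4] -> z0 a j = z a j.
  by rewrite !inE !negb_or => /andP[? ?]; rewrite /z0 !denE !update_other.
pose cont Y (i : 'I_(size slots)) := ascore_item lam (alive R) u Y (item_at i).
pose Inv k (s1 : memory) :=
  s1 u3 0 = \max_(i < size slots | i < k) cont Z i /\
  s1 u4 0 = \max_(i < size slots | i < k) cont (v |: Z) i.
suff [-> ->] : Inv (size slots) (denote (for_ c3 (when (eand (elt (X_ c3) (X_ aIT)) (eeq (G_ aOWN (X_ c3)) (X_ t2)))
    (when (eeq (G_ aCODE (X_ c3)) (X_ u5)) (setv u3 (maxe (X_ u3) (eval_item (X_ c3)))) ;;
     when (eeq (G_ aCODE (X_ c3)) (X_ u5 +' G_ aPOW (X_ t1)))
       (setv u4 (maxe (X_ u4) (eval_item (X_ c3))))))) z0).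
  by rewrite !ascoreE.
apply: (forI_ind (Inv := Inv) B0) => //.
  by split; rewrite /z0 !denE /update /= big_pred0.
move=> i s1 B1 Hf Hc [IH3 IH4].
have F1 a j : a \notin [:: c3; u3; u4] -> s1 a j = z a j.
  move=> an; rewrite Hf ?E0 //; move: an; rewrite /= !inE; clear; lia.
rewrite tr_eq /= Hc (b_OWN B1) F1 // H2 /Inv !max_ordS -IH3 -IH4 /cont /ascore_item !item_own /iown.
have [/val_inj Eo|no] := eqVneq (nat_of_ord (slot_at i).1) u; last first.
  by rewrite (_ : ((slot_at i).1 == u) = false) /= ?maxn0 //; apply: contraNF no => /eqP->.
rewrite Eo eqxx /= denote_seq; set Y := (item_at i).1.2 :&: alive R.
have vE : s1 aVAL i - s1 aLOSS i = (item_at i).2 - \sum_(x in (item_at i).1.2 :\: alive R) lam x.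
  by rewrite (b_VAL B1) F1 // hl.
have cE : s1 aCODE i = scode Y by rewrite F1 // hc.
have sc (X W : {set V}) : (scode X == scode W) = (X == W) by apply/eqP/eqP => [/scode_inj|->].
set s2 := denote (when _ _) s1.
have U3 : s2 u3 0 = maxn (s1 u3 0) (if Y == Z then (item_at i).2 - \sum_(x in (item_at i).1.2 :\: alive R) lam x else 0).
  rewrite /s2 when_putE tr_eq /= Hc cE F1 // H5 sc !andbT vE -maxnE.
  by case: ifP; rewrite ?maxn0.
have S2 a j : a != u3 -> s2 a j = s1 a j by move=> au; rewrite /s2 when_putE (negbTE au) andbF.
clearbody s2; split; first by rewrite when_putE /= andbF.
rewrite when_putE tr_eq /= !S2 // Hc cE (F1 u5) // H5 (F1 t1) // H1 (b_POW B1) ?ordN //.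
have -> : scode Z + 2 ^ v = scode (v |: Z) by rewrite /scode big_setU1 //= addnC.
by rewrite sc andbT vE -maxnE; case: ifP; rewrite ?maxn0.
Qed.

Definition tmp_undo := [:: aCODE; aLOSS; aDM; t1; t2; u3; u4; u5; c2; c3].

Lemma undo_ok s (Pb : V -> {set V}) : winst s -> dmst s Pb ->
  (forall x y, x \in Pb y -> x \in C /\ y \in C) ->
  dmst (denote p_undo s) (undo its lam par (d_r d) Pb).
Proof.
move=> H Hd sub0; have B := win_base H; set r := d_r d.
have lf := c_leaf (q_core (a_path (e_ana (n_keep H)))); have un := l_uniq lf.
have lamE (x : V) : s aLAM x = lam x by rewrite -(q_lam (a_path (e_ana (n_keep H)))).
(* The vertex eliminated last stands first in [r], so after [k] rounds [drop k r] remains to be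
   undone; applied to the digraph [Q] in memory, the remaining steps must still give the final
   result. *)
pose Inv k (z : memory) := agree_off tmp_undo s z /\ codest z (drop k r) /\
  exists Q, [/\ undo its lam par r Pb = undo its lam par (drop k r) Q, dmst z Q
    & forall x y, x \in Q y -> x \in alive (drop k r) /\ y \in alive (drop k r)].
have upd k z l : Inv k z -> Inv k (update z c2 0 l).
  move=> [h1 [h2 h3]]; split=> // a j aX; rewrite update_other ?h1 //; apply: contraNneq aX => ->; exact: isT.
have : Inv (s aN 0) (denote p_undo s).
  apply: for_ind => //.
    apply: (upd); split=> //; rewrite drop0; split; last by exists Pb.
    split=> i; first exact: (l_code lf).
    by rewrite (l_loss lf); apply: eq_bigr => x _; apply: (q_lam (a_path (e_ana (n_keep H)))).
  move=> k z kN _ Hc _ [h1 [h2 [Q [hQ hd sub]]]]; apply: (upd).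
  rewrite denote_if tr_lt /= Hc h1 // (l_no lf) -/r denote_skip; case: ltnP => kr; last first.
    split=> //; have E : drop k.+1 r = drop k r by rewrite !drop_oversize // leqW.
    by rewrite E; split=> //; exists Q.
  have v0 : V by move: kr; case: (r) => // x.
  set v := nth v0 r k; set R := drop k.+1 r.
  have Er : drop k r = v :: R by rewrite (drop_nth v0).
  have vr : v \in r by apply: mem_nth.
  have vR : v \notin R.
    by have := drop_uniq k un; rewrite -/r Er => /andP[].
  pose u := par v.
  have Ov : s aORD (s aNO 0 - 1 - k) = v.
    rewrite (l_no lf) -/r (l_ord lf) -/r; last by move: kr; clear; lia.
    rewrite (nth_map v0) ?size_rev; last by move: kr; clear; lia.
    rewrite nth_rev; last by move: kr; clear; lia.
    by congr (nat_of_ord (nth _ _ _)); move: kr; clear; lia.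
  have Pu : s aPAR v = u.
    rewrite /u -(a_par (e_ana (n_keep H))) /parm val_insubd (l_par lf) //.
  do 5 rewrite denote_seq; set z1 := denote (setv t1 _) z; set z2 := denote (setv t2 _) z1.
  have T1 : z2 t1 0 = v by rewrite /z2 /z1 !denE /update /= Hc !h1 // Ov.
  have T2 : z2 t2 0 = u by rewrite /z2 /z1 !denE /update /= Hc !h1 // Ov Pu.
  have A2 : agree_off tmp_undo s z2.
    by apply: agree_trans h1 _; apply: (agree_trans (s2 := z1)); apply: agree_frame.
  have S2 a j : a \notin [:: t1; t2] -> z2 a j = z a j.
    by rewrite !inE !negb_or => /andP[? ?]; rewrite /z2 /z1 !denE !update_other.
  have C2 : codest z2 (v :: R) by rewrite -Er; case: h2 => g1 g2; split=> i; rewrite S2.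
  have D2 : dmst z2 Q by move=> x y; rewrite S2.
  clearbody z1 z2.
  have B2 : base z2 by apply: base_agree A2 B.
  have L2 (x : V) : z2 aLAM x = lam x by rewrite A2.
  have C3 := uncharge_ok B2 T1 L2 vR C2; set z3 := denote p_uncharge z2 in C3 *.
  have A3 : agree_off tmp_undo s z3 by apply: agree_trans A2 _; apply: agree_frame.
  have B3 : base z3 by apply: base_agree A3 B.
  have T13 : z3 t1 0 = v by rewrite /z3 frame.
  have T23 : z3 t2 0 = u by rewrite /z3 frame.
  have D3 : dmst z3 Q by move=> x y; rewrite /z3 frame.
  clearbody z3.
  have U5 := rowcode_ok B3 T23 D3; set z4 := denote p_rowcode z3 in U5 *.
  have A4 : agree_off tmp_undo s z4 by apply: agree_trans A3 _; apply: agree_frame.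
  have B4 : base z4 by apply: base_agree A4 B.
  have T14 : z4 t1 0 = v by rewrite /z4 frame.
  have T24 : z4 t2 0 = u by rewrite /z4 frame.
  have D4 : dmst z4 Q by move=> x y; rewrite /z4 frame.
  have C4 : codest z4 R by case: C3 => g1 g2; split=> i; rewrite /z4 frame.
  clearbody z4.
  have vQ : v \notin Q u.
    by apply/negP => /sub[]; rewrite Er !inE eqxx.
  have [U3 U4] := lookup_ok B4 T14 T24 U5 vQ C4; set z5 := denote p_lookup z4 in U3 U4 *.
  have A5 : agree_off tmp_undo s z5 by apply: agree_trans A4 _; apply: agree_frame.
  have B5 : base z5 by apply: base_agree A5 B.
  have T15 : z5 t1 0 = v by rewrite /z5 frame.
  have T25 : z5 t2 0 = u by rewrite /z5 frame.
  have D5 : dmst z5 Q by move=> x y; rewrite /z5 frame.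
  have C5 : codest z5 R by case: C4 => g1 g2; split=> i; rewrite /z5 frame.
  clearbody z5; set z6 := denote p_reattach z5.
  have [lfv _] : leaf its A lam (alive R) v u /\ True.
    have := ok_elim ok; rewrite -/r -(cat_take_drop k r) Er; elim: (take k r) => [|x l IHl] /= [] //.
  have sub' x y : x \in Q y -> x \in alive R :\ v /\ y \in alive R :\ v.
    by move/sub; rewrite Er alive_cons.
  split; first by apply: agree_trans A5 _; apply: agree_frame.
  split; first by case: C5 => g1 g2; split=> i; rewrite /z6 frame.
  exists (leaf_back its lam (alive R) v u Q); split.
  - by rewrite hQ Er.
  - have e12 : eval z5 (ix (X_ t1) (X_ t2)) = v * N + u by rewrite (eval_ix _ B5) /= ?T15 ?T25 ?ordN.
    have e21 : eval z5 (ix (X_ t2) (X_ t1)) = u * N + v by rewrite (eval_ix _ B5) /= ?T15 ?T25 ?ordN.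
    have Lv : z5 aLAM v = lam v by rewrite A5.
    have Tin : tr z5 (elt (X_ u3) (X_ u4 -' G_ aLAM (X_ t1))) =
        (ascore its lam (alive R) u (Q u) < ascore its lam (alive R) u (v |: Q u) - lam v).
      by rewrite tr_lt /= U3 U4 T15 Lv.
    move=> x y; rewrite (leaf_backE _ _ _ sub').
    have Ev1 : eval z5 (X_ t1) = v by exact: T15.
    have Ev2 : eval z5 (X_ t2) = u by exact: T25.
    rewrite /z6 /p_reattach denote_if tr_not tr_eq Ev1 Ev2.
    rewrite /leaf_in [nat_of_ord v == _]eq_sym (inj_eq val_inj) denote_skip -(D5 x y).
    have [uv|uv] := eqVneq u v; first by rewrite /= !andbF !orbF.
    rewrite ![~~ false]/= !andTb denote_if Tin; case: ifP => li.
      rewrite denote_put e21 /update cell_eq.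
      by case: (y == u); case: (x == v); case: (y == v); case: (z5 aDM _ != 0).
    rewrite when_putE tr_get Ev1 Lv e12 cell_eq.
    by case: (lam v) => [|l]; case: (y == v); case: (x == u); case: (y == u); case: (z5 aDM _ != 0).
  - by move=> x y /(leaf_back_sub lfv sub').
rewrite (b_N B) => -[_ [_ [Q [-> hd _]]]].
rewrite drop_oversize //; have rn : size r <= n.
  by have := uniq_leq_size un (fun x _ => mem_enum V x); rewrite size_enum_ord.
by apply: leq_trans rn _; have := nN L; clear; lia.
Qed.

End Back.

(** * Running times *)

Definition entries_word k (l : seq (seq 'I_k * nat)) := flatten [seq p.2 :: vlist_word p.1 | p <- l].

(** An entry is jumped over by means of its recorded length, so it costs constant time whatever its
    size. *)
Lemma skip_entries k (l : seq (seq 'I_k * nat)) (s : memory) : s aSR 0 = size l ->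
  (forall q, q < size (entries_word l) -> s 0 (s aSP 0 + q) = nth 0 (entries_word l) q) ->
  exists t s', [/\ exec (While (X_ aSR)
          (Seq (Put aSP (C_ 0) (X_ aSP +' G_ 0 (X_ aSP +' C_ 1) +' C_ 2))
               (Put aSR (C_ 0) (X_ aSR -' C_ 1)))) s t s',
    s' aSP 0 = s aSP 0 + size (entries_word l), agree_off [:: aSP; aSR] s s'
    & t <= 22 * size l + 3].
Proof.
elim: l s => [|p l IH] s Hr Hw.
  exists 3, s; split=> //; last by rewrite addn0.
  by apply: exec_while_false.
set pos := s aSP 0 in Hw *.
have Ew : entries_word (p :: l) = p.2 :: size p.1 :: map (@nat_of_ord k) p.1 ++ entries_word l by [].
have Es : size (entries_word (p :: l)) = size p.1 + 2 + size (entries_word l).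
  by rewrite Ew /= size_cat size_map addn2.
have H1 : s 0 (pos + 1) = size p.1 by rewrite Hw // Es; clear; lia.
set s1 := update s aSP 0 (pos + size p.1 + 2); set s2 := update s1 aSR 0 (size l).
have P2 : s2 aSP 0 = pos + size p.1 + 2 by [].
have A2 : agree_off [:: aSP; aSR] s s2.
  by move=> a j; rewrite !inE negb_or => /andP[h1 h2]; rewrite /s2 /s1 !update_other.
have [||t [s' [E P A T]]] := IH s2; first by [].
  move=> q qw; rewrite P2 A2 // -!addnA Hw; last by rewrite Es; move: qw; clear; lia.
  rewrite Ew addnA addn2 /= nth_cat size_map ltnNge leq_addr /= addKn //.
exists (2 + (12 + 6).+1 + t).+1, s'; split.
- apply: exec_while_true E; first by rewrite /= Hr.
  have -> : s2 = update s1 (aSR) (eval s1 (C_ 0)) (eval s1 (X_ aSR -' C_ 1)).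
    by rewrite /s2 /= /s1 update_other // Hr /= subn1.
  apply: (exec_seq (s2 := s1) (t1 := 12) (t2 := 6)); last exact: (exec_put aSR (C_ 0) (X_ aSR -' C_ 1)).
  have -> : s1 = update s aSP (eval s (C_ 0)) (eval s (X_ aSP +' G_ 0 (X_ aSP +' C_ 1) +' C_ 2)).
    by rewrite /s1 /= -/pos H1.
  exact: (exec_put aSP (C_ 0) (X_ aSP +' G_ 0 (X_ aSP +' C_ 1) +' C_ 2)).
- by rewrite P P2 Es !addnA.
- exact: agree_trans A2 A.
- by move: T => /=; clear; lia.
Qed.

Lemma entries_size k (l : seq (seq 'I_k * nat)) : 2 * size l <= size (entries_word l).
Proof.
elim: l => // p l IH.
rewrite (_ : size (entries_word (p :: l)) = size p.1 + 2 + size (entries_word l)); last first.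
  by rewrite /entries_word /= size_cat size_map addn2.
rewrite [size (p :: l)]/=; move: IH; move: (size (entries_word l)); clear; lia.
Qed.

Lemma skip_lists k (ls : seq (seq (seq 'I_k * nat))) (s : memory)
    (w := flatten [seq nonzero_list_word l | l <- ls]) (X := [:: aSP; aSN; aSV; aSR]) :
  s aSN 0 = s aSV 0 + size ls ->
  (forall q, q < size w -> s 0 (s aSP 0 + q) = nth 0 w q) ->
  exists t s', [/\ exec (While (X_ aSN -' X_ aSV)
   (Seq (Put aSR (C_ 0) (G_ 0 (X_ aSP)))
   (Seq (Put aSP (C_ 0) (X_ aSP +' C_ 1))
   (Seq (While (X_ aSR)
          (Seq (Put aSP (C_ 0) (X_ aSP +' G_ 0 (X_ aSP +' C_ 1) +' C_ 2))
               (Put aSR (C_ 0) (X_ aSR -' C_ 1))))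
        (Put aSV (C_ 0) (X_ aSV +' C_ 1)))))) s t s',
    s' aSP 0 = s aSP 0 + size w, agree_off X s s' & t <= 30 * size w + 10].
Proof.
rewrite /w {w}; elim: ls s => [|l ls IH] s Hr Hw.
  exists 6, s; split=> //; last by rewrite addn0.
  by apply: exec_while_false; rewrite /= Hr addn0 subnn.
set W := flatten [seq nonzero_list_word l | l <- ls] in IH *.
set pos := s aSP 0 in Hw *.
have Ew : flatten [seq nonzero_list_word l | l <- l :: ls] = size l :: entries_word l ++ W by [].
rewrite Ew in Hw *.
have H0 : s 0 pos = size l by have := Hw 0 isT; rewrite addn0.
set s1 := update s aSR 0 (size l); set s2 := update s1 aSP 0 (pos + 1).
have P2 : s2 aSP 0 = pos + 1 by [].
have A2 : agree_off X s s2.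
  by move=> a j; rewrite !inE !negb_or => /and4P[? ? ? ?]; rewrite /s2 /s1 !update_other.
have [||t1 [s3 [E3 P3 A3 T3]]] := @skip_entries _ l s2; first by [].
  move=> q qw; rewrite P2 A2 // -addnA add1n Hw; last by rewrite /= size_cat; move: qw; clear; lia.
  by rewrite /= nth_cat qw.
set s4 := update s3 aSV 0 (s3 aSV 0 + 1).
have A4 : agree_off X s s4.
  move=> a j aX; rewrite /s4 update_other; last by apply: contraNneq aX => ->.
  rewrite A3; first exact: A2.
  by apply: contra aX; rewrite !inE => /orP[]->; rewrite ?orbT.
have P4 : s4 aSP 0 = pos + 1 + size (entries_word l) by rewrite /s4 update_other // P3 P2.
have V4 : s4 aSV 0 = s aSV 0 + 1 by rewrite /s4 /update /= A3.
have N4 : s4 aSN 0 = s aSN 0 by rewrite /s4 update_other // A3.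
have [||t [s' [E P A T]]] := IH s4.
- by rewrite V4 N4 Hr /=; clear; lia.
- move=> q qw; rewrite P4 A4 // -!addnA add1n Hw; last by rewrite /= size_cat; move: qw; rewrite -/W; clear; lia.
  by rewrite /= nth_cat ltnNge leq_addr /= addKn.
exists (5 + (5 + (6 + (t1 + 6).+1).+1).+1 + t).+1, s'; split.
- apply: exec_while_true E; first by rewrite /= Hr /=; clear; lia.
  apply: (exec_seq (s2 := s1)).
    have -> : s1 = update s aSR (eval s (C_ 0)) (eval s (G_ 0 (X_ aSP))) by rewrite /s1 /= -/pos H0.
    exact: (exec_put aSR (C_ 0) (G_ 0 (X_ aSP))).
  apply: (exec_seq (s2 := s2)); first exact: (exec_put aSP (C_ 0) (X_ aSP +' C_ 1)).
  apply: (exec_seq (s2 := s3)); first exact: E3.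
  exact: (exec_put aSV (C_ 0) (X_ aSV +' C_ 1)).
- by rewrite P P4 /= size_cat -/W; clear; lia.
- exact: agree_trans A4 A.
- have := entries_size l; by move: T T3; rewrite /= size_cat -/W; clear; lia.
Qed.

Lemma skip_ok (I : instance) (w : seq nat) (s : memory) : encodes_instance I w ->
  (forall q, q < size w -> s 0 (s aSP 0 + q) = nth 0 w q) ->
  exists t s', [/\ exec c_skip s t s', s' aSP 0 = s aSP 0 + size w,
    agree_off [:: aSP; aSN; aSV; aSR] s s' & t <= 30 * size w + 40].
Proof.
move=> [L _ Ew] Hw; set pos := s aSP 0 in Hw *.
set W := flatten _ in Ew.
have Hs : size w = 3 + size W by rewrite Ew size_cat.
have H0 : s 0 pos = nvert I by have := Hw 0; rewrite addn0 Hs Ew; apply.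
set s1 := update s aSN 0 (nvert I); set s2 := update s1 aSP 0 (pos + 3); set s3 := update s2 aSV 0 0.
have A3 : agree_off [:: aSP; aSN; aSV; aSR] s s3.
  by move=> a j; rewrite !inE !negb_or => /and4P[? ? ? ?]; rewrite /s3 /s2 /s1 !update_other.
have [||t [s' [E P A T]]] := @skip_lists _ [seq L v | v <- enum 'I_(nvert I)] s3.
- by rewrite size_map size_enum_ord.
- rewrite -map_comp -/W => q qw; rewrite A3 // -addnA Hw; last by rewrite Hs; move: qw; clear; lia.
  by rewrite Ew nth_cat /= addKn.
rewrite -map_comp -/W in P T.
exists (5 + (6 + (3 + t).+1).+1).+1, s'; split.
- apply: (exec_seq (s2 := s1)).
    have -> : s1 = update s aSN (eval s (C_ 0)) (eval s (G_ 0 (X_ aSP))) by rewrite /s1 /= -/pos H0.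
    exact: (exec_put aSN (C_ 0) (G_ 0 (X_ aSP))).
  apply: (exec_seq (s2 := s2)); first exact: (exec_put aSP (C_ 0) (X_ aSP +' C_ 3)).
  by apply: (exec_seq (s2 := s3)) E; apply: (exec_put aSV (C_ 0) (C_ 0)).
- by rewrite P Hs addnA.
- exact: agree_trans A3 A.
- by move: T; rewrite Hs; clear; lia.
Qed.

(** A non-empty parent set P takes 2 + |P| <= 3|P| words. The empty set adds nothing to [inst_size]
    but takes two words; it occurs at most once in a list and is charged, with the header of the
    list, to the vertex, which accounts for three words per vertex. *)
Lemma word_size (I : instance) (w : seq nat) : encodes_instance I w -> size w <= 3 * inst_size I + 3.
Proof.
move=> [L HL ->]; rewrite size_cat addnC leq_add2r.
have lv v : size (nonzero_list_word (L v)) <= 3 + 3 * \sum_(P in Gamma v) #|P|.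
  have [ua us memL _] := HL v.
  have -> : size (nonzero_list_word (L v)) = 1 + \sum_(p <- L v) (2 + size p.1).
    rewrite /= add1n; congr _.+1; elim: (L v) => [|p l IH]; first by rewrite big_nil.
    by rewrite big_cons /= !size_cat /= size_map IH.
  have -> : \sum_(p <- L v) (2 + size p.1) = \sum_(P in Gamma v) (2 + #|P|).
    rewrite -(eq_big_seq (F1 := fun p : seq 'I_(nvert I) * nat => 2 + #|[set x in p.1]|)); last first.
      by move=> p /(allP ua) up; rewrite cardsE (card_uniqP up).
    rewrite -(big_map (fun p : seq 'I_(nvert I) * nat => [set x in p.1]) xpredT (fun P => 2 + #|P|)).
    rewrite -[RHS]big_enum /=; apply: perm_big; apply: uniq_perm => //; first exact: enum_uniq.
    by move=> P; rewrite memL mem_enum.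
  have : \sum_(P in Gamma v) (2 + #|P|) <= \sum_(P in Gamma v) ((if P == set0 then 2 else 0) + 3 * #|P|).
    apply: leq_sum => P _; case: eqP => [->|/eqP]; first by rewrite cards0.
    by rewrite -card_gt0; clear; lia.
  have -> : \sum_(P in Gamma v) ((if P == set0 then 2 else 0) + 3 * #|P|) =
      \sum_(P in Gamma v) (if P == set0 then 2 else 0) + 3 * \sum_(P in Gamma v) #|P|.
    by rewrite big_split /= -big_distrr.
  have : \sum_(P in Gamma v) (if P == set0 then 2 else 0) <= 2.
    rewrite -big_mkcondr /=; have [h|h] := boolP (set0 \in Gamma v).
      by rewrite (big_pred1 set0) // => P; rewrite /= andbC; case: eqP => // ->.
    by rewrite big_pred0 // => P; rewrite /= andbC; case: eqP => // ->; apply/negbTE.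
  by clear; lia.
rewrite size_flatten /shape -map_comp sumnE big_map big_enum /=.
apply: leq_trans (leq_sum _ (fun v _ => lv v)) _; rewrite big_split /= -big_distrr /=.
by rewrite sum_nat_const card_ord /inst_size; move: (\sum_i _) => x; clear; lia.
Qed.

(** For m >= 1 one has N + 1 <= 3m + 4 <= 7m; for m = 0 the additive term is enough. *)
Lemma poly_bound K D N m : N <= 3 * m + 3 ->
  K * N.+1 ^ D <= K * 7 ^ D * m ^ D + K * 7 ^ D.
Proof.
move=> Nm; rewrite -mulnA -mulnDr leq_mul2l; apply/orP; right.
case: m Nm => [|m] Nm.
  apply: (@leq_trans (7 ^ D)); last exact: leq_addl.
  by case: D => // D; rewrite leq_exp2r //; move: Nm; clear; lia.
apply: leq_trans (leq_addr _ _); rewrite -expnMn; case: D => // D.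
by rewrite leq_exp2r //; move: Nm; clear; lia.
Qed.

Lemma time_bound K D c N m t : N <= 3 * m + 3 -> t <= K * N.+1 ^ D -> K * 7 ^ D <= c -> 0 < D <= c ->
  t <= c * m ^ c + c.
Proof.
move=> Nm tK Kc /andP[D0 Dc]; apply: leq_trans tK _; apply: leq_trans (poly_bound K D Nm) _.
apply: leq_add => //; apply: leq_mul => //.
by case: m {Nm} => [|m]; [rewrite exp0n|rewrite leq_pexp2l].
Qed.

Lemma reads_analysis : all [pred a | 1 < a < 90] (reads p_analysis).
Proof. by vm_compute. Qed.

Lemma writes_analysis : all [pred a | 1 < a < 90] (writes p_analysis).
Proof. by vm_compute. Qed.

(** * The three algorithms on actual inputs *)

Section Assembly.
Variables (I : instance) (L : 'I_(nvert I) -> seq (seq 'I_(nvert I) * nat)).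
Hypothesis HL : forall v, nonzero_list v (L v).
Notation n := (nvert I).
Notation V := 'I_n.
Notation A := (superstructure I).
Notation its := (its L).
Notation word := (word L).
Notation N := (size word).
Notation base := (base L).
Notation dmst := (dmst L).

(* The analysis is run in three programs; it is determined by the input alone,
   so that all of them find the decomposition found from this memory. *)
Definition canon : memory := fun a i =>
  if a == aIN then nth 0 word i else if (a == aN) && (i == 0) then N else 0.

Lemma canon_init : init_ok L canon.
Proof.
split=> // a i ar; rewrite /canon.
have -> : (a == aIN) = false by move: ar; clear; lia.
by have -> : (a == aN) = false by move: ar; clear; lia.
Qed.

Variable d : dec I.
Hypothesis Hd : winst L d (denote p_analysis canon).
Hypothesis ok : dec_ok its d.
Notation winst := (winst L d).
Notation C := (alive (d_r d)).
Notation Ps := (longs d).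
Notation kept := (kept d).
Notation V' := 'I_#|kept|.

Definition started (s : memory) :=
  [/\ s aN 0 = N, forall j, j < N -> s 0 (s aOFF 0 + j) = nth 0 word j
    & forall a i : nat, 1 < a < 90 -> (a, i) != (aN, 0) -> s a i = 0].

Lemma copy_ok s : started s -> forall j, denote p_copy s aIN j = nth 0 word j.
Proof.
move=> [HN H0 HZ]; pose Inv k (z : memory) := agree_off [:: aIN; c2] s z /\
  forall i, z aIN i = if i < k then nth 0 word i else 0.
have : Inv (s aN 0) (denote p_copy s).
  apply: for_ind => //.
    split; first by move=> a' i; rewrite !inE negb_or => /andP[h1 h2]; rewrite update_other.
    by move=> i; rewrite update_other // HZ.
  move=> k z kN _ Hc _ [h1 h2]; split.
    move=> a' i aX; move: (aX); rewrite !inE negb_or => /andP[g1 g2].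
    by rewrite update_other // denE update_other // h1.
  have E0 : z 0 (z aOFF 0 + k) = nth 0 word k by rewrite !h1 // H0 // -HN.
  move=> i; rewrite update_other // denote_put /update.
  rewrite (_ : eval z (X_ c2) = k) // (_ : eval z (G_ 0 (X_ aOFF +' X_ c2)) = nth 0 word k); last first.
    by rewrite -E0 -Hc.
  by rewrite (ltnS i k) (leq_eqVlt i k) h2 eqxx andTb; case: (i =P k) => [->|].
rewrite HN => -[_ H] j; rewrite H; case: ltnP => // jN; by rewrite nth_default.
Qed.

(** After the copy, the memory agrees with [canon] on all the arrays that the analysis reads. By
    [denote_agree] the analysis then ends with the decomposition [d] already fixed. *)
Lemma prepare s (s' := denote p_analysis (denote p_copy s)) : started s ->
  winst s' /\ forall a j, ~~ (1 < a < 90) -> a != c2 -> s' a j = s a j.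
Proof.
move=> St; have [HN H0 HZ] := St; split; last first.
  move=> a j ar ac; rewrite /s' frame; last by apply/negP => /(allP writes_analysis)/=; rewrite (negbTE ar).
  by rewrite frame //= !inE (negbTE ac) /=; apply: contraNneq ar => ->.
have E a : 1 < a < 90 -> denote p_copy s a =1 canon a.
  move=> ar j; have [->|an] := eqVneq a aIN; first exact: copy_ok.
  rewrite frame; last by rewrite /= !inE (negbTE an) orbF; move: ar; clear; lia.
  rewrite /canon (negbTE an); case: (eqVneq a aN) => [->|aN'] /=; last by rewrite HZ // xpair_eqE (negbTE aN').
  by case: eqP => [->|/eqP j0] //; rewrite HZ // xpair_eqE (negbTE j0) andbF.
have EA := denote_agree (R := [pred a | 1 < a < 90]) E reads_analysis.
by apply: winst_eq Hd => a j ar; apply: EA => //=; move: ar; clear; lia.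
Qed.

Lemma word_enc : encodes_instance I word.
Proof. by exists L => //; exact: word_encodes. Qed.

Lemma kernel_run : exists w', [/\ encodes_instance (kinst (its_super HL) ok) w',
    size w' <= 3 + size (slots L) * (N + 33)
  & exists2 t, computes c_kernel word w' t & t <= (csize p_kernel + 100) * N.+1 ^ 2].
Proof.
have [|t1 [s1 [E1 P1 A1 T1]]] := skip_ok (s := initial word) word_enc; first by [].
set s2 := update s1 aN 0 N.
have St : started s2.
  split=> //.
  - by move=> j jN; rewrite /s2 !update_other // A1 // (A1 aOFF).
  - move=> a i ar ne; rewrite /s2 /update; case: ifP => [/andP[/eqP E /eqP E']|_].
      by rewrite E E' eqxx in ne.
    rewrite A1; first by rewrite /initial; case: eqP ar => // ->.
    by rewrite !inE; move: ar; clear; lia.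
have [W Fr] := prepare St.
have [w' [e' sz out]] := emit_instance HL ok W.
exists w'; split=> //.
have /andP[/andP[wf_ /eqP dp] Nw] := wf_kernel.
have [t2 E2 T2] := run_prog s2 wf_ Nw.
rewrite dp (_ : s2 aN 0 = N) // in T2.
exists (t1 + (4 + t2).+1).+1.
  exists (denote p_kernel s2).
    apply: exec_seq E1 _; apply: (exec_seq (s2 := s2)) E2.
    have -> : s2 = update s1 aN (eval s1 (C_ 0)) (eval s1 (X_ aSP)) by rewrite /s2 /= P1.
    exact: (exec_put aN (C_ 0) (X_ aSP)).
  by move=> i iw; rewrite /p_kernel; do 2 rewrite denote_seq; apply: out.
move: T1 T2; rewrite mulnDl; move: (csize _ * _) => x T1 T2.
have : N.+1 <= N.+1 ^ 2 by rewrite -{1}(expn1 N.+1) leq_pexp2l.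
by move: T1 T2; move: (N.+1 ^ 2) => y; clear; lia.
Qed.

Lemma win_frame p s : all (fun a => ~~ (1 < a < 57)) (writes p) -> winst s -> winst (denote p s).
Proof. by move=> h; apply: winst_off h; apply: agree_frame; apply/allP. Qed.

Lemma dmst_eq s (Pa Pb : V -> {set V}) : Pa =1 Pb -> dmst s Pa -> dmst s Pb.
Proof. by move=> E H x y; rewrite -E. Qed.

Lemma fwd_denote s (p : V -> seq V) (D : rel V) pos (dd := flatten [seq vlist_word (p v) | v <- enum V]) :
  started s -> (forall v, uniq (p v) /\ p v =i parents D v) ->
  s aDP 0 = pos -> (forall q, q < size dd -> s 0 (pos + q) = nth 0 dd q) -> (forall j, s aDM j = 0) ->
  exists2 d', encodes_digraph (dig (kforward (d := d) (parents D))) d'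
    & forall i, i < size d' -> denote p_fwd s 1 i = nth 0 d' i.
Proof.
move=> St Hp Hpos Hdd HD; rewrite /p_fwd; do 5 rewrite denote_seq.
have [W1 Fr] := prepare St; set s1 := denote p_analysis _ in W1 Fr *.
have D1 j : s1 aDM j = 0 by rewrite Fr.
have P1 : s1 aDP 0 = pos by rewrite Fr.
have I1 q : q < size dd -> s1 0 (pos + q) = nth 0 dd q by move=> qd; rewrite Fr // Hdd.
clearbody s1; have B1 := win_base W1; have Ha := e_ana (n_keep W1).
have [A2 R2] : agree_off tmp_read s1 (denote (p_read_dig (X_ aNV) aID) s1) /\
    forall x y : V, (denote (p_read_dig (X_ aNV) aID) s1 aDM (y * N + x) != 0) =
      [exists i, [exists j, [&& i == y, j == x & j \in p i]]].
  apply: (read_ok (M := id) (pos := pos)) => //.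
  - by have := nN L; clear; lia.
  - by move=> i; case: (Hp i).
  - by move=> z Az; rewrite /= Az // (b_NV B1).
  - by move=> i; case: (a_id Ha i).
set s2 := denote (p_read_dig _ _) s1 in A2 R2 *.
have D2 : dmst s2 (parents D).
  move=> x y; rewrite R2; apply/existsP/idP => [[i /existsP[j /and3P[/eqP <- /eqP <-]]]|H].
    by have [_ ->] := Hp i.
  by exists y; apply/existsP; exists x; rewrite !eqxx; have [_ ->] := Hp y.
have W2 : winst s2 by apply: winst_off A2 _ W1.
clearbody s2; have B2 := win_base W2.
have [A3 D3] : agree_off [:: aDM; c2; c3] s2 (denote p_restrict s2) /\
    dmst (denote p_restrict s2) (fun y => [set x in parents D y | [&& A y x, y \in C & x \in C]]).
  apply: (clear_ok (t := fun y x => [&& A y x, y \in C & x \in C]) B2 D2).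
  move=> z x y Az H2 H3; have Wz : winst z by apply: winst_off Az _ W2.
  have Bz := win_base Wz; have lf := c_leaf (q_core (a_path (e_ana (n_keep Wz)))).
  rewrite tr_not !tr_and (tr_eadj (a := y) (b := x) Bz) // !tr_get /= H2 H3 !(l_alv lf).
  by case: (A y x) => //=; case: (y \in C) => //=; case: (x \in C).
have D3' : dmst (denote p_restrict s2) (restrict d (parents D)).
  apply: dmst_eq D3 => y; apply/setP=> x; rewrite in_set /restrict.
  case: (y \in C); rewrite ?in_set0 ?andbF // in_setI in_nbrs.
  by case: (x \in parents D y); case: (A y x); case: (x \in C).
have W3 : winst (denote p_restrict s2) by apply: winst_off A3 _ W2.
set s3 := denote p_restrict s2 in D3' W3 *; clearbody s3.
have nr : normal A C (restrict d (parents D)).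
  move=> a b; rewrite /restrict; case: ifP => bC; last by rewrite in_set0.
  by rewrite in_setI in_nbrs => /and3P[_ aC ab]; rewrite super_sym.
have D4 : dmst (denote p_forward s3) (fw Ps (restrict d (parents D))).
  exact: (forward_ok ok nr W3 D3').
have W4 : winst (denote p_forward s3) by apply: win_frame W3.
set s4 := denote p_forward s3 in D4 W4 *; clearbody s4.
set Q := fw Ps (restrict d (parents D)) in D4.
have Hk (v : V) : (s4 aKEPT v != 0) = (v \in kept) by rewrite (e_kept (n_keep W4)); case: (v \in kept).
have [_ O] : outst (denote (p_write_dig aKEPT aNEW) s4) (flatten [seq size l :: l | l <-
    [seq [seq s4 aNEW (nat_of_ord x) | x <- enum V & (x \in kept) && (x \in Q v)] | v <- enum V & v \in kept]]).
  exact: (write_ok (kp := fun v => v \in kept) (mm := fun v => s4 aNEW v) (win_base W4) D4).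
pose p' (v' : V') := [seq x' <- enum V' | enum_val x' \in Q (enum_val v')].
exists (flatten [seq vlist_word (p' v') | v' <- enum V']).
  exists p' => // v'; split; first by apply: filter_uniq; apply: enum_uniq.
  by move=> x'; rewrite mem_filter mem_enum andbT inE /dig /kforward inE.
move=> i; have -> : flatten [seq vlist_word (p' v') | v' <- enum V'] = flatten [seq size l :: l | l <-
    [seq [seq s4 aNEW (nat_of_ord x) | x <- enum V & (x \in kept) && (x \in Q v)] | v <- enum V & v \in kept]].
  rewrite (enum_kept d) -!map_comp; congr flatten; apply/eq_map => v' /=.
  have -> : [seq s4 aNEW (nat_of_ord x) | x <- enum V & (x \in kept) && (x \in Q (enum_val v'))] =
      [seq nat_of_ord x | x <- p' v'].
    have -> : [seq x <- enum V | (x \in kept) && (x \in Q (enum_val v'))] =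
        [seq x <- [seq x <- enum V | x \in kept] | x \in Q (enum_val v')].
      by elim: (enum V) => //= x l IH; case: (x \in kept) => /=; rewrite IH.
    rewrite (enum_kept d) filter_map -map_comp; apply/eq_map => x' /=; exact: (e_new (n_keep W4)).
  by rewrite /vlist_word size_map.
exact: O.
Qed.

Lemma bwd_denote s (p : V' -> seq V') (D : rel V') pos (dd := flatten [seq vlist_word (p v) | v <- enum V']) :
  started s -> (forall v, uniq (p v) /\ p v =i parents D v) ->
  s aDP 0 = pos -> (forall q, q < size dd -> s 0 (pos + q) = nth 0 dd q) -> (forall j, s aDM j = 0) ->
  exists2 d', encodes_digraph (dig (kbackward its (d := d) (parents D))) d'
    & forall i, i < size d' -> denote p_bwd s 1 i = nth 0 d' i.
Proof.
move=> St Hp Hpos Hdd HD; rewrite /p_bwd; do 7 rewrite denote_seq.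
have [W1 Fr] := prepare St; set s1 := denote p_analysis _ in W1 Fr *.
have D1 j : s1 aDM j = 0 by rewrite Fr.
have P1 : s1 aDP 0 = pos by rewrite Fr.
have I1 q : q < size dd -> s1 0 (pos + q) = nth 0 dd q by move=> qd; rewrite Fr // Hdd.
clearbody s1; have B1 := win_base W1.
have [A2 R2] : agree_off tmp_read s1 (denote (p_read_dig (X_ aNK) aOLD) s1) /\
    forall x y : V, (denote (p_read_dig (X_ aNK) aOLD) s1 aDM (y * N + x) != 0) =
      [exists i : V', [exists j, [&& enum_val i == y, enum_val j == x & j \in p i]]].
  apply: (read_ok (M := fun i : V' => enum_val i) (pos := pos)) => //.
  - apply: (@leq_trans n); last by have := nN L; clear; lia.
    by have := max_card (mem kept); rewrite card_ord.
  - by move=> i; case: (Hp i).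
  - by move=> z Az; rewrite /= Az // (e_nk (n_keep W1)).
  - exact: (e_old (n_keep W1)).
set s2 := denote (p_read_dig _ _) s1 in A2 R2 *; set Q := push (parents D).
have D2 : dmst s2 Q.
  move=> x y; rewrite R2; apply/existsP/idP => [[i /existsP[j /and3P[/eqP <- /eqP <- jp]]]|].
    by rewrite /Q pushE; have [_ <-] := Hp i.
  move=> /push_in[x' [y' [-> -> H]]]; exists y'; apply/existsP; exists x'; rewrite !eqxx.
  by have [_ ->] := Hp y'.
have W2 : winst s2 by apply: winst_off A2 _ W1.
clearbody s2.
have [A3 B3] : agree_off tmp_bits s2 (denote p_bits s2) /\ forall P, P \in Ps -> bitst Q (denote p_bits s2) P.
  exact: (bits_ok ok W2 D2).
set s3 := denote p_bits s2 in A3 B3 *.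
have W3 : winst s3 by apply: winst_off A3 _ W2.
have D3 : dmst s3 Q by move=> x y; rewrite A3.
clearbody s3.
have [A4 D4] : agree_off [:: aDM; c2; c3] s3 (denote p_mask s3) /\ dmst (denote p_mask s3) (masked d Q).
  exact: (mask_ok W3 D3).
set s4 := denote p_mask s3 in A4 D4 *.
have W4 : winst s4 by apply: winst_off A4 _ W3.
have B4 P : P \in Ps -> bitst Q s4 P by move=> /B3[h1 h2 h3]; split; rewrite A4.
clearbody s4.
have D5 : dmst (denote p_backtrack s4) (bw A C (ascore its (d_lam d) C) Ps Q).
  exact: (backtrack_ok ok W4 B4 D4).
have W5 : winst (denote p_backtrack s4) by apply: win_frame W4.
set s5 := denote p_backtrack s4 in D5 W5 *; clearbody s5.
have D6 : dmst (denote p_undo s5) (kbackward its (d := d) (parents D)).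
  apply: undo_ok => // x y.
  by case/(bw_normal (@super_sym I) (Ps_good ok) (Ps_disj ok) (Ps_uniq ok)).
have B6 : base (denote p_undo s5) by apply: base_frame (win_base W5).
have [E1 E2] : (forall v : V, denote p_undo s5 aID v = v) /\ (forall v : V, denote p_undo s5 aALL v = 1).
  by split=> v; rewrite frame //; have [] := a_id (e_ana (n_keep W5)) v.
set s6 := denote p_undo s5 in D6 B6 E1 E2 *; clearbody s6.
set R := kbackward _ _ in D6 *.
have [_ O] : outst (denote (p_write_dig aALL aID) s6) (flatten [seq size l :: l | l <-
    [seq [seq nat_of_ord x | x <- enum V & true && (x \in R v)] | v <- enum V & true]]).
  by apply: (write_ok (kp := xpredT) (mm := fun v => nat_of_ord v) B6 D6) => // v; rewrite E2.
pose p' (v : V) := [seq x <- enum V | x \in R v].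
exists (flatten [seq vlist_word (p' v) | v <- enum V]).
  exists p' => // v; split; first by apply: filter_uniq; apply: enum_uniq.
  by move=> x; rewrite mem_filter mem_enum andbT inE.
move=> i; have -> : flatten [seq vlist_word (p' v) | v <- enum V] = flatten [seq size l :: l | l <-
    [seq [seq nat_of_ord x | x <- enum V & true && (x \in R v)] | v <- enum V & true]].
  rewrite filter_predT -map_comp; congr flatten; apply/eq_map => v /=.
  by rewrite /vlist_word size_map.
exact: O.
Qed.

Lemma fwd_run (J : instance) (u dd : seq nat) (D : rel V) :
  encodes_instance J u -> encodes_digraph D dd ->
  exists d' t, [/\ encodes_digraph (dig (kforward (d := d) (parents D))) d',
    computes c_fwd (word ++ u ++ dd) d' t
  & t <= 30 * (N + size u) + csize p_fwd * N.+1 ^ depth p_fwd + 100].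
Proof.
move=> eu [p Hp Ed]; set inp := word ++ u ++ dd.
have [|t1 [s1 [E1 P1 A1 T1]]] := skip_ok (s := initial inp) word_enc.
  by move=> q qw; rewrite /initial /= add0n /inp nth_cat qw.
set s2 := update s1 aN 0 N.
have Z2 j : s2 0 j = nth 0 inp j by rewrite /s2 update_other // A1.
have P2 : s2 aSP 0 = N by rewrite /s2 update_other.
have [|t2 [s3 [E3 P3 A3 T3]]] := skip_ok (s := s2) eu.
  by move=> q qu; rewrite P2 Z2 /inp nth_cat ltnNge leq_addr /= addKn nth_cat qu.
rewrite P2 in P3; set s4 := update s3 aDP 0 (N + size u).
have S4 a j : a \notin [:: aSP; aSN; aSV; aSR; aN; aDP] -> s4 a j = initial inp a j.
  rewrite !inE !negb_or => /and5P[h1 h2 h3 h4 /andP[h5 h6]].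
  by rewrite /s4 update_other // A3 ?inE ?negb_or ?h1 ?h2 ?h3 // /s2 update_other // A1 // !inE !negb_or h1 h2 h3.
have St : started s4.
  split.
  - by rewrite /s4 update_other // A3.
  - by move=> j jN; rewrite !S4 // /initial /= add0n /inp nth_cat jN.
  - move=> a i ar ne; have [Ea|an] := eqVneq a aN; last first.
      by rewrite S4 ?/initial; [case: eqP ar => // ->|rewrite !inE (negbTE an); move: ar; clear; lia].
    move: ne; rewrite Ea xpair_eqE eqxx /= => i0; rewrite /s4 update_other // A3 // /s2 /update (negbTE i0) andbF A1 //.
have I0 j : s4 0 j = nth 0 inp j by rewrite S4.
have [|||d' ed' O] := fwd_denote (pos := N + size u) St Hp.
- by rewrite /s4 /update.
- by rewrite -Ed => q qd; rewrite I0 /inp catA nth_cat size_cat ltnNge leq_addr /= addKn.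
- by move=> j; rewrite S4.
have /andP[wf_ Nw] := wf_fwd; have [t3 E5 T5] := run_prog s4 wf_ Nw.
have N4 : s4 aN 0 = N by case: St.
rewrite N4 in T5.
exists d', (t1 + (4 + (t2 + (4 + t3).+1).+1).+1).+1; split=> //.
- exists (denote p_fwd s4); last exact: O.
  apply: exec_seq E1 _; apply: (exec_seq (s2 := s2)).
    have -> : s2 = update s1 aN (eval s1 (C_ 0)) (eval s1 (X_ aSP)) by rewrite /s2 /= P1.
    exact: (exec_put aN (C_ 0) (X_ aSP)).
  apply: exec_seq E3 _; apply: (exec_seq (s2 := s4)) E5.
  have -> : s4 = update s3 aDP (eval s3 (C_ 0)) (eval s3 (X_ aSP)) by rewrite /s4 /= P3.
  exact: (exec_put aDP (C_ 0) (X_ aSP)).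
- by move: T1 T3 T5; move: (csize _ * _) => x; clear; lia.
Qed.

Lemma bwd_run (J : instance) (u dd : seq nat) (D : rel V') :
  encodes_instance J u -> encodes_digraph D dd ->
  exists d' t, [/\ encodes_digraph (dig (kbackward its (d := d) (parents D))) d',
    computes c_bwd (u ++ word ++ dd) d' t
  & t <= 30 * (N + size u) + csize p_bwd * N.+1 ^ depth p_bwd + 120].
Proof.
move=> eu [p Hp Ed]; set inp := u ++ word ++ dd.
have [|t1 [s1 [E1 P1 A1 T1]]] := skip_ok (s := initial inp) eu.
  by move=> q qw; rewrite /initial /= add0n /inp nth_cat qw.
set s2 := update s1 aOFF 0 (size u).
have Z2 j : s2 0 j = nth 0 inp j by rewrite /s2 update_other // A1.
have P2 : s2 aSP 0 = size u by rewrite /s2 update_other.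
have [|t2 [s3 [E3 P3 A3 T3]]] := skip_ok (s := s2) word_enc.
  by move=> q qu; rewrite P2 Z2 /inp nth_cat ltnNge leq_addr [~~ true]/= addKn nth_cat qu.
rewrite P2 in P3; have O3 : s3 aOFF 0 = size u by rewrite A3.
set s4 := update s3 aN 0 N; set s5 := update s4 aDP 0 (size u + N).
have S5 a j : a \notin [:: aSP; aSN; aSV; aSR; aOFF; aN; aDP] -> s5 a j = initial inp a j.
  rewrite !inE !negb_or => /and5P[h1 h2 h3 h4 /and3P[h5 h6 h7]].
  rewrite /s5 update_other // /s4 update_other // A3 ?inE ?negb_or ?h1 ?h2 ?h3 // /s2 update_other //.
  by rewrite A1 // !inE !negb_or h1 h2 h3.
have I0 j : s5 0 j = nth 0 inp j by rewrite S5.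
have O5 : s5 aOFF 0 = size u by rewrite /s5 /s4 !update_other.
have St : started s5.
  split.
  - by rewrite /s5 update_other.
  - by move=> j jN; rewrite O5 I0 /inp nth_cat ltnNge leq_addr [~~ true]/= addKn nth_cat jN.
  - move=> a i ar ne; have [Ea|an] := eqVneq a aN; last first.
      by rewrite S5 ?/initial; [case: eqP ar => // ->|rewrite !inE (negbTE an); move: ar; clear; lia].
    move: ne; rewrite Ea xpair_eqE eqxx /= => i0.
    by rewrite /s5 update_other // /s4 /update (negbTE i0) andbF A3 // /s2 update_other // A1.
have [|||d' ed' O] := bwd_denote (pos := size u + N) St Hp.
- by rewrite /s5 /update.
- by rewrite -Ed => q qd; rewrite I0 /inp catA nth_cat size_cat ltnNge leq_addr /= addKn.
- by move=> j; rewrite S5.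
have /andP[wf_ Nw] := wf_bwd; have [t3 E5 T5] := run_prog s5 wf_ Nw.
have N4 : s5 aN 0 = N by case: St.
rewrite N4 in T5.
exists d', (t1 + (4 + (t2 + (7 + (4 + t3).+1).+1).+1).+1).+1; split=> //.
- exists (denote p_bwd s5); last exact: O.
  apply: exec_seq E1 _; apply: (exec_seq (s2 := s2)).
    have -> : s2 = update s1 aOFF (eval s1 (C_ 0)) (eval s1 (X_ aSP)) by rewrite /s2 /= P1.
    exact: (exec_put aOFF (C_ 0) (X_ aSP)).
  apply: exec_seq E3 _; apply: (exec_seq (s2 := s4)).
    have -> : s4 = update s3 aN (eval s3 (C_ 0)) (eval s3 (X_ aSP -' X_ aOFF)).
      by rewrite /s4 /= P3 O3 addKn.
    exact: (exec_put aN (C_ 0) (X_ aSP -' X_ aOFF)).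
  apply: (exec_seq (s2 := s5)) E5.
  have -> : s5 = update s4 aDP (eval s4 (C_ 0)) (eval s4 (X_ aSP)).
    by rewrite /s5 /= /s4 update_other // P3.
  exact: (exec_put aDP (C_ 0) (X_ aSP)).
- by move: T1 T3 T5; move: (csize _ * _) => x; clear; lia.
Qed.

End Assembly.

(** The word of the kernel has at most 36(N + 1)^2 letters, as each slot writes at most N + 33.
    Skipping it at 30 steps per letter is absorbed by two more factors N + 1 and by the constant
    2000. *)
Lemma run_bound N sl su cs dp t : sl <= N -> su <= 3 + sl * (N + 33) ->
  t <= 30 * (N + su) + cs * N.+1 ^ dp + 120 -> t <= (cs + 2000) * N.+1 ^ dp.+2.
Proof.
move=> slN Hsu Ht; rewrite mulnDl.
have h1 : su <= 36 * N.+1 ^ 2.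
  have : sl * (N + 33) <= N * (N + 33) by rewrite leq_mul2r slN orbT.
  by move: Hsu; rewrite expnS expn1; clear; nia.
have h2 : N.+1 ^ 2 <= N.+1 ^ dp.+2 by rewrite leq_pexp2l.
have h3 : N.+1 ^ dp <= N.+1 ^ dp.+2 by rewrite leq_pexp2l // leqW.
have h4 : N.+1 <= N.+1 ^ dp.+2 by rewrite -{1}(expn1 N.+1) leq_pexp2l.
have h5 : cs * N.+1 ^ dp <= cs * N.+1 ^ dp.+2 by rewrite leq_mul2l h3 orbT.
move: Ht h1 h2 h4 h5; move: (cs * N.+1 ^ dp) (cs * N.+1 ^ dp.+2) (N.+1 ^ dp.+2) (N.+1 ^ 2).
by clear; lia.
Qed.

Theorem theorem9 :
  exists (kernel fwd bwd : cmd) (c : nat),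
  forall (I : instance) (w : seq nat) (k : nat),
    encodes_instance I w ->
    feedback_edge_number (superstructure I) k ->
    exists (I' : instance) (w' : seq nat) (t : nat),
      [/\ encodes_instance I' w',
          computes kernel w w' t,
          t <= c * inst_size I ^ 2 + c,
          equivalent_via fwd bwd c (inst_size I) I w I' w'
        & nvert I' <= 24 * k].
Proof.
exists c_kernel, c_fwd, c_bwd.
pose Kk := csize p_kernel + 100.
pose Kf := csize p_fwd + 2000; pose Df := (depth p_fwd).+2.
pose Kb := csize p_bwd + 2000; pose Db := (depth p_bwd).+2.
(* In [transforms_solutions] the same constant is the factor and the exponent; the summands [Df] and
   [Db] make it large enough as an exponent. *)
pose c := Kk * 7 ^ 2 + (Kf * 7 ^ Df + Df) + (Kb * 7 ^ Db + Db); exists c.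
have c1 : Kk * 7 ^ 2 <= c by apply: leq_trans (leq_addr _ _); apply: leq_addr.
have c2 : Kf * 7 ^ Df + Df <= c by apply: leq_trans (leq_addr _ _); apply: leq_addl.
have c3 : Kb * 7 ^ Db + Db <= c by apply: leq_addl.
clearbody c; move=> I w k [L HL Ew] Hk.
have {Ew} -> : w = word L by rewrite Ew word_encodes.
(* The decomposition is taken once from the canonical memory, so that the kernel and both
   transformations speak of the same instance. *)
have [d Hd] := analysis_ok HL (canon_init L); have ok := a_ok (e_ana (n_keep Hd)).
have [w' [e' sz [t ct tb]]] := kernel_run HL Hd ok.
have wN := word_size (word_enc HL).
have slN : size (slots L) <= size (word L) by apply: leq_trans (size_word L); apply: leq_addr.
exists (kinst (its_super HL) ok), w', t; split; [exact: e'|exact: ct| | |exact: (ksize ok)].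
- apply: leq_trans tb _; apply: leq_trans (poly_bound Kk 2 wN) _.
  by apply: leq_add; [apply: leq_mul; [|apply: leqnn]|].
- split; first exact: (kyes (its_score HL)).
  + move=> D dd sD ed; have [d' [t' [ed' cp tb']]] := fwd_run HL Hd ok e' ed.
    exists (dig (kforward (d := d) (parents D))), d', t'.
    split; [exact: (kforwardP (its_score HL))|exact: ed'|exact: cp|].
    apply: (time_bound (K := Kf) (D := Df) wN); last by rewrite /=; apply: leq_trans (leq_addl _ _) c2.
      by apply: (run_bound slN sz); apply: leq_trans tb' _; rewrite leq_add2l.
    exact: leq_trans (leq_addr _ _) c2.
  + move=> D dd sD ed; have [d' [t' [ed' cp tb']]] := bwd_run HL Hd ok e' ed.
    exists (dig (kbackward (its L) (d := d) (parents D))), d', t'.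
    split; [exact: (kbackwardP (its_score HL) sD)|exact: ed'|exact: cp|].
    apply: (time_bound (K := Kb) (D := Db) wN); last by rewrite /=; apply: leq_trans (leq_addl _ _) c3.
      exact: (run_bound slN sz).
    exact: leq_trans (leq_addr _ _) c3.
Qed.
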